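(* Let $\Lambda,\Gamma$ be subsets of $\{1,\ldots,n\}$ such that $\Lambda\cup\Gamma=\{1,\ldots,n\}$, and let $\{\varphi_\lambda(z_\lambda)\}_{\lambda\in\Lambda}$ and $\{\psi_t(z_t)\}_{t\in\Gamma}$ be non-constant inner functions, $\varphi_\lambda$ depending only on the variable $z_\lambda$ and $\psi_t$ only on $z_t$. Consider the quotient modules $$\mathcal{Q}_{\Phi_\Lambda}=H^2(\mathbb{D}^n)\ominus\sum_{\lambda\in\Lambda}\varphi_\lambda(z_\lambda)H^2(\mathbb{D}^n),\qquad \mathcal{Q}_{\Psi_\Gamma}=H^2(\mathbb{D}^n)\ominus\sum_{t\in\Gamma}\psi_t(z_t)H^2(\mathbb{D}^n).$$ Then $P=P_{\mathcal{Q}_{\Phi_\Lambda}}P_{\mathcal{Q}_{\Psi_\Gamma}}$ is a finite rank projection if and only if the inner functions $\{\varphi_i(z_i)\}_{i\in\Lambda\setminus(\Lambda\cap\Gamma)}$ and $\{\psi_j(z_j)\}_{j\in\Gamma\setminus(\Lambda\cap\Gamma)}$ are finite Blaschke products, and for every $j\in\Lambda\cap\Gamma$ at least one of the following conditions holds: (a) $\varphi_j$ divides $\psi_j$ and $\varphi_j$ is a finite Blaschke product; (b) $\psi_j$ divides $\varphi_j$ and $\psi_j$ is a finite Blaschke product.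
   Context: Throughout $n\ge 2$. $H^2(\mathbb{D}^n)$ is the Hardy space of analytic functions $f$ on the unit polydisc $\mathbb{D}^n$ with $\|f\|=\sup_{0\le r<1}\big(\int_{\mathbb{T}^n}|f(r\boldsymbol z)|^2\,d\mu\big)^{1/2}<\infty$, where $\mu$ is normalized Lebesgue measure on $\mathbb{T}^n$. For a closed subspace $\mathcal{Q}$, $P_{\mathcal{Q}}$ is the orthogonal projection of $H^2(\mathbb{D}^n)$ onto $\mathcal{Q}$, and $\ominus$ denotes orthogonal complement. ''Projection'' means orthogonal projection. An inner function on $\mathbb{D}^n$ is a bounded analytic function on $\mathbb{D}^n$ whose boundary values have modulus $1$ almost everywhere on $\mathbb{T}^n$; a function depending only on $z_j$ is also regarded as a function on $\mathbb{D}$. For inner functions $\varphi,\psi$, $\varphi$ divides $\psi$ means $\psi=\varphi\eta$ for some inner function $\eta$. *)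

(* Defs.v *)
From HB Require Import structures.
From mathcomp Require Import all_boot all_order all_algebra.
From mathcomp Require Import complex.
From mathcomp Require Import all_classical all_reals all_analysis.

Set Implicit Arguments.
Unset Strict Implicit.
Unset Printing Implicit Defensive.

Import Order.TTheory GRing.Theory Num.Theory.
Import numFieldNormedType.Exports.

Local Open Scope classical_set_scope.
Local Open Scope ring_scope.
Local Open Scope complex_scope.

(* The topology and norm of R[i] as a numFieldType. *)
HB.instance Definition _ (R : rcfType) := NormedModule.copy R[i] R[i]^o.

Section Torus.
Context {R : realType}.

Lemma lt0_2pi : 0 < 2 * pi :> R.
Proof. by rewrite mulr_gt0// pi_gt0. Qed.

Definition cons_angle n (p : measurableTypeR R * n.-tuple (measurableTypeR R)) :
  n.+1.-tuple (measurableTypeR R) := [tuple of p.1 :: p.2].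

Lemma measurable_cons_angle n : measurable_fun setT (@cons_angle n).
Proof. exact: measurable_cons. Qed.

HB.instance Definition _ n :=
  isMeasurableFun.Build _ _ _ _ (@cons_angle n) (@measurable_cons_angle n).

(* The torus T^n is parametrized by angles in [0, 2 pi]^n; its normalized
   Lebesgue measure becomes the n-fold product of the uniform probability. *)
Fixpoint torus_measure n : probability (n.-tuple (measurableTypeR R)) R :=
  match n with
  | 0 => \d_[tuple]
  | m.+1 => distribution (uniform_prob lt0_2pi \x torus_measure m)%E (@cons_angle m)
  end.

Definition torus_point n (t : n.-tuple (measurableTypeR R)) : 'rV[R[i]]_n :=
  \row_(j < n) (cos (tnth t j) +i* sin (tnth t j)).

End Torus.

Section Hardy.
Context {R : realType} {n : nat}.
Local Notation C := R[i].
Local Notation fct := ('rV[C]_n -> C).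
Implicit Types (z w : 'rV[C]_n) (f g h : fct) (M S : set fct).

Definition polydisc : set 'rV[C]_n := [set z | forall j, `|z ord0 j| < 1].

(* Differentiability is taken over the scalar field R[i], so it means complex
   (Frechet) differentiability. *)
Definition analytic_on_polydisc f :=
  forall z, polydisc z -> differentiable f z.

Definition hardy_norm f : \bar R :=
  ereal_sup [set Lnorm (torus_measure n) 2%:E
      (fun t => (ComplexField.Normc.normc (f (r%:C *: torus_point t)))%:E)
    | r in [set r : R | 0 <= r < 1]].

(* An element of H^2(D^n) is represented by its extension by zero outside D^n,
   so that two elements are equal iff they are equal as Rocq functions. *)
Definition hardy : set fct :=
  [set f | [/\ forall z, ~ polydisc z -> f z = 0,
               analytic_on_polydisc f & (hardy_norm f < +oo)%E]].

Definition sqnorm f : R := fine (hardy_norm f) ^+ 2.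

(* The inner product (linear in its first argument) that the norm determines
   through the polarization identity. *)
Definition hardy_dot f g : C :=
  ((sqnorm (f + g) - sqnorm (f - g)) / 4) +i*
  ((sqnorm (f + 'i%C \*o g) - sqnorm (f - 'i%C \*o g)) / 4).

Definition hardy_ominus S : set fct :=
  [set f | hardy f /\ forall g, S g -> hardy_dot f g = 0].

Definition closed_subspace M :=
  [/\ M `<=` hardy, M 0,
     forall (a : C) f g, M f -> M g -> M (a \*o f + g) &
     forall f, hardy f ->
       (forall e : R, 0 < e -> exists2 g, M g & (hardy_norm (f - g)%R < e%:E)%E) ->
       M f].

(* For a closed subspace M and f in H^2 there is exactly one such g; the default
   value 0 is never used. *)
Definition hardy_proj M f : fct :=
  xget 0 [set g | M g /\ forall h, M h -> hardy_dot (f - g) h = 0].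

Definition is_projection (P : fct -> fct) :=
  exists2 M, closed_subspace M & forall f, hardy f -> P f = hardy_proj M f.

Definition finite_rank (P : fct -> fct) :=
  exists (m : nat) (e : 'I_m -> fct), forall f, hardy f ->
    exists c : 'I_m -> C, P f = \sum_(k < m) c k \*o e k.

Definition finite_rank_projection (P : fct -> fct) :=
  is_projection P /\ finite_rank P.

(* Boundary values are radial limits. *)
Definition inner_function f :=
  [/\ analytic_on_polydisc f,
      exists B : R, forall z, polydisc z -> `|f z| <= B%:C &
      {ae @torus_measure R n, forall t, exists2 b : C, `|b| = 1 &
        f (r%:C *: torus_point t) @[r --> (1 : R)^'-] --> b}].

Definition nonconstant f := ~ exists c : C, forall z, polydisc z -> f z = c.

Definition depends_only_on (j : 'I_n) f :=
  forall z w, polydisc z -> polydisc w -> z ord0 j = w ord0 j -> f z = f w.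

Definition inner_divides f g :=
  exists2 h, inner_function h & forall z, polydisc z -> g z = f z * h z.

(* f(z) = b(z_j) for a finite Blaschke product b on the unit disc, with zeros
   listed with multiplicity in s. *)
Definition finite_Blaschke_product (j : 'I_n) f :=
  exists (c : C) (s : seq C),
    [/\ `|c| = 1, forall a, a \in s -> `|a| < 1 &
       forall z, polydisc z ->
         f z = c * \prod_(a <- s) ((z ord0 j - a) / (1 - a^* * z ord0 j))].

(* \sum_(l in L) phi_l H^2(D^n), an algebraic sum of submodules. *)
Definition sum_submodule (L : {set 'I_n}) (phi : 'I_n -> fct) : set fct :=
  [set (fun z => \sum_(l in L) phi l z * h l z)
    | h in [set h : 'I_n -> fct | forall l, hardy (h l)]].

Definition quotient_module (L : {set 'I_n}) (phi : 'I_n -> fct) : set fct :=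
  hardy_ominus (sum_submodule L phi).

End Hardy.

(* Main.v *)
(** Complex analysis on the polydisc enters through the Cauchy formula: a
    function analytic on D^n is a power series, and its Hardy norm is the l^2
    norm of its coefficients.  Hence H^2 is a Hilbert space in which the
    monomials are orthonormal, and multiplication by an inner function is an
    isometry M.  Multiplications by inner functions of different variables
    doubly commute (M_1^* M_2 = M_2 M_1^* ), so the projection onto a quotient
    module is the product of the projections 1 - M_l M_l^*.

    If the divisibility conditions hold, these projections preserve the other
    quotient module, so P is the projection onto the intersection of the two.
    On it a recurrence with the polynomials of the finite Blaschke products
    determines all coefficients from those in a box.

    Conversely, P <> 0: otherwise 1, obtained from a product of kernel functions
    of the second quotient module, is orthogonal to the first one.  A nonzero
    vector of the range of P provides a vector u, free of z_j, on whose
    multiples by functions of z_j the product P acts as a product of two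
    projections in the variable z_j.  Being self-adjoint, they commute.
    Comparing A B = B A with its conjugate by the shift leaves an identity
    between operators of rank two, which forces phi_j or psi_j to divide the
    other.  Finally, finite rank puts a nonzero polynomial p in the range of
    M_j, and removing the roots of p one at a time shows that the inner function
    is a finite Blaschke product. *)

(* Boundary values enter only through the definition of inner functions; those of a general element
   of $H^2$ are not constructed. So $\|fx\|=\|x\|$ is proved by dominated convergence along radii
   for bounded $x$, and polarization on monomials extends it to $H^2$. From then on an inner
   function is used as an isometry: its adjoint is built from the projection onto its range,
   $|f|\le1$ follows by playing the constant norms of the powers $f^m$ against bounded point
   evaluation, and a quotient in $H^2$ of inner functions is inner because it acts as an isometry.
   Identities between bounded operators are checked on monomials, as the vectors satisfying them
   form a closed subspace.

   In the converse, the passage to one variable rests on the space of vectors killed by $M_l^*$ for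
   all $l\ne j$ of both families. It is invariant under multiplication by inner functions of $z_j$
   and under the adjoints, and the extraction of coefficients at the indices $\beta+ke_j$ with
   $\beta_j=0$ commutes with the projections in $z_j$. This carries commutation and finite rank over
   to functions of $z_j$ alone, provided the space is nonzero; hence the detour through $P\ne0$. *)
Require Import Defs.
From HB Require Import structures.
From mathcomp Require Import all_boot all_order all_algebra.
From mathcomp Require Import complex ring lra.
From mathcomp Require Import all_classical all_reals all_analysis measurable_realfun.

Set Implicit Arguments.
Unset Strict Implicit.
Unset Printing Implicit Defensive.

Import Order.TTheory GRing.Theory Num.Theory.
Import numFieldNormedType.Exports.
Import ComplexField.Normc.

Local Open Scope classical_set_scope.
Local Open Scope ring_scope.
Local Open Scope complex_scope.

Local Notation Re := (@complex.Re _).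
Local Notation Im := (@complex.Im _).

(** * Complex integrals and Cauchy's formula *)

Section ComplexModulus.
Context {R : rcfType}.
Implicit Types (z w : R[i]).

Lemma normc_ge0 z : 0 <= normc z.
Proof. by case: z => a b; exact: sqrtr_ge0. Qed.

(** The norm of [R[i]] takes its values in [R[i]]. Estimates are carried out with the real modulus
    [normc], so that they are inequalities in an ordered real field. *)
Lemma norm_normc z : `|z| = (normc z)%:C.
Proof. by case: z. Qed.

Lemma normr_ltC z (x : R) : (`|z| < x%:C) = (normc z < x).
Proof. by rewrite norm_normc ltcR. Qed.

Lemma normr_leC z (x : R) : (`|z| <= x%:C) = (normc z <= x).
Proof. by rewrite norm_normc lecR. Qed.

Lemma normr_lt1 z : (`|z| < 1) = (normc z < 1).
Proof. exact: normr_ltC. Qed.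

Lemma normc_le_ReIm z : normc z <= `|Re z| + `|Im z|.
Proof.
case: z => a b /=; rewrite -[leRHS]ger0_norm ?addr_ge0// -[leRHS]sqrtr_sqr; apply: ler_wsqrtr.
rewrite sqrrD !real_normK ?num_real// lerD2r lerDl.
by rewrite mulrn_wge0// mulr_ge0.
Qed.

Lemma Re_le_normc z : `|Re z| <= normc z.
Proof.
by case: z => a b /=; rewrite -[leLHS]sqrtr_sqr; apply: ler_wsqrtr; rewrite lerDl sqr_ge0.
Qed.

Lemma Im_le_normc z : `|Im z| <= normc z.
Proof.
by case: z => a b /=; rewrite -[leLHS]sqrtr_sqr; apply: ler_wsqrtr; rewrite lerDr sqr_ge0.
Qed.

Lemma normcR (x : R) : normc x%:C = `|x|.
Proof. by rewrite /= expr0n addr0 sqrtr_sqr. Qed.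

Lemma normcX z k : normc (z ^+ k) = normc z ^+ k.
Proof.
by elim: k => [|k IH]; rewrite ?expr0 ?normc1// !exprS normcM IH.
Qed.

Lemma normc_eq0 z : (normc z == 0) = (z == 0).
Proof.
by apply/eqP/eqP => [/eq0_normc//|->]; exact: normc0.
Qed.

Lemma normc_gt0 z : (0 < normc z) = (z != 0).
Proof. by rewrite lt_def normc_ge0 andbT normc_eq0. Qed.

Lemma normcB z w : normc (z - w) = normc (w - z).
Proof. by rewrite -normcN opprB. Qed.

Lemma normc_conj z : normc (conjc z) = normc z.
Proof. by case: z => a b /=; rewrite sqrrN. Qed.

Lemma le_normcB z w : normc z - normc w <= normc (z - w).
Proof. by rewrite lerBlDr (le_trans _ (le_normcD _ _))// subrK. Qed.

Lemma normc_sum (I : Type) (s : seq I) (P : pred I) (F : I -> R[i]) :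
  normc (\sum_(k <- s | P k) F k) <= \sum_(k <- s | P k) normc (F k).
Proof.
elim/big_ind2 : _ => //; first by rewrite normc0.
by move=> x1 x2 y1 y2 h1 h2; rewrite (le_trans (le_normcD _ _))// lerD.
Qed.

Lemma normc_prod (I : Type) (s : seq I) (P : pred I) (F : I -> R[i]) :
  normc (\prod_(k <- s | P k) F k) = \prod_(k <- s | P k) normc (F k).
Proof. by apply: (big_morph _ (@normcM R)); exact: normc1. Qed.

Lemma sqr_normcE z : normc z ^+ 2 = Re z ^+ 2 + Im z ^+ 2.
Proof. by case: z => a b /=; rewrite sqr_sqrtr// addr_ge0 ?sqr_ge0. Qed.

Lemma mulcJ z : z * (conjc z) = (normc z ^+ 2)%:C.
Proof. by rewrite sqr_normcE; case: z => a b; simpc; congr (_ +i* _); ring. Qed.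

Lemma cReD z w : Re (z + w) = Re z + Re w. Proof. by case: z; case: w. Qed.
Lemma cImD z w : Im (z + w) = Im z + Im w. Proof. by case: z; case: w. Qed.
Lemma cReN z : Re (- z) = - Re z. Proof. by case: z. Qed.
Lemma cImN z : Im (- z) = - Im z. Proof. by case: z. Qed.
Lemma cReM z w : Re (z * w) = Re z * Re w - Im z * Im w.
Proof. by case: z; case: w. Qed.
Lemma cImM z w : Im (z * w) = Re z * Im w + Im z * Re w.
Proof. by case: z; case: w. Qed.
Lemma cReJ z : Re (conjc z) = Re z. Proof. by case: z. Qed.
Lemma cImJ z : Im (conjc z) = - Im z. Proof. by case: z. Qed.

Lemma conjcB z w : conjc (z - w) = conjc z - conjc w.
Proof. exact: rmorphB. Qed.

Lemma conjcD z w : conjc (z + w) = conjc z + conjc w.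
Proof. exact: rmorphD. Qed.

Lemma conjcM z w : conjc (z * w) = conjc z * conjc w.
Proof. exact: rmorphM. Qed.

Lemma complex_ext z w : Re z = Re w -> Im z = Im w -> z = w.
Proof. by case: z w => [a b] [c d] /= -> ->. Qed.

End ComplexModulus.

(** * Integrals of complex-valued functions by real and imaginary parts *)

Section ComplexIntegral.
Context d (T : measurableType d) (R : realType).
Variables (mu : {measure set T -> \bar R}) (D : set T).
Hypothesis mD : measurable D.
Implicit Types (f g : T -> R[i]).

Definition cintegrable f :=
  mu.-integrable D (EFin \o (fun x => Re (f x))) /\
  mu.-integrable D (EFin \o (fun x => Im (f x))).

Definition cint f : R[i] :=
  (\int[mu]_(x in D) Re (f x)) +i* (\int[mu]_(x in D) Im (f x)).

Lemma eq_cint f g : {in D, f =1 g} -> cint f = cint g.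
Proof.
by move=> fg; congr (_ +i* _); apply: eq_Rintegral => x xD; rewrite fg.
Qed.

Lemma eq_cintegrable f g : {in D, f =1 g} -> cintegrable f -> cintegrable g.
Proof.
move=> fg [h1 h2]; split;
  [apply: eq_integrable h1 => // | apply: eq_integrable h2 => //];
  by move=> x xD /=; rewrite fg.
Qed.

Lemma cintegrableD f g :
  cintegrable f -> cintegrable g -> cintegrable (fun x => f x + g x).
Proof.
move=> [f1 f2] [g1 g2]; split.
  apply: eq_integrable (integrableD mD f1 g1) => // x _ /=.
  by rewrite cReD EFinD.
apply: eq_integrable (integrableD mD f2 g2) => // x _ /=.
by rewrite cImD EFinD.
Qed.

Lemma cintegrableZ (c : R[i]) f :
  cintegrable f -> cintegrable (fun x => c * f x).
Proof.
move=> [f1 f2]; split.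
  have := integrableB mD (integrableZl mD (Re c) f1) (integrableZl mD (Im c) f2).
  apply: eq_integrable => // x _ /=.
  by rewrite cReM EFinB !EFinM.
have := integrableD mD (integrableZl mD (Re c) f2) (integrableZl mD (Im c) f1).
apply: eq_integrable => // x _ /=.
by rewrite cImM EFinD !EFinM.
Qed.

Lemma cintD f g : cintegrable f -> cintegrable g ->
  cint (fun x => f x + g x) = cint f + cint g.
Proof.
move=> [f1 f2] [g1 g2]; rewrite /cint; simpc; congr (_ +i* _).
  by rewrite -RintegralD//; apply: eq_Rintegral => x _; rewrite cReD.
by rewrite -RintegralD//; apply: eq_Rintegral => x _; rewrite cImD.
Qed.

Lemma integrableEFinZ (c : R) (f : T -> R) : mu.-integrable D (EFin \o f) ->
  mu.-integrable D (EFin \o (fun x => c * f x)).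
Proof.
by move=> h; apply: eq_integrable (integrableZl mD c h).
Qed.

Lemma cintZ (c : R[i]) f : cintegrable f ->
  cint (fun x => c * f x) = c * cint f.
Proof.
move=> [f1 f2]; apply: complex_ext; rewrite ?cReM ?cImM /=.
  rewrite -!RintegralZl// -RintegralB//; try exact: integrableEFinZ.
  by apply: eq_Rintegral => x _; rewrite cReM.
rewrite -!RintegralZl// -RintegralD//; try exact: integrableEFinZ.
by apply: eq_Rintegral => x _; rewrite cImM.
Qed.

Lemma cintegrableN f : cintegrable f -> cintegrable (fun x => - f x).
Proof.
by move=> /(cintegrableZ (-1)); apply: eq_cintegrable => x _; rewrite mulN1r.
Qed.

Lemma cintegrableB f g :
  cintegrable f -> cintegrable g -> cintegrable (fun x => f x - g x).
Proof. by move=> hf hg; apply: cintegrableD => //; exact: cintegrableN. Qed.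

Lemma cintN f : cintegrable f -> cint (fun x => - f x) = - cint f.
Proof.
by move=> h; rewrite -mulN1r -cintZ//; apply: eq_cint => x _; rewrite mulN1r.
Qed.

Lemma cintB f g : cintegrable f -> cintegrable g ->
  cint (fun x => f x - g x) = cint f - cint g.
Proof. by move=> hf hg; rewrite cintD ?cintN//; exact: cintegrableN. Qed.

Lemma integrable_cst_fin (c : R) : (mu D < +oo)%E ->
  mu.-integrable D (EFin \o (fun=> c)).
Proof.
move=> muD; apply: measurable_bounded_integrable => //.
by exists `|c|; split; rewrite ?num_real// => y cy x Dx; exact: ltW.
Qed.

Lemma cintegrable_cst (c : R[i]) : (mu D < +oo)%E -> cintegrable (fun=> c).
Proof.
by move=> muD; split; exact: integrable_cst_fin.
Qed.

Lemma cint_cst (c : R[i]) : cint (fun=> c) = (fine (mu D))%:C * c.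
Proof.
rewrite /cint !Rintegral_cst//; case: c => a b /=; simpc.
by congr (_ +i* _); ring.
Qed.

Lemma cint_sum (I : Type) (s : seq I) (F : I -> T -> R[i]) :
  (mu D < +oo)%E -> (forall k, cintegrable (F k)) ->
  cintegrable (fun x => \sum_(k <- s) F k x) /\
  cint (fun x => \sum_(k <- s) F k x) = \sum_(k <- s) cint (F k).
Proof.
move=> muD hF; elim: s => [|k s [IH1 IH2]].
  split; last first.
    rewrite big_nil (@eq_cint _ (fun=> 0)) ?cint_cst ?mulr0//.
    by move=> x _; rewrite big_nil.
  apply: eq_cintegrable (cintegrable_cst 0 muD) => x _.
  by rewrite big_nil.
split.
  by apply: eq_cintegrable (cintegrableD (hF k) IH1) => x _; rewrite big_cons.
rewrite big_cons -IH2 -cintD//.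
by apply: eq_cint => x _; rewrite big_cons.
Qed.

Lemma bounded_cintegrable f (M : R) : (mu D < +oo)%E ->
  measurable_fun D (fun x => Re (f x)) -> measurable_fun D (fun x => Im (f x)) ->
  (forall x, D x -> normc (f x) <= M) -> cintegrable f.
Proof.
move=> muD mRe mIm hM; split;
  apply: measurable_bounded_integrable => //; exists M; split; rewrite ?num_real//;
  move=> y My x Dx /=; apply: le_trans (ltW My).
  exact: le_trans (Re_le_normc _) (hM _ Dx).
exact: le_trans (Im_le_normc _) (hM _ Dx).
Qed.

(** The factor 2 comes from bounding the real and imaginary parts separately. It recurs in the
    Cauchy estimates below, where only the order of magnitude matters. *)
Lemma normc_cint f (M : R) : (mu D < +oo)%E -> cintegrable f ->
  (forall x, D x -> normc (f x) <= M) ->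
  normc (cint f) <= 2 * M * fine (mu D).
Proof.
move=> muD [f1 f2] hM; apply: (le_trans (normc_le_ReIm _)) => /=.
have H (g : T -> R) : mu.-integrable D (EFin \o g) ->
    (forall x, D x -> `|g x| <= normc (f x)) ->
    `|\int[mu]_(x in D) g x| <= M * fine (mu D).
  move=> ig hg; apply: (le_trans (le_normr_Rintegral mD ig)).
  rewrite -Rintegral_cst//; apply: le_Rintegral => //.
  - exact: (integrable_abse ig).
  - exact: integrable_cst_fin.
  - by move=> x Dx; apply: le_trans (hM _ Dx); exact: hg.
rewrite mulrAC -mulrA mulrC mulrDr mulr1; apply: lerD; rewrite mulrC; apply: H => // x _.
  exact: Re_le_normc.
exact: Im_le_normc.
Qed.

End ComplexIntegral.

#[global] Arguments normc : simpl never.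

(** * Bisection for additive functions of rectangles *)

Section Bisection.
Context {R : realType}.
Implicit Types (J : R -> R -> R -> R -> R[i]).

Lemma nondecreasing_bounded_lim (u v : R^nat) (L : R) :
  (forall k, u k <= u k.+1) -> (forall k, v k.+1 <= v k) ->
  (forall k, v k - u k = L / 2 ^+ k) -> 0 <= L ->
  exists p, forall k, u k <= p <= v k.
Proof.
move=> hu hv huv L0.
have uh : {homo u : n m / (n <= m)%N >-> n <= m} by exact/nondecreasing_seqP.
have vh : {homo v : n m / (n <= m)%N >-> m <= n} by exact/nonincreasing_seqP.
have uv k : u k <= v k by rewrite -subr_ge0 huv divr_ge0// exprn_ge0.
have uvm k m : u k <= v m.
  have [km|mk] := leqP k m.
    by rewrite (le_trans _ (uv m))// uh.
  by rewrite (le_trans (uv k))// vh// ltnW.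
exists (sup (range u)) => k; apply/andP; split.
  by apply: ub_le_sup; [exists (v 0) => _ [m _ <-]; exact: uvm|exists k].
by apply: ge_sup; [exists (u 0); exists 0|move=> _ [m _ <-]; exact: uvm].
Qed.

(** Goursat's argument with the boundary integral abstracted to a function [J x y u v] of the
    rectangle $[x,y]\times[u,v]$. Additivity leaves, at each stage, a quarter carrying at least a
    quarter of the modulus; the nested quarters shrink to a point, near which [J] is of smaller
    order than the square of the side. *)
Lemma goursat_bisection J (a b s t : R) : a < b -> s < t ->
  (forall x y u v, a <= x -> x < y -> y <= b -> s <= u -> u < v -> v <= t ->
    J x y u v = J x ((x + y) / 2) u v + J ((x + y) / 2) y u v /\
    J x y u v = J x y u ((u + v) / 2) + J x y ((u + v) / 2) v) ->
  (forall p q, a <= p <= b -> s <= q <= t -> forall e, 0 < e ->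
    exists2 d, 0 < d & forall x y u v,
      a <= x -> x <= p -> p <= y -> y <= b -> x < y ->
      s <= u -> u <= q -> q <= v -> v <= t -> u < v ->
      y - x < d -> v - u < d ->
      normc (J x y u v) <= e * ((y - x) + (v - u)) ^+ 2) ->
  J a b s t = 0.
Proof.
move=> ab st addJ locJ.
apply/eqP; rewrite -normc_eq0; apply/negPn/negP => J0.
have {}J0 : 0 < normc (J a b s t) by rewrite lt_def J0 normc_ge0.
set kappa := normc _ in J0.
(* After [k] bisections the sides are divided by $2^k$ and at least $\kappa/4^k$ of the modulus
   remains. *)
pose good k (r : R * R * (R * R)) := [/\ a <= r.1.1, r.1.2 <= b, s <= r.2.1,
  r.2.2 <= t & [/\ r.1.2 - r.1.1 = (b - a) / 2 ^+ k,
   r.2.2 - r.2.1 = (t - s) / 2 ^+ k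
   & kappa / 4 ^+ k <= normc (J r.1.1 r.1.2 r.2.1 r.2.2)]].
pose sub (r r' : R * R * (R * R)) := [/\ r.1.1 <= r'.1.1, r'.1.2 <= r.1.2,
   r.2.1 <= r'.2.1 & r'.2.2 <= r.2.2].
have step k r : good k r -> exists r', good k.+1 r' /\ sub r r'.
  move: r => [[x y] [u v]] [/= ax yb su vt [xy uv Jr]].
  have xLy : x < y by rewrite -subr_gt0 xy divr_gt0 ?exprn_gt0// subr_gt0.
  have uLv : u < v by rewrite -subr_gt0 uv divr_gt0 ?exprn_gt0// subr_gt0.
  set m := (x + y) / 2; set n := (u + v) / 2.
  have [xm my] : x < m /\ m < y by rewrite /m; split; lra.
  have [un nv] : u < n /\ n < v by rewrite /n; split; lra.
  have mx : m - x = (b - a) / 2 ^+ k.+1.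
    have -> : m - x = (y - x) / 2 by rewrite /m; field.
    by rewrite xy exprS; field; rewrite expf_neq0.
  have ym : y - m = (b - a) / 2 ^+ k.+1.
    by rewrite -mx /m; field.
  have nu : n - u = (t - s) / 2 ^+ k.+1.
    have -> : n - u = (v - u) / 2 by rewrite /n; field.
    by rewrite uv exprS; field; rewrite expf_neq0.
  have vn : v - n = (t - s) / 2 ^+ k.+1.
    by rewrite -nu /n; field.
  have [e1 _] := addJ x y u v ax xLy yb su uLv vt.
  have my' := le_trans (ltW my) yb; have am := le_trans ax (ltW xm).
  have [_ e2] := addJ x m u v ax xm my' su uLv vt.
  have [_ e3] := addJ m y u v am my yb su uLv vt.
  move: Jr; rewrite e1 e2 e3 => Jr.
  have sn := le_trans su (ltW un); have nt := le_trans (ltW nv) vt.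
  have k4 : kappa / 4 ^+ k = 4 * (kappa / 4 ^+ k.+1).
    by rewrite exprS; field; rewrite expf_neq0.
  set K := kappa / 4 ^+ k.+1 in k4.
  have [h|h1] := leP K (normc (J x m u n)).
    by exists (x, m, (u, n)); split; split => //=; exact: ltW.
  have [h|h2] := leP K (normc (J x m n v)).
    by exists (x, m, (n, v)); split; split => //=; exact: ltW.
  have [h|h3] := leP K (normc (J m y u n)).
    by exists (m, y, (u, n)); split; split => //=; exact: ltW.
  have [h|h4] := leP K (normc (J m y n v)).
    by exists (m, y, (n, v)); split; split => //=; exact: ltW.
  (* All four quarters are below $K=\kappa/4^{k+1}$, so the whole would be below $4K$. *)
  exfalso; move: Jr; apply/negP; rewrite -ltNge k4.
  apply: (le_lt_trans (le_normcD _ _)).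
  have := le_normcD (J x m u n) (J x m n v).
  have := le_normcD (J m y u n) (J m y n v).
  lra.
(* The choice of a quarter depends on the proof of [good], so the iteration runs on pairs of a stage
   and a rectangle bundled with that proof. *)
have [F [F0 FS]] : exists F : nat -> R * R * (R * R), F 0 = (a, b, (s, t)) /\
    forall k, good k (F k) /\ sub (F k) (F k.+1).
  have stepT : forall kr : {kr : nat * (R * R * (R * R)) | good kr.1 kr.2},
      exists kr' : {kr : nat * (R * R * (R * R)) | good kr.1 kr.2},
        (sval kr').1 = (sval kr).1.+1 /\ sub (sval kr).2 (sval kr').2.
    move=> [[k r] /= g]; have [r' [g' sr]] := step _ _ g.
    by exists (exist _ (k.+1, r') g').
  have g0 : good 0 (a, b, (s, t)).
    split=> //=; split; rewrite ?expr0 ?divr1//.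
  have [G HG] := choice stepT.
  pose x0 : {kr : nat * (R * R * (R * R)) | good kr.1 kr.2} :=
    exist _ (0, (a, b, (s, t))) g0.
  exists (fun k => (sval (iter k G x0)).2); split => // k.
  have -> : good k = good (sval (iter k G x0)).1.
    by congr good; elim: k => // k IH; rewrite iterS (HG _).1 -IH.
  by split; [exact: (svalP (iter k G x0))|rewrite iterS; exact: (HG _).2].
have [p hp] : exists p, forall k, (F k).1.1 <= p <= (F k).1.2.
  apply: (@nondecreasing_bounded_lim _ _ (b - a)).
  - by move=> k; case: (FS k) => _ [].
  - by move=> k; case: (FS k) => _ [].
  - by move=> k; case: (FS k) => -[_ _ _ _ []].
  - by rewrite subr_ge0 ltW.
have [q hq] : exists q, forall k, (F k).2.1 <= q <= (F k).2.2.
  apply: (@nondecreasing_bounded_lim _ _ (t - s)).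
  - by move=> k; case: (FS k) => _ [].
  - by move=> k; case: (FS k) => _ [].
  - by move=> k; case: (FS k) => -[_ _ _ _ []].
  - by rewrite subr_ge0 ltW.
pose D := (b - a) + (t - s).
have D0 : 0 < D by rewrite addr_gt0// subr_gt0.
(* This $\varepsilon$ makes the local bound at stage [k] equal to half of $\kappa/4^k$. *)
have e0 : 0 < kappa / (2 * D ^+ 2) by rewrite divr_gt0// mulr_gt0// exprn_gt0.
have pab : a <= p <= b by have := hp 0; rewrite F0.
have qst : s <= q <= t by have := hq 0; rewrite F0.
have [d d0 hd] := locJ p q pab qst _ e0.
have [k hk] : exists k, D / 2 ^+ k < d.
  have : (fun k => D * (2^-1) ^+ k) @ \oo --> D * 0.
    by apply: cvgMr; apply: cvg_expr; rewrite ger0_norm ?invr_ge0// invf_lt1// ltr1n.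
  rewrite mulr0 => /cvgrPdist_lt /(_ d d0) [N _ /(_ N (leqnn N))] /=.
  rewrite sub0r normrN => h; exists N; apply: le_lt_trans h.
  by rewrite exprVn ler_norm.
have [[ax yb su vt [xy uv Jr]] _] := FS k.
have /andP[xp py] := hp k; have /andP[uq qv] := hq k.
have xLy : (F k).1.1 < (F k).1.2 by rewrite -subr_gt0 xy divr_gt0 ?exprn_gt0// subr_gt0.
have uLv : (F k).2.1 < (F k).2.2 by rewrite -subr_gt0 uv divr_gt0 ?exprn_gt0// subr_gt0.
have yxd : (F k).1.2 - (F k).1.1 < d.
  rewrite xy (le_lt_trans _ hk)// ler_wpM2r ?invr_ge0 ?exprn_ge0//.
  by rewrite /D lerDl subr_ge0 ltW.
have vud : (F k).2.2 - (F k).2.1 < d.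
  rewrite uv (le_lt_trans _ hk)// ler_wpM2r ?invr_ge0 ?exprn_ge0//.
  by rewrite /D lerDr subr_ge0 ltW.
have := hd _ _ _ _ ax xp py yb xLy su uq qv vt uLv yxd vud.
apply/negP; rewrite -ltNge (lt_le_trans _ Jr)//.
rewrite xy uv -mulrDl -/D.
have -> : kappa / (2 * D ^+ 2) * (D / 2 ^+ k) ^+ 2 = kappa / 4 ^+ k / 2.
  have -> : 4 ^+ k = (2 ^+ k) ^+ 2 :> R by rewrite -exprM mulnC exprM; congr (_ ^+ k); ring.
  by field; apply/andP; split; rewrite ?expf_neq0// gt_eqF.
by rewrite ltr_pdivrMr// ltr_pMr ?ltr1n// divr_gt0// exprn_gt0.
Qed.

End Bisection.

(** * Continuity and integrals along a real parameter *)

Section CurveIntegral.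
Context {R : realType}.
Notation mu := (@lebesgue_measure R).
Implicit Types (f g : R -> R[i]) (a b : R) (A : set R).

(** Stated with [normc] because the parameter lives over [R] while the values are normed by [R[i]];
    [ccont_within] is the passage to the real topology. *)
Definition ccont A f := forall x, A x -> forall e, 0 < e ->
  exists2 d, 0 < d & forall y, A y -> `|y - x| < d -> normc (f y - f x) < e.

Lemma ccont_cst A (c : R[i]) : ccont A (fun=> c).
Proof. by move=> x _ e e0; exists 1 => // y _ _; rewrite subrr normc0. Qed.

Lemma ccontD A f g : ccont A f -> ccont A g -> ccont A (fun x => f x + g x).
Proof.
move=> hf hg x Ax e e0; have e2 : 0 < e / 2 by rewrite divr_gt0.
have [d d0 hd] := hf x Ax _ e2; have [d' d'0 hd'] := hg x Ax _ e2.
exists (Num.min d d'); first by rewrite lt_min d0.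
move=> y Ay; rewrite lt_min => /andP[yd yd'].
rewrite opprD addrACA (le_lt_trans (le_normcD _ _))// [e]splitr.
by rewrite ltrD ?hd ?hd'.
Qed.

Lemma ccontM A f g : ccont A f -> ccont A g -> ccont A (fun x => f x * g x).
Proof.
move=> hf hg x Ax e e0.
set M := normc (g x) + 1; set N := normc (f x) + 1.
have M0 : 0 < M by rewrite ltr_wpDl ?normc_ge0.
have N0 : 0 < N by rewrite ltr_wpDl ?normc_ge0.
have eM : 0 < e / 2 / M by rewrite !divr_gt0.
have eN : 0 < e / 2 / N by rewrite !divr_gt0.
have [d d0 hd] := hf x Ax _ eM; have [d' d'0 hd'] := hg x Ax _ eN.
have [d1 d10 hd1] := hg x Ax _ ltr01.
exists (Num.min d (Num.min d' d1)); first by rewrite !lt_min d0 d'0.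
move=> y Ay; rewrite !lt_min => /and3P[yd yd' yd1].
have -> : f y * g y - f x * g x = (f y - f x) * g y + f x * (g y - g x) by ring.
rewrite (le_lt_trans (le_normcD _ _))// !normcM.
have gy : normc (g y) <= M.
  by rewrite /M -lerBlDl (le_trans (le_normcB _ _))// ltW// hd1.
apply: (@le_lt_trans _ _ (normc (f y - f x) * M + N * normc (g y - g x))).
  by apply: lerD; [exact: ler_wpM2l (normc_ge0 _) _ _ _|
                   apply: ler_wpM2r; rewrite ?normc_ge0// /N lerDl].
rewrite [e]splitr; apply: ltrD.
  by rewrite -ltr_pdivlMr// hd.
by rewrite mulrC -ltr_pdivlMr// hd'.
Qed.

Lemma ccont_within A f : ccont A f ->
  {within A, continuous (fun x => Re (f x))} /\
  {within A, continuous (fun x => Im (f x))}.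
Proof.
move=> hf; split; apply/subspace_continuousP => x Ax;
  apply/cvgrPdist_lt => e e0; have [d d0 hd] := hf x Ax e e0;
  rewrite !near_withinE; exists d => //= y; rewrite /ball_/= distrC => yd Ay;
  rewrite distrC; apply: le_lt_trans (hd y Ay yd).
  by rewrite -cReN -cReD Re_le_normc.
by rewrite -cImN -cImD Im_le_normc.
Qed.

Lemma ccont_cintegrable a b f : ccont `[a, b] f -> cintegrable mu `[a, b] f.
Proof.
move=> /ccont_within[h1 h2]; split;
  by apply: continuous_compact_integrable => //; exact: segment_compact.
Qed.

Lemma itv_mu_fin a b : (mu `[a, b] < +oo)%E.
Proof. by rewrite lebesgue_measure_itv/=; case: ifPn => // _; rewrite ltry. Qed.

Lemma fine_mu_itv a b : a <= b -> fine (mu `[a, b]) = b - a.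
Proof.
rewrite lebesgue_measure_itv/= lte_fin le_eqVlt => /predU1P[->|ab].
  by rewrite ltxx subrr.
by rewrite ab.
Qed.

Lemma cint_split a m b f : a <= m -> m <= b -> ccont `[a, b] f ->
  cint mu `[a, b] f = cint mu `[a, m] f + cint mu `[m, b] f.
Proof.
move=> am mb /ccont_cintegrable[h1 h2].
have H (g : R -> R) : mu.-integrable `[a, b] (EFin \o g) ->
    \int[mu]_(x in `[a, b]) g x =
    \int[mu]_(x in `[a, m]) g x + \int[mu]_(x in `[m, b]) g x.
  move=> ig; have := @Rintegral_itvB R g (BLeft a) (BRight b) m ig.
  rewrite !bnd_simp => /(_ am mb) /eqP; rewrite subr_eq addrC => /eqP ->.
  congr (_ + _); apply: Rintegral_itv_obnd_cbnd.
  apply: integrableS ig => //; apply: subset_itv; rewrite bnd_simp//.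
by rewrite /cint; simpc; rewrite !H.
Qed.

Lemma Rintegral_derive a b (F f : R -> R) : a < b ->
  (forall t : R, is_derive t (1 : R) F (f t)) -> {within `[a, b], continuous f} ->
  \int[mu]_(x in `[a, b]) f x = F b - F a.
Proof.
move=> ab dF cf.
have cF : continuous F by move=> t; apply/differentiable_continuous/derivable1_diffP; case: (dF t).
rewrite /Rintegral (@continuous_FTC2 _ f F)//.
  split; first by move=> t _; case: (dF t).
    exact/cvg_at_right_filter/cF.
  exact/cvg_at_left_filter/cF.
by move=> t _; rewrite derive1E; case: (dF t).
Qed.

(* The explicit antiderivative is [h0 * g + h1 * (g - z0)^2 / 2]. *)
Lemma cint_affine a b (g g' : R -> R[i]) (z0 h0 h1 : R[i]) : a < b ->
  (forall t : R, is_derive t (1 : R) (fun t => Re (g t)) (Re (g' t))) ->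
  (forall t : R, is_derive t (1 : R) (fun t => Im (g t)) (Im (g' t))) ->
  ccont `[a, b] g -> ccont `[a, b] g' ->
  cint mu `[a, b] (fun t => (h0 + h1 * (g t - z0)) * g' t) =
  (h0 * g b + h1 * (g b - z0) ^+ 2 / 2) - (h0 * g a + h1 * (g a - z0) ^+ 2 / 2).
Proof.
move=> ab dx dy cg cg'.
have cf : ccont `[a, b] (fun t => (h0 + h1 * (g t - z0)) * g' t).
  apply: ccontM => //; apply: ccontD; first exact: ccont_cst.
  apply: ccontM; first exact: ccont_cst.
  by apply: ccontD => //; exact: ccont_cst.
have [c1 c2] := ccont_within cf.
have half (z : R[i]) : z / 2 = (Re z / 2) +i* (Im z / 2).
  apply: (@mulIf _ 2); rewrite ?pnatr_eq0// divfK ?pnatr_eq0// mulr_natr mulr2n.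
  by case: z => u v; simpc; rewrite -!splitr.
pose x t := Re (g t); pose y t := Im (g t).
pose x' t := Re (g' t); pose y' t := Im (g' t).
have gE t : g t = x t +i* y t by rewrite /x /y; case: (g t).
have g'E t : g' t = x' t +i* y' t by rewrite /x' /y'; case: (g' t).
case: z0 h0 h1 cf c1 c2 => [x0 y0] [p q] [u v] cf c1 c2.
pose F1 t := p * x t - q * y t + 2^-1 * (u * ((x t - x0) * (x t - x0) - (y t - y0) * (y t - y0)) - 2 * v * ((x t - x0) * (y t - y0))).
pose F2 t := p * y t + q * x t + 2^-1 * (v * ((x t - x0) * (x t - x0) - (y t - y0) * (y t - y0)) + 2 * u * ((x t - x0) * (y t - y0))).
have dx' t : is_derive t (1 : R) x (x' t) by exact: dx.
have dy' t : is_derive t (1 : R) y (y' t) by exact: dy.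
have dF1 t : is_derive t (1 : R) F1 (Re (((p +i* q) + (u +i* v) * (g t - (x0 +i* y0))) * g' t)).
  apply: is_derive_eq; rewrite gE g'E; simpc; rewrite /GRing.scale/=; by field.
have dF2 t : is_derive t (1 : R) F2 (Im (((p +i* q) + (u +i* v) * (g t - (x0 +i* y0))) * g' t)).
  apply: is_derive_eq; rewrite gE g'E; simpc; rewrite /GRing.scale/=; by field.
rewrite /cint (Rintegral_derive ab dF1 c1) (Rintegral_derive ab dF2 c2).
rewrite !half !gE /F1 /F2 !expr2; simpc; congr (_ +i* _) => /=; by field.
Qed.

End CurveIntegral.

(** * Goursat's theorem for the circle *)

Section Goursat.
Context {R : realType}.
Local Notation C := R[i].
Notation mu := (@lebesgue_measure R).

Lemma derivable_eps (h : C -> C) (z : C) : derivable h z (1 : C) ->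
  exists h1 : C, forall e : R, 0 < e -> exists2 d : R, 0 < d &
    forall z', normc (z' - z) < d ->
      normc (h z' - (h z + h1 * (z' - z))) <= e * normc (z' - z).
Proof.
move=> /cvg_ex[h1 /= /cvgrPdist_lt hh]; exists h1 => e e0.
have eC : 0 < e%:C :> C by rewrite ltcR.
have [d /= d0 hd] := hh _ eC.
have dR : d = (Re d)%:C by case: (d) d0 => u v; rewrite ltcE /= => /andP[/eqP -> _].
exists (Re d) => [|z' z'd]; first by rewrite -ltcR -dR.
have [->|zz'] := eqVneq z' z.
  by rewrite !subrr mulr0 addr0 subrr normc0 mulr0.
have := hd (z' - z).
rewrite /ball_/= sub0r normrN subr_eq0 zz' dR normr_ltC => /(_ z'd isT).
rewrite normr_ltC; have -> : (z' - z) *: (1 : C) + z = z' by rewrite /GRing.scale/= mulr1 subrK.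
have nz : 0 < normc (z' - z) by rewrite normc_gt0 subr_eq0.
rewrite -(ltr_pM2r nz) -normcM => /ltW; apply: le_trans.
rewrite -normcN le_eqVlt; apply/orP; left; apply/eqP; congr normc.
rewrite /GRing.scale/=; field; by rewrite subr_eq0.
Qed.

Lemma ccont_comp (h : C -> C) (A : set R) (g : R -> C) :
  (forall t, A t -> derivable h (g t) (1 : C)) -> ccont A g -> ccont A (h \o g).
Proof.
move=> dh cg t At e e0; have [h1 H] := derivable_eps (dh t At).
have [d d0 hd] := H 1 ltr01.
set N := 1 + normc h1.
have N0 : 0 < N by rewrite ltr_pwDl ?normc_ge0.
have m0 : 0 < Num.min d (e / N) by rewrite lt_min d0 divr_gt0.
have [d' d'0 hd'] := cg t At _ m0; exists d' => // y Ay yt.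
have := hd' y Ay yt; rewrite lt_min => /andP[gd ge].
apply: (@le_lt_trans _ _ (N * normc (g y - g t))); last first.
  by rewrite mulrC -ltr_pdivlMr.
have -> : (h \o g) y - (h \o g) t =
  (h (g y) - (h (g t) + h1 * (g y - g t))) + h1 * (g y - g t) by rewrite /=; ring.
apply: (le_trans (le_normcD _ _)); rewrite mulrDl normcM; apply: lerD => //.
exact: hd.
Qed.

(** The first-order part of [h] has an antiderivative, so its integral depends on the endpoints
    only. Over the four sides of a rectangle these endpoint terms cancel, and just the errors
    bounded here remain. *)
Lemma cint_curve_approx (a b : R) (h : C -> C) (g g' : R -> C) (z0 h0 h1 : C) (E L : R) :
  a < b ->
  (forall t : R, is_derive t (1 : R) (fun t => Re (g t)) (Re (g' t))) ->
  (forall t : R, is_derive t (1 : R) (fun t => Im (g t)) (Im (g' t))) ->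
  ccont `[a, b] g -> ccont `[a, b] g' -> ccont `[a, b] (h \o g) ->
  (forall t, a <= t <= b -> normc (h (g t) - (h0 + h1 * (g t - z0))) <= E) ->
  (forall t, a <= t <= b -> normc (g' t) <= L) -> 0 <= E -> 0 <= L ->
  normc (cint mu `[a, b] (fun t => h (g t) * g' t) -
    ((h0 * g b + h1 * (g b - z0) ^+ 2 / 2) - (h0 * g a + h1 * (g a - z0) ^+ 2 / 2)))
  <= 2 * E * L * (b - a).
Proof.
move=> ab dx dy cg cg' ch hE hL E0 L0.
rewrite -(cint_affine z0 h0 h1 ab dx dy cg cg').
have ca : ccont `[a, b] (fun t => (h0 + h1 * (g t - z0)) * g' t).
  apply: ccontM => //; apply: ccontD; first exact: ccont_cst.
  apply: ccontM; first exact: ccont_cst.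
  by apply: ccontD => //; exact: ccont_cst.
rewrite -cintB//; try (apply: ccont_cintegrable => //; exact: ccontM).
rewrite -mulrA -(fine_mu_itv (ltW ab)) !mulrA -(mulrA 2).
apply: normc_cint => //; first exact: itv_mu_fin.
  apply: cintegrableB => //; apply: ccont_cintegrable => //; exact: ccontM.
move=> t /=; rewrite in_itv/= => tab; rewrite -mulrBl normcM.
by apply: ler_pM; rewrite ?normc_ge0 ?hE ?hL.
Qed.

Definition circ (r t : R) : C := (r * cos t) +i* (r * sin t).

Lemma normc_circ r t : 0 <= r -> normc (circ r t) = r.
Proof.
move=> r0; rewrite /normc /circ !exprMn -mulrDr cos2Dsin2 mulr1 sqrtr_sqr.
exact: ger0_norm.
Qed.

Lemma ccont_circ r A : ccont A (circ r).
Proof.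
have cc : continuous (fun t : R => r * cos t).
  by move=> t; apply: cvgM; [exact: cvg_cst|exact: continuous_cos].
have cs : continuous (fun t : R => r * sin t).
  by move=> t; apply: cvgM; [exact: cvg_cst|exact: continuous_sin].
move=> t _ e e0; have e2 : 0 < e / 2 by rewrite divr_gt0.
have /cvgrPdist_lt/(_ _ e2)[d /= d0 hd] := cc t.
have /cvgrPdist_lt/(_ _ e2)[d' /= d'0 hd'] := cs t.
exists (Num.min d d'); first by rewrite lt_min d0.
move=> y _; rewrite lt_min distrC => /andP[yd yd'].
apply: (le_lt_trans (normc_le_ReIm _)); rewrite [ltRHS]splitr.
by apply: ltrD; rewrite /= distrC; [apply: hd|apply: hd'].
Qed.

Lemma derive_Re_circ r (t : R) :
  is_derive t (1 : R) (fun t => Re (circ r t)) (Re (circ r t * 'i%C)).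
Proof. by apply: is_derive_eq; rewrite /GRing.scale/=; ring. Qed.

Lemma derive_Im_circ r (t : R) :
  is_derive t (1 : R) (fun t => Im (circ r t)) (Im (circ r t * 'i%C)).
Proof. by apply: is_derive_eq; rewrite /GRing.scale/=; ring. Qed.

Lemma normc_i : normc ('i%C : C) = 1.
Proof. by rewrite /normc expr0n expr1n add0r sqrtr1. Qed.

Lemma circ_lip r u v : 0 <= r -> u < v ->
  normc (circ r v - circ r u) <= 2 * r * (v - u).
Proof.
move=> r0 uv.
have ci : ccont `[u, v] (fun t => circ r t * 'i%C).
  by apply: ccontM; [exact: ccont_circ|exact: ccont_cst].
have := cint_affine 0 1 0 uv (derive_Re_circ r) (derive_Im_circ r) (@ccont_circ r _) ci.
rewrite !mul0r !addr0 !mul1r => <-.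
rewrite -(fine_mu_itv (ltW uv)).
apply: normc_cint => //; first exact: itv_mu_fin.
  apply: ccont_cintegrable; apply: ccontM => //.
  apply: ccontD; first exact: ccont_cst.
  apply: ccontM; first exact: ccont_cst.
  by apply: ccontD; [exact: ccont_circ|exact: ccont_cst].
by move=> t _; rewrite mul0r addr0 mul1r normcM normc_i mulr1 normc_circ.
Qed.

Lemma normcD4 (z1 z2 z3 z4 : C) :
  normc (z1 + z2 - z3 - z4) <= normc z1 + normc z2 + normc z3 + normc z4.
Proof.
have := le_normcD (z1 + z2 - z3) (- z4); have := le_normcD (z1 + z2) (- z3).
by have := le_normcD z1 z2; rewrite !normcN; lra.
Qed.

(* Goursat's theorem for the circle, shrunk radially to the interior point
   [w]: the integral over [w + l * (circ - w)] does not depend on [l], and the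
   integrand is bounded as [l] tends to 0. *)
Lemma cauchy_circle (h : C -> C) (r : R) (w : C) (M l1 : R) :
  normc w < r -> 0 < l1 ->
  (forall z, normc z <= r -> z != w -> derivable h z (1 : C)) ->
  (forall z, normc (z - w) <= l1 -> z != w -> normc (h z) <= M) ->
  cint mu `[0, 2 * pi] (fun t => h (circ r t) * circ r t) = 0.
Proof.
move=> wr l10 dh hM.
have r0 : 0 < r by rewrite (le_lt_trans _ wr)// normc_ge0.
pose c t := circ r t - w.
pose g l t := w + l%:C * c t.
have c2r t : normc (c t) <= 2 * r.
  rewrite (le_trans (le_normcD _ _))// normcN normc_circ ?(ltW r0)//.
  by have := wr; lra.
have c0 t : c t != 0.
  rewrite /c subr_eq0; apply: contraTneq wr => <-.
  by rewrite normc_circ ?(ltW r0)// ltxx.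
have gw l t : 0 < l -> g l t != w.
  move=> l0; rewrite /g -subr_eq0 addrC addKr mulf_neq0//.
  by rewrite -normc_eq0 normcR normr_eq0 gt_eqF.
have gr l t : 0 < l -> l <= 1 -> normc (g l t) <= r.
  move=> l0 l1'; have -> : g l t = (1 - l)%:C * w + l%:C * circ r t.
    by rewrite /g /c rmorphB rmorph1; ring.
  rewrite (le_trans (le_normcD _ _))// !normcM !normcR normc_circ ?(ltW r0)//.
  rewrite !ger0_norm ?subr_ge0// ?(ltW l0)//.
  have := wr; nra.
have dg l t : 0 < l -> l <= 1 -> derivable h (g l t) (1 : C).
  by move=> l0 l1'; apply: dh; [exact: gr|exact: gw].
have cc A : ccont A c by apply: ccontD; [exact: ccont_circ|exact: ccont_cst].
have cg1 l A : ccont A (g l).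
  by apply: ccontD; [exact: ccont_cst|apply: ccontM => //; exact: ccont_cst].
have cR A : ccont A (fun l : R => l%:C).
  move=> x _ e e0; exists e => // y _; rewrite -rmorphB normcR//.
have cg2 t A : ccont A (g ^~ t).
  by apply: ccontD; [exact: ccont_cst|apply: ccontM => //; exact: ccont_cst].
have ci A : ccont A (fun t => circ r t * 'i%C).
  by apply: ccontM; [exact: ccont_circ|exact: ccont_cst].
pose H1 t x y := cint mu `[x, y] (fun l => h (g l t) * c t).
pose H2 l u v := cint mu `[u, v] (fun t => h (g l t) * (l%:C * (circ r t * 'i%C))).
have ch1 t x y : 0 < x -> y <= 1 -> ccont `[x, y] (h \o (g ^~ t)).
  move=> x0 y1; apply: ccont_comp => // l /=; rewrite in_itv/= => /andP[xl ly].
  by apply: dg; [exact: lt_le_trans xl|exact: le_trans ly _].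
have ch2 l u v : 0 < l -> l <= 1 -> ccont `[u, v] (h \o (g l)).
  by move=> l0 l1'; apply: ccont_comp => // t _; exact: dg.
pose J x y u v := H1 u x y + H2 y u v - H1 v x y - H2 x u v.
have twopi : 0 < 2 * pi :> R by rewrite mulr_gt0// pi_gt0.
have J0 l0 : 0 < l0 -> l0 < 1 -> J l0 1 0 (2 * pi) = 0.
  move=> l00 l01; apply: goursat_bisection => //.
    move=> x y u v ax xy yb su uv vt.
    have x0 := lt_le_trans l00 ax.
    set m := (x + y) / 2; set n := (u + v) / 2.
    have [xm my] : x < m /\ m < y by rewrite /m; split; lra.
    have [un nv] : u < n /\ n < v by rewrite /n; split; lra.
    have S1 t : H1 t x y = H1 t x m + H1 t m y.
      apply: cint_split; [exact: ltW|exact: ltW|].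
      by apply: ccontM; [exact: ch1|exact: ccont_cst].
    have S2 l : 0 < l -> l <= 1 -> H2 l u v = H2 l u n + H2 l n v.
      move=> ? ?; apply: cint_split; [exact: ltW|exact: ltW|].
      by apply: ccontM; [exact: ch2|apply: ccontM => //; exact: ccont_cst].
    have S2x := S2 x x0 (le_trans (ltW xy) yb); have S2y := S2 y (lt_trans x0 xy) yb.
    rewrite /J; clear J S2 ch1 ch2; clearbody H1 H2 m n.
    by split; [rewrite !S1|rewrite S2x S2y]; ring.
  move=> p q /andP[ap pb] /andP[sq qt] e e0.
  have p0 := lt_le_trans l00 ap.
  have [h1 Hd] := derivable_eps (dg p q p0 pb).
  (* Each of the four sides will contribute at most $2\cdot(E\cdot2rD)\cdot2r\cdot D=8Er^2D^2$; one
     factor $2r$ comes from the distance bound [near], the other from the speed of the curve. *)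
  pose E := e / (32 * r ^+ 2).
  have E0 : 0 < E by rewrite divr_gt0// mulr_gt0// exprn_gt0.
  have [d d0 hd] := Hd E E0.
  have r2 : 0 < 2 * r by rewrite mulr_gt0.
  exists (d / (4 * r)); first by rewrite divr_gt0// mulr_gt0.
  move=> x y u v ax xp py yb xy su uq qv vt uv yxd vud.
  have x0 := lt_le_trans l00 ax; have y0 := lt_trans x0 xy.
  have x1 := le_trans (ltW xy) yb.
  pose D := (y - x) + (v - u).
  have D0 : 0 < D by rewrite addr_gt0// subr_gt0.
  have Dd : 2 * r * D < d.
    rewrite mulrC -ltr_pdivlMr//.
    have -> : d / (2 * r) = d / (4 * r) + d / (4 * r) by field; rewrite gt_eqF.
    exact: ltrD.
  have lipc s : u <= s <= v -> normc (c s - c q) <= 2 * r * (v - u).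
    move=> /andP[us sv]; rewrite /c opprB addrA subrK.
    have [sq'|qs|->] := ltgtP s q.
    - rewrite normcB (le_trans (circ_lip (ltW r0) sq'))// ler_pM2l//; lra.
    - rewrite (le_trans (circ_lip (ltW r0) qs))// ler_pM2l//; lra.
    - by rewrite subrr normc0 mulr_ge0// ?(ltW r2)// subr_ge0 ltW.
  have near l s : x <= l <= y -> u <= s <= v ->
      normc (g l s - g p q) <= 2 * r * D.
    move=> /andP[xl ly] us; have -> : g l s - g p q =
      (l - p)%:C * c s + p%:C * (c s - c q) by rewrite /g rmorphB; ring.
    rewrite (le_trans (le_normcD _ _))// !normcM !normcR /D mulrDr.
    apply: lerD; last first.
      rewrite -[leRHS]mul1r; apply: ler_pM; rewrite ?normc_ge0//.
        by rewrite ger0_norm// ltW.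
      exact: lipc.
    rewrite mulrC; apply: ler_pM; rewrite ?normc_ge0//.
    rewrite ler_norml; apply/andP; split; lra.
  have approx l s : x <= l <= y -> u <= s <= v ->
      normc (h (g l s) - (h (g p q) + h1 * (g l s - g p q))) <= E * (2 * r * D).
    move=> hl hs; apply: (le_trans (hd _ (le_lt_trans (near _ _ hl hs) Dd))).
    by rewrite ler_pM2l// near.
  have B0 : 0 <= E * (2 * r * D) by rewrite mulr_ge0 ?(ltW E0)// mulr_ge0 ?ltW.
  pose G z : C := h (g p q) * z + h1 * (z - g p q) ^+ 2 / 2.
  have A1 s : u <= s <= v -> normc (H1 s x y - (G (g y s) - G (g x s))) <=
      2 * (E * (2 * r * D)) * (2 * r) * (y - x).
    move=> hs; apply: (cint_curve_approx xy) => //; rewrite ?(ltW r2)//.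
    - move=> t; have : is_derive t (1 : R) (fun l : R => Re w + l * Re (c s)) (Re (c s)).
        by apply: is_derive_eq; rewrite /GRing.scale/=; ring.
      congr is_derive; apply/funext => l; rewrite [RHS]cReD [X in _ = _ + X]cReM/=; ring.
    - move=> t; have : is_derive t (1 : R) (fun l : R => Im w + l * Im (c s)) (Im (c s)).
        by apply: is_derive_eq; rewrite /GRing.scale/=; ring.
      congr is_derive; apply/funext => l; rewrite [RHS]cImD [X in _ = _ + X]cImM/=; ring.
    - exact: ccont_cst.
    - exact: ch1.
    - by move=> l hl; exact: approx.
  have A2 l : x <= l <= y -> normc (H2 l u v - (G (g l v) - G (g l u))) <=
      2 * (E * (2 * r * D)) * (2 * r) * (v - u).
    move=> hl; have /andP[xl ly] := hl.
    have l0' := lt_le_trans x0 xl; have l1' := le_trans ly yb.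
    apply: (cint_curve_approx uv) => //; rewrite ?(ltW r2)//.
    - move=> t; have D1 := derive_Re_circ r t; have D2 := derive_Im_circ r t.
      have : is_derive t (1 : R) (fun t : R => Re w + l * (Re (circ r t) - Re w)) (l * Re (circ r t * 'i%C)).
        by apply: is_derive_eq; rewrite /GRing.scale/=; ring.
      have -> : l * Re (circ r t * 'i%C) = Re (l%:C * (circ r t * 'i%C)) by rewrite [RHS]cReM/=; ring.
      congr is_derive; apply/funext => l'; rewrite [RHS]cReD [X in _ = _ + X]cReM /c cReD cReN/=; ring.
    - move=> t; have D1 := derive_Re_circ r t; have D2 := derive_Im_circ r t.
      have : is_derive t (1 : R) (fun t : R => Im w + l * (Im (circ r t) - Im w)) (l * Im (circ r t * 'i%C)).
        by apply: is_derive_eq; rewrite /GRing.scale/=; ring.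
      have -> : l * Im (circ r t * 'i%C) = Im (l%:C * (circ r t * 'i%C)) by rewrite [RHS]cImM/=; ring.
      congr is_derive; apply/funext => l'; rewrite [RHS]cImD [X in _ = _ + X]cImM /c cImD cImN/=; ring.
    - by apply: ccontM => //; exact: ccont_cst.
    - exact: ch2.
    - by move=> s hs; exact: approx.
    - move=> s _; rewrite !normcM normc_i normcR normc_circ ?(ltW r0)// mulr1.
      rewrite ger0_norm ?(ltW l0')//; nra.
  have xx : x <= x <= y by rewrite lexx ltW.
  have yy : x <= y <= y by rewrite lexx ltW.
  have uu : u <= u <= v by rewrite lexx ltW.
  have vv : u <= v <= v by rewrite lexx ltW.
  have -> : J x y u v = (H1 u x y - (G (g y u) - G (g x u)))
    + (H2 y u v - (G (g y v) - G (g y u)))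
    - (H1 v x y - (G (g y v) - G (g x v)))
    - (H2 x u v - (G (g x v) - G (g x u))) by rewrite /J; ring.
  have a1 := A1 u uu; have a2 := A1 v vv; have a3 := A2 x xx; have a4 := A2 y yy.
  apply: (le_trans (normcD4 _ _ _ _)).
  have -> : e * ((y - x) + (v - u)) ^+ 2 =
    4 * (2 * (E * (2 * r * D)) * (2 * r) * D).
    by rewrite -/D /E; field; rewrite gt_eqF.
  set K := 2 * (E * (2 * r * D)) * (2 * r) in a1 a2 a3 a4 *.
  have K0 : 0 <= K by rewrite /K mulr_ge0 ?(ltW r2)// mulr_ge0.
  have yD : K * (y - x) <= K * D by rewrite ler_wpM2l// /D lerDl subr_ge0 ltW.
  have vD : K * (v - u) <= K * D by rewrite ler_wpM2l// /D lerDr subr_ge0 ltW.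
  have -> : 4 * (K * D) = K * D + K * D + K * D + K * D by ring.
  by apply: lerD (lerD (lerD _ _) _) _; [exact: le_trans a1 yD|exact: le_trans a4 vD|
    exact: le_trans a2 yD|exact: le_trans a3 vD].
(* The curve closes up, so the radial sides at the angles 0 and $2\pi$ coincide and cancel. *)
have per l : g l 0 = g l (2 * pi).
  by rewrite /g /c /circ cos0 sin0 mulr2n mulrDl mul1r -mulr2n cos2pi sin2pi.
have perc : c 0 = c (2 * pi).
  by rewrite /c /circ cos0 sin0 mulr2n mulrDl mul1r -mulr2n cos2pi sin2pi.
set I := cint _ _ _.
have I1 : I = - 'i%C * H2 1 0 (2 * pi).
  rewrite /I /H2 -cintZ//.
    apply: eq_cint => t _; rewrite /g /c mul1r [w + _]addrC subrK.
    have := sqr_i R; rewrite expr2 => ii.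
    have -> : - 'i%C * (h (circ r t) * (1 * (circ r t * 'i%C))) =
      - ('i%C * 'i%C) * (h (circ r t) * circ r t) :> C by ring.
    by rewrite ii opprK mul1r.
  apply: ccont_cintegrable; apply: ccontM; first exact: ch2.
  by apply: ccontM => //; exact: ccont_cst.
apply/eqP; rewrite -normc_eq0 eq_le normc_ge0 andbT; apply/ler_addgt0Pl => e e0.
rewrite addr0 I1 normcM normcN normc_i mul1r.
(* So small that the shrunken curve lies where [h] is bounded by [M], and that its integral, of
   order [l], is at most [e]. *)
have [l [l0 l1' lr lM]] : exists l, [/\ 0 < l, l < 1, l * (2 * r) <= l1
    & 2 * (`|M| * (l * r)) * (2 * pi) <= e].
  pose A := (2 * pi * `|M| * (2 * r)).
  have A0 : 0 <= A by rewrite !mulr_ge0// ?(ltW r0)// pi_ge0.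
  have Ap : 0 < A + 1 by rewrite ltr_wpDl.
  exists (Num.min (2^-1) (Num.min (l1 / (2 * r)) (e / (A + 1)))); split.
  - by rewrite !lt_min invr_gt0 ltr0n/= !divr_gt0// mulr_gt0.
  - by rewrite !gt_min invf_lt1// ltr1n.
  - by rewrite -ler_pdivlMr ?mulr_gt0// !ge_min lexx orbT.
  - have -> x : 2 * (`|M| * (x * r)) * (2 * pi) = A * x by rewrite /A; ring.
    apply: (@le_trans _ _ (A * (e / (A + 1)))).
      by rewrite ler_wpM2l// !ge_min lexx !orbT.
    by rewrite mulrA ler_pdivrMr// mulrDr mulr1 mulrC lerDl ltW.
have := J0 l l0 l1'; rewrite /J.
have -> : H1 (2 * pi) l 1 = H1 0 l 1.
  by apply: eq_cint => s _; rewrite per perc.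
move=> /eqP; rewrite [H1 0 l 1 + _]addrC addrK subr_eq0 => /eqP ->.
apply: le_trans lM.
rewrite [leRHS](_ : _ = 2 * (`|M| * (l * r)) * fine (mu `[0, 2 * pi])); last first.
  by rewrite fine_mu_itv ?subr0// ltW.
apply: normc_cint => //; first exact: itv_mu_fin.
  apply: ccont_cintegrable; apply: ccontM; first exact/ch2/ltW.
  by apply: ccontM => //; exact: ccont_cst.
move=> t _; rewrite !normcM normc_i mulr1 normcR normc_circ ?(ltW r0)//.
apply: ler_pM; rewrite ?normc_ge0// ?mulr_ge0// ?(ltW r0)//.
  apply: le_trans (ler_norm _); apply: hM; last exact: gw.
  rewrite /g addrC addKr normcM normcR ger0_norm ?(ltW l0)//.
  apply: le_trans lr; apply: ler_wpM2l => //; exact: ltW.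
by rewrite ger0_norm ?(ltW l0).
Qed.

End Goursat.

#[global] Arguments circ : simpl never.

(** * Cauchy's integral formula in one variable *)

Section CauchyFormula.
Context {R : realType}.
Local Notation C := R[i].
Local Notation mu := (@lebesgue_measure R).

Lemma circ_neq (r t : R) (w : C) : normc w < r -> circ r t - w != 0.
Proof.
move=> wr; have r0 : 0 < r by rewrite (le_lt_trans _ wr)// normc_ge0.
rewrite subr_eq0; apply: contraTneq wr => <-.
by rewrite normc_circ ?(ltW r0)// ltxx.
Qed.

Lemma circ_neq0 (r t : R) : 0 < r -> circ r t != 0.
Proof. by move=> r0; rewrite -normc_eq0 normc_circ ?(ltW r0)// gt_eqF. Qed.

Lemma ccont_inv (A : set R) (f : R -> C) : (forall t, A t -> f t != 0) ->
  ccont A f -> ccont A (fun t => (f t)^-1).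
Proof.
move=> f0 cf; apply: (@ccont_comp _ (fun z => z^-1)) => // t At.
apply: derivableV; [exact: f0|exact: derivable_id].
Qed.

Lemma ccont_kernel (A : set R) (r : R) (w : C) : normc w < r ->
  ccont A (fun t => circ r t / (circ r t - w)).
Proof.
move=> wr; apply: ccontM; first exact: ccont_circ.
apply: ccont_inv; first by move=> t _; exact: circ_neq.
by apply: ccontD; [exact: ccont_circ|exact: ccont_cst].
Qed.

Lemma ccont_compcirc (A : set R) (g : C -> C) (r : R) : 0 <= r ->
  (forall z, normc z <= r -> derivable g z (1 : C)) -> ccont A (g \o circ r).
Proof.
move=> r0 dg; apply: ccont_comp; last exact: ccont_circ.
by move=> t _; apply: dg; rewrite normc_circ.
Qed.

(** The integrand is $\zeta$ times the difference quotient of [g] at [w], which is differentiable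
    off [w] and bounded near it by $1+|g'(w)|$. This is the kind of exceptional point that
    [cauchy_circle] tolerates. *)
Lemma cauchy_diff (g : C -> C) (r : R) (w : C) : normc w < r ->
  (forall z, normc z <= r -> derivable g z (1 : C)) ->
  cint mu `[0, 2 * pi] (fun t => (g (circ r t) - g w) * (circ r t / (circ r t - w))) = 0.
Proof.
move=> wr dg.
have [g1 H] := derivable_eps (dg w (ltW wr)).
have [d d0 hd] := H 1 ltr01.
pose h z := (g z - g w) / (z - w).
have d2 : 0 < d / 2 by rewrite divr_gt0.
rewrite -[RHS](@cauchy_circle _ h r w (1 + normc g1) (d / 2))//.
- by apply: eq_cint => t _; rewrite /h; ring.
- move=> z zr zw; apply: derivableM.
    by apply: derivableB; [exact: dg|exact: derivable_cst].
  apply: derivableV; first by rewrite subr_eq0.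
  by apply: derivableB; [exact: derivable_id|exact: derivable_cst].
move=> z zd zw; rewrite /h normcM normcV.
have z0 : 0 < normc (z - w) by rewrite normc_gt0 subr_eq0.
rewrite ler_pdivrMr//.
have zd' : normc (z - w) < d by rewrite (le_lt_trans zd)//; lra.
have := hd z zd'.
have -> : g z - g w = (g z - (g w + g1 * (z - w))) + g1 * (z - w) by ring.
move=> h1; rewrite (le_trans (le_normcD _ _))// mulrDl; apply: lerD => //.
by rewrite normcM.
Qed.

Lemma cintJ (d : measure_display) (T : measurableType d)
  (m : {measure set T -> \bar R}) (D : set T) (f : T -> C) :
  measurable D -> cintegrable m D f ->
  cint m D (fun x => conjc (f x)) = conjc (cint m D f).
Proof.
move=> mD [_ i2]; apply: complex_ext => /=.
  by apply: eq_Rintegral => x _; rewrite cReJ.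
rewrite -mulN1r -RintegralZl//.
by apply: eq_Rintegral => x _; rewrite cImJ mulN1r.
Qed.

Lemma circJ (r t : R) : 0 < r -> conjc (circ r t) = (r ^+ 2)%:C / circ r t.
Proof.
move=> r0; have c0 := circ_neq0 t r0.
by apply: (mulfI c0); rewrite mulcJ normc_circ ?ltW// mulrCA divff// mulr1.
Qed.

Lemma pi2_gt0 : 0 < 2 * pi :> R. Proof. by rewrite mulr_gt0// pi_gt0. Qed.

Lemma cint_circle_cst (c : C) : cint mu `[0, 2 * pi] (fun=> c) = (2 * pi)%:C * c.
Proof. by rewrite cint_cst// fine_mu_itv ?subr0// ltW// pi2_gt0. Qed.

Lemma normc_cint_circle (f : R -> C) (M : R) : ccont `[0, 2 * pi] f ->
  (forall t, normc (f t) <= M) ->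
  normc (cint mu `[0, 2 * pi] f) <= 2 * M * (2 * pi).
Proof.
move=> cf fM; rewrite [leRHS](_ : _ = 2 * M * fine (mu `[0, 2 * pi])).
  by apply: normc_cint => //; [exact: itv_mu_fin|exact: ccont_cintegrable].
by rewrite fine_mu_itv ?subr0// ltW// pi2_gt0.
Qed.

(** On the circle of radius [r] the kernel is the complex conjugate of $K(\zeta)=(1-\bar
    w\zeta/r^2)^{-1}$. As $K$ is differentiable on the closed disc, its mean is $K(0)=1$ by
    [cauchy_diff] at the centre. *)
Lemma cauchy_kernel (r : R) (w : C) : normc w < r ->
  cint mu `[0, 2 * pi] (fun t => circ r t / (circ r t - w)) = (2 * pi)%:C.
Proof.
move=> wr; have r0 : 0 < r by rewrite (le_lt_trans _ wr)// normc_ge0.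
pose K z := (1 - (conjc w) / (r ^+ 2)%:C * z)^-1.
have r2 : (r ^+ 2)%:C != 0 :> C by rewrite -normc_eq0 normcR normr_eq0 expf_neq0// gt_eqF.
have den z : normc z <= r -> 1 - (conjc w) / (r ^+ 2)%:C * z != 0.
  move=> zr; rewrite subr_eq0; apply/eqP => /(congr1 (@normc R)).
  rewrite normc1 !normcM normcV normc_conj normcR ger0_norm ?sqr_ge0// => e.
  have : normc w / r ^+ 2 * normc z < 1.
    rewrite mulrAC ltr_pdivrMr ?exprn_gt0// mul1r expr2.
    apply: (@le_lt_trans _ _ (normc w * r)).
      by rewrite ler_wpM2l// normc_ge0.
    by rewrite ltr_pM2r.
  by rewrite -e ltxx.
have dK z : normc z <= r -> derivable K z (1 : C).
  move=> zr; apply: derivableV; first exact: den.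
  apply: derivableB; first exact: derivable_cst.
  by apply: derivableM; [exact: derivable_cst|exact: derivable_id].
have cK A : ccont A (K \o circ r).
  exact: ccont_compcirc (ltW r0) dK.
have K0 : K 0 = 1 by rewrite /K mulr0 subr0 invr1.
have : cint mu `[0, 2 * pi] (fun t => K (circ r t) - 1) = 0.
  have n0 : normc 0 < r by rewrite normc0.
  rewrite -[RHS](cauchy_diff n0 dK); apply: eq_cint => t _.
  by rewrite subr0 divff ?mulr1 ?K0// circ_neq0.
rewrite cintB//; last 2 first.
- exact: ccont_cintegrable.
- by apply: ccont_cintegrable; exact: ccont_cst.
rewrite cint_circle_cst mulr1 => /eqP; rewrite subr_eq0 => /eqP e.
rewrite -[RHS]conjc_real -e -cintJ//; last exact: ccont_cintegrable.
apply: eq_cint => t _.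
have c0 := circ_neq0 t r0; have cw := circ_neq t wr.
rewrite /K conjc_inv conjcB conjc1 !conjcM conjcK circJ// conjc_inv conjc_real.
have rC : r%:C != 0 :> C by rewrite -normc_eq0 normcR normr_eq0 gt_eqF.
by field; apply/and3P.
Qed.

Lemma cauchy_formula (g : C -> C) (r : R) (w : C) : normc w < r ->
  (forall z, normc z <= r -> derivable g z (1 : C)) ->
  cint mu `[0, 2 * pi] (fun t => g (circ r t) * (circ r t / (circ r t - w)))
  = (2 * pi)%:C * g w.
Proof.
move=> wr dg; have r0 : 0 < r by rewrite (le_lt_trans _ wr)// normc_ge0.
have ck := @ccont_kernel `[0, 2 * pi] _ _ wr.
have cg : ccont `[0, 2 * pi] (fun t => g (circ r t)) by exact: ccont_compcirc (ltW r0) dg.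
have : cint mu `[0, 2 * pi] (fun t => g (circ r t) * (circ r t / (circ r t - w))
   - g w * (circ r t / (circ r t - w))) = 0.
  by rewrite -[RHS](cauchy_diff wr dg); apply: eq_cint => t _; rewrite mulrBl.
have i1 := ccont_cintegrable (ccontM cg ck).
have i2 := ccont_cintegrable ck.
rewrite cintB//; last exact: cintegrableZ.
by rewrite cintZ// cauchy_kernel// => /eqP; rewrite subr_eq0 => /eqP ->; rewrite mulrC.
Qed.

(* The remainder comes from [c/(c - s) = 1 + s/c + s^2/(c (c - s))]. *)
Lemma cauchy_taylor1 (g : C -> C) (r M : R) : 0 < r ->
  (forall z, normc z <= r -> derivable g z (1 : C)) ->
  (forall z, normc z <= r -> normc (g z) <= M) ->
  exists c1, normc c1 <= 2 * M / r /\ forall s, normc s <= r / 2 ->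
    normc (g s - (g 0 + c1 * s)) <= 4 * M / r ^+ 2 * normc s ^+ 2.
Proof.
move=> r0 dg gM.
have cg : ccont `[0, 2 * pi] (fun t => g (circ r t)) by exact: ccont_compcirc (ltW r0) dg.
have ci : ccont `[0, 2 * pi] (fun t => (circ r t)^-1).
  by apply: ccont_inv; [move=> t _; exact: circ_neq0|exact: ccont_circ].
have p0 : (2 * pi)%:C != 0 :> C by rewrite -normc_eq0 normcR normr_eq0 gt_eqF ?pi2_gt0.
have M0 : 0 <= M by rewrite (le_trans (normc_ge0 (g 0)))// gM// normc0 ltW.
have gci := ccont_cintegrable (ccontM cg ci).
pose I1 := cint mu `[0, 2 * pi] (fun t => g (circ r t) / circ r t).
exists ((2 * pi)%:C^-1 * I1); split.
  rewrite normcM normcV normcR gtr0_norm ?pi2_gt0// mulrC ler_pdivrMr ?pi2_gt0//.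
  rewrite -(mulrA 2); apply: normc_cint_circle; first exact: ccontM.
  move=> t; rewrite normcM normcV normc_circ ?(ltW r0)//.
  by rewrite ler_wpM2r ?invr_ge0 ?(ltW r0)// gM// normc_circ// ltW.
move=> s sr.
have sr' : normc s < r by rewrite (le_lt_trans sr)//; lra.
have n0 : normc 0 < r by rewrite normc0.
have ck := @ccont_kernel `[0, 2 * pi] _ _ sr'.
pose F2 t := g (circ r t) * ((circ r t)^-1 * (circ r t)^-1 * (circ r t / (circ r t - s))).
have cgi : ccont `[0, 2 * pi] F2.
  by apply: ccontM => //; apply: ccontM => //; exact: ccontM.
have i1 := ccont_cintegrable cgi.
pose I2 := cint mu `[0, 2 * pi] F2.
have ck0 := ccont_cintegrable (ccontM cg (@ccont_kernel `[0, 2 * pi] _ _ n0)).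
have K : (2 * pi)%:C * g s - ((2 * pi)%:C * g 0 + s * I1) = s ^+ 2 * I2.
  rewrite -(cauchy_formula sr' dg) -(cauchy_formula n0 dg) -!cintZ// -cintD//; last exact: cintegrableZ.
  rewrite -cintB//; last 2 first.
  - exact: ccont_cintegrable (ccontM cg ck).
  - by apply: cintegrableD => //; exact: cintegrableZ.
  apply: eq_cint => t _; have c0 := circ_neq0 t r0; have cw := circ_neq t sr'.
  by rewrite /F2 subr0; field; rewrite c0 cw.
have -> : g s - (g 0 + (2 * pi)%:C^-1 * I1 * s) = (2 * pi)%:C^-1 * (s ^+ 2 * I2).
  by apply: (mulfI p0); rewrite mulrA divff// mul1r -K;
    move: p0; generalize ((2 * pi)%:C : C) => q q0; field.
rewrite 2!normcM normcV normcR gtr0_norm ?pi2_gt0// normcX.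
rewrite mulrC ler_pdivrMr ?pi2_gt0// [leRHS]mulrAC [leRHS]mulrC.
apply: ler_wpM2l; first by rewrite exprn_ge0// normc_ge0.
have -> : 4 * M / r ^+ 2 = 2 * (M * (r^-1 * r^-1 * 2)) by field; rewrite gt_eqF.
apply: normc_cint_circle => // t; rewrite !normcM !normcV normc_circ ?(ltW r0)//.
apply: ler_pM; rewrite ?normc_ge0 ?mulr_ge0 ?invr_ge0 ?(ltW r0) ?normc_ge0//.
  by rewrite gM// normc_circ// ltW.
apply: ler_wpM2l; first by rewrite mulr_ge0 ?invr_ge0 ?(ltW r0).
have h2 : r / 2 <= normc (circ r t - s).
  apply: le_trans (le_normcB _ _); rewrite normc_circ ?(ltW r0)//; have := sr; lra.
rewrite ler_pdivrMr; last by apply: lt_le_trans h2; rewrite divr_gt0.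
by have := h2; lra.
Qed.

End CauchyFormula.

(** * Power series on the polydisc *)

Section Polydisc.
Context {R : realType} {n : nat}.
Local Notation C := R[i].
Implicit Types (z w : 'rV[C]_n) (f F G : 'rV[C]_n -> C).

Lemma posC (e : C) : 0 < e -> e = (Re e)%:C /\ 0 < Re e.
Proof. by case: e => a b; rewrite ltcE /= => /andP[/eqP -> ->]. Qed.

(** Balls of ['rV[C]_n] have radii in [R[i]]; real coordinatewise radii replace them from here
    on. *)
Lemma nbhs_coordP z (P : set 'rV[C]_n) : nbhs z P <->
  exists2 d : R, 0 < d & forall z', (forall j, normc (z' ord0 j - z ord0 j) < d) -> P z'.
Proof.
split.
  move=> /nbhs_ballP[e /= e0 he]; have [eE e0'] := posC e0.
  exists (Re e) => // z' hz'; apply: he; split; first by [].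
  move=> i j; rewrite ord1 eE /ball/= distrC normr_ltC; exact: hz'.
move=> [d d0 hd]; apply/nbhs_ballP; exists d%:C; first by rewrite /= ltcR.
move=> z' [_ hz']; apply: hd => j; have := hz' ord0 j.
by rewrite /ball/= distrC normr_ltC.
Qed.

Lemma nbhs_normcP (c : C) (P : set C) : nbhs c P <->
  exists2 d : R, 0 < d & forall c', normc (c' - c) < d -> P c'.
Proof.
split.
  move=> /nbhs_ballP[e /= e0 he]; have [eE e0'] := posC e0.
  exists (Re e) => // z' hz'; apply: he; rewrite eE.
  by rewrite /ball/= distrC normr_ltC.
move=> [d d0 hd]; apply/nbhs_ballP; exists d%:C; first by rewrite /= ltcR.
move=> z' hz'; apply: hd.
by move: hz'; rewrite /ball/= distrC normr_ltC.
Qed.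

Lemma compact_disc (r : R) : compact [set c : C | normc c <= r].
Proof.
pose m (p : R * R) : C := p.1 +i* p.2.
have cm : continuous m.
  move=> p U /nbhs_normcP[d d0 hd].
  have d2 : 0 < d / 2 by rewrite divr_gt0.
  apply/nbhs_ballP; exists (d / 2) => // q [/= q1 q2]; apply: hd.
  apply: (le_lt_trans (normc_le_ReIm _)); rewrite [ltRHS]splitr.
  by apply: ltrD; rewrite /= distrC.
have cK : compact (m @` (`[- r, r] `*` `[- r, r])).
  apply: continuous_compact; first exact: continuous_subspaceT.
  by apply: compact_setX; exact: segment_compact.
apply: subclosed_compact cK _; last first.
  move=> c /= cr; exists (Re c, Im c); last by rewrite /m; case: (c).
  by split; rewrite /= in_itv/= -ler_norml (le_trans _ cr) ?Re_le_normc ?Im_le_normc.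
move=> c cl /=; rewrite leNgt; apply/negP => rc.
have : nbhs c [set c' | normc (c' - c) < normc c - r].
  by apply/nbhs_normcP; exists (normc c - r); rewrite ?subr_gt0.
move=> /cl[c' [/= c'r c'c]].
have := le_normcB c c'; rewrite normcB; lra.
Qed.

Definition cpoly (r : R) : set 'rV[C]_n := [set z | forall j, normc (z ord0 j) <= r].

Lemma compact_cpoly (r : R) : compact (cpoly r).
Proof. exact: (rV_compact (fun=> @compact_disc r)). Qed.

Lemma differentiable_eps f z : differentiable f z -> forall e : R, 0 < e ->
  exists2 d : R, 0 < d &
  forall z', (forall j, normc (z' ord0 j - z ord0 j) < d) -> normc (f z' - f z) < e.
Proof.
move=> /differentiable_continuous cf e e0.
have : nbhs (f z) [set c | normc (c - f z) < e] by apply/nbhs_normcP; exists e.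
by move=> /cf/nbhs_coordP[d d0 hd]; exists d.
Qed.

Lemma cpoly_polydisc (r : R) z : r < 1 -> cpoly r z -> polydisc z.
Proof.
by move=> r1 zr j; rewrite normr_lt1; exact: le_lt_trans (zr j) r1.
Qed.

Lemma analytic_unif f (r : R) : analytic_on_polydisc f -> r < 1 ->
  forall e, 0 < e -> exists2 d, 0 < d & forall z z', cpoly r z ->
    (forall j, normc (z' ord0 j - z ord0 j) < d) -> normc (f z' - f z) < e.
Proof.
move=> af r1 e e0.
pose P (d : R) z := forall z', (forall j, normc (z' ord0 j - z ord0 j) < d) ->
  normc (f z' - f z) < e.
have : \forall d \near 0^'+, cpoly r `<=` P d.
  have /compact_near_coveringP := @compact_cpoly r; apply => z zr.
  have e2 : 0 < e / 2 by rewrite divr_gt0.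
  have [d d0 hd] := differentiable_eps (af z (cpoly_polydisc r1 zr)) e2.
  exists ([set z' : 'rV[C]_n | forall j, normc (z' ord0 j - z ord0 j) < d / 2], [set x : R | x < d / 2]) => /=.
    split; first by apply/nbhs_coordP; exists (d / 2) => //; rewrite divr_gt0.
    by apply: nbhs_right_lt; rewrite divr_gt0.
  move=> [z1 x] [/= hz1 xd] z2 hz2.
  have -> : f z2 - f z1 = (f z2 - f z) + (f z - f z1) by ring.
  rewrite (le_lt_trans (le_normcD _ _))// [ltRHS]splitr; apply: ltrD.
    apply: hd => j; have -> : z2 ord0 j - z ord0 j = (z2 ord0 j - z1 ord0 j) + (z1 ord0 j - z ord0 j) by ring.
    rewrite (le_lt_trans (le_normcD _ _))// [ltRHS]splitr; apply: ltrD => //.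
    exact: lt_trans (hz2 j) xd.
  rewrite normcB; apply: hd => j; apply: lt_trans (hz1 j) _.
  by rewrite ltr_pdivrMr// ltr_pMr// ltr1n.
move=> [d /= d0 hd]; exists (d / 2); first by rewrite divr_gt0.
move=> z z' zr; apply: hd => //; last by rewrite divr_gt0.
rewrite /ball/= sub0r normrN gtr0_norm ?divr_gt0//.
by rewrite ltr_pdivrMr// ltr_pMr// ltr1n.
Qed.

Lemma analytic_bounded f (r : R) : analytic_on_polydisc f -> r < 1 ->
  exists2 M, 0 < M & forall z, cpoly r z -> normc (f z) <= M.
Proof.
move=> af r1.
have : \forall M \near +oo, cpoly r `<=` [set z | normc (f z) <= M].
  have /compact_near_coveringP := @compact_cpoly r; apply => z zr.
  have [d d0 hd] := differentiable_eps (af z (cpoly_polydisc r1 zr)) ltr01.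
  exists ([set z' : 'rV[C]_n | forall j, normc (z' ord0 j - z ord0 j) < d], [set x : R | normc (f z) + 1 < x]) => /=.
    split; first by apply/nbhs_coordP; exists d.
    by apply: nbhs_pinfty_gt; rewrite num_real.
  move=> [z1 x] [/= hz1 xd]; apply: le_trans (ltW xd).
  by have := hd _ hz1; have := le_normcB (f z1) (f z); lra.
move=> [M [_ hM]]; exists (`|M| + 1); first by rewrite ltr_wpDl.
by apply: hM; rewrite (le_lt_trans (ler_norm _))// ltrDl.
Qed.

Definition upd z (j : 'I_n) (c : C) : 'rV[C]_n :=
  \row_k (if k == j then c else z ord0 k).

Lemma updE z j c k : upd z j c ord0 k = if k == j then c else z ord0 k.
Proof. by rewrite mxE. Qed.

Lemma derivable_line f (a v : 'rV[C]_n) (s : C) :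
  differentiable f (a + s *: v) -> derivable (fun s : C => f (a + s *: v)) s (1 : C).
Proof.
move=> df; apply: diff_derivable.
apply: (@differentiable_comp _ _ _ _ (fun s : C => a + s *: v) f) => //.
Qed.

Lemma upd_line z j c : upd z j c = upd z j 0 + c *: delta_mx ord0 j.
Proof.
apply/rowP => k; rewrite !mxE eqxx/=; case: eqP => _.
  by rewrite mulr1 add0r.
by rewrite mulr0 addr0.
Qed.

Lemma derivable_upd f z j c : differentiable f (upd z j c) ->
  derivable (fun c => f (upd z j c)) c (1 : C).
Proof.
move=> df; have -> : (fun c => f (upd z j c)) = (fun c => f (upd z j 0 + c *: delta_mx ord0 j)).
  by apply/funext => c'; rewrite upd_line.
by apply: derivable_line; rewrite -upd_line.
Qed.

End Polydisc.

(** * Iterated circular means and the Cauchy formula on the polydisc *)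

Section IteratedMean.
Context {R : realType} {n : nat}.
Local Notation C := R[i].
Local Notation mu := (@lebesgue_measure R).
Implicit Types (z w : 'rV[C]_n) (f F G : 'rV[C]_n -> C) (s : seq 'I_n).

Variable r : R.
Hypothesis r0 : 0 < r.

Definition tor : set 'rV[C]_n := [set z | forall j, normc (z ord0 j) = r].

Lemma upd_tor z j t : tor z -> tor (upd z j (circ r t)).
Proof. by move=> zt k; rewrite updE; case: ifP => // _; rewrite normc_circ// ltW. Qed.

Definition cmean (j : 'I_n) F z : C :=
  (2 * pi)%:C^-1 * cint mu `[0, 2 * pi] (fun t => F (upd z j (circ r t))).

Definition imean s F := foldr cmean F s.

(** Uniform continuity and boundedness on the torus of radius [r]. Uniformity is what survives
    averaging in one variable, so that [cmean] can be iterated. *)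
Definition torcont F :=
  (forall e, 0 < e -> exists2 d, 0 < d & forall z z', tor z -> tor z' ->
    (forall j, normc (z' ord0 j - z ord0 j) < d) -> normc (F z' - F z) < e) /\
  exists2 M, 0 < M & forall z, tor z -> normc (F z) <= M.

Lemma torcont_cst (c : C) : torcont (fun=> c).
Proof.
split; first by move=> e e0; exists 1 => // z z' _ _ _; rewrite subrr normc0.
by exists (normc c + 1) => [|z _]; rewrite ?lerDl// ltr_wpDl ?normc_ge0.
Qed.

Lemma torcont_coord j : torcont (fun z => z ord0 j).
Proof.
by split; [move=> e e0; exists e => // z z' _ _|exists r => // z zt; rewrite zt].
Qed.

Lemma torcontD F G : torcont F -> torcont G -> torcont (fun z => F z + G z).
Proof.
move=> [hF [M M0 FM]] [hG [N N0 GN]]; split; last first.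
  exists (M + N) => [|z zt]; first by rewrite addr_gt0.
  by rewrite (le_trans (le_normcD _ _))// lerD ?FM ?GN.
move=> e e0; have e2 : 0 < e / 2 by rewrite divr_gt0.
have [d d0 hd] := hF _ e2; have [d' d'0 hd'] := hG _ e2.
exists (Num.min d d'); first by rewrite lt_min d0.
move=> z z' zt zt' zz; rewrite opprD addrACA.
rewrite (le_lt_trans (le_normcD _ _))// [ltRHS]splitr.
by apply: ltrD; [apply: hd|apply: hd'] => // j; have := zz j; rewrite lt_min => /andP[].
Qed.

Lemma torcontM F G : torcont F -> torcont G -> torcont (fun z => F z * G z).
Proof.
move=> [hF [M M0 FM]] [hG [N N0 GN]]; split; last first.
  exists (M * N) => [|z zt]; first by rewrite mulr_gt0.
  by rewrite normcM ler_pM ?normc_ge0 ?FM ?GN.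
move=> e e0.
have eM : 0 < e / 2 / M by rewrite !divr_gt0.
have eN : 0 < e / 2 / N by rewrite !divr_gt0.
have [d d0 hd] := hF _ eN; have [d' d'0 hd'] := hG _ eM.
exists (Num.min d d'); first by rewrite lt_min d0.
move=> z z' zt zt' zz.
have -> : F z' * G z' - F z * G z = (F z' - F z) * G z' + F z * (G z' - G z) by ring.
rewrite (le_lt_trans (le_normcD _ _))// !normcM [ltRHS]splitr; apply: ltrD.
  apply: (@le_lt_trans _ _ (normc (F z' - F z) * N)).
    by rewrite ler_wpM2l ?normc_ge0 ?GN.
  rewrite -ltr_pdivlMr//; apply: hd => // j.
  by have := zz j; rewrite lt_min => /andP[].
apply: (@le_lt_trans _ _ (M * normc (G z' - G z))).
  by rewrite ler_wpM2r ?normc_ge0 ?FM.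
rewrite mulrC -ltr_pdivlMr//; apply: hd' => // j.
by have := zz j; rewrite lt_min => /andP[].
Qed.

Lemma torcont_sum (I : Type) (l : seq I) (P : pred I) (F : I -> 'rV[C]_n -> C) :
  (forall k, torcont (F k)) -> torcont (fun z => \sum_(k <- l | P k) F k z).
Proof.
move=> hF; elim: l => [|k l IH].
  by under eq_fun do rewrite big_nil; exact: torcont_cst.
under eq_fun do rewrite big_cons; case: (P k) => //.
exact: torcontD.
Qed.

Lemma torcont_prod (I : Type) (l : seq I) (P : pred I) (F : I -> 'rV[C]_n -> C) :
  (forall k, torcont (F k)) -> torcont (fun z => \prod_(k <- l | P k) F k z).
Proof.
move=> hF; elim: l => [|k l IH].
  by under eq_fun do rewrite big_nil; exact: torcont_cst.
under eq_fun do rewrite big_cons; case: (P k) => //.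
exact: torcontM.
Qed.

Lemma torcont_inv F m : 0 < m -> torcont F ->
  (forall z, tor z -> m <= normc (F z)) -> torcont (fun z => (F z)^-1).
Proof.
move=> m0 [hF _] Fm; split; last first.
  exists m^-1 => [|z zt]; first by rewrite invr_gt0.
  by rewrite normcV lef_pV2 ?Fm// posrE// (lt_le_trans m0)// Fm.
move=> e e0; have em : 0 < e * m ^+ 2 by rewrite mulr_gt0// exprn_gt0.
have [d d0 hd] := hF _ em; exists d => // z z' zt zt' zz.
have p0 := lt_le_trans m0 (Fm z zt); have p0' := lt_le_trans m0 (Fm z' zt').
have -> : (F z')^-1 - (F z)^-1 = (F z - F z') * ((F z)^-1 * (F z')^-1).
  by field; rewrite -!normc_eq0 !gt_eqF.
rewrite !normcM !normcV normcB -invfM ltr_pdivrMr ?mulr_gt0//.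
apply: (lt_le_trans (hd z z' zt zt' zz)); rewrite ler_pM2l// expr2.
by apply: ler_pM; rewrite ?(ltW m0)// Fm.
Qed.

Lemma torcont_exp F k : torcont F -> torcont (fun z => F z ^+ k).
Proof.
move=> hF; elim: k => [|k IH].
  by under eq_fun do rewrite expr0; exact: torcont_cst.
by under eq_fun do rewrite exprS; exact: torcontM.
Qed.

Lemma torcont_ccont F z j A : torcont F -> tor z ->
  ccont A (fun t => F (upd z j (circ r t))).
Proof.
move=> [hF _] zt t At e e0; have [d d0 hd] := hF e e0.
have [d' d'0 hd'] := @ccont_circ _ r setT t I d d0.
exists d' => // y Ay yt; apply: hd; try exact: upd_tor.
move=> k; rewrite !updE; case: ifP => _; last by rewrite subrr normc0.
exact: hd'.
Qed.

Lemma torcont_cintegrable F z j : torcont F -> tor z ->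
  cintegrable mu `[0, 2 * pi] (fun t => F (upd z j (circ r t))).
Proof. by move=> hF zt; apply: ccont_cintegrable; exact: torcont_ccont. Qed.

Lemma cmean_bound F z j M : torcont F -> tor z ->
  (forall y, tor y -> normc (F y) <= M) -> normc (cmean j F z) <= 2 * M.
Proof.
move=> hF zt FM; rewrite normcM normcV normcR gtr0_norm ?pi2_gt0//.
rewrite mulrC ler_pdivrMr ?pi2_gt0//; apply: normc_cint_circle.
  exact: torcont_ccont.
by move=> t; apply: FM; exact: upd_tor.
Qed.

Lemma cmeanB F G z j : torcont F -> torcont G -> tor z ->
  cmean j (fun y => F y - G y) z = cmean j F z - cmean j G z.
Proof.
by move=> hF hG zt; rewrite /cmean cintB ?mulrBr//; exact: torcont_cintegrable.
Qed.

Lemma cmeanZ (c : C) F z j : torcont F -> tor z ->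
  cmean j (fun y => c * F y) z = c * cmean j F z.
Proof.
move=> hF zt; have h := torcont_cintegrable j hF zt.
have mI : measurable (`[0, 2 * pi] : set (measurableTypeR R)) by exact: measurable_itv.
by have E := cintZ mI c h; rewrite /cmean [X in _ * X = _]E mulrCA.
Qed.

Lemma cmean_sum (I : Type) (l : seq I) (F : I -> 'rV[C]_n -> C) z j :
  (forall k, torcont (F k)) -> tor z ->
  cmean j (fun y => \sum_(k <- l) F k y) z = \sum_(k <- l) cmean j (F k) z.
Proof.
move=> hF zt.
have mI : measurable (`[0, 2 * pi] : set (measurableTypeR R)) by exact: measurable_itv.
have [_ E] := cint_sum mI l (itv_mu_fin 0 (2 * pi))
  (fun k => torcont_cintegrable j (hF k) zt).
by rewrite /cmean [X in _ * X = _]E mulr_sumr.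
Qed.

Lemma eq_cmean F G z j : (forall t, F (upd z j (circ r t)) = G (upd z j (circ r t))) ->
  cmean j F z = cmean j G z.
Proof. by move=> h; congr (_ * _); apply: eq_cint => t _. Qed.

Lemma torcont_cmean F j : torcont F -> torcont (cmean j F).
Proof.
move=> hF; have [hF1 [M M0 FM]] := hF; split; last first.
  by exists (2 * M) => [|z zt]; [rewrite mulr_gt0|exact: cmean_bound].
move=> e e0; have e4 : 0 < e / 4 by rewrite divr_gt0.
have [d d0 hd] := hF1 _ e4; exists d => // z z' zt zt' zz.
apply: (@le_lt_trans _ _ (2 * (e / 4))); last by lra.
rewrite /cmean -mulrBr -cintB//; try exact: torcont_cintegrable.
rewrite normcM normcV normcR gtr0_norm ?pi2_gt0//.
rewrite mulrC ler_pdivrMr ?pi2_gt0//; apply: normc_cint_circle.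
  apply: ccontD; first exact: torcont_ccont.
  have cN := ccontM (@ccont_cst R `[0, 2 * pi] (-1)) (@torcont_ccont F z j `[0, 2 * pi] hF zt).
  by move: cN; congr ccont; apply/funext => t; rewrite mulN1r.
move=> t; apply: ltW; apply: hd; try exact: upd_tor.
by move=> k; rewrite !updE; case: ifP => // _; rewrite subrr normc0.
Qed.

Lemma torcont_imean F s : torcont F -> torcont (imean s F).
Proof. by move=> hF; elim: s => //= j s IH; exact: torcont_cmean. Qed.

Lemma imean_bound F s M z : torcont F -> tor z ->
  (forall y, tor y -> normc (F y) <= M) -> normc (imean s F z) <= 2 ^+ size s * M.
Proof.
move=> hF zt FM; elim: s z zt => [|j s IH] z zt /=; first by rewrite mul1r FM.
rewrite exprS -mulrA; apply: cmean_bound => //.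
exact: torcont_imean.
Qed.

Lemma eq_imean F G s z : (forall y : 'rV[C]_n, (forall k, k \notin s -> y ord0 k = z ord0 k) ->
    (forall k, k \in s -> normc (y ord0 k) = r) -> F y = G y) ->
  imean s F z = imean s G z.
Proof.
elim: s z => [|j s IH] z h /=.
  by apply: h.
apply: eq_cmean => t; apply: IH => y hy1 hy2; apply: h => k.
  by rewrite inE negb_or => /andP[kj ks]; rewrite hy1// updE (negbTE kj).
rewrite inE; have [/hy2//|ks] := boolP (k \in s); rewrite orbF => /eqP kj.
by rewrite hy1// updE kj eqxx normc_circ// ltW.
Qed.

Lemma imeanB F G z s : torcont F -> torcont G -> tor z ->
  imean s (fun y => F y - G y) z = imean s F z - imean s G z.
Proof.
move=> hF hG; elim: s z => [|j s IH] z zt //=.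
rewrite -cmeanB//; try exact: torcont_imean.
by apply: eq_cmean => t; rewrite IH//; exact: upd_tor.
Qed.

Lemma imeanZ (c : C) F z s : torcont F -> tor z ->
  imean s (fun y => c * F y) z = c * imean s F z.
Proof.
move=> hF; elim: s z => [|j s IH] z zt //=.
rewrite -cmeanZ//; try exact: torcont_imean.
by apply: eq_cmean => t; rewrite IH//; exact: upd_tor.
Qed.

Lemma imean_sum (I : Type) (l : seq I) (F : I -> 'rV[C]_n -> C) z s :
  (forall k, torcont (F k)) -> tor z ->
  imean s (fun y => \sum_(k <- l) F k y) z = \sum_(k <- l) imean s (F k) z.
Proof.
move=> hF; elim: s z => [|j s IH] z zt //=.
rewrite -cmean_sum//; last by move=> k; exact: torcont_imean.
by apply: eq_cmean => t; rewrite IH//; exact: upd_tor.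
Qed.

(** All coordinates are integrated out. This moves the base point from the interior point [w] of the
    Cauchy formula to the torus, where the bounds for [torcont] apply. *)
Lemma imean_indep F z z' : imean (enum 'I_n) F z = imean (enum 'I_n) F z'.
Proof.
have H s : forall y y' : 'rV[C]_n, (forall k, k \notin s -> y ord0 k = y' ord0 k) ->
    imean s F y = imean s F y'.
  elim: s => [|j s IH] y y' h /=.
    by congr F; apply/rowP => k; rewrite h.
  congr (_ * _); apply: eq_cint => t _; apply: IH => k ks.
  rewrite !updE; case: ifP => // kj; apply: h.
  by rewrite inE kj.
by apply: H => k; rewrite mem_enum.
Qed.

(** Coordinates outside [s] keep the values of [w]. Induction from the end of the list makes the new
    variable the innermost one, so the one-variable formula applies with all other coordinates
    fixed. *)
Lemma cauchy_polydisc f w s : analytic_on_polydisc f -> r < 1 -> uniq s ->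
  (forall j, normc (w ord0 j) < r) ->
  f w = imean s (fun y => f y * \prod_(j <- s) (y ord0 j / (y ord0 j - w ord0 j))) w.
Proof.
move=> af r1 + wr; elim/last_ind: s => [|s j IH].
  by rewrite /= big_nil mulr1.
rewrite rcons_uniq => /andP[js us]; rewrite [LHS]IH// /imean foldr_rcons.
apply: eq_imean => y hy1 hy2.
have yr k : normc (y ord0 k) <= r.
  by have [/hy2->//|/hy1->] := boolP (k \in s); exact: ltW.
have yw : upd y j (w ord0 j) = y.
  by apply/rowP => k; rewrite updE; case: eqP => // ->; rewrite hy1.
have dg (c : C) : normc c <= r -> derivable (fun c => f (upd y j c)) c (1 : C).
  move=> cr; apply/derivable_upd/af/(@cpoly_polydisc _ _ r) => // k.
  by rewrite updE; case: ifP.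
have := cauchy_formula (wr j) dg; rewrite yw => E.
have p0 : (2 * pi)%:C != 0 :> C by rewrite -normc_eq0 normcR normr_eq0 gt_eqF ?pi2_gt0.
apply: (mulfI p0); rewrite mulrA -E /cmean mulrA divff// mul1r mulrC -cintZ//; last first.
  apply: ccont_cintegrable; apply: ccontM; last exact: ccont_kernel.
  exact: (@ccont_compcirc _ `[0, 2 * pi] _ _ (ltW r0) dg).
apply: eq_cint => t _; rewrite big_rcons/= updE eqxx.
set P1 := \prod_(i <- s) _; set P2 := \prod_(i <- s) _.
have -> : P2 = P1; last by ring.
apply: eq_big_seq => k ks; rewrite !updE; case: eqP => // kj.
by rewrite -kj ks in js.
Qed.

End IteratedMean.

(** * Power series expansion of analytic functions *)

Section PowerSeries.
Context {R : realType} {n : nat}.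
Local Notation C := R[i].
Implicit Types (z w : 'rV[C]_n) (f : 'rV[C]_n -> C) (a b : ('I_n -> nat) -> C).

Definition monom (alpha : 'I_n -> nat) z : C := \prod_j z ord0 j ^+ alpha j.

Definition expo N (alpha : {ffun 'I_n -> 'I_N}) : 'I_n -> nat := fun j => alpha j.

(** Partial sums run over cubes of exponents: with them the truncated geometric series in [n]
    variables is a product of one-variable ones. *)
Definition psum a N z : C :=
  \sum_(alpha : {ffun 'I_n -> 'I_N}) a (expo alpha) * monom (expo alpha) z.

Lemma normc_prod_sub1 (I : Type) (s : seq I) (x : I -> C) (e : R) :
  0 <= e -> (forall k, normc (x k) <= e) ->
  normc (1 - \prod_(k <- s) (1 - x k)) <= (1 + e) ^+ size s - 1.
Proof.
move=> e0 xe; elim: s => [|k s IH]; first by rewrite big_nil !subrr normc0.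
rewrite big_cons /= exprS.
have -> : 1 - (1 - x k) * \prod_(i <- s) (1 - x i) =
  (1 - \prod_(i <- s) (1 - x i)) * (1 - x k) + x k by ring.
rewrite (le_trans (le_normcD _ _))// normcM.
have h1 : normc (1 - x k) <= 1 + e.
  by rewrite (le_trans (le_normcD _ _))// normc1 normcN lerD2l.
have : normc (1 - \prod_(i <- s) (1 - x i)) * normc (1 - x k) <=
    ((1 + e) ^+ size s - 1) * (1 + e).
  by apply: ler_pM; rewrite ?normc_ge0.
have := xe k; lra.
Qed.

Lemma geometric_box N (x : 'I_n -> C) : (forall j, normc (x j) < 1) ->
  \prod_j (1 - x j)^-1 -
  \sum_(alpha : {ffun 'I_n -> 'I_N}) \prod_j x j ^+ expo alpha j =
  \prod_j (1 - x j)^-1 * (1 - \prod_j (1 - x j ^+ N)).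
Proof.
move=> x1; rewrite -(bigA_distr_bigA (fun j (k : 'I_N) => x j ^+ k)).
rewrite mulrBr mulr1 -big_split/=; congr (_ - _); apply: eq_bigr => j _.
have h : 1 - x j != 0.
  rewrite subr_eq0; apply: contraTneq (x1 j) => <-.
  by rewrite normc1 ltxx.
apply: (mulfI h); rewrite mulrA divff// mul1r.
by have := subrX1 (x j) N; rewrite -[1 - _]opprB mulNr => <-; rewrite opprB.
Qed.

Lemma geometric_box_bound (q e : R) : 0 <= q -> q < 1 -> 0 < e ->
  exists N0, forall N (x : 'I_n -> C), (N0 <= N)%N -> (forall j, normc (x j) <= q) ->
  normc (\prod_j (1 - x j)^-1 -
    \sum_(alpha : {ffun 'I_n -> 'I_N}) \prod_j x j ^+ expo alpha j) < e.
Proof.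
move=> q0 q1 e0; pose D := ((1 - q)^-1) ^+ n.
have p0 : 0 < (1 - q)^-1 by rewrite invr_gt0 subr_gt0.
have D0 : 0 < D by rewrite exprn_gt0.
have : (fun N => D * ((1 + q ^+ N) ^+ n - 1)) @ \oo --> D * ((1 + 0) ^+ n - 1).
  apply: cvgM; first exact: cvg_cst.
  apply: cvgB; last exact: cvg_cst.
  have c1 : (fun N => 1 + q ^+ N) @ \oo --> (1 + 0 : R).
    by apply: cvgD; [exact: cvg_cst|apply: cvg_expr; rewrite ger0_norm].
  elim: n => [|m IH]; first by under eq_fun do rewrite expr0; exact: cvg_cst.
  by under eq_fun do rewrite exprS; rewrite exprS; exact: cvgM.
rewrite addr0 expr1n subrr mulr0 => /cvgrPdist_lt/(_ _ e0)[N0 _ hN0].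
exists N0 => N x NN xq.
have := hN0 N NN; rewrite /= sub0r normrN => /(le_lt_trans (ler_norm _)).
apply: le_lt_trans.
rewrite geometric_box; last by move=> j; exact: le_lt_trans (xq j) q1.
rewrite normcM; apply: ler_pM; rewrite ?normc_ge0//.
  have -> : D = \prod_(j < n) (1 - q)^-1 by rewrite prodr_const card_ord.
  rewrite normc_prod; apply: ler_prod => j _.
  rewrite normc_ge0 normcV lef_pV2 ?posrE ?subr_gt0//.
    have := le_normcB 1 (x j); rewrite normc1; have := xq j; lra.
  apply: lt_le_trans (le_normcB _ _); rewrite normc1 subr_gt0.
  exact: le_lt_trans (xq j) q1.
have := @normc_prod_sub1 _ (enum 'I_n) (fun j => x j ^+ N) (q ^+ N).
rewrite big_enum/= size_enum_ord; apply; first exact: exprn_ge0.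
by move=> k; rewrite normcX lerXn2r// nnegrE ?normc_ge0.
Qed.

(** The kernel $\prod_j(1-w_j/y_j)^{-1}$ is replaced by its truncated geometric series under the
    iterated mean. The coefficients found may depend on [r] at this stage; [analytic_is_coef]
    removes the dependence. *)
Lemma cauchy_series f (r : R) : analytic_on_polydisc f -> 0 < r -> r < 1 ->
  exists a, forall q e, 0 <= q -> q < 1 -> 0 < e -> exists N0, forall N w,
    (N0 <= N)%N -> (forall j, normc (w ord0 j) <= q * r) ->
    normc (f w - psum a N w) < e.
Proof.
move=> af r0 r1.
pose z0 : 'rV[C]_n := \row_j r%:C.
have tz0 : tor r z0 by move=> j; rewrite mxE normcR gtr0_norm.
have tf : torcont r f.
  split.
    move=> e e0; have [d d0 hd] := analytic_unif af r1 e0.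
    by exists d => // z z' zt _; apply: hd => j; rewrite zt.
  by have [M M0 hM] := analytic_bounded af r1; exists M => // z zt; apply: hM => j; rewrite zt.
have tor_neq0 (y : 'rV[C]_n) j : tor r y -> y ord0 j != 0.
  by move=> ty; rewrite -normc_eq0 ty gt_eqF.
have tinv j : torcont r (fun y : 'rV[C]_n => (y ord0 j)^-1).
  apply: (torcont_inv r0); last by move=> z zt; rewrite zt.
  exact: torcont_coord.
pose T alpha (y : 'rV[C]_n) := f y * \prod_j (y ord0 j)^-1 ^+ alpha j.
have tT alpha : torcont r (T alpha).
  by apply: torcontM => //; apply: torcont_prod => j; exact: torcont_exp.
exists (fun alpha => imean r (enum 'I_n) (T alpha) z0).
move=> q e q0 q1 e0.
have [M M0 fM] := analytic_bounded af r1.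
(* The power of 2 is the loss of [n] circular means in [imean_bound], [M] bounds [f], and the last 2
   makes the inequality strict. *)
pose e' := e / (2 ^+ n * M * 2).
have e'0 : 0 < e' by rewrite divr_gt0// !mulr_gt0// exprn_gt0.
have [N0 hN0] := geometric_box_bound q0 q1 e'0; exists N0 => N w NN wq.
have wr j : normc (w ord0 j) < r.
  by rewrite (le_lt_trans (wq j))// gtr_pMl.
pose K (y : 'rV[C]_n) := \prod_(j <- enum 'I_n) (y ord0 j / (y ord0 j - w ord0 j)).
have tK : torcont r K.
  apply: torcont_prod => j; apply: torcontM; first exact: torcont_coord.
  apply: (@torcont_inv _ _ r _ (r - normc (w ord0 j))); first by rewrite subr_gt0.
    apply: torcontD; [exact: torcont_coord|exact: torcont_cst].
  by move=> z zt; rewrite -{1}(zt j); exact: le_normcB.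
have -> : f w = imean r (enum 'I_n) (fun y => f y * K y) z0.
  by rewrite (cauchy_polydisc r0 af r1 (enum_uniq 'I_n) wr); exact: imean_indep.
have -> : psum (fun alpha => imean r (enum 'I_n) (T alpha) z0) N w =
    imean r (enum 'I_n) (fun y => \sum_(alpha : {ffun 'I_n -> 'I_N})
      monom (expo alpha) w * T (expo alpha) y) z0.
  rewrite imean_sum//; last first.
    by move=> alpha; apply: torcontM => //; exact: torcont_cst.
  by apply: eq_bigr => alpha _; rewrite (imeanZ _ _ _ (tT _))// mulrC.
have ts : torcont r (fun y => \sum_(alpha : {ffun 'I_n -> 'I_N})
      monom (expo alpha) w * T (expo alpha) y).
  by apply: torcont_sum => alpha; apply: torcontM => //; exact: torcont_cst.
rewrite -imeanB//; last exact: torcontM.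
apply: (@le_lt_trans _ _ (2 ^+ n * (M * e'))); last first.
  have -> : 2 ^+ n * (M * e') = e / 2.
    by rewrite /e'; field; rewrite !gt_eqF// exprn_gt0.
  by rewrite ltr_pdivrMr// ltr_pMr// ltr1n.
have -> : 2 ^+ n = 2 ^+ size (enum 'I_n) :> R by rewrite size_enum_ord.
apply: imean_bound => //.
  apply: torcontD; first exact: torcontM.
  have := torcontM (torcont_cst r (-1)) ts.
  by under eq_fun do rewrite mulN1r.
move=> y ty.
have -> : f y * K y - \sum_(alpha : {ffun 'I_n -> 'I_N}) monom (expo alpha) w * T (expo alpha) y
  = f y * (\prod_j (1 - w ord0 j / y ord0 j)^-1 - \sum_(alpha : {ffun 'I_n -> 'I_N})
       \prod_j (w ord0 j / y ord0 j) ^+ expo alpha j).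
  rewrite mulrBr mulr_sumr; congr (_ * _ - _).
    rewrite /K big_enum; apply: eq_bigr => j _.
    have y0 := tor_neq0 y j ty.
    have yw : y ord0 j - w ord0 j != 0.
      rewrite subr_eq0; apply: contraTneq (wr j) => <-.
      by rewrite ty ltxx.
    by field; rewrite y0 yw.
  apply: eq_bigr => alpha _; rewrite /T /monom mulrCA -big_split; congr (_ * _).
  by apply: eq_bigr => j _; rewrite /= exprMn.
rewrite normcM; apply: ler_pM; rewrite ?normc_ge0//.
  by apply: fM => j; rewrite ty.
apply: ltW; apply: hN0 => // j.
by rewrite normcM normcV ty ler_pdivrMr.
Qed.

End PowerSeries.

(** * Hardy norms and coefficients *)

Section TorusMeasure.
Context {R : realType}.
Local Notation C := R[i].
Local Notation mu := (@lebesgue_measure R).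
Local Notation TR := (measurableTypeR R).
Local Notation U := (uniform_prob (@lt0_2pi R)).

Lemma probability_fin d (T : measurableType d) (P : probability T R) : (P setT < +oo)%E.
Proof. by rewrite probability_setT ltry. Qed.

Lemma fin_bounded_integrable d (T : measurableType d) (m : {measure set T -> \bar R})
    (D : set T) (f : T -> R) (M : R) : measurable D -> (m D < +oo)%E ->
  measurable_fun D f -> (forall x, `|f x| <= M) -> m.-integrable D (EFin \o f).
Proof.
move=> mD mDoo mf fM; apply: measurable_bounded_integrable => //.
by exists M; split; rewrite ?num_real// => y My x _ /=; apply: le_trans (ltW My).
Qed.

Lemma bounded_integrable d (T : measurableType d) (P : probability T R) (f : T -> R) (M : R) :
  measurable_fun setT f -> (forall x, `|f x| <= M) -> P.-integrable setT (EFin \o f).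
Proof.
move=> mf fM; apply: measurable_bounded_integrable => //.
  exact: (probability_fin P).
by exists M; split; rewrite ?num_real// => y My x _ /=; apply: le_trans (ltW My).
Qed.

(** [torus_measure] is the image of a product measure under [cons_angle], so Fubini's theorem
    applies after a change of variables. *)
Lemma Rintegral_torus_prod m (u : TR -> R) (v : m.-tuple TR -> R) (M N : R) :
  measurable_fun setT u -> measurable_fun setT v ->
  (forall x, `|u x| <= M) -> (forall x, `|v x| <= N) ->
  \int[torus_measure m.+1]_t (u (thead t) * v [tuple of behead t]) =
  (\int[U]_x u x) * (\int[torus_measure m]_t v t).
Proof.
move=> mu' mv uM vN.
pose F (t : m.+1.-tuple TR) := u (thead t) * v [tuple of behead t].
have mF : measurable_fun setT F.
  apply: measurable_funM; first exact: measurableT_comp (measurable_tnth ord0).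
  exact: measurableT_comp (@measurable_behead _ _ _).
have FE (p : TR * m.-tuple TR) : F (cons_angle p) = u p.1 * v p.2.
  rewrite /F /cons_angle theadE; congr (_ * v _).
  by apply/val_inj.
have mFc : measurable_fun setT (F \o @cons_angle R m).
  exact: measurableT_comp mF (@measurable_cons_angle R m).
have iF : (U \x torus_measure m)%E.-integrable setT (EFin \o (F \o @cons_angle R m)).
  apply: (@bounded_integrable _ _ (U \x torus_measure m)%E _ (M * N)) => // p.
  by rewrite /= FE normrM; apply: ler_pM.
rewrite /Rintegral.
have -> : (\int[torus_measure m.+1]_t (F t)%:E =
    \int[U \x torus_measure m]_p (F (cons_angle p))%:E)%E.
  have mFE : measurable_fun setT (EFin \o F) by exact/measurable_EFinP.
  exact: (@integral_pushforward _ _ _ _ _ _ (@measurable_cons_angle R m)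
    (U \x torus_measure m)%E setT _ mFE iF measurableT).
have iv : (torus_measure m).-integrable setT (EFin \o v) by exact: bounded_integrable vN.
have iu : U.-integrable setT (EFin \o u) by exact: bounded_integrable uM.
rewrite -(integral12_prod_meas1 iF) /fubini_F.
have fv := integrable_fin_num measurableT iv.
have fu := integrable_fin_num measurableT iu.
have -> : (\int[U]_x \int[torus_measure m]_y (EFin \o (F \o @cons_angle R m)) (x, y) =
    \int[U]_x ((fine (\int[torus_measure m]_y (v y)%:E))%:E * (u x)%:E))%E.
  apply: eq_integral => x _; rewrite fineK// muleC -integralZl//.
  by apply: eq_integral => y _; rewrite /= FE.
by rewrite integralZl//= fineM// mulrC.
Qed.

Definition bmeas d (T : measurableType d) (f : T -> C) :=
  [/\ measurable_fun setT (fun x => Re (f x)), measurable_fun setT (fun x => Im (f x)) &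
   exists M, forall x, normc (f x) <= M].

Lemma bmeas_cintegrable d (T : measurableType d) (P : probability T R) (f : T -> C) :
  bmeas f -> cintegrable P setT f.
Proof.
move=> [m1 m2 [M hM]]; apply: (@bounded_cintegrable _ _ _ _ _ _ _ M) => //.
exact: (probability_fin P).
Qed.

Lemma bmeasM d (T : measurableType d) (f g : T -> C) :
  bmeas f -> bmeas g -> bmeas (fun x => f x * g x).
Proof.
move=> [f1 f2 [M fM]] [g1 g2 [N gN]]; split.
- under eq_fun do rewrite cReM.
  by apply: measurable_funB; apply: measurable_funM.
- under eq_fun do rewrite cImM.
  by apply: measurable_funD; apply: measurable_funM.
by exists (M * N) => x; rewrite normcM; apply: ler_pM; rewrite ?normc_ge0.
Qed.

Lemma bmeasD d (T : measurableType d) (f g : T -> C) :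
  bmeas f -> bmeas g -> bmeas (fun x => f x + g x).
Proof.
move=> [f1 f2 [M fM]] [g1 g2 [N gN]]; split.
- by under eq_fun do rewrite cReD; exact: measurable_funD.
- by under eq_fun do rewrite cImD; exact: measurable_funD.
by exists (M + N) => x; rewrite (le_trans (le_normcD _ _))// lerD.
Qed.

Lemma bmeas_cst d (T : measurableType d) (c : C) : bmeas (fun _ : T => c).
Proof. by split; [| |exists (normc c)]. Qed.

Lemma bmeas_conj d (T : measurableType d) (f : T -> C) :
  bmeas f -> bmeas (fun x => conjc (f x)).
Proof.
move=> [f1 f2 [M fM]]; split.
- by under eq_fun do rewrite cReJ.
- by under eq_fun do rewrite cImJ; exact: measurable_funN.
by exists M => x; rewrite normc_conj.
Qed.

Lemma bmeas_sum d (T : measurableType d) (I : Type) (l : seq I) (F : I -> T -> C) :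
  (forall k, bmeas (F k)) -> bmeas (fun x => \sum_(k <- l) F k x).
Proof.
move=> hF; elim: l => [|k l IH].
  by under eq_fun do rewrite big_nil; exact: bmeas_cst.
by under eq_fun do rewrite big_cons; exact: bmeasD.
Qed.

Lemma bmeas_prod d (T : measurableType d) (I : Type) (l : seq I) (F : I -> T -> C) :
  (forall k, bmeas (F k)) -> bmeas (fun x => \prod_(k <- l) F k x).
Proof.
move=> hF; elim: l => [|k l IH].
  by under eq_fun do rewrite big_nil; exact: bmeas_cst.
by under eq_fun do rewrite big_cons; exact: bmeasM.
Qed.

Lemma bmeas_exp d (T : measurableType d) (f : T -> C) k :
  bmeas f -> bmeas (fun x => f x ^+ k).
Proof.
move=> hf; elim: k => [|k IH].
  by under eq_fun do rewrite expr0; exact: bmeas_cst.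
by under eq_fun do rewrite exprS; exact: bmeasM.
Qed.

Lemma bmeas_comp d d' (T : measurableType d) (T' : measurableType d') (f : T' -> C)
  (g : T -> T') : measurable_fun setT g -> bmeas f -> bmeas (f \o g).
Proof.
move=> mg [f1 f2 [M fM]]; split; last by exists M => x /=.
  exact: (measurableT_comp f1 mg).
exact: (measurableT_comp f2 mg).
Qed.

Lemma bmeas_circ : bmeas (circ 1 : TR -> C).
Proof.
split.
- apply: measurable_funM => //; apply: continuous_measurable_fun; exact: continuous_cos.
- apply: measurable_funM => //; apply: continuous_measurable_fun; exact: continuous_sin.
by exists 1 => x; rewrite normc_circ.
Qed.

Lemma cint_torus_prod m (u : TR -> C) (v : m.-tuple TR -> C) : bmeas u -> bmeas v ->
  cint (torus_measure m.+1) setT (fun t => u (thead t) * v [tuple of behead t]) =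
  cint U setT u * cint (torus_measure m) setT v.
Proof.
move=> bu bv; have [u1 u2 [M uM]] := bu; have [v1 v2 [N vN]] := bv.
have prodR (f : TR -> R) (g : m.-tuple TR -> R) :
    measurable_fun setT f -> measurable_fun setT g ->
    (forall x, `|f x| <= normc (u x)) -> (forall x, `|g x| <= normc (v x)) ->
  (\int[torus_measure m.+1]_t (f (thead t) * g [tuple of behead t]) =
  (\int[U]_x f x) * (\int[torus_measure m]_t g t)) /\
   (torus_measure m.+1).-integrable setT (EFin \o (fun t => f (thead t) * g [tuple of behead t])).
  move=> mf mg fu gv; split.
    apply: (@Rintegral_torus_prod _ _ _ M N) => // x.
      exact: le_trans (fu x) (uM x).
    exact: le_trans (gv x) (vN x).
  apply: (@bounded_integrable _ _ _ _ (M * N)).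
    apply: measurable_funM; first exact: measurableT_comp (measurable_tnth ord0).
    exact: measurableT_comp (@measurable_behead _ _ _).
  move=> t; rewrite normrM; apply: ler_pM => //.
    exact: le_trans (fu _) (uM _).
  exact: le_trans (gv _) (vN _).
have uR x := Re_le_normc (u x); have uI x := Im_le_normc (u x).
have vR x := Re_le_normc (v x); have vI x := Im_le_normc (v x).
have [e1 i1] := prodR _ _ u1 v1 uR vR; have [e2 i2] := prodR _ _ u2 v2 uI vI.
have [e3 i3] := prodR _ _ u1 v2 uR vI; have [e4 i4] := prodR _ _ u2 v1 uI vR.
apply: complex_ext; rewrite ?cReM ?cImM /=.
  rewrite -e1 -e2 -RintegralB//; apply: eq_Rintegral => t _; exact: cReM.
rewrite -e3 -e4 -RintegralD//; apply: eq_Rintegral => t _; exact: cImM.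
Qed.

Lemma cint_uniform (f : TR -> C) : bmeas f ->
  cint U setT f = (2 * pi)%:C^-1 * cint mu `[0, 2 * pi] f.
Proof.
move=> bf; have [f1 f2 [M fM]] := bf.
have H (g : TR -> R) : measurable_fun setT g -> (forall x, `|g x| <= M) ->
    \int[U]_x g x = (2 * pi)^-1 * \int[mu]_(x in `[0, 2 * pi]) g x.
  move=> mg gM.
  have iU : U.-integrable setT (EFin \o g) by exact: bounded_integrable gM.
  have ic : U.-integrable setT (EFin \o (fun=> M)).
    by apply: (@bounded_integrable _ _ _ _ `|M|).
  have fin := @itv_mu_fin R 0 (2 * pi).
  have icm : mu.-integrable `[0, 2 * pi] (EFin \o (fun=> M)).
    by apply: integrable_cst_fin => //; exact: fin.
  have igm : mu.-integrable `[0, 2 * pi] (EFin \o g).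
    by apply: (@fin_bounded_integrable _ _ _ _ _ M) => //; exact: measurable_funTS.
  (* The integral formula for the uniform law concerns nonnegative functions, so [g] is shifted by
     its bound [M] and the constant is cancelled at the end. *)
  have mgM : measurable_fun setT (fun x => g x + M) by exact: measurable_funD.
  have gM0 x : 0 <= g x + M by have := gM x; rewrite ler_norml => /andP[]; lra.
  have E1 : \int[U]_x (g x + M) = \int[U]_x g x + M.
    rewrite RintegralD// Rintegral_cst//; congr (_ + _).
    rewrite -[RHS]mulr1; congr (_ * _).
    exact: (congr1 fine (@probability_setT _ _ _ U)).
  have E2 : \int[mu]_(x in `[0, 2 * pi]) (g x + M) =
      \int[mu]_(x in `[0, 2 * pi]) g x + M * (2 * pi).
    by rewrite RintegralD// Rintegral_cst// fine_mu_itv ?subr0// ltW// pi2_gt0.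
  have E : (\int[U]_x (g x + M)%:E =
      (2 * pi - 0)^-1%:E * \int[mu]_(x in `[0%R, (2 * pi)%R]) (g x + M)%:E)%E.
    by apply: integral_uniform => [|x]; [exact/measurable_EFinP|rewrite lee_fin].
  have : \int[U]_x (g x + M) = (2 * pi)^-1 * \int[mu]_(x in `[0, 2 * pi]) (g x + M).
    rewrite /Rintegral E fineM ?subr0//.
    have iD : mu.-integrable `[0, 2 * pi] (EFin \o (fun x => g x + M)).
      apply: eq_integrable (integrableD _ igm icm) => //.
    exact: (integrable_fin_num _ iD).
  have pM : (2 * pi)^-1 * (M * (2 * pi)) = M.
    by rewrite mulrCA mulVf ?mulr1// gt_eqF// pi2_gt0.
  rewrite E1 E2; set B := \int[mu]_(x in _) g x => h; apply: (@addIr _ M).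
  by rewrite h (mulrDr _ B) pM.
have c0 : (2 * pi)%:C^-1 = ((2 * pi)^-1)%:C :> C by rewrite fmorphV.
rewrite c0; apply: complex_ext; rewrite ?cReM ?cImM /= mul0r ?subr0 ?addr0.
  by apply: H => // x; apply: le_trans (fM x); exact: Re_le_normc.
by apply: H => // x; apply: le_trans (fM x); exact: Im_le_normc.
Qed.

Lemma cint_circ_exp k : cint mu `[0, 2 * pi] (fun t => circ 1 t ^+ k.+1) = 0.
Proof.
have n0 : normc (0 : C) < 1 by rewrite normc0 ltr01.
have dg z : normc z <= 1 -> derivable (fun z : C => z ^+ k.+1) z (1 : C).
  by move=> _; exact: exprn_derivable.
rewrite -[RHS](cauchy_diff n0 dg); apply: eq_cint => t _.
by rewrite expr0n /= !subr0 divff ?mulr1// circ_neq0.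
Qed.

(** For $k\ne l$ the common factor has modulus 1 on the circle; there remains a positive power or
    its conjugate, of mean 0 by Cauchy's theorem. *)
Lemma cint_uniform_monom k l :
  cint U setT (fun t => circ 1 t ^+ k * conjc (circ 1 t ^+ l)) = (k == l)%:R.
Proof.
have bm k' l' : bmeas (fun t : TR => circ 1 t ^+ k' * conjc (circ 1 t ^+ l')).
  apply: bmeasM; first exact/bmeas_exp/bmeas_circ.
  exact/bmeas_conj/bmeas_exp/bmeas_circ.
have mI : measurable (`[0, 2 * pi] : set TR) by exact: measurable_itv.
have cX m : ccont `[0, 2 * pi] (fun t : R => circ 1 t ^+ m).
  elim: m => [|m IH]; first exact: ccont_cst.
  have -> : (fun t : R => circ 1 t ^+ m.+1) = (fun t => circ 1 t * circ 1 t ^+ m).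
    by apply/funext => t; rewrite exprS.
  by apply: ccontM => //; exact: ccont_circ.
have cc (t : R) m : circ 1 t ^+ m * conjc (circ 1 t ^+ m) = 1.
  rewrite mulcJ normcX normc_circ//.
  by rewrite !expr1n.
have c0 m : cintegrable mu `[0, 2 * pi] (fun t : R => circ 1 t ^+ m).
  exact: ccont_cintegrable.
have E (t : R) a b : circ 1 t ^+ (a + b) * conjc (circ 1 t ^+ b) = circ 1 t ^+ a.
  by rewrite exprD -mulrA cc mulr1.
rewrite cint_uniform//.
have [kl|kl|->] := ltngtP k l.
- rewrite -[l](subnK (ltnW kl)).
  have -> : cint mu `[0, 2 * pi] (fun t => circ 1 t ^+ k * conjc (circ 1 t ^+ (l - k + k))) =
    conjc (cint mu `[0, 2 * pi] (fun t => circ 1 t ^+ (l - k))).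
    rewrite -cintJ//; apply: eq_cint => t _.
    by rewrite -(E t (l - k)%N k) conjcM conjcK mulrC.
  rewrite -(subnSK kl) cint_circ_exp conjc0 mulr0//.
- rewrite -[k](subnK (ltnW kl)).
  have -> : cint mu `[0, 2 * pi] (fun t => circ 1 t ^+ (k - l + l) * conjc (circ 1 t ^+ l)) =
    cint mu `[0, 2 * pi] (fun t => circ 1 t ^+ (k - l)).
    by apply: eq_cint => t _; rewrite E.
  by rewrite -(subnSK kl) cint_circ_exp mulr0.
have -> : cint mu `[0, 2 * pi] (fun t => circ 1 t ^+ l * conjc (circ 1 t ^+ l)) =
    cint mu `[0, 2 * pi] (fun=> 1).
  by apply: eq_cint => t _; rewrite cc.
rewrite cint_circle_cst mulr1 mulVf//.
by rewrite -normc_eq0 normcR normr_eq0 gt_eqF ?pi2_gt0.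
Qed.

Lemma cint_torus_cst m (c : C) : cint (torus_measure m) setT (fun=> c) = c.
Proof.
rewrite cint_cst//.
by rewrite (congr1 fine (@probability_setT _ _ _ (torus_measure m))) mul1r.
Qed.

Lemma cint_torus_bigprod m (u : 'I_m -> TR -> C) : (forall j, bmeas (u j)) ->
  cint (torus_measure m) setT (fun t => \prod_j u j (tnth t j)) =
  \prod_j cint U setT (u j).
Proof.
elim: m u => [|m IH] u bu.
  rewrite big_ord0 -[RHS](cint_torus_cst 0); apply: eq_cint => t _.
  by rewrite big_ord0.
rewrite big_ord_recl -IH//.
have bv : bmeas (fun t : m.-tuple TR => \prod_j u (lift ord0 j) (tnth t j)).
  apply: bmeas_prod => j.
  exact: (@bmeas_comp _ _ _ _ (u (lift ord0 j)) (@tnth _ _ ^~ j) (measurable_tnth j)).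
rewrite -cint_torus_prod//; apply: eq_cint => t _.
rewrite big_ord_recl; congr (_ * _); apply: eq_bigr => j _.
by rewrite tnth_behead; congr (u _ (tnth _ _)); apply/val_inj; rewrite /= inordK ?ltnS.
Qed.

End TorusMeasure.

(** * Parseval's identity and the Hardy norm *)

Section Parseval.
Context {R : realType} {n : nat}.
Local Notation C := R[i].
Local Notation TR := (measurableTypeR R).
Local Notation T := (n.-tuple TR).
Local Notation P := (@torus_measure R n).
Implicit Types (f : 'rV[C]_n -> C) (a b : ('I_n -> nat) -> C).

Definition tpt (r : R) (t : T) : 'rV[C]_n := r%:C *: torus_point t.

Lemma tptE r t j : tpt r t ord0 j = r%:C * circ 1 (tnth t j).
Proof. by rewrite !mxE /circ !mul1r. Qed.

Lemma tpt_cpoly r t : 0 <= r -> cpoly r (tpt r t).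
Proof.
by move=> r0 j; rewrite tptE normcM normcR normc_circ// mulr1 ger0_norm.
Qed.

Definition deg (alpha : 'I_n -> nat) : nat := (\sum_j alpha j)%N.

Definition tchar (alpha : 'I_n -> nat) (t : T) : C := \prod_j circ 1 (tnth t j) ^+ alpha j.

Lemma monom_tpt alpha r t : monom alpha (tpt r t) = (r ^+ deg alpha)%:C * tchar alpha t.
Proof.
rewrite /monom /tchar /deg rmorphXn expr_sum -big_split; apply: eq_bigr => j _.
by rewrite tptE exprMn.
Qed.

Lemma bmeas_tchar alpha : bmeas (tchar alpha).
Proof.
apply: bmeas_prod => j; apply: bmeas_exp.
exact: (@bmeas_comp _ _ _ _ _ (circ 1) (@tnth _ _ ^~ j) (measurable_tnth j) bmeas_circ).
Qed.

Lemma tchar_orth alpha beta :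
  cint P setT (fun t => tchar alpha t * conjc (tchar beta t)) =
  \prod_j (alpha j == beta j)%:R.
Proof.
rewrite -(eq_bigr _ (fun j _ => cint_uniform_monom (alpha j) (beta j))).
rewrite -(@cint_torus_bigprod _ _ (fun j t => circ 1 t ^+ alpha j * conjc (circ 1 t ^+ beta j))).
  apply: eq_cint => t _; rewrite /tchar.
  by rewrite (big_morph conjc (@conjcM R) (@conjc1 R)) -big_split.
move=> j; apply: bmeasM; first exact/bmeas_exp/bmeas_circ.
exact/bmeas_conj/bmeas_exp/bmeas_circ.
Qed.

Lemma prod_eq_nat (I : finType) N (alpha beta : {ffun I -> 'I_N}) :
  \prod_j ((alpha j : nat) == beta j)%:R = (alpha == beta)%:R :> C.
Proof.
have [->|ab] := eqVneq alpha beta.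
  by rewrite big1// => j _; rewrite eqxx.
have [j abj] : exists j, alpha j != beta j.
  apply/existsP; apply: contraNT ab => /existsPn h.
  by apply/eqP/ffunP => j; apply/eqP; have := h j; rewrite negbK.
by rewrite (bigD1 j)//= (_ : _ == _ = false) ?mul0r//; exact: negbTE abj.
Qed.

Lemma bmeas_psum a N r : bmeas (fun t => psum a N (tpt r t)).
Proof.
apply: bmeas_sum => alpha; apply: bmeasM; first exact: bmeas_cst.
under eq_fun do rewrite monom_tpt.
by apply: bmeasM; [exact: bmeas_cst|exact: bmeas_tchar].
Qed.

Definition boxsq a (r : R) N : R :=
  \sum_(alpha : {ffun 'I_n -> 'I_N}) normc (a (expo alpha)) ^+ 2 * (r ^+ deg (expo alpha)) ^+ 2.

Lemma parseval_box a N r : \int[P]_t normc (psum a N (tpt r t)) ^+ 2 = boxsq a r N.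
Proof.
pose c (alpha : {ffun 'I_n -> 'I_N}) := a (expo alpha) * (r ^+ deg (expo alpha))%:C.
have E t : psum a N (tpt r t) = \sum_alpha c alpha * tchar (expo alpha) t.
  by apply: eq_bigr => alpha _; rewrite monom_tpt mulrA.
have bt alpha beta : bmeas (fun t => tchar alpha t * conjc (tchar beta t)).
  by apply: bmeasM; [exact: bmeas_tchar|exact/bmeas_conj/bmeas_tchar].
have bc (alpha beta : {ffun 'I_n -> 'I_N}) : cintegrable P setT
    (fun t => (c alpha * conjc (c beta)) * (tchar (expo alpha) t * conjc (tchar (expo beta) t))).
  by apply: bmeas_cintegrable; apply: bmeasM => //; exact: bmeas_cst.
have S1 (alpha : {ffun 'I_n -> 'I_N}) := cint_sum measurableT (index_enum {ffun 'I_n -> 'I_N}) (probability_fin P)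
  (fun beta : {ffun 'I_n -> 'I_N} => bc alpha beta).
have [_ S2] := cint_sum measurableT (index_enum {ffun 'I_n -> 'I_N}) (probability_fin P)
  (fun alpha : {ffun 'I_n -> 'I_N} => (S1 alpha).1).
have -> : \int[P]_t normc (psum a N (tpt r t)) ^+ 2 =
    Re (cint P setT (fun t => \sum_alpha \sum_beta (c alpha * conjc (c beta)) *
      (tchar (expo alpha) t * conjc (tchar (expo beta) t)))).
  apply: eq_Rintegral => t _; rewrite -[LHS]/(Re (normc (psum a N (tpt r t)) ^+ 2)%:C).
  congr (Re _); rewrite -mulcJ E (big_morph conjc (@conjcD R) (@conjc0 R)) mulr_suml.
  apply: eq_bigr => alpha _; rewrite mulr_sumr; apply: eq_bigr => beta _.
  by rewrite conjcM; ring.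
rewrite S2.
have -> : \sum_alpha cint P setT (fun t => \sum_beta (c alpha * conjc (c beta)) *
      (tchar (expo alpha) t * conjc (tchar (expo beta) t))) = (boxsq a r N)%:C.
  rewrite /boxsq rmorph_sum; apply: eq_bigr => alpha _.
  rewrite (S1 alpha).2 (bigD1 alpha)//= big1 ?addr0.
    rewrite cintZ//; last exact: bmeas_cintegrable.
    rewrite tchar_orth prod_eq_nat eqxx mulr1 mulcJ /c normcM normcR exprMn.
    by rewrite real_normK ?num_real// rmorphM.
  move=> beta ab; rewrite cintZ//; last exact: bmeas_cintegrable.
  by rewrite tchar_orth prod_eq_nat eq_sym (negbTE ab) mulr0.
by [].
Qed.

Lemma expo_inj N : injective (@expo n N).
Proof.
move=> alpha beta ab; apply/ffunP => j; apply/val_inj.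
exact: (congr1 (@^~ j) ab).
Qed.

Lemma le_box_sum (F : ('I_n -> nat) -> R) N M : (forall alpha, 0 <= F alpha) -> (N <= M)%N ->
  \sum_(alpha : {ffun 'I_n -> 'I_N}) F (expo alpha) <=
  \sum_(alpha : {ffun 'I_n -> 'I_M}) F (expo alpha).
Proof.
move=> F0 NM; pose h (alpha : {ffun 'I_n -> 'I_N}) : {ffun 'I_n -> 'I_M} :=
  [ffun j => widen_ord NM (alpha j)].
have hE alpha : expo (h alpha) = expo alpha by apply/funext => j; rewrite /expo ffunE.
have hi : injective h.
  by move=> x y xy; apply: expo_inj; rewrite -hE xy hE.
have -> : \sum_(alpha : {ffun 'I_n -> 'I_N}) F (expo alpha) =
    \sum_(beta in h @: [set: {ffun 'I_n -> 'I_N}]%SET) F (expo beta).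
  rewrite big_imset/=; last by move=> x y _ _; exact: hi.
  by apply: eq_big => [alpha|alpha _]; rewrite ?inE ?hE.
rewrite [leRHS](bigID (mem (h @: [set: {ffun 'I_n -> 'I_N}]%SET)))/= lerDl.
exact: sumr_ge0.
Qed.

Definition toffun N (alpha : 'I_n -> nat) : {ffun 'I_n -> 'I_N.+1} :=
  [ffun j => inord (alpha j)].

Lemma expo_toffun N alpha : (deg alpha <= N)%N -> expo (toffun N alpha) = alpha.
Proof.
move=> dN; apply/funext => j; rewrite /expo ffunE inordK// ltnS (leq_trans _ dN)//.
by rewrite /deg (bigD1 j)//= leq_addr.
Qed.

Lemma le_term_box (F : ('I_n -> nat) -> R) N alpha : (forall alpha, 0 <= F alpha) ->
  (deg alpha < N)%N -> F alpha <= \sum_(beta : {ffun 'I_n -> 'I_N}) F (expo beta).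
Proof.
case: N => // N F0; rewrite ltnS => dN.
rewrite (bigD1 (toffun N alpha))//= expo_toffun// lerDl.
exact: sumr_ge0.
Qed.

(** Uniform convergence of the cubic partial sums on smaller closed polydiscs, the form in which
    Parseval's identity passes to the limit. *)
Definition is_coef f a := forall r e, 0 <= r -> r < 1 -> 0 < e ->
  exists N0, forall N w, (N0 <= N)%N -> cpoly r w -> normc (f w - psum a N w) < e.

Lemma psumB a b N w : psum (fun alpha => a alpha - b alpha) N w = psum a N w - psum b N w.
Proof. by rewrite -sumrB; apply: eq_bigr => alpha _; rewrite mulrBl. Qed.

Lemma Rintegral_le_bound (g : T -> R) M : measurable_fun setT g ->
  (forall t, `|g t| <= M) -> \int[P]_t g t <= M.
Proof.
move=> mg gM; have -> : M = \int[P]_t M.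
  rewrite Rintegral_cst//.
  by rewrite (congr1 fine (@probability_setT _ _ _ P)) mulr1.
apply: le_Rintegral => //.
- exact: bounded_integrable gM.
- by apply: (@bounded_integrable _ _ _ _ _ `|M|).
- by move=> t _; apply: le_trans (gM t); exact: ler_norm.
Qed.

Lemma bmeas_sqnorm (d : measure_display) (T' : measurableType d) (g : T' -> C) :
  bmeas g -> measurable_fun setT (fun x => normc (g x) ^+ 2).
Proof.
move=> [g1 g2 _]; under eq_fun do rewrite sqr_normcE.
by apply: measurable_funD; exact: measurable_funX.
Qed.

(** Parseval's identity for the difference of the two partial sums, at the single radius [r], bounds
    $|a_\alpha-b_\alpha|^2r^{2|\alpha|}$ by the square of a uniform distance that tends to 0. *)
Lemma coef_uniq f a b (r : R) : 0 < r ->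
  (forall e, 0 < e -> exists N0, forall N w, (N0 <= N)%N -> cpoly r w ->
     normc (f w - psum a N w) < e) ->
  (forall e, 0 < e -> exists N0, forall N w, (N0 <= N)%N -> cpoly r w ->
     normc (f w - psum b N w) < e) -> a = b.
Proof.
move=> r0 ha hb; apply/funext => alpha; apply/eqP; rewrite -subr_eq0 -normc_eq0.
rewrite -sqrf_eq0 eq_le sqr_ge0 andbT; apply/ler_addgt0Pl => e e0; rewrite addr0.
pose D := (r ^+ deg alpha) ^+ 2.
have D0 : 0 < D by rewrite !exprn_gt0.
(* Two errors [e1] are added, and $(2e_1)^2=eD$. *)
pose e1 := Num.sqrt (e * D) / 2.
have e10 : 0 < e1 by rewrite divr_gt0// sqrtr_gt0 mulr_gt0.
have [N1 h1] := ha e1 e10; have [N2 h2] := hb e1 e10.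
pose N := maxn (maxn N1 N2) (deg alpha).+1.
rewrite -(ler_pM2r D0).
apply: (@le_trans _ _ (boxsq (fun alpha => a alpha - b alpha) r N)).
  apply: (@le_term_box (fun alpha => normc (a alpha - b alpha) ^+ 2 * (r ^+ deg alpha) ^+ 2)).
    by move=> beta; rewrite mulr_ge0 ?sqr_ge0.
  by rewrite leq_max ltnSn orbT.
rewrite -parseval_box; apply: Rintegral_le_bound.
  by apply: bmeas_sqnorm; exact: bmeas_psum.
move=> t; rewrite ger0_norm ?sqr_ge0// psumB.
have -> : e * D = (e1 + e1) ^+ 2.
  by rewrite /e1 -splitr sqr_sqrtr// mulr_ge0// ltW.
rewrite lerXn2r ?nnegrE ?normc_ge0 ?addr_ge0 ?(ltW e10)//.
have cr := tpt_cpoly t (ltW r0).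
have -> : psum a N (tpt r t) - psum b N (tpt r t) =
  (f (tpt r t) - psum b N (tpt r t)) - (f (tpt r t) - psum a N (tpt r t)) by ring.
rewrite (le_trans (le_normcD _ _))// normcN; apply: lerD; apply: ltW.
  by apply: h2 => //; rewrite /N !leq_max leqnn orbT.
by apply: h1 => //; rewrite /N !leq_max leqnn.
Qed.

Lemma analytic_is_coef f : analytic_on_polydisc f -> exists a, is_coef f a.
Proof.
move=> af; have h0 : (0 : R) < 2^-1 by rewrite invr_gt0.
have h1 : (2^-1 : R) < 1 by rewrite invf_lt1// ltr1n.
have [a ha] := cauchy_series af h0 h1; exists a => r e r0 r1 e0.
(* A radius above both [r] and 1/2. The expansions obtained at the radii 1/2 and [s] are both valid
   on the polydisc of radius 1/4, hence have the same coefficients. *)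
pose s := (1 + Num.max r 2^-1) / 2.
have rs : r < s /\ 2^-1 < s /\ s < 1.
  have : r <= Num.max r 2^-1 by rewrite le_max lexx.
  have : 2^-1 <= Num.max r 2^-1 by rewrite le_max lexx orbT.
  have : Num.max r 2^-1 < 1 by rewrite gt_max r1.
  rewrite /s; lra.
case: rs => rs [hs s1]; have s0 : 0 < s by rewrite (lt_trans h0).
have [b hb] := cauchy_series af s0 s1.
have ab : a = b.
  apply: (@coef_uniq f _ _ (2^-1 * 2^-1)); first by rewrite mulr_gt0.
    by move=> e' e'0; have [N0 h] := ha _ _ (ltW h0) h1 e'0; exists N0.
  move=> e' e'0; have [N0 h] := hb _ _ (ltW h0) h1 e'0; exists N0 => N w NN cw.
  apply: h => // j; apply: (le_trans (cw j)); rewrite ler_pM2l//; exact: ltW.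
have rs0 : 0 <= r / s by rewrite divr_ge0// ltW.
have rs1 : r / s < 1 by rewrite ltr_pdivrMr// mul1r.
rewrite ab; have [N0 h] := hb _ _ rs0 rs1 e0; exists N0 => N w NN cw; apply: h => // j.
by rewrite divfK ?gt_eqF//; exact: cw.
Qed.

Definition mean2 f (r : R) : R := \int[P]_t normc (f (tpt r t)) ^+ 2.

Lemma coef_bmeas f a r : is_coef f a -> 0 <= r -> r < 1 -> bmeas (fun t => f (tpt r t)).
Proof.
move=> hf r0 r1; have c t := tpt_cpoly t r0.
have cv t : (psum a N (tpt r t)) @[N --> \oo] --> f (tpt r t).
  move=> A /nbhs_normcP[e e0 he]; have [N0 h] := hf r e r0 r1 e0.
  by exists N0 => // N NN; apply: he; rewrite normcB; exact: h.
have cvR t : (fun N => Re (psum a N (tpt r t))) @ \oo --> Re (f (tpt r t)).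
  apply/cvgrPdist_lt => e e0; have [N0 h] := hf r e r0 r1 e0.
  exists N0 => // N NN /=; rewrite -cReN -cReD.
  by apply: (le_lt_trans (Re_le_normc _)); exact: h.
have cvI t : (fun N => Im (psum a N (tpt r t))) @ \oo --> Im (f (tpt r t)).
  apply/cvgrPdist_lt => e e0; have [N0 h] := hf r e r0 r1 e0.
  exists N0 => // N NN /=; rewrite -cImN -cImD.
  by apply: (le_lt_trans (Im_le_normc _)); exact: h.
split.
- apply: (@measurable_fun_cvg _ _ _ setT (fun N t => Re (psum a N (tpt r t)))) => //.
    by move=> N; case: (bmeas_psum a N r).
- apply: (@measurable_fun_cvg _ _ _ setT (fun N t => Im (psum a N (tpt r t)))) => //.
    by move=> N; case: (bmeas_psum a N r).
have [N0 h] := hf r 1 r0 r1 ltr01; have [_ _ [M hM]] := bmeas_psum a N0 r.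
exists (1 + M) => t.
have -> : f (tpt r t) = (f (tpt r t) - psum a N0 (tpt r t)) + psum a N0 (tpt r t) by ring.
by rewrite (le_trans (le_normcD _ _))// lerD// ltW// h.
Qed.

Lemma mean2_approx f a r : is_coef f a -> 0 <= r -> r < 1 -> forall e, 0 < e ->
  exists N0, forall N, (N0 <= N)%N -> `|mean2 f r - boxsq a r N| <= e.
Proof.
move=> hf r0 r1 e e0; have bf := coef_bmeas hf r0 r1; have [_ _ [M hM]] := bf.
(* From $|x^2-y^2|=|x-y|(x+y)$ with $x\le|M|$ and $y\le|M|+1$. *)
pose K := 2 * `|M| + 1.
have K0 : 0 < K by rewrite ltr_wpDl// mulr_ge0.
pose d := Num.min 1 (e / K).
have d0 : 0 < d by rewrite lt_min ltr01 divr_gt0.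
have [N0 h] := hf r d r0 r1 d0; exists N0 => N NN.
have bp := bmeas_psum a N r; have [_ _ [M' hM']] := bp.
have isq (g : T -> C) : bmeas g -> P.-integrable setT (EFin \o (fun t => normc (g t) ^+ 2)).
  move=> bg; have [_ _ [L hL]] := bg.
  apply: (@bounded_integrable _ _ _ _ _ (L ^+ 2)); first exact: bmeas_sqnorm.
  move=> t; rewrite ger0_norm ?sqr_ge0// lerXn2r ?nnegrE ?normc_ge0//.
  exact: le_trans (normc_ge0 _) (hL t).
have B t : `|normc (f (tpt r t)) ^+ 2 - normc (psum a N (tpt r t)) ^+ 2| <= e.
  set x := normc (f _); set y := normc (psum _ _ _).
  have x0 : 0 <= x := normc_ge0 _; have y0 : 0 <= y := normc_ge0 _.
  have xM : x <= `|M| by apply: le_trans (ler_norm M); exact: hM.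
  have xy : `|x - y| <= d.
    apply: ltW; apply: le_lt_trans (h N (tpt r t) NN (tpt_cpoly t r0)).
    by rewrite ler_norml lerNl opprB le_normcB andbT normcB le_normcB.
  have yM : y <= `|M| + 1.
    have : d <= 1 by rewrite ge_min lexx.
    move: xy; rewrite ler_norml => /andP[]; lra.
  rewrite subr_sqr normrM; apply: (@le_trans _ _ (d * K)).
    apply: ler_pM => //; rewrite ger0_norm ?addr_ge0// /K; lra.
  by rewrite -ler_pdivlMr// ge_min lexx orbT.
have mB : measurable_fun setT (fun t => normc (f (tpt r t)) ^+ 2 - normc (psum a N (tpt r t)) ^+ 2).
  by apply: measurable_funB; exact: bmeas_sqnorm.
rewrite -parseval_box /mean2 -RintegralB//; try exact: isq.
apply: le_trans (le_normr_Rintegral measurableT _) _.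
  exact: bounded_integrable B.
apply: Rintegral_le_bound; first exact: measurableT_comp.
by move=> t; rewrite normr_id.
Qed.

Lemma boxsq_le_mean2 f a r N : is_coef f a -> 0 <= r -> r < 1 ->
  boxsq a r N <= mean2 f r.
Proof.
move=> hf r0 r1; apply/ler_addgt0Pl => e e0.
have [N0 h] := mean2_approx hf r0 r1 e0.
apply: (@le_trans _ _ (boxsq a r (maxn N N0))).
  apply: (@le_box_sum (fun alpha => normc (a alpha) ^+ 2 * (r ^+ deg alpha) ^+ 2)).
    by move=> beta; rewrite mulr_ge0 ?sqr_ge0.
  exact: leq_maxl.
by have := h _ (leq_maxr N N0); rewrite ler_norml => /andP[]; lra.
Qed.

Lemma mean2_le f a r S : is_coef f a -> 0 <= r -> r < 1 ->
  (forall N, boxsq a r N <= S) -> mean2 f r <= S.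
Proof.
move=> hf r0 r1 hS; apply/ler_addgt0Pl => e e0.
have [N0 h] := mean2_approx hf r0 r1 e0.
by have := h _ (leqnn N0); have := hS N0; rewrite ler_norml => ? /andP[]; lra.
Qed.

Lemma mean2_ge0 f r : 0 <= mean2 f r.
Proof. by apply: Rintegral_ge0 => t _; exact: sqr_ge0. Qed.

Lemma Lnorm2_mean2 f a r : is_coef f a -> 0 <= r -> r < 1 ->
  Lnorm P 2%:E (fun t => (normc (f (r%:C *: torus_point t)))%:E) = (Num.sqrt (mean2 f r))%:E.
Proof.
move=> hf r0 r1; rewrite unlock /=.
have -> : (\int[P]_t (`|(normc (f (r%:C *: torus_point t)))%:E| `^ 2))%E = (mean2 f r)%:E.
  have bf := coef_bmeas hf r0 r1; have [_ _ [M hM]] := bf.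
  have i2 : P.-integrable setT (EFin \o (fun t => normc (f (tpt r t)) ^+ 2)).
    apply: (@bounded_integrable _ _ _ _ _ (M ^+ 2)); first exact: bmeas_sqnorm.
    move=> t; rewrite ger0_norm ?sqr_ge0// lerXn2r ?nnegrE ?normc_ge0//.
    exact: le_trans (normc_ge0 _) (hM t).
  rewrite /mean2 fineK ?integrable_fin_num//.
  apply: eq_integral => t _; rewrite /= ger0_norm ?normc_ge0//.
  by rewrite powR_mulrn// normc_ge0.
by rewrite poweR_EFin powR12_sqrt// mean2_ge0.
Qed.

Definition coefsq a N : R := \sum_(alpha : {ffun 'I_n -> 'I_N}) normc (a (expo alpha)) ^+ 2.

Lemma boxsq_le_coefsq a r N : 0 <= r -> r <= 1 -> boxsq a r N <= coefsq a N.
Proof.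
move=> r0 r1; apply: ler_sum => alpha _; rewrite ler_piMr ?sqr_ge0//.
by rewrite !exprn_ile1 ?exprn_ge0.
Qed.

Lemma boxsq_cvg a N : boxsq a (1 - k.+1%:R^-1) N @[k --> \oo] --> coefsq a N.
Proof.
have -> : coefsq a N = boxsq a 1 N.
  by apply: eq_bigr => alpha _; rewrite !expr1n mulr1.
apply: cvg_big => [|alpha _]; first exact: add_continuous.
apply: cvgM; first exact: cvg_cst.
have c1 : (1 - k.+1%:R^-1) @[k --> \oo] --> (1 : R).
  rewrite -[X in _ --> X]subr0; apply: cvgB; first exact: cvg_cst.
  exact: cvg_harmonic.
have cX m (l : R) (u : R^nat) : u @ \oo --> l -> (fun k => u k ^+ m) @ \oo --> l ^+ m.
  move=> cu; elim: m => [|m IH]; first exact: cvg_cst.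
  by under eq_fun do rewrite exprS; rewrite exprS; exact: cvgM.
by apply: (cX 2%N); exact: cX.
Qed.

Lemma harmonic_radius k : (0 <= 1 - k.+1%:R^-1 :> R) /\ (1 - k.+1%:R^-1 < 1 :> R).
Proof.
rewrite subr_ge0 ltrBlDr ltrDl invr_gt0 ltr0n; split=> //.
by rewrite invf_le1 ?ler1n// ltr0n.
Qed.

Lemma coefsq_le a N S : (forall r, 0 <= r -> r < 1 -> boxsq a r N <= S) ->
  coefsq a N <= S.
Proof.
move=> hS; apply: (cvgr_to_le (@boxsq_cvg a N)); apply: nearW => k.
by have [r0 r1] := harmonic_radius k; exact: hS.
Qed.

(** The suprema over radii and over cubes are exchanged: [boxsq a r N] is below the mean at radius
    [r] for every [N], and it tends to [coefsq a N] as [r] tends to 1. *)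
Lemma hardy_norm_leP f a (s : R) : is_coef f a -> 0 <= s ->
  (hardy_norm f <= s%:E)%E <-> forall N, coefsq a N <= s ^+ 2.
Proof.
move=> hf s0.
have sq r : (Num.sqrt (mean2 f r) <= s) = (mean2 f r <= s ^+ 2).
  by rewrite -[in RHS](sqr_sqrtr (mean2_ge0 f r)) ler_pXn2r ?nnegrE ?sqrtr_ge0.
split=> [hs N|hs].
  apply: coefsq_le => r r0 r1; apply: le_trans (boxsq_le_mean2 N hf r0 r1) _.
  rewrite -sq -lee_fin -(Lnorm2_mean2 hf r0 r1).
  apply: le_trans hs; apply: ereal_sup_ubound; exists r => //=.
  by rewrite r0 r1.
apply: ge_ereal_sup => _ [r /= /andP[r0 r1] <-].
rewrite (Lnorm2_mean2 hf r0 r1) lee_fin sq; apply: (mean2_le hf) => // N.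
by apply: le_trans (hs N); apply: boxsq_le_coefsq => //; exact: ltW.
Qed.

End Parseval.

(** * Differentiability through coordinatewise estimates *)

Section DifferentiableCriterion.
Context {R : realType} {n : nat}.
Local Notation C := R[i].
Implicit Types (z w h : 'rV[C]_n) (f g : 'rV[C]_n -> C).

Lemma norm_rV_ltP h (e : R) : 0 < e ->
  (`|h| < e%:C) <-> (forall j, normc (h ord0 j) < e).
Proof.
move=> e0; have E : (`|h| < e%:C) <-> ball (0 : 'rV[C]_n) e%:C h.
  by rewrite mx_norm_ball /ball_/= sub0r normrN.
split=> [/E[_ hb] j|hb].
  by have := hb ord0 j; rewrite /ball/= mxE sub0r normrN normr_ltC.
apply/E; split; first by rewrite ltcR.
by move=> i j; rewrite ord1 /ball/= mxE sub0r normrN normr_ltC.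
Qed.

Lemma norm_rV_real h : `|h| = (Re `|h|)%:C /\ 0 <= Re `|h|.
Proof.
by have := normr_ge0 h; case: `|h| => a b; rewrite lecE /= => /andP[/eqP -> ->].
Qed.

Lemma norm_rV_le h (D : R) : 0 <= D -> (forall j, normc (h ord0 j) <= D) ->
  Re `|h| <= D.
Proof.
move=> D0 hD; have [E N0] := norm_rV_real h; apply/ler_addgt0Pl => e e0.
have De : 0 < e + D by rewrite ltr_pwDl.
apply: ltW; rewrite -ltcR -E; apply/norm_rV_ltP => // j.
by rewrite (le_lt_trans (hD j))// ltrDr.
Qed.

Lemma coord_le_norm h j : normc (h ord0 j) <= Re `|h|.
Proof.
have [E N0] := norm_rV_real h; apply/ler_addgt0Pl => e e0.
have De : 0 < e + Re `|h| by rewrite ltr_pwDl.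
apply: ltW; apply: (norm_rV_ltP h De).1.
by rewrite {1}E ltcR ltrDr.
Qed.

Lemma differentiable_small g z :
  (forall e, 0 < e -> exists2 d, 0 < d & forall z' D, D < d ->
    (forall j, normc (z' ord0 j - z ord0 j) <= D) -> 0 <= D ->
    normc (g z' - g z) <= e * D) -> differentiable g z.
Proof.
move=> hg.
pose V : normedModType C := 'rV[C]_n; pose W : normedModType C := C.
have L : (g : V -> W) \o shift (z : V) = cst (g z) + (\0 : {linear V -> W}) +o_ 0 id.
  apply/eqaddoP => _/posnumP[e]; have [eE e0] := posC (gt0 e).
  have [d d0 hd] := hg _ e0.
  rewrite near_simpl; apply/nbhs_coordP; exists d => // h hh.
  have hd' : Re `|h| < d.
    rewrite -ltcR -(norm_rV_real h).1; apply/norm_rV_ltP => // j.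
    by have := hh j; rewrite mxE subr0.
  have := hd (h + z) (Re `|h|) hd'.
  rewrite eE (norm_rV_real h).1 -rmorphM => H.
  have -> : (((g : V -> W) \o shift (z : V)) - (cst (g z) + (\0 : {linear V -> W}))) h
    = g (h + z) - g z :> C by rewrite !fctE/= addr0.
  rewrite normr_leC; apply: H; last exact: (norm_rV_real h).2.
  by move=> j; rewrite mxE addrK; exact: coord_le_norm.
have c0 : continuous (\0 : {linear V -> W}) by exact: cst_continuous.
by apply/diff_locallyP; rewrite (diff_unique c0 L).
Qed.

(** The candidate linear part is subtracted, which leaves a function with derivative 0 at [z]. The
    real bound [D] on the coordinates stands for the norm of the increment. *)
Lemma differentiable_expand f z (l : 'I_n -> C) :
  (forall e, 0 < e -> exists2 d, 0 < d & forall z' D, D < d ->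
    (forall j, normc (z' ord0 j - z ord0 j) <= D) -> 0 <= D ->
    normc (f z' - (f z + \sum_j l j * (z' ord0 j - z ord0 j))) <= e * D) ->
  differentiable f z.
Proof.
move=> hf; pose A z' := \sum_j l j * z' ord0 j.
have -> : f = (fun z' => f z' - A z') + A.
  by apply/funext => z' /=; rewrite fctE subrK.
apply: differentiableD.
  apply: differentiable_small => e e0; have [d d0 hd] := hf e e0.
  exists d => // z' D Dd hD D0; have := hd z' D Dd hD D0.
  congr (normc _ <= _); rewrite /A.
  have -> : \sum_j l j * (z' ord0 j - z ord0 j) = \sum_j l j * z' ord0 j - \sum_j l j * z ord0 j.
    by rewrite -sumrB; apply: eq_bigr => j _; rewrite mulrBr.
  by ring.
have -> : A = \sum_j (fun z' : 'rV[C]_n => l j * z' ord0 j).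
  by apply/funext => z'; rewrite fct_sumE.
apply: differentiable_sum => j; apply: differentiableM => //.
exact: differentiable_coord.
Qed.

Lemma differentiable_expansion f z : differentiable f z -> exists l : 'I_n -> C,
  forall e, 0 < e -> exists2 d, 0 < d & forall z' D, D < d ->
    (forall j, normc (z' ord0 j - z ord0 j) <= D) -> 0 <= D ->
    normc (f z' - (f z + \sum_j l j * (z' ord0 j - z ord0 j))) <= e * D.
Proof.
move=> df; have /eqaddoP L := diff_locally df.
exists (fun j => 'd f z (delta_mx ord0 j)) => e e0.
have eC : 0 < e%:C :> C by rewrite ltcR.
have /nbhs_coordP[d d0 hd] := L _ eC; exists d => // z' D Dd hD D0.
have hd' : forall j, normc ((z' - z) ord0 j - (0 : 'rV[C]_n) ord0 j) < d.
  by move=> j; rewrite !mxE subr0; exact: le_lt_trans (hD j) Dd.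
have := hd _ hd'; rewrite /= !fctE /= subrK.
have -> : 'd f z (z' - z) = \sum_j 'd f z (delta_mx ord0 j) * (z' ord0 j - z ord0 j).
  rewrite {1}(row_sum_delta (z' - z)) linear_sum; apply: eq_bigr => j _.
  by rewrite linearZ !mxE /= mulrC.
rewrite (norm_rV_real (z' - z)).1 -rmorphM normr_leC => H.
apply: (le_trans H); apply: ler_wpM2l; first exact: ltW.
by apply: norm_rV_le => // j; rewrite !mxE.
Qed.

Lemma eq_differentiable f g z d : 0 < d ->
  (forall z', (forall j, normc (z' ord0 j - z ord0 j) < d) -> f z' = g z') ->
  differentiable f z -> differentiable g z.
Proof.
move=> d0 fg /differentiable_expansion[l hl]; apply: (@differentiable_expand _ _ l) => e e0.
have [d' d'0 h] := hl e e0; exists (Num.min d d'); first by rewrite lt_min d0.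
move=> z' D; rewrite lt_min => /andP[Dd Dd'] hD D0.
rewrite -fg; last by move=> j; exact: le_lt_trans (hD j) Dd.
rewrite -(fg z); last by move=> j; rewrite subrr normc0.
exact: h.
Qed.

Lemma polydisc_open z : polydisc z -> exists2 d, 0 < d &
  forall z', (forall j, normc (z' ord0 j - z ord0 j) < d) -> polydisc z'.
Proof.
move=> zp; pose m := \big[Num.max/0]_j normc (z ord0 j).
have m1 : m < 1.
  by apply: bigmax_lt => // j _; have := zp j; rewrite normr_lt1.
exists (1 - m) => [|z' hz j]; first by rewrite subr_gt0.
rewrite normr_lt1; have hm : normc (z ord0 j) <= m by exact: le_bigmax_cond.
have := le_normcB (z' ord0 j) (z ord0 j); have := hz j.
lra.
Qed.

(** Matches the convention of [hardy] that functions vanish off the polydisc; as the polydisc is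
    open, analyticity is not affected. *)
Definition extz g z : C := if `[< polydisc z >] then g z else 0.

Lemma extzE g z : polydisc z -> extz g z = g z.
Proof. by move=> zp; rewrite /extz asboolT. Qed.

Lemma extz0 g z : ~ polydisc z -> extz g z = 0.
Proof. by move=> zp; rewrite /extz asboolF. Qed.

Lemma eq_analytic f g : (forall z, polydisc z -> f z = g z) ->
  analytic_on_polydisc f -> analytic_on_polydisc g.
Proof.
move=> fg af z zp; have [d d0 hd] := polydisc_open zp.
by apply: (eq_differentiable d0 _ (af z zp)) => z' hz; apply/fg/hd.
Qed.

Lemma analytic_extz g : analytic_on_polydisc g -> analytic_on_polydisc (extz g).
Proof. by apply: eq_analytic => z zp; rewrite extzE. Qed.

End DifferentiableCriterion.

(** * Hardy functions and their coefficients *)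

Section HardyCoef.
Context {R : realType} {n : nat}.
Local Notation C := R[i].
Local Notation fct := ('rV[C]_n -> C).
Implicit Types (f g : fct) (a b : ('I_n -> nat) -> C).

Definition coef f : ('I_n -> nat) -> C := xget (fun=> 0) (is_coef f).

Lemma coefP f : analytic_on_polydisc f -> is_coef f (coef f).
Proof.
by move=> /analytic_is_coef[a ha]; rewrite /coef; case: xgetP => // /(_ a).
Qed.

Lemma is_coef_uniq f a b : is_coef f a -> is_coef f b -> a = b.
Proof.
move=> ha hb; have h0 : (0 : R) < 2^-1 by rewrite invr_gt0.
have h1 : (2^-1 : R) < 1 by rewrite invf_lt1// ltr1n.
by apply: (@coef_uniq _ _ f _ _ 2^-1) => // e e0; [apply: ha|apply: hb] => //; exact: ltW.
Qed.

Lemma coef_eq f a : is_coef f a -> coef f = a.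
Proof.
move=> ha; have : is_coef f (coef f).
  by rewrite /coef; case: xgetP => // /(_ a).
by move=> h; exact: is_coef_uniq h ha.
Qed.

Lemma is_coef_lin (c : C) f g a b : is_coef f a -> is_coef g b ->
  is_coef (c \*o f + g) (fun alpha => c * a alpha + b alpha).
Proof.
move=> ha hb r e r0 r1 e0.
pose K := normc c + 1; have K0 : 0 < K by rewrite ltr_wpDl ?normc_ge0.
have e1 : 0 < e / 2 / K by rewrite !divr_gt0.
have e2 : 0 < e / 2 by rewrite divr_gt0.
have [N1 h1] := ha r _ r0 r1 e1; have [N2 h2] := hb r _ r0 r1 e2.
exists (maxn N1 N2) => N w; rewrite geq_max => /andP[NN1 NN2] cw.
have -> : psum (fun alpha => c * a alpha + b alpha) N w = c * psum a N w + psum b N w.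
  rewrite /psum mulr_sumr -big_split; apply: eq_bigr => alpha _ /=.
  by rewrite mulrDl mulrA.
have -> : (c \*o f + g) w - (c * psum a N w + psum b N w) =
  c * (f w - psum a N w) + (g w - psum b N w) by rewrite fctE /=; ring.
rewrite (le_lt_trans (le_normcD _ _))// normcM [ltRHS]splitr; apply: ler_ltD; last exact: h2.
have := h1 N w NN1 cw; rewrite ltr_pdivlMr// => /ltW; apply: le_trans.
by rewrite mulrC ler_wpM2l ?normc_ge0// /K lerDl.
Qed.

Lemma analytic_lin (c : C) f g : analytic_on_polydisc f -> analytic_on_polydisc g ->
  analytic_on_polydisc (c \*o f + g).
Proof.
move=> af ag z zp; apply: differentiableD; last exact: ag.
by apply: (@differentiableZ _ _ C); exact: af.
Qed.

Lemma coefsq_ge0 a N : 0 <= coefsq a N.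
Proof. by apply: sumr_ge0 => alpha _; exact: sqr_ge0. Qed.

Lemma coefsq_homo a : {homo coefsq a : N M / (N <= M)%N >-> N <= M}.
Proof.
move=> N M NM; apply: (@le_box_sum _ _ (fun alpha => normc (a alpha) ^+ 2)) => // alpha.
exact: sqr_ge0.
Qed.

Lemma hardy_norm_ge0 f : (0 <= hardy_norm f)%E.
Proof.
apply: le_trans (ereal_sup_ubound _).
  2: by exists 0 => //=; rewrite lexx ltr01.
exact: Lnorm_ge0.
Qed.

Lemma hardyP f : hardy f <-> [/\ forall z, ~ polydisc z -> f z = 0,
  analytic_on_polydisc f & exists S, forall N, coefsq (coef f) N <= S].
Proof.
split=> -[f0 af H]; split=> //.
  have h0 := hardy_norm_ge0 f.
  have hE : hardy_norm f = (fine (hardy_norm f))%:E by rewrite fineK// ge0_fin_numE.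
  exists (fine (hardy_norm f) ^+ 2); apply/(hardy_norm_leP (coefP af)).
    exact: fine_ge0.
  by rewrite -hE.
case: H => S hS; have S0 : 0 <= S := le_trans (coefsq_ge0 _ 0%N) (hS 0%N).
apply: (@le_lt_trans _ _ (Num.sqrt S)%:E); last exact: ltry.
apply/(hardy_norm_leP (coefP af)); first exact: sqrtr_ge0.
by move=> N; rewrite sqr_sqrtr.
Qed.

Lemma hardy_lin (c : C) f g : hardy f -> hardy g -> hardy (c \*o f + g).
Proof.
move=> /hardyP[f0 af [S hS]] /hardyP[g0 ag [S' hS']]; apply/hardyP; split.
- by move=> z zp; rewrite fctE /= f0// g0// mulr0 addr0.
- exact: analytic_lin.
exists (2 * (normc c ^+ 2 * S + S')) => N.
rewrite (coef_eq (is_coef_lin c (coefP af) (coefP ag))).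
apply: (@le_trans _ _ (2 * (normc c ^+ 2 * coefsq (coef f) N + coefsq (coef g) N))); last first.
  by rewrite ler_pM2l// lerD// ler_wpM2l ?sqr_ge0.
rewrite /coefsq !mulr_sumr -big_split/= mulr_sumr; apply: ler_sum => alpha _.
set x := coef f _; set y := coef g _.
apply: (@le_trans _ _ ((normc c * normc x + normc y) ^+ 2)).
  rewrite lerXn2r ?nnegrE ?addr_ge0 ?mulr_ge0 ?normc_ge0//.
  by rewrite (le_trans (le_normcD _ _))// normcM.
have := sqr_ge0 (normc c * normc x - normc y); rewrite -exprMn; nra.
Qed.

Lemma hardy0 : hardy (0 : fct).
Proof.
have H r e (r0 : 0 <= r) (r1 : r < 1) (e0 : 0 < e) : exists N0 : nat, forall N (w : 'rV[C]_n),
    (N0 <= N)%N -> cpoly r w -> normc ((0 : fct) w - psum (fun=> 0) N w) < e.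
  exists 0%N => N w _ _; rewrite /psum big1 ?subr0 ?normc0// => alpha _.
  by rewrite mul0r.
apply/hardyP; split=> //.
exists 0 => N; rewrite (coef_eq (a := fun=> 0) H) /coefsq big1// => alpha _.
by rewrite normc0 expr0n.
Qed.

Lemma psum_cvg_eq f g a : is_coef f a -> is_coef g a ->
  forall z, polydisc z -> f z = g z.
Proof.
move=> hf hg z zp; apply/eqP; rewrite -subr_eq0 -normc_eq0 eq_le normc_ge0 andbT.
pose r := \big[Num.max/0]_j normc (z ord0 j).
have r1 : r < 1.
  by apply: bigmax_lt => // j _; have := zp j; rewrite normr_lt1.
have zr : cpoly r z by move=> j; exact: le_bigmax_cond.
have r0 : 0 <= r by exact: bigmax_ge_id.
apply/ler_addgt0Pl => e e0; have e2 : 0 < e / 2 by rewrite divr_gt0.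
have [N1 h1] := hf r _ r0 r1 e2; have [N2 h2] := hg r _ r0 r1 e2.
pose N := maxn N1 N2.
have -> : f z - g z = (f z - psum a N z) - (g z - psum a N z) by ring.
rewrite addr0 (le_trans (le_normcD _ _))// normcN [leRHS]splitr.
by apply: lerD; apply: ltW; [apply: h1|apply: h2] => //; rewrite ?leq_maxl ?leq_maxr.
Qed.

Lemma hardy_ext f g : hardy f -> hardy g -> coef f = coef g -> f = g.
Proof.
move=> [f0 af _] [g0 ag _] fg; apply/funext => z.
have [zp|zp] := pselect (polydisc z); last by rewrite f0// g0.
apply: (@psum_cvg_eq _ _ (coef f)) => //; first exact: coefP.
by rewrite fg; exact: coefP.
Qed.

(** [hardy_norm_leP] is read in both directions: with the norm itself as bound, and with the square
    root of the supremum of the partial sums. *)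
Lemma sqnorm_cvg f : hardy f -> coefsq (coef f) N @[N --> \oo] --> sqnorm f.
Proof.
move=> hf; have [f0 af [S hS]] := (hardyP f).1 hf.
have h0 := hardy_norm_ge0 f; have hoo : (hardy_norm f < +oo)%E by case: hf.
have hE : hardy_norm f = (fine (hardy_norm f))%:E by rewrite fineK// ge0_fin_numE.
have ub : has_ubound (range (coefsq (coef f))) by exists S => _ [N _ <-].
have hle : forall N, coefsq (coef f) N <= sqnorm f.
  apply/(hardy_norm_leP (coefP af)); first exact: fine_ge0.
  by rewrite -hE.
have := nondecreasing_cvgn (@coefsq_homo (coef f)) ub.
have -> : sup (range (coefsq (coef f))) = sqnorm f; last by [].
apply/eqP; rewrite eq_le; apply/andP; split.
  by apply: ge_sup; [exists (coefsq (coef f) 0%N); exists 0%N|move=> _ [N _ <-]].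
have s0 : 0 <= sup (range (coefsq (coef f))).
  by apply: le_trans (coefsq_ge0 (coef f) 0%N) (ub_le_sup ub _); exists 0%N.
rewrite /sqnorm -[leRHS](sqr_sqrtr s0) lerXn2r ?nnegrE ?sqrtr_ge0 ?fine_ge0//.
rewrite -lee_fin -hE; apply/(hardy_norm_leP (coefP af)); first exact: sqrtr_ge0.
by move=> N; rewrite sqr_sqrtr//; apply: ub_le_sup => //; exists N.
Qed.

Definition coefdot a b N : C :=
  \sum_(alpha : {ffun 'I_n -> 'I_N}) a (expo alpha) * conjc (b (expo alpha)).

Lemma polarization (x y : C) : x * conjc y =
  ((normc (x + y) ^+ 2 - normc (x - y) ^+ 2) / 4) +i*
  ((normc (x + 'i%C * y) ^+ 2 - normc (x - 'i%C * y) ^+ 2) / 4).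
Proof.
case: x y => a b [c d]; rewrite !sqr_normcE; simpc => /=.
by congr (_ +i* _); field.
Qed.

Lemma fct_subE f g : f - g = (-1 : C) \*o g + f.
Proof. by apply/funext => z; rewrite !fctE /= mulN1r addrC. Qed.

Lemma hardy_coef_lin (c : C) f g : hardy f -> hardy g ->
  coef (c \*o f + g) = fun alpha => c * coef f alpha + coef g alpha.
Proof. by move=> [_ af _] [_ ag _]; apply: coef_eq; apply: is_coef_lin; exact: coefP. Qed.

Lemma hardy_scale (c : C) f : hardy f -> hardy (c \*o f) /\
  coef (c \*o f) = fun alpha => c * coef f alpha.
Proof.
move=> hf; split; first by have := hardy_lin c hf hardy0; rewrite addr0.
have := hardy_coef_lin c hf hardy0; rewrite addr0 => ->.
apply/funext => alpha; suff -> : coef (0 : fct) = fun=> 0 by rewrite addr0.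
apply: coef_eq => r e r0 r1 e0; exists 0%N => N w _ _.
rewrite /psum big1 ?subr0 ?normc0// => beta _; by rewrite mul0r.
Qed.

(** The inner product is defined by polarizing norms. The same identity holds coefficient by
    coefficient, so each of the four norms can be expanded separately. *)
Lemma hardy_dot_cvg f g : hardy f -> hardy g ->
  coefdot (coef f) (coef g) N @[N --> \oo] --> hardy_dot f g.
Proof.
move=> hf hg; pose a := coef f; pose b := coef g.
have [hig cig] := hardy_scale 'i%C hg.
have D1 : f + g = 1 \*o g + f by apply/funext => z; rewrite !fctE /= mul1r addrC.
have D2 : f + 'i%C \*o g = 'i%C \*o g + f by rewrite addrC.
have H1 : hardy (f + g) /\ coef (f + g) = fun alpha => a alpha + b alpha.
  rewrite D1; split; first exact: hardy_lin.
  by rewrite hardy_coef_lin//; apply/funext => alpha; rewrite mul1r addrC.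
have H2 : hardy (f - g) /\ coef (f - g) = fun alpha => a alpha - b alpha.
  rewrite fct_subE; split; first exact: hardy_lin.
  by rewrite hardy_coef_lin//; apply/funext => alpha; rewrite mulN1r addrC.
have H3 : hardy (f + 'i%C \*o g) /\ coef (f + 'i%C \*o g) = fun alpha => a alpha + 'i%C * b alpha.
  rewrite D2; split; first exact: hardy_lin.
  by rewrite hardy_coef_lin//; apply/funext => alpha; rewrite addrC.
have H4 : hardy (f - 'i%C \*o g) /\ coef (f - 'i%C \*o g) = fun alpha => a alpha - 'i%C * b alpha.
  rewrite fct_subE; split; first exact: hardy_lin.
  by rewrite hardy_coef_lin// cig; apply/funext => alpha; rewrite mulN1r addrC.
have c1 := sqnorm_cvg H1.1; have c2 := sqnorm_cvg H2.1.
have c3 := sqnorm_cvg H3.1; have c4 := sqnorm_cvg H4.1.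
rewrite H1.2 in c1; rewrite H2.2 in c2; rewrite H3.2 in c3; rewrite H4.2 in c4.
pose u N := (coefsq (fun alpha => a alpha + b alpha) N - coefsq (fun alpha => a alpha - b alpha) N) / 4.
pose v N := (coefsq (fun alpha => a alpha + 'i%C * b alpha) N - coefsq (fun alpha => a alpha - 'i%C * b alpha) N) / 4.
have cu : u @ \oo --> (sqnorm (f + g) - sqnorm (f - g)) / 4.
  by apply: cvgM; [exact: cvgB|exact: cvg_cst].
have cv : v @ \oo --> (sqnorm (f + 'i%C \*o g) - sqnorm (f - 'i%C \*o g)) / 4.
  by apply: cvgM; [exact: cvgB|exact: cvg_cst].
have E N : coefdot a b N = (u N) +i* (v N).
  rewrite /u /v /coefsq -!sumrB !mulr_suml.
  have -> (I : finType) (F G : I -> R) : (\sum_i F i) +i* (\sum_i G i) = \sum_i ((F i) +i* (G i)).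
    elim: (index_enum I) => [|i s IH]; first by rewrite !big_nil.
    by rewrite !big_cons -IH; simpc.
  by apply: eq_bigr => alpha _; rewrite polarization.
move=> A /nbhs_normcP[e e0 he]; have e2 : 0 < e / 2 by rewrite divr_gt0.
have /cvgrPdist_lt/(_ _ e2)[N1 _ h1] := cu; have /cvgrPdist_lt/(_ _ e2)[N2 _ h2] := cv.
exists (maxn N1 N2) => // N /=; rewrite geq_max => /andP[NN1 NN2]; apply: he.
rewrite -/a -/b E (le_lt_trans (normc_le_ReIm _))// [ltRHS]splitr.
by apply: ltrD; rewrite /= distrC; [exact: h1|exact: h2].
Qed.

End HardyCoef.

(** * Hilbert spaces *)

Lemma conjcN (R : rcfType) (z : R[i]) : conjc (- z) = - conjc z.
Proof. exact: rmorphN. Qed.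

Section Hilbert.
Context {R : realType} {V : lmodType R[i]}.
Local Notation C := R[i].
Variable dot : V -> V -> C.
Implicit Types (x y z : V) (c : C) (N : set V).

(** The Hilbert space is abstract, so that the operator theory below does not see analytic
    functions. Completeness is stated through squared distances. *)
Record is_hilbert : Prop := {
  dotL : forall c x y z, dot (c *: x + y) z = c * dot x z + dot y z;
  dotC : forall x y, dot y x = conjc (dot x y);
  dot_pos : forall x, x != 0 -> 0 < Re (dot x x);
  dot_complete : forall u : nat -> V,
    (forall e, 0 < e -> exists K, forall m k, (K <= m)%N -> (K <= k)%N ->
       Re (dot (u m - u k) (u m - u k)) < e) ->
    exists l, forall e, 0 < e -> exists K, forall k, (K <= k)%N ->
       Re (dot (u k - l) (u k - l)) < e }.

Hypothesis H : is_hilbert.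

Definition sq x : R := Re (dot x x).

Lemma dotDl x y z : dot (x + y) z = dot x z + dot y z.
Proof. by rewrite -[x in LHS]scale1r (dotL H) mul1r. Qed.

Lemma dot0l z : dot 0 z = 0.
Proof. by apply: (@addrI _ (dot 0 z)); rewrite -dotDl !addr0. Qed.

Lemma dotZl c x z : dot (c *: x) z = c * dot x z.
Proof. by rewrite -[c *: x]addr0 (dotL H) dot0l addr0. Qed.

Lemma dotNl x z : dot (- x) z = - dot x z.
Proof. by rewrite -scaleN1r dotZl mulN1r. Qed.

Lemma dotBl x y z : dot (x - y) z = dot x z - dot y z.
Proof. by rewrite dotDl dotNl. Qed.

Lemma dotDr x y z : dot x (y + z) = dot x y + dot x z.
Proof. by rewrite !(dotC H _ x) dotDl conjcD. Qed.

Lemma dotZr c x z : dot x (c *: z) = conjc c * dot x z.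
Proof. by rewrite !(dotC H _ x) dotZl conjcM. Qed.

Lemma dot0r x : dot x 0 = 0.
Proof. by rewrite (dotC H) dot0l conjc0. Qed.

Lemma dotNr x z : dot x (- z) = - dot x z.
Proof. by rewrite -scaleN1r dotZr conjcN conjc1 mulN1r. Qed.

Lemma dotBr x y z : dot x (y - z) = dot x y - dot x z.
Proof. by rewrite dotDr dotNr. Qed.

Lemma dot_sumr (I : Type) (s : seq I) (F : I -> V) x :
  dot x (\sum_(i <- s) F i) = \sum_(i <- s) dot x (F i).
Proof. by apply: (big_morph (dot x) (dotDr x) (dot0r x)). Qed.

Lemma dot_suml (I : Type) (s : seq I) (F : I -> V) x :
  dot (\sum_(i <- s) F i) x = \sum_(i <- s) dot (F i) x.
Proof. by apply: (big_morph (dot^~ x) (fun y z => dotDl y z x) (dot0l x)). Qed.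

Lemma dotxx x : dot x x = (sq x)%:C.
Proof.
have := dotC H x x; rewrite /sq; case: (dot x x) => a b /= [] /eqP.
by rewrite -subr_eq0 opprK -mulr2n mulrn_eq0/= => /eqP ->.
Qed.

Lemma sq_ge0 x : 0 <= sq x.
Proof.
have [->|/(dot_pos H)/ltW//] := eqVneq x 0.
by rewrite /sq dot0l.
Qed.

Lemma sq_eq0 x : sq x = 0 -> x = 0.
Proof. by move=> x0; apply/eqP/negPn/negP => /(dot_pos H); rewrite -/(sq x) x0 ltxx. Qed.

Lemma sq0 : sq 0 = 0. Proof. by rewrite /sq dot0l. Qed.

Lemma dot_eq0 x : dot x x = 0 -> x = 0.
Proof. by rewrite dotxx => -[]; exact: sq_eq0. Qed.

Lemma sqD x y : sq (x + y) = sq x + sq y + 2 * Re (dot x y).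
Proof.
rewrite /sq dotDl !dotDr !cReD (dotC H x y) cReJ; ring.
Qed.

Lemma sqZ c x : sq (c *: x) = normc c ^+ 2 * sq x.
Proof.
rewrite {1}/sq dotZl dotZr mulrA mulcJ dotxx.
by rewrite -rmorphM.
Qed.

Lemma sqN x : sq (- x) = sq x.
Proof. by rewrite -scaleN1r sqZ normcN normc1 expr1n mul1r. Qed.

Lemma sqBC x y : sq (x - y) = sq (y - x).
Proof. by rewrite -sqN opprB. Qed.

Lemma sqB x y : sq (x - y) = sq x + sq y - 2 * Re (dot x y).
Proof. by rewrite sqD sqN dotNr cReN mulrN. Qed.

Lemma parallelogram x y : sq (x + y) + sq (x - y) = 2 * sq x + 2 * sq y.
Proof. by rewrite sqD sqB; ring. Qed.

Lemma cauchy_schwarz x y : normc (dot x y) ^+ 2 <= sq x * sq y.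
Proof.
have [->|y0] := eqVneq y 0; first by rewrite dot0r normc0 expr0n sq0 mulr0.
have sy : 0 < sq y := dot_pos H y0.
have := sq_ge0 ((sq y)%:C *: x - dot x y *: y).
rewrite sqB !sqZ normcR ger0_norm ?(ltW sy)// dotZl dotZr.
rewrite [conjc _ * _]mulrC mulcJ -rmorphM/=; nra.
Qed.

Definition nrm x : R := Num.sqrt (sq x).

Lemma nrm_ge0 x : 0 <= nrm x. Proof. exact: sqrtr_ge0. Qed.

Lemma sqr_nrm x : nrm x ^+ 2 = sq x. Proof. by rewrite sqr_sqrtr// sq_ge0. Qed.

Lemma normc_dot x y : normc (dot x y) <= nrm x * nrm y.
Proof.
rewrite -(@ler_pXn2r _ 2)// ?nnegrE ?normc_ge0 ?mulr_ge0 ?nrm_ge0//.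
by rewrite exprMn !sqr_nrm cauchy_schwarz.
Qed.

Lemma nrmD x y : nrm (x + y) <= nrm x + nrm y.
Proof.
rewrite -(@ler_pXn2r _ 2)// ?nnegrE ?addr_ge0 ?nrm_ge0// sqr_nrm sqD.
rewrite sqrrD !sqr_nrm mulr2n.
have : Re (dot x y) <= nrm x * nrm y; last by lra.
exact: le_trans (ler_norm _) (le_trans (Re_le_normc _) (normc_dot _ _)).
Qed.

Definition csub N := [/\ N 0, forall c x y, N x -> N y -> N (c *: x + y) &
  forall x, (forall e, 0 < e -> exists2 y, N y & sq (x - y) < e) -> N x].

Lemma csubD N x y : csub N -> N x -> N y -> N (x + y).
Proof. by move=> [_ h _] Nx Ny; rewrite -[x]scale1r; exact: h. Qed.

Lemma csubZ N c x : csub N -> N x -> N (c *: x).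
Proof. by move=> [h0 h _] Nx; rewrite -[_ *: _]addr0; exact: h. Qed.

Lemma csubN N x : csub N -> N x -> N (- x).
Proof. by move=> hN Nx; rewrite -scaleN1r; exact: csubZ. Qed.

Lemma csubB N x y : csub N -> N x -> N y -> N (x - y).
Proof. by move=> hN Nx Ny; apply: csubD => //; exact: csubN. Qed.

Definition orth N : set V := [set x | forall y, N y -> dot x y = 0].

Lemma csub_orth N : csub (orth N).
Proof.
split; first by move=> y _; rewrite dot0l.
  by move=> c x y hx hy z Nz; rewrite (dotL H) hx// hy// mulr0 addr0.
move=> x hx y Ny; apply/eqP; rewrite -normc_eq0 eq_le normc_ge0 andbT.
apply/ler_addgt0Pl => e e0; rewrite addr0.
pose K := nrm y + 1; have K0 : 0 < K by rewrite ltr_wpDl ?nrm_ge0.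
have [z Nz zx] := hx ((e / K) ^+ 2) (exprn_gt0 _ (divr_gt0 e0 K0)).
have -> : dot x y = dot (x - z) y by rewrite dotBl Nz// subr0.
apply: (le_trans (normc_dot _ _)).
have h : nrm (x - z) <= e / K.
  rewrite -(@ler_pXn2r _ 2)// ?nnegrE ?nrm_ge0 ?divr_ge0 ?(ltW e0) ?(ltW K0)//.
  by rewrite sqr_nrm ltW.
apply: (@le_trans _ _ (e / K * K)); last by rewrite divfK// gt_eqF.
by apply: ler_pM; rewrite ?nrm_ge0// lerDl.
Qed.

Lemma csubI N M : csub N -> csub M -> csub (N `&` M).
Proof.
move=> [a1 a2 a3] [b1 b2 b3]; split=> //.
  by move=> c x y [? ?] [? ?]; split; [exact: a2|exact: b2].
by move=> x hx; split; [apply: a3|apply: b3] => e e0;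
  have [y [? ?] ?] := hx e e0; exists y.
Qed.

Lemma csub_bigcap (I : Type) (P : set I) (F : I -> set V) :
  (forall i, P i -> csub (F i)) -> csub (\bigcap_(i in P) F i).
Proof.
move=> hF; split.
- by move=> i Pi; case: (hF i Pi).
- by move=> c x y hx hy i Pi; case: (hF i Pi) => _ h _; apply: h; [exact: hx|exact: hy].
- move=> x hx i Pi; case: (hF i Pi) => _ _; apply => e e0.
  by have [y hy yx] := hx e e0; exists y => //; exact: hy.
Qed.

(** A minimizing sequence for the distance is Cauchy by the parallelogram identity; its limit
    minimizes, and a variation along [z] gives orthogonality. *)
Lemma projection_exists N : csub N -> forall x,
  exists y, N y /\ forall z, N z -> dot (x - y) z = 0.
Proof.
move=> hN x; have [N0 Nlin Ncl] := hN.
pose A := [set sq (x - y) | y in N].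
have A0 : has_inf A.
  by split; [exists (sq (x - 0)); exists 0|exists 0 => _ [y _ <-]; exact: sq_ge0].
set d := inf A.
have dle y : N y -> d <= sq (x - y).
  by move=> Ny; apply: ge_inf; [exact: A0.2|exists y].
have d0 : 0 <= d.
  by apply: lb_le_inf; [exact: A0.1|move=> _ [y _ <-]; exact: sq_ge0].
have hu k : exists y, N y /\ sq (x - y) < d + k.+1%:R^-1.
  have k0 : (0 : R) < k.+1%:R^-1 by rewrite invr_gt0 ltr0n.
  by have [_ [y Ny <-] hy] := inf_adherent k0 A0; exists y.
have [u huN] := choice hu.
have cauchy m k : sq (u m - u k) <= 2 * m.+1%:R^-1 + 2 * k.+1%:R^-1.
  have [Nm hm] := huN m; have [Nk hk] := huN k.
  have := parallelogram (x - u m) (x - u k).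
  have -> : x - u m - (x - u k) = - (u m - u k).
    by rewrite !opprB addrC addrA subrK.
  have -> : x - u m + (x - u k) = 2%:R *: (x - 2^-1 *: (u m + u k)).
    rewrite scalerBr scalerA divff ?pnatr_eq0// scale1r scaler_nat mulr2n.
    by rewrite addrACA opprD.
  rewrite sqN sqZ.
  have -> : normc (2%:R : C) = 2.
    by rewrite -(rmorph_nat (real_complex R) 2) normcR ger0_norm.
  have h4 : (2 : R) ^+ 2 = 4 by ring.
  rewrite h4; have := dle _ (csubZ 2^-1 hN (csubD hN Nm Nk)).
  move: hm hk; set a1 := sq _; set a2 := sq (x - u k); set a3 := sq (x - _ *: _).
  set a4 := sq (u m - u k); set i1 := _^-1; set i2 := k.+1%:R^-1.
  move=> h1 h2 h3 h5; lra.
have inv_small (e : R) : 0 < e -> exists K, forall k, (K <= k)%N -> k.+1%:R^-1 < e.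
  move=> e0; have /cvgrPdist_lt/(_ _ e0)[K _ hK] := @cvg_harmonic R.
  exists K => k Kk; have := hK k Kk; rewrite /= sub0r normrN.
  exact: le_lt_trans (ler_norm _).
have [l hl] : exists l, forall e, 0 < e -> exists K, forall k, (K <= k)%N ->
    sq (u k - l) < e.
  apply: (dot_complete H) => e e0.
  have e4 : 0 < e / 4 by rewrite divr_gt0.
  have [K hK] := inv_small _ e4; exists K => m k Km Kk.
  apply: (le_lt_trans (cauchy m k)); move: (hK m Km) (hK k Kk).
  by set i1 := m.+1%:R^-1; set i2 := k.+1%:R^-1; move=> h1 h2; lra.
have Nl : N l.
  apply: Ncl => e e0; have [K hK] := hl e e0; exists (u K); first by case: (huN K).
  by rewrite sqBC; exact: hK.
have ld : sq (x - l) <= d.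
  rewrite -[leRHS]sqr_sqrtr// -sqr_nrm ler_pXn2r ?nnegrE ?nrm_ge0 ?sqrtr_ge0//.
  apply/ler_addgt0Pl => e e0; have e2 : 0 < e / 2 by rewrite divr_gt0.
  have [K1 hK1] := hl _ (exprn_gt0 2 e2).
  have [K2 hK2] := inv_small _ (exprn_gt0 2 e2).
  pose k := maxn K1 K2.
  have h1 : nrm (u k - l) <= e / 2.
    rewrite -(@ler_pXn2r _ 2)// ?nnegrE ?nrm_ge0 ?(ltW e2)// sqr_nrm.
    by apply/ltW/hK1; rewrite leq_maxl.
  have h2 : nrm (x - u k) <= Num.sqrt d + e / 2.
    rewrite -(@ler_pXn2r _ 2)// ?nnegrE ?nrm_ge0 ?addr_ge0 ?sqrtr_ge0 ?(ltW e2)// sqr_nrm.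
    have [_ hk] := huN k; have hk2 := hK2 k (leq_maxr _ _).
    rewrite sqrrD sqr_sqrtr//.
    have : 0 <= Num.sqrt d * (e / 2) *+ 2 by rewrite mulrn_wge0// mulr_ge0 ?sqrtr_ge0 ?ltW.
    move: hk hk2; set i1 := k.+1%:R^-1; set a1 := sq _; set s1 := _ *+ 2; set e1 := (e / 2) ^+ 2.
    by move=> h2 h3 h4; lra.
  have -> : x - l = (x - u k) + (u k - l) by rewrite addrA subrK.
  by apply: (le_trans (nrmD _ _)); move: h1 h2; lra.
exists l; split=> // z Nz.
have [->|z0] := eqVneq z 0; first by rewrite dot0r.
have sz : 0 < sq z := dot_pos H z0.
have hvc c : sq (x - l) <= sq (x - l - c *: z).
  by rewrite (le_trans ld)// -addrA -opprD; apply: dle; apply: csubD => //; exact: csubZ.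
move: (x - l) hvc => v hvc.
(* The multiple of [z] that lowers $\|v-cz\|^2$ most, namely by $|\langle v,z\rangle|^2/\|z\|^2$. *)
pose c := dot v z / (sq z)%:C; have := hvc c.
rewrite sqB sqZ dotZr.
have szC : (sq z)%:C != 0 :> C by rewrite -normc_eq0 normcR normr_eq0 gt_eqF.
have -> : conjc c * dot v z = (normc (dot v z) ^+ 2 / sq z)%:C.
  rewrite /c conjcM conjc_inv conjc_real mulrAC [conjc _ * _]mulrC mulcJ.
  exact/esym/fmorph_div.
have -> : normc c ^+ 2 * sq z = normc (dot v z) ^+ 2 / sq z.
  rewrite /c normcM normcV normcR ger0_norm ?(ltW sz)// exprMn.
  by field; rewrite gt_eqF.
rewrite /= => h; apply/eqP; rewrite -normc_eq0 -sqrf_eq0 eq_le sqr_ge0 andbT.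
have : normc (dot v z) ^+ 2 / sq z <= 0 by move: h; lra.
by rewrite ler_pdivrMr// mul0r.
Qed.

Definition oproj N x : V := xget 0 [set y | N y /\ forall z, N z -> dot (x - y) z = 0].

Lemma projP N x : csub N -> N (oproj N x) /\ forall z, N z -> dot (x - oproj N x) z = 0.
Proof.
move=> hN; have [y hy] := projection_exists hN x.
by rewrite /oproj; case: xgetP => [z _ //|/(_ y)].
Qed.

Lemma proj_in N x : csub N -> N (oproj N x).
Proof. by move=> hN; case: (projP x hN). Qed.

Lemma proj_orth N x z : csub N -> N z -> dot (x - oproj N x) z = 0.
Proof. by move=> hN; case: (projP x hN) => _; apply. Qed.

Lemma proj_uniq N x y : csub N -> N y -> (forall z, N z -> dot (x - y) z = 0) ->
  oproj N x = y.
Proof.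
move=> hN Ny hy; apply/eqP; rewrite -subr_eq0; apply/eqP/dot_eq0.
have Nd : N (oproj N x - y) by apply: csubB => //; exact: proj_in.
have E : oproj N x - y = (x - y) - (x - oproj N x) by rewrite opprB [RHS]addrC addrA subrK.
by rewrite {1}E dotBl hy// proj_orth// subr0.
Qed.

Lemma proj_id N x : csub N -> N x -> oproj N x = x.
Proof. by move=> hN Nx; apply: proj_uniq => // z _; rewrite subrr dot0l. Qed.

Lemma sq_proj N x : csub N -> sq x = sq (oproj N x) + sq (x - oproj N x).
Proof.
move=> hN; have [Np hp] := projP x hN.
have E : x = (x - oproj N x) + oproj N x by rewrite subrK.
by rewrite {1}E sqD hp// mulr0 addr0 addrC.
Qed.

(* If [y] is the component of [x] orthogonal to [N], then [c1 y - c2 T y] is in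
   [N], so that [c1 |y|^2 = c2 <T y, y>]. *)
Lemma csub_resolvent N (T : V -> V) c1 c2 x : csub N ->
  (forall c u v, T (c *: u + v) = c *: T u + T v) ->
  (forall u, sq (T u) <= sq u) -> (forall u, N u -> N (T u)) ->
  normc c2 < normc c1 -> N (c1 *: x - c2 *: T x) -> N x.
Proof.
move=> hN Tlin Tle TN c21 hx; have [Np hp] := projP x hN.
set p := oproj N x in Np hp; pose y := x - p.
have Ty : T y = T x - T p.
  by rewrite /y addrC -scaleN1r Tlin scaleN1r addrC.
have yN : N (c1 *: y - c2 *: T y).
  have -> : c1 *: y - c2 *: T y = (c1 *: x - c2 *: T x) - (c1 *: p - c2 *: T p).
    by rewrite Ty /y !scalerBr !opprB addrACA [RHS]addrACA; congr (_ + _); rewrite addrC.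
  apply: csubB => //; apply: csubB => //; apply: csubZ => //; exact: TN.
have := hp _ yN; rewrite -/y (dotC H) => /(congr1 (@conjc R)); rewrite conjcK conjc0.
rewrite dotBl !dotZl => /eqP; rewrite subr_eq0 => /eqP /(congr1 (@normc R)).
rewrite !normcM dotxx normcR ger0_norm ?sq_ge0// => E.
have h : normc (dot (T y) y) <= sq y.
  rewrite -sqr_nrm expr2; apply: (le_trans (normc_dot _ _)).
  apply: ler_wpM2r; first exact: nrm_ge0.
  by rewrite -(@ler_pXn2r _ 2)// ?nnegrE ?nrm_ge0// !sqr_nrm.
have y0 : sq y = 0.
  apply/eqP; rewrite eq_le sq_ge0 andbT leNgt; apply/negP => sy.
  have : normc c2 * normc (dot (T y) y) < normc c1 * sq y.
    apply: (@le_lt_trans _ _ (normc c2 * sq y)); last by rewrite ltr_pM2r.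
    by rewrite ler_wpM2l// normc_ge0.
  by rewrite E ltxx.
by have := sq_eq0 y0; rewrite /y => /eqP; rewrite subr_eq0 => /eqP ->.
Qed.

End Hilbert.

(** * The Hardy space as a Hilbert space *)

Section Weierstrass.
Context {R : realType} {n : nat}.
Local Notation C := R[i].
Implicit Types (z w h : 'rV[C]_n) (f g : 'rV[C]_n -> C).

Lemma cvgC_P (x : nat -> C) (c : C) : x @ \oo --> c <->
  forall e, 0 < e -> exists K, forall k, (K <= k)%N -> normc (x k - c) < e.
Proof.
split=> [xc e e0|h A /nbhs_normcP[e e0 he]].
  have : nbhs c [set c' | normc (c' - c) < e] by apply/nbhs_normcP; exists e.
  by move=> /xc[K _ hK]; exists K.
by have [K hK] := h e e0; exists K => // k Kk; apply: he; exact: hK.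
Qed.

Lemma cauchy_cvgC (x : nat -> C) :
  (forall e, 0 < e -> exists K, forall k m, (K <= k)%N -> (K <= m)%N ->
     normc (x k - x m) < e) -> exists c : C, x @ \oo --> c.
Proof.
move=> cx.
have cR (p : C -> R) : (forall a b, `|p a - p b| <= normc (a - b)) ->
    exists l : R, (fun k => p (x k)) @ \oo --> l.
  move=> hp; apply/cvg_ex; apply: cauchy_cvg; apply/cauchy_exP => e e0.
  have [K hK] := cx e e0; exists (p (x K)); exists K => // k Kk.
  by rewrite /ball/=; apply: le_lt_trans (hp _ _) (hK _ _ _ _).
have [a ha] : exists l : R, (fun k => Re (x k)) @ \oo --> l.
  by apply: cR => a b; rewrite -cReN -cReD; exact: Re_le_normc.
have [b hb] : exists l : R, (fun k => Im (x k)) @ \oo --> l.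
  by apply: cR => a' b; rewrite -cImN -cImD; exact: Im_le_normc.
exists (a +i* b); apply/cvgC_P => e e0; have e2 : 0 < e / 2 by rewrite divr_gt0.
have /cvgrPdist_lt/(_ _ e2)[K1 _ h1] := ha; have /cvgrPdist_lt/(_ _ e2)[K2 _ h2] := hb.
exists (maxn K1 K2) => k; rewrite geq_max => /andP[k1 k2].
rewrite (le_lt_trans (normc_le_ReIm _))// [ltRHS]splitr.
rewrite cReD cImD cReN cImN /=; apply: ltrD; rewrite distrC.
  exact: h1.
exact: h2.
Qed.

Lemma cvgC_normc_le (x : nat -> C) (c : C) (B : R) : x @ \oo --> c ->
  (forall k, normc (x k) <= B) -> normc c <= B.
Proof.
move=> /cvgC_P xc xB; apply/ler_addgt0Pl => e e0; have [K hK] := xc e e0.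
have := hK K (leqnn _); have := xB K; rewrite normcB => h1 h2.
by have := le_normcB c (x K); lra.
Qed.

Lemma cvgC_sum (I : Type) (s : seq I) (F : nat -> I -> C) (G : I -> C) :
  (forall i, F k i @[k --> \oo] --> G i) ->
  (\sum_(i <- s) F k i) @[k --> \oo] --> \sum_(i <- s) G i.
Proof.
move=> h; elim: s => [|i s IH].
  by rewrite big_nil; under eq_fun do rewrite big_nil; exact: cvg_cst.
rewrite big_cons; have -> : (fun k => \sum_(j <- i :: s) F k j) =
    (fun k => F k i + \sum_(j <- s) F k j) by apply/funext => k; rewrite big_cons.
by apply: cvgD; [exact: h|exact: IH].
Qed.

Definition is_grad f z (l : 'I_n -> C) :=
  forall e, 0 < e -> exists2 d, 0 < d & forall z' D, D < d ->
    (forall j, normc (z' ord0 j - z ord0 j) <= D) -> 0 <= D ->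
    normc (f z' - (f z + \sum_j l j * (z' ord0 j - z ord0 j))) <= e * D.

Lemma is_gradB f g z l m : is_grad f z l -> is_grad g z m ->
  is_grad (fun w => f w - g w) z (fun j => l j - m j).
Proof.
move=> hf hg e e0; have e2 : 0 < e / 2 by rewrite divr_gt0.
have [d d0 hd] := hf _ e2; have [d' d'0 hd'] := hg _ e2.
exists (Num.min d d'); first by rewrite lt_min d0.
move=> z' D; rewrite lt_min => /andP[Dd Dd'] hD D0.
have -> : \sum_j (l j - m j) * (z' ord0 j - z ord0 j) =
    \sum_j l j * (z' ord0 j - z ord0 j) - \sum_j m j * (z' ord0 j - z ord0 j).
  by rewrite -sumrB; apply: eq_bigr => j _; rewrite mulrBl.
set A := \sum_j l j * _; set B := \sum_j m j * _.
have -> : f z' - g z' - (f z - g z + (A - B)) =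
  (f z' - (f z + A)) - (g z' - (g z + B)) by ring.
rewrite (le_trans (le_normcD _ _))// normcN.
have h1 := hd z' D Dd hD D0; have h2 := hd' z' D Dd' hD D0.
by rewrite -/A in h1; rewrite -/B in h2; move: h1 h2; lra.
Qed.

(** On a complex line $s\mapsto f(z+sv)$ with $|v_j|\le1$ the estimate [cauchy_taylor1] applies, and
    its coefficient must be $\sum_jl_jv_j$. Basis vectors [v] give the bound on [l]; the direction
    $v=(z'-z)/D$ gives the remainder. *)
Lemma grad_taylor f z l (r delta M : R) : analytic_on_polydisc f -> r < 1 ->
  0 < delta -> (forall j, normc (z ord0 j) + delta <= r) ->
  (forall w, cpoly r w -> normc (f w) <= M) -> is_grad f z l ->
  (forall j, normc (l j) <= 2 * M / delta) /\
  (forall z' D, (forall j, normc (z' ord0 j - z ord0 j) <= D) -> 0 <= D -> D <= delta / 2 ->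
    normc (f z' - (f z + \sum_j l j * (z' ord0 j - z ord0 j))) <= 4 * M / delta ^+ 2 * D ^+ 2).
Proof.
move=> af r1 d0 zr fM hl.
have line (v : 'rV[C]_n) : (forall j, normc (v ord0 j) <= 1) ->
    normc (\sum_j l j * v ord0 j) <= 2 * M / delta /\
    forall s, normc s <= delta / 2 ->
      normc (f (z + s *: v) - (f z + (\sum_j l j * v ord0 j) * s)) <= 4 * M / delta ^+ 2 * normc s ^+ 2.
  move=> v1; pose g (s : C) := f (z + s *: v).
  have cg s : normc s <= delta -> cpoly r (z + s *: v).
    move=> sd j; rewrite !mxE (le_trans (le_normcD _ _))// (le_trans _ (zr j))// lerD2l.
    rewrite normcM -[leRHS]mulr1; apply: ler_pM; rewrite ?normc_ge0//.
  have dg s : normc s <= delta -> derivable g s (1 : C).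
    by move=> sd; apply/derivable_line/af/(cpoly_polydisc r1)/cg.
  have gM s : normc s <= delta -> normc (g s) <= M by move=> sd; apply/fM/cg.
  have [c1 [hc1 T]] := cauchy_taylor1 d0 dg gM.
  suff E : \sum_j l j * v ord0 j = c1.
    by rewrite E; split=> // s sd; have := T s sd; rewrite /g scale0r addr0.
  apply/eqP; rewrite -subr_eq0 -normc_eq0 eq_le normc_ge0 andbT.
  apply/ler_addgt0Pl => e e0; rewrite addr0; have e2 : 0 < e / 2 by rewrite divr_gt0.
  have [d dd0 hd] := hl _ e2.
  have M0 : 0 <= M by apply: le_trans (normc_ge0 (g 0)) (gM _ _); rewrite normc0 ltW.
  pose K := 4 * M / delta ^+ 2.
  have K0 : 0 <= K by rewrite /K divr_ge0 ?exprn_ge0 ?(ltW d0)// mulr_ge0.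
  have K1 : 0 < K + 1 by rewrite ltr_wpDl.
  pose s := Num.min (d / 2) (Num.min (delta / 2) (e / 2 / (K + 1))).
  have s0 : 0 < s by rewrite !lt_min !divr_gt0.
  have sd : s < d.
    by rewrite (@le_lt_trans _ _ (d / 2))// ?ge_min ?lexx// ltr_pdivrMr// ltr_pMr// ltr1n.
  have sdl : s <= delta / 2 by rewrite !ge_min lexx orbT.
  have sK : K * s <= e / 2.
    apply: (@le_trans _ _ ((K + 1) * s)); first by rewrite ler_pM2r// lerDl.
    by rewrite mulrC -ler_pdivlMr// !ge_min lexx !orbT.
  have ns : normc s%:C = s by rewrite normcR gtr0_norm.
  have h1 := T s%:C; rewrite ns in h1; have {}h1 := h1 sdl.
  have h2 := hd (z + s%:C *: v) s sd.
  have hv j : normc ((z + s%:C *: v) ord0 j - z ord0 j) <= s.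
    rewrite !mxE addrC addKr normcM ns -[leRHS]mulr1; apply: ler_wpM2l => //.
    exact: ltW.
  have {}h2 := h2 hv (ltW s0).
  have E2 : \sum_j l j * ((z + s%:C *: v) ord0 j - z ord0 j) = (\sum_j l j * v ord0 j) * s%:C.
    rewrite mulr_suml; apply: eq_bigr => j _.
    by rewrite !mxE [_ + s%:C * _]addrC addrK; ring.
  rewrite E2 in h2; rewrite /g scale0r addr0 in h1.
  rewrite -(ler_pM2r s0) -{1}ns -normcM mulrBl.
  set A := _ * s%:C in h2 *; set B := c1 * s%:C in h1 *; set F := f _ in h1 h2.
  have -> : A - B = (F - (f z + B)) - (F - (f z + A)) by ring.
  rewrite (le_trans (le_normcD _ _))// normcN.
  have h3 : K * s ^+ 2 <= e / 2 * s by rewrite expr2 mulrA ler_pM2r.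
  by rewrite -/K in h1; move: h1 h2 h3; lra.
split=> [j|z' D hD D0 Dd].
  have := (line (delta_mx ord0 j) _).1.
  have -> : \sum_j0 l j0 * (delta_mx ord0 j : 'rV[C]_n) ord0 j0 = l j.
    rewrite (bigD1 j)//= !mxE !eqxx mulr1 big1 ?addr0// => k /negbTE kj.
    by rewrite !mxE kj /= mulr0.
  apply => k; rewrite !mxE /=; case: (k == j); rewrite ?normc1 ?normc0//.
have [D00|Dp] := eqVneq D 0.
  have -> : z' = z.
    apply/rowP => j; have := hD j; rewrite D00 => h; apply/eqP.
    by rewrite -subr_eq0 -normc_eq0 eq_le h normc_ge0.
  rewrite big1 ?addr0 ?subrr ?normc0; last by move=> j _; rewrite subrr mulr0.
  by rewrite D00 expr0n mulr0.
have {}Dp : 0 < D by rewrite lt_def Dp.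
have DC : D%:C != 0 :> C by rewrite -normc_eq0 normcR normr_eq0 gt_eqF.
have nD : normc D%:C = D by rewrite normcR gtr0_norm.
have hv j : normc ((D%:C^-1 *: (z' - z)) ord0 j) <= 1.
  by rewrite !mxE normcM normcV nD mulrC ler_pdivrMr// mul1r.
have := (line _ hv).2 D%:C; rewrite nD => /(_ Dd).
rewrite scalerA divff// scale1r (_ : z + (z' - z) = z'); last by rewrite addrC subrK.
have -> : (\sum_j l j * (D%:C^-1 *: (z' - z)) ord0 j) * D%:C =
  \sum_j l j * (z' ord0 j - z ord0 j); last by [].
by rewrite mulr_suml; apply: eq_bigr => j _; rewrite !mxE; field.
Qed.

Lemma polydisc_room z : polydisc z -> exists r delta : R,
  [/\ 0 <= r, r < 1, 0 < delta & forall j, normc (z ord0 j) + delta <= r].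
Proof.
move=> zp; pose m := \big[Num.max/0]_j normc (z ord0 j).
have m1 : m < 1.
  by apply: bigmax_lt => // j _; have := zp j; rewrite normr_lt1.
have m0 : 0 <= m by exact: bigmax_ge_id.
exists ((1 + m) / 2), ((1 - m) / 2); split; try lra.
move=> j; have : normc (z ord0 j) <= m by exact: le_bigmax_cond.
lra.
Qed.

(* Cauchy's estimates along complex lines make the gradients converge and the
   second-order remainders uniform. *)
Lemma weierstrass (u : nat -> 'rV[C]_n -> C) (l : 'rV[C]_n -> C) :
  (forall k, analytic_on_polydisc (u k)) ->
  (forall r e, 0 <= r -> r < 1 -> 0 < e -> exists K, forall k w, (K <= k)%N ->
     cpoly r w -> normc (u k w - l w) < e) -> analytic_on_polydisc l.
Proof.
move=> au ul z zp; have [r [delta [r0 r1 d0 zr]]] := polydisc_room zp.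
have gr k : exists g : 'I_n -> C, is_grad (u k) z g by apply: differentiable_expansion; exact: au.
have [g hg] := choice gr.
have dist k m e : (forall w, cpoly r w -> normc (u k w - u m w) <= e) ->
    forall j, normc (g k j - g m j) <= 2 * e / delta.
  move=> hkm; apply: (grad_taylor _ r1 d0 zr hkm (is_gradB (hg k) (hg m))).1.
  by move=> w wp; apply: differentiableB; exact: au.
have cau e : 0 < e -> exists K, forall k m, (K <= k)%N -> (K <= m)%N ->
    forall w, cpoly r w -> normc (u k w - u m w) <= e.
  move=> e0; have e2 : 0 < e / 2 by rewrite divr_gt0.
  have [K hK] := ul r _ r0 r1 e2; exists K => k m Kk Km w cw.
  have -> : u k w - u m w = (u k w - l w) - (u m w - l w) by ring.
  rewrite (le_trans (le_normcD _ _))// normcN.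
  by have := hK k w Kk cw; have := hK m w Km cw; lra.
have [G hG] : exists G : 'I_n -> C, forall j, g k j @[k --> \oo] --> G j.
  have hc j : exists c : C, g k j @[k --> \oo] --> c.
    apply: cauchy_cvgC => e e0.
    have e4 : 0 < e * delta / 4 by rewrite divr_gt0// mulr_gt0.
    have [K hK] := cau _ e4; exists K => k m Kk Km.
    apply: (le_lt_trans (dist k m _ (hK k m Kk Km) j)).
    have -> : 2 * (e * delta / 4) / delta = e / 2 by field; rewrite gt_eqF.
    by rewrite ltr_pdivrMr// ltr_pMr// ltr1n.
  by have [G hG] := choice hc; exists G.
have [M MM] : exists K M, forall k w, (K <= k)%N -> cpoly r w -> normc (u k w) <= M.
  have [K hK] := ul r _ r0 r1 ltr01; exists K.
  have [M M0 hM] := analytic_bounded (au K) r1; exists (M + 2) => k w Kk cw.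
  have -> : u k w = (u k w - l w) - (u K w - l w) + u K w by ring.
  rewrite (le_trans (le_normcD _ _))// (le_trans (lerD (le_normcD _ _) (hM w cw)))// normcN.
  by have := hK k w Kk cw; have := hK K w (leqnn _) cw; lra.
case: MM => B hB.
have cl w : cpoly r w -> u (k + M)%N w @[k --> \oo] --> l w.
  move=> cw; apply/cvgC_P => e e0; have [K hK] := ul r e r0 r1 e0.
  by exists K => k Kk; apply: hK => //; rewrite (leq_trans Kk)// leq_addr.
have cz : cpoly r z by move=> j; rewrite (le_trans _ (zr j))// lerDl ltW.
have T z' D : (forall j, normc (z' ord0 j - z ord0 j) <= D) -> 0 <= D -> D <= delta / 2 ->
    normc (l z' - (l z + \sum_j G j * (z' ord0 j - z ord0 j))) <= 4 * B / delta ^+ 2 * D ^+ 2.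
  move=> hD D0 Dd.
  have cz' : cpoly r z'.
    move=> j; have := zr j; have := hD j; have := le_normcB (z' ord0 j) (z ord0 j).
    by move: Dd d0; lra.
  apply: (@cvgC_normc_le (fun k => u (k + M)%N z' - (u (k + M)%N z + \sum_j g (k + M)%N j * (z' ord0 j - z ord0 j)))).
    apply: cvgB; first exact: cl.
    apply: cvgD; first exact: cl.
    apply: cvgC_sum => j; apply: cvgM; last exact: cvg_cst.
    have := hG j; rewrite -(cvg_shiftn M); exact.
  move=> k; apply: (grad_taylor (au _) r1 d0 zr _ (hg _)).2 => // w cw.
  by apply: hB => //; rewrite leq_addl.
have B0 : 0 <= B by apply: le_trans (normc_ge0 (u M z)) (hB M z (leqnn _) cz).
pose Q := 4 * B / delta ^+ 2.
have Q0 : 0 <= Q by rewrite /Q divr_ge0 ?exprn_ge0 ?(ltW d0)// mulr_ge0.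
apply: (@differentiable_expand _ _ _ _ G) => e e0.
exists (Num.min (delta / 2) (e / (Q + 1))); first by rewrite lt_min !divr_gt0// ltr_wpDl.
move=> z' D; rewrite lt_min => /andP[D1 D2] hD D0.
apply: (le_trans (T z' D hD D0 (ltW D1))); rewrite -/Q expr2 mulrA ler_wpM2r//.
move: D2; rewrite ltr_pdivlMr ?ltr_wpDl// mulrDr mulr1 mulrC; lra.
Qed.

End Weierstrass.

(** * The Hardy space as a complete inner product space *)

Section HardyType.
Context {R : realType} {n : nat}.
Local Notation C := R[i].
Local Notation fct := ('rV[C]_n -> C).

Definition hardy_pred : {pred fct} := fun f => `[< hardy f >].

Lemma hardy_predP (f : fct) : reflect (hardy f) (f \in hardy_pred).
Proof. exact: asboolP. Qed.

Lemma hardy_submod : submod_closed hardy_pred.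
Proof.
split; first by apply/hardy_predP; exact: hardy0.
move=> c f g /hardy_predP hf /hardy_predP hg; apply/hardy_predP.
exact: hardy_lin.
Qed.

HB.instance Definition _ := GRing.isSubmodClosed.Build C fct hardy_pred hardy_submod.

(** Bundling makes $H^2$ a module to which [is_hilbert] applies; [toHd] sends functions outside
    $H^2$ to 0. *)
Record Hd := MkHd { hfun :> fct; hfunP : hfun \in hardy_pred }.

HB.instance Definition _ := [isSub for hfun].
HB.instance Definition _ := [Choice of Hd by <:].
HB.instance Definition _ := [SubChoice_isSubLmodule of Hd by <:].

Lemma Hd_hardy (f : Hd) : hardy (f : fct).
Proof. exact/hardy_predP/hfunP. Qed.

Lemma Hd_lin (c : C) (f g : Hd) : (c *: f + g : Hd) = c \*o f + g :> fct.
Proof. by []. Qed.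

Lemma HdD (f g : Hd) z : (f + g : Hd) z = f z + g z. Proof. by []. Qed.
Lemma HdB (f g : Hd) z : (f - g : Hd) z = f z - g z. Proof. by []. Qed.
Lemma HdZ (c : C) (f : Hd) z : (c *: f : Hd) z = c * f z. Proof. by []. Qed.
Lemma Hd0 z : (0 : Hd) z = 0. Proof. by []. Qed.

Lemma Hd_sum (I : Type) (s : seq I) (F : I -> Hd) z :
  (\sum_(i <- s) F i : Hd) z = \sum_(i <- s) F i z.
Proof. by elim: s => [|i s IH]; rewrite ?big_nil// !big_cons -IH. Qed.

Lemma Hd_ext (f g : Hd) : (forall z, polydisc z -> f z = g z) -> f = g.
Proof.
move=> fg; apply/val_inj/funext => z /=.
have [zp|zp] := pselect (polydisc z); first exact: fg.
by have [f0 _ _] := Hd_hardy f; have [g0 _ _] := Hd_hardy g; rewrite f0// g0.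
Qed.

Lemma Hd_analytic (f : Hd) : analytic_on_polydisc f.
Proof. by case: (Hd_hardy f). Qed.

Definition toHd (f : fct) : Hd := insubd (0 : Hd) f.

Lemma toHdE (f : fct) : hardy f -> (toHd f : fct) = f.
Proof. by move=> /hardy_predP hf; rewrite /toHd -[LHS]/(val _) val_insubd hf. Qed.

Lemma toHdK (f : Hd) : toHd f = f.
Proof. by apply: val_inj; rewrite /= toHdE//; exact: Hd_hardy. Qed.

Definition dotH (f g : Hd) : C := hardy_dot f g.

Lemma coefH_lin (c : C) (f g : Hd) alpha :
  coef (c *: f + g : Hd) alpha = c * coef f alpha + coef g alpha.
Proof. by rewrite hardy_coef_lin//; exact: Hd_hardy. Qed.

Lemma coefHB (f g : Hd) alpha : coef (f - g : Hd) alpha = coef f alpha - coef g alpha.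
Proof. by rewrite addrC -scaleN1r coefH_lin mulN1r addrC. Qed.

Lemma coefH_inj (f g : Hd) : coef f = coef g -> f = g.
Proof. by move=> fg; apply: val_inj; apply: hardy_ext => //; exact: Hd_hardy. Qed.

Lemma cvgC_unique (x : nat -> C) (a b : C) : x @ \oo --> a -> x @ \oo --> b -> a = b.
Proof.
have hC : hausdorff_space C by exact: norm_hausdorff.
by move=> ha hb; exact: (cvg_unique hC ha hb).
Qed.

Lemma dotH_cvg (f g : Hd) : coefdot (coef f) (coef g) N @[N --> \oo] --> dotH f g.
Proof. by apply: hardy_dot_cvg; exact: Hd_hardy. Qed.

Lemma dotH_self (f : Hd) : dotH f f = (sqnorm f)%:C.
Proof.
apply: (cvgC_unique (@dotH_cvg f f)); apply/cvgC_P => e e0.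
have /cvgrPdist_lt/(_ _ e0)[K _ hK] := sqnorm_cvg (Hd_hardy f).
exists K => k Kk; have := hK k Kk; rewrite /= distrC -normcR rmorphB /= => h.
apply: le_lt_trans h; rewrite le_eqVlt; apply/orP; left; apply/eqP.
congr (normc (_ - _)); rewrite /coefsq /coefdot rmorph_sum; apply: eq_bigr => alpha _.
exact: mulcJ.
Qed.

Lemma coefsq_le_sqnorm (f : Hd) N : coefsq (coef f) N <= sqnorm f.
Proof.
have h := sqnorm_cvg (Hd_hardy f).
rewrite -(cvg_lim (@Rhausdorff R) h).
apply: nondecreasing_cvgn_le; last by apply/cvg_ex; exists (sqnorm f).
exact: coefsq_homo.
Qed.

Lemma coef_sq_le (f : Hd) alpha : normc (coef f alpha) ^+ 2 <= sqnorm f.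
Proof.
apply: le_trans (coefsq_le_sqnorm f (deg alpha).+1).
apply: (@le_term_box _ _ (fun alpha => normc (coef f alpha) ^+ 2)) => // beta.
exact: sqr_ge0.
Qed.

Lemma sqnorm_ge0 (f : Hd) : 0 <= sqnorm f.
Proof. exact: sqr_ge0. Qed.

(** Every coefficient is at most the norm of [f] in modulus, and the monomials are bounded by the
    geometric series $\sum_\alpha r^{|\alpha|}=(1-r)^{-n}$. *)
Lemma eval_bound (r : R) : 0 <= r -> r < 1 -> exists2 K, 0 < K &
  forall (f : Hd) w, cpoly r w -> normc (f w) <= K * Num.sqrt (sqnorm f).
Proof.
move=> r0 r1; have p0 : 0 < (1 - r)^-1 by rewrite invr_gt0 subr_gt0.
exists (((1 - r)^-1) ^+ n); first exact: exprn_gt0.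
move=> f w cw; set s := Num.sqrt _.
have s0 : 0 <= s := sqrtr_ge0 _.
have ps N : normc (psum (coef f) N w) <= ((1 - r)^-1) ^+ n * s.
  rewrite (le_trans (normc_sum _ _ _))//.
  apply: (@le_trans _ _ (\sum_(alpha : {ffun 'I_n -> 'I_N}) s * \prod_j r ^+ alpha j)).
    apply: ler_sum => alpha _; rewrite normcM; apply: ler_pM; rewrite ?normc_ge0//.
      rewrite -(@ler_pXn2r _ 2)// ?nnegrE ?normc_ge0// sqr_sqrtr ?sqnorm_ge0//.
      exact: coef_sq_le.
    rewrite normc_prod; apply: ler_prod => j _; rewrite normc_ge0 normcX /=.
    by rewrite lerXn2r ?nnegrE ?normc_ge0.
  rewrite -mulr_sumr mulrC; apply: ler_wpM2r => //.
  rewrite -(bigA_distr_bigA (fun j (k : 'I_N) => r ^+ k)).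
  have -> : (1 - r)^-1 ^+ n = \prod_(j < n) (1 - r)^-1 by rewrite prodr_const card_ord.
  apply: ler_prod => j _; rewrite sumr_ge0/=; last by move=> k _; exact: exprn_ge0.
  rewrite -[leRHS]mul1r ler_pdivlMr ?subr_gt0// mulrC.
  have -> : (1 - r) * (\sum_(k < N) r ^+ k) = 1 - r ^+ N by rewrite -opprB mulNr -subrX1 opprB.
  by rewrite lerBlDr lerDl exprn_ge0.
apply/ler_addgt0Pl => e e0; have [N0 h] := coefP (Hd_analytic f) r0 r1 e0.
have -> : f w = (f w - psum (coef f) N0 w) + psum (coef f) N0 w by ring.
rewrite (le_trans (le_normcD _ _))//; apply: lerD => //.
by apply/ltW/h.
Qed.

Lemma boxsq_le_sup (f : fct) a (r e : R) N : is_coef f a -> 0 <= r -> r < 1 ->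
  (forall w, cpoly r w -> normc (f w) <= e) -> boxsq a r N <= e ^+ 2.
Proof.
move=> hf r0 r1 fe; apply: le_trans (boxsq_le_mean2 N hf r0 r1) _.
apply: Rintegral_le_bound; first exact/bmeas_sqnorm/(coef_bmeas hf).
move=> t; rewrite ger0_norm ?sqr_ge0// lerXn2r ?nnegrE ?normc_ge0//.
  by apply: le_trans (normc_ge0 (f (tpt r t))) (fe _ (tpt_cpoly t r0)).
exact/fe/tpt_cpoly.
Qed.

Lemma coefsq_bound (f : fct) a B : is_coef f a -> (forall N, coefsq a N <= B) -> 
  (forall z, ~ polydisc z -> f z = 0) -> analytic_on_polydisc f ->
  hardy f /\ sqnorm f <= B.
Proof.
move=> hf hB f0 af; have hh : hardy f.
  by apply/hardyP; split=> //; exists B => N; rewrite (coef_eq hf).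
split=> //; apply: (cvgr_to_le (sqnorm_cvg hh)); apply: nearW => N.
by rewrite (coef_eq hf).
Qed.

(** By [eval_bound] a Cauchy sequence converges locally uniformly, to an analytic limit by
    [weierstrass]. Convergence in norm is then checked one cube and one radius at a time. *)
Lemma Hd_complete (u : nat -> Hd) :
  (forall e, 0 < e -> exists K, forall m k, (K <= m)%N -> (K <= k)%N ->
     Re (dotH (u m - u k) (u m - u k)) < e) ->
  exists l, forall e, 0 < e -> exists K, forall k, (K <= k)%N ->
     Re (dotH (u k - l) (u k - l)) < e.
Proof.
move=> cu.
have {}cu e : 0 < e -> exists K, forall m k, (K <= m)%N -> (K <= k)%N -> sqnorm (u m - u k : Hd) < e.
  move=> e0; have [K hK] := cu e e0; exists K => m k Km Kk.
  by have := hK m k Km Kk; rewrite dotH_self.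
have unif (r e : R) : 0 <= r -> r < 1 -> 0 < e -> exists K, forall m k w,
    (K <= m)%N -> (K <= k)%N -> cpoly r w -> normc (u m w - u k w) < e.
  move=> r0 r1 e0; have [Kr Kr0 hr] := eval_bound r0 r1.
  have [K hK] := cu _ (exprn_gt0 2 (divr_gt0 e0 Kr0)); exists K => m k w Km Kk cw.
  rewrite -HdB; apply: (le_lt_trans (hr _ w cw)); rewrite mulrC -ltr_pdivlMr//.
  rewrite -(@ltr_pXn2r _ 2)// ?nnegrE ?sqrtr_ge0 ?divr_ge0 ?(ltW e0) ?(ltW Kr0)//.
  by rewrite sqr_sqrtr ?sqnorm_ge0//; exact: hK.
have lim w : exists c : C, (polydisc w -> (fun k => u k w) @ \oo --> c) /\ (~ polydisc w -> c = 0).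
  have [wp|wp] := pselect (polydisc w); last by exists 0.
  have [r [d [r0 r1 d0 hr]]] := polydisc_room wp.
  have cw : cpoly r w by move=> j; rewrite (le_trans _ (hr j))// lerDl ltW.
  have [c hc] : exists c : C, (fun k => u k w) @ \oo --> c.
    apply: cauchy_cvgC => e e0; have [K hK] := unif r e r0 r1 e0.
    by exists K => k m Kk Km; exact: hK.
  by exists c.
have [l hl] := choice lim.
have l0 z : ~ polydisc z -> l z = 0 by move=> zp; apply: (hl z).2.
have ul (r e : R) : 0 <= r -> r < 1 -> 0 < e -> exists K, forall k w, (K <= k)%N ->
     cpoly r w -> normc (u k w - l w) < e.
  move=> r0 r1 e0; have e2 : 0 < e / 2 by rewrite divr_gt0.
  have [K hK] := unif r _ r0 r1 e2; exists K => k w Kk cw.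
  apply: (@le_lt_trans _ _ (e / 2)); last by rewrite ltr_pdivrMr// ltr_pMr// ltr1n.
  apply: (@cvgC_normc_le _ (fun m => u k w - u (m + K)%N w)).
    apply: cvgB; first exact: cvg_cst.
    have := (hl w).1 (cpoly_polydisc r1 cw); rewrite -(cvg_shiftn K); exact.
  by move=> m; apply/ltW/hK => //; exact: leq_addl.
have al : analytic_on_polydisc l.
  by apply: (weierstrass (u := fun k => (u k : fct))) => // k; exact: Hd_analytic.
have hlc := coefP al.
pose cf k alpha := (-1 : C) * coef (u k) alpha + coef l alpha.
have hcf k : is_coef ((-1 : C) \*o (u k : fct) + l) (cf k).
  by apply: is_coef_lin => //; exact/coefP/Hd_analytic.
(* The comparison index [m] below may depend on [r]. The bound does not, because [boxsq] of
   [u m - u k] is controlled by the norm. *)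
have key e : 0 < e -> exists K, forall k, (K <= k)%N -> forall N, coefsq (cf k) N <= e.
  move=> e0; have e4 : 0 < e / 4 by rewrite divr_gt0.
  have [K hK] := cu _ e4; exists K => k Kk N; apply: coefsq_le => r r0 r1.
  have s0 : 0 < Num.sqrt (e / 4) by rewrite sqrtr_gt0.
  have [K' hK'] := ul r _ r0 r1 s0; pose m := maxn K K'.
  have b1 : boxsq (cf m) r N <= e / 4.
    rewrite -[leRHS]sqr_sqrtr ?(ltW e4)//; apply: (boxsq_le_sup N (hcf m) r0 r1) => w cw.
    rewrite fctE /= mulN1r addrC normcB; apply/ltW/hK' => //; exact: leq_maxr.
  have b2 : boxsq (coef (u m - u k : Hd)) r N <= e / 4.
    apply: (le_trans (boxsq_le_coefsq _ _ r0 (ltW r1))).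
    apply: (le_trans (coefsq_le_sqnorm _ _)); apply/ltW/hK => //; exact: leq_maxl.
  apply: (@le_trans _ _ (2 * boxsq (cf m) r N + 2 * boxsq (coef (u m - u k : Hd)) r N)); last first.
    by move: b1 b2; lra.
  rewrite /boxsq !mulr_sumr -big_split/=; apply: ler_sum => alpha _.
  set w := (r ^+ _) ^+ 2; have w0 : 0 <= w by exact: sqr_ge0.
  rewrite ![2 * (_ * w)]mulrA -mulrDl; apply: (ler_wpM2r w0).
  have -> : cf k (expo alpha) = cf m (expo alpha) + coef (u m - u k : Hd) (expo alpha).
    by rewrite coefHB /cf; ring.
  set x := cf m _; set y := coef _ _.
  apply: (@le_trans _ _ ((normc x + normc y) ^+ 2)).
    by rewrite lerXn2r ?nnegrE ?addr_ge0 ?normc_ge0// le_normcD.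
  by have := sqr_ge0 (normc x - normc y); nra.
have v0 k z : ~ polydisc z -> ((-1 : C) \*o (u k : fct) + l) z = 0.
  by move=> zp; have [u0 _ _] := Hd_hardy (u k); rewrite fctE /= u0// l0// mulr0 addr0.
have van k : analytic_on_polydisc ((-1 : C) \*o (u k : fct) + l).
  by apply: analytic_lin => //; exact: Hd_analytic.
have hl' : hardy l.
  have [K hK] := key 1 ltr01.
  have [h _] := coefsq_bound (hcf K) (hK K (leqnn K)) (v0 K) (van K).
  have -> : l = 1 \*o (u K : fct) + ((-1 : C) \*o (u K : fct) + l).
    by apply/funext => z; rewrite !fctE /= mul1r mulN1r addrA subrr add0r.
  by apply: hardy_lin => //; exact: Hd_hardy.
exists (toHd l) => e e0; have e2 : 0 < e / 2 by rewrite divr_gt0.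
have [K hK] := key _ e2; exists K => k Kk.
have [_ h] := coefsq_bound (hcf k) (hK k Kk) (v0 k) (van k).
rewrite dotH_self; change (sqnorm (hfun (u k - toHd l)) < e).
have -> : ((u k - toHd l : Hd) : fct) = (-1 : C) \*o ((-1 : C) \*o (u k : fct) + l).
  apply/funext => z; rewrite HdB toHdE// !fctE /=; ring.
have -> : sqnorm ((-1 : C) \*o ((-1 : C) \*o (u k : fct) + l)) = sqnorm ((-1 : C) \*o (u k : fct) + l).
  have hm : hardy ((-1 : C) \*o (u k : fct) + l) by apply: hardy_lin => //; exact: Hd_hardy.
  have [hs cs] := hardy_scale (-1) hm.
  apply: (cvg_unique (@Rhausdorff R) (sqnorm_cvg hs)).
  have -> : coefsq (coef ((-1 : C) \*o ((-1 : C) \*o (u k : fct) + l))) =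
      coefsq (coef ((-1 : C) \*o (u k : fct) + l)); last exact: sqnorm_cvg.
  apply/funext => N; apply: eq_bigr => alpha _.
  by rewrite cs mulN1r normcN.
by apply: (le_lt_trans h); rewrite ltr_pdivrMr// ltr_pMr// ltr1n.
Qed.

Lemma cvg_conjc (x : nat -> C) (c : C) : x @ \oo --> c ->
  (fun k => conjc (x k)) @ \oo --> conjc c.
Proof.
move=> /cvgC_P h; apply/cvgC_P => e e0; have [K hK] := h e e0; exists K => k Kk.
by rewrite -conjcB normc_conj hK.
Qed.

Lemma Hd_hilbert : is_hilbert dotH.
Proof.
split; last exact: Hd_complete.
- move=> c f g h; apply: (cvgC_unique (@dotH_cvg _ h)).
  have -> : (fun N => coefdot (coef (c *: f + g : Hd)) (coef h) N) =
    (fun N => c * coefdot (coef f) (coef h) N + coefdot (coef g) (coef h) N).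
    apply/funext => N; rewrite /coefdot mulr_sumr -big_split; apply: eq_bigr => alpha _ /=.
    by rewrite coefH_lin mulrDl mulrA.
  apply: cvgD; last exact: dotH_cvg.
  by apply: cvgM; [exact: cvg_cst|exact: dotH_cvg].
- move=> f g; apply: (cvgC_unique (@dotH_cvg g f)).
  have -> : (fun N => coefdot (coef g) (coef f) N) = (fun N => conjc (coefdot (coef f) (coef g) N)).
    apply/funext => N; rewrite /coefdot (big_morph conjc (@conjcD R) (@conjc0 R)).
    by apply: eq_bigr => alpha _; rewrite conjcM conjcK mulrC.
  by apply: cvg_conjc; exact: dotH_cvg.
- move=> f f0; rewrite dotH_self /= lt_def sqnorm_ge0 andbT.
  apply: contra f0 => /eqP s0; apply/eqP/coefH_inj/funext => alpha.
  have -> : coef (0 : Hd) alpha = 0 by rewrite -(subrr f) coefHB subrr.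
  apply/eqP; rewrite -normc_eq0 -sqrf_eq0 eq_le sqr_ge0 andbT -s0.
  exact: coef_sq_le.
Qed.

End HardyType.

(** * Isometries and doubly commuting families *)

Section Isometry.
Context {R : realType} {V : lmodType R[i]}.
Local Notation C := R[i].
Variable dot : V -> V -> C.
Hypothesis H : is_hilbert dot.
Implicit Types (x y z : V) (c : C) (N : set V) (S T : V -> V).
Local Notation sq := (sq dot).
Local Notation csub := (csub dot).
Local Notation oproj := (oproj dot).

Lemma dot_ext x y : (forall z, dot x z = dot y z) -> x = y.
Proof.
move=> h; apply/eqP; rewrite -subr_eq0; apply/eqP/(dot_eq0 H).
by rewrite (dotBl H) h subrr.
Qed.

Lemma sqD_le x y : sq (x + y) <= 2 * sq x + 2 * sq y.
Proof. by rewrite -(parallelogram H) lerDl (sq_ge0 H). Qed.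

Definition islin T := forall c x y, T (c *: x + y) = c *: T x + T y.

Lemma islinD T x y : islin T -> T (x + y) = T x + T y.
Proof. by move=> h; rewrite -[x in LHS]scale1r h scale1r. Qed.

Lemma islin0 T : islin T -> T 0 = 0.
Proof. by move=> h; apply: (@addrI _ (T 0)); rewrite -islinD// !addr0. Qed.

Lemma islinZ T c x : islin T -> T (c *: x) = c *: T x.
Proof. by move=> h; rewrite -[c *: x]addr0 h islin0// addr0. Qed.

Lemma islinB T x y : islin T -> T (x - y) = T x - T y.
Proof. by move=> h; rewrite addrC -scaleN1r h scaleN1r addrC. Qed.

Lemma islin_sum T (I : Type) (s : seq I) (F : I -> V) : islin T ->
  T (\sum_(i <- s) F i) = \sum_(i <- s) T (F i).
Proof.
by move=> h; apply: (big_morph T (fun x y => islinD x y h) (islin0 h)).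
Qed.

Lemma csub_preimage T (B : R) N : islin T -> (forall x, sq (T x) <= B * sq x) ->
  csub N -> csub (T @^-1` N).
Proof.
move=> hT TB [N0 Nl Nc]; split; first by rewrite /= islin0.
  by move=> c x y /= Tx Ty; rewrite hT; exact: Nl.
move=> x hx /=; apply: Nc => e e0.
have K0 : 0 < `|B| + 1 by rewrite ltr_wpDl.
have [y Ny xy] := hx (e / (`|B| + 1)) (divr_gt0 e0 K0).
exists (T y) => //; rewrite -islinB// (le_lt_trans (TB _))//.
move: xy; rewrite ltr_pdivlMr// mulrC; apply: le_lt_trans.
apply: ler_wpM2r; first exact: (sq_ge0 H).
by rewrite (le_trans (ler_norm _))// lerDl.
Qed.

Lemma csub0 : csub [set 0].
Proof.
split=> //; first by move=> c x y /= -> ->; rewrite scaler0 addr0.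
move=> x hx /=; apply/(sq_eq0 H)/eqP; rewrite eq_le (sq_ge0 H) andbT.
apply/ler_addgt0Pl => e e0; rewrite addr0; have [_ -> ] := hx e e0.
by rewrite subr0 => /ltW.
Qed.

Lemma csub_ker T (B : R) : islin T -> (forall x, sq (T x) <= B * sq x) ->
  csub [set x | T x = 0].
Proof. by move=> hT TB; exact: (csub_preimage hT TB csub0). Qed.

(** The vectors at which a bounded operator satisfies a given scalar identity form a closed
    subspace. Together with [csub_dense] this reduces adjoint computations to monomials. *)
Lemma csub_dot T (B : R) u v : islin T -> (forall x, sq (T x) <= B * sq x) ->
  csub [set x | dot (T x) u = dot x v].
Proof.
move=> hT TB; split; first by rewrite /= islin0// !(dot0l H).
  by move=> c x y /= hx hy; rewrite hT !(dotL H) hx hy.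
move=> x hx /=; pose K := nrm dot u + nrm dot v + 1.
have K0 : 0 < K by rewrite ltr_wpDl// addr_ge0// nrm_ge0.
have B0 : 0 < `|B| + 1 by rewrite ltr_wpDl.
apply/eqP; rewrite -subr_eq0 -normc_eq0 eq_le normc_ge0 andbT.
apply/ler_addgt0Pl => e e0; rewrite addr0.
have eK : 0 < e / K := divr_gt0 e0 K0.
have [y /= hy xy] := hx _ (divr_gt0 (exprn_gt0 2 eK) B0).
have {}xy : (`|B| + 1) * sq (x - y) <= (e / K) ^+ 2.
  by rewrite mulrC -ler_pdivlMr// ltW.
have n0 z : sq z <= (e / K) ^+ 2 -> nrm dot z <= e / K.
  by move=> h; rewrite -(@ler_pXn2r _ 2)// ?nnegrE ?nrm_ge0 ?(ltW eK)// (sqr_nrm H).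
have n1 : nrm dot (x - y) <= e / K.
  by apply/n0/(le_trans _ xy); rewrite ler_peMl ?(sq_ge0 H)// lerDr.
have n2 : nrm dot (T x - T y) <= e / K.
  apply/n0/(le_trans _ xy); rewrite -islinB// (le_trans (TB _))//.
  by rewrite ler_wpM2r ?(sq_ge0 H)// (le_trans (ler_norm _))// lerDl.
have -> : dot (T x) u - dot x v = dot (T x - T y) u - dot (x - y) v.
  by rewrite !(dotBl H) hy opprB addrA subrK.
rewrite (le_trans (le_normcD _ _))// normcN.
apply: (@le_trans _ _ (e / K * nrm dot u + e / K * nrm dot v)).
  by apply: lerD; apply: (le_trans (normc_dot H _ _)); apply: ler_wpM2r; rewrite ?nrm_ge0.
rewrite -mulrDr -[leRHS](divfK (lt0r_neq0 K0)); apply: ler_wpM2l; first exact: ltW.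
by rewrite lerDl.
Qed.

Definition isom T := islin T /\ forall x, sq (T x) = sq x.

(** The norm identity is assumed only along the complex line through [x] in the direction [y]: the
    lemma has to apply where [T] is known to preserve the norm of bounded functions alone. *)
Lemma polar_eq T x y : islin T -> (forall c, sq (T (x + c *: y)) = sq (x + c *: y)) ->
  sq (T y) = sq y -> dot (T x) (T y) = dot x y.
Proof.
move=> hT hc Ty; have Tx : sq (T x) = sq x by have := hc 0; rewrite scale0r addr0.
have hR c : Re (dot (T x) (T (c *: y))) = Re (dot x (c *: y)).
  have := hc c; rewrite (islinD _ _ hT) !(sqD H) Tx (islinZ _ _ hT) !(sqZ H) Ty => /addrI.
  by apply: mulfI; rewrite pnatr_eq0.
apply: complex_ext; first by have := hR 1; rewrite scale1r.
have := hR 'i; rewrite (islinZ _ _ hT) !(dotZr H).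
by case: (dot (T x) (T y)) => a b; case: (dot x y) => a' b' /=; lra.
Qed.

Lemma isom_dot T x y : isom T -> dot (T x) (T y) = dot x y.
Proof. by move=> [hT Tsq]; apply: polar_eq. Qed.

Lemma isom_inj T : isom T -> injective T.
Proof.
move=> [hT Tsq] x y xy; apply/eqP; rewrite -subr_eq0; apply/eqP/(sq_eq0 H).
by rewrite -Tsq islinB// xy subrr (sq0 H).
Qed.

(** Preimages of a convergent sequence of the range have the same mutual distances, so completeness
    provides a limit, and its image is the limit of the sequence. *)
Lemma isom_csub T : isom T -> csub (range T).
Proof.
move=> [hT Tsq]; split; first by exists 0 => //; exact: islin0.
  by move=> c _ _ [x _ <-] [y _ <-]; exists (c *: x + y).
move=> x hx.
have hu k : exists y, sq (x - T y) < k.+1%:R^-1.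
  have k0 : (0 : R) < k.+1%:R^-1 by rewrite invr_gt0 ltr0n.
  by have [_ [y _ <-] ?] := hx _ k0; exists y.
have [u hU] := choice hu.
have inv_small (e : R) : 0 < e -> exists K, forall k, (K <= k)%N -> k.+1%:R^-1 < e.
  move=> e0; have /cvgrPdist_lt/(_ _ e0)[K _ hK] := @cvg_harmonic R.
  exists K => k Kk; have := hK k Kk; rewrite /= sub0r normrN.
  exact: le_lt_trans (ler_norm _).
have [l hl] : exists l, forall e, 0 < e -> exists K, forall k, (K <= k)%N ->
    sq (u k - l) < e.
  apply: (dot_complete H) => e e0; have e4 : 0 < e / 4 by rewrite divr_gt0.
  have [K hK] := inv_small _ e4; exists K => m k Km Kk; rewrite -/(sq _).
  have -> : sq (u m - u k) = sq ((x - T (u k)) - (x - T (u m))).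
    rewrite -Tsq islinB//; congr sq.
    by rewrite opprB [RHS]addrC addrA subrK.
  have := sqD_le (x - T (u k)) (- (x - T (u m))); rewrite (sqN H).
  move: (hU m) (hU k) (hK m Km) (hK k Kk).
  set i1 := m.+1%:R^-1; set i2 := k.+1%:R^-1; set a := sq _; set b := sq _; set c := sq _.
  by move=> *; lra.
exists l => //; apply/eqP; rewrite eq_sym -subr_eq0; apply/eqP/(sq_eq0 H)/eqP.
rewrite eq_le (sq_ge0 H) andbT; apply/ler_addgt0Pl => e e0; rewrite addr0.
have e4 : 0 < e / 4 by rewrite divr_gt0.
have [K hK] := inv_small _ e4; have [K' hK'] := hl _ e4.
pose k := maxn K K'; have := hK k (leq_maxl _ _); have := hK' k (leq_maxr _ _).
rewrite -Tsq islinB// => h1 h2; have := sqD_le (x - T (u k)) (T (u k) - T l).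
rewrite addrA subrK; move: (hU k) h1 h2.
set i1 := k.+1%:R^-1; set a := sq _; set b := sq _; set c := sq _.
by move=> *; lra.
Qed.

(** For an isometry this is the Hilbert space adjoint, obtained as the preimage of the component in
    the closed range; the default value of [xget] is then never taken. *)
Definition adj T y : V := xget 0 [set x | T x = oproj (range T) y].

(** The operator $TT^*$, for an isometry the projection onto its range. *)
Definition pr T y : V := T (adj T y).

Lemma prE T y : isom T -> pr T y = oproj (range T) y.
Proof.
move=> hT; have [x _ hx] := proj_in H y (isom_csub hT).
by rewrite /pr /adj; case: xgetP => [z _ //|/(_ x)].
Qed.

Lemma dot_adj T x y : isom T -> dot (adj T y) x = dot y (T x).
Proof.
move=> hT; rewrite -(isom_dot _ _ hT) -/(pr T y) prE//.
have := @proj_orth _ _ _ H _ y (T x) (isom_csub hT) (ex_intro2 _ _ x I erefl).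
by rewrite (dotBl H) => /eqP; rewrite subr_eq0 => /eqP.
Qed.

Lemma dot_adjr T x y : isom T -> dot x (adj T y) = dot (T x) y.
Proof. by move=> hT; rewrite (dotC H) dot_adj// -(dotC H). Qed.

Lemma adjK T x : isom T -> adj T (T x) = x.
Proof. by move=> hT; apply: dot_ext => z; rewrite dot_adj// isom_dot. Qed.

Lemma adj_lin T : isom T -> islin (adj T).
Proof.
move=> hT c x y; apply: dot_ext => z.
by rewrite dot_adj// !(dotL H) !dot_adj.
Qed.

Lemma pr_lin T : isom T -> islin (pr T).
Proof. by move=> hT c x y; rewrite /pr adj_lin//; apply: hT.1. Qed.

Lemma pr_dot T x y : isom T -> dot (pr T x) y = dot x (pr T y).
Proof. by move=> hT; rewrite /pr -dot_adj// -dot_adjr. Qed.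

Lemma sq_pr T x : isom T -> sq (pr T x) <= sq x.
Proof.
by move=> hT; rewrite prE// (sq_proj H x (isom_csub hT)) lerDl (sq_ge0 H).
Qed.

Lemma sq_adj T x : isom T -> sq (adj T x) <= sq x.
Proof. by move=> hT; rewrite -(hT.2 (adj T x)) sq_pr. Qed.

Lemma adj_sub_pr T x : isom T -> adj T (x - pr T x) = 0.
Proof. by move=> hT; rewrite (islinB _ _ (adj_lin hT)) adjK// subrr. Qed.

Lemma pr_id T x : isom T -> pr T (T x) = T x.
Proof. by move=> hT; rewrite /pr adjK. Qed.

Lemma adj_eq0P T x : isom T -> (adj T x = 0) <-> forall y, dot x (T y) = 0.
Proof.
move=> hT; split=> [x0 y|h]; first by rewrite -dot_adj// x0 (dot0l H).
by apply: dot_ext => z; rewrite dot_adj// h (dot0l H).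
Qed.

Lemma csub_adj T : isom T -> csub [set x | adj T x = 0].
Proof.
move=> hT; apply: (@csub_ker _ 1); first exact: adj_lin.
by move=> x; rewrite mul1r sq_adj.
Qed.

Lemma adj_comm S T x : isom S -> isom T -> (forall y, S (T y) = T (S y)) ->
  adj S (adj T x) = adj T (adj S x).
Proof. by move=> hS hT ST; apply: dot_ext => z; rewrite !dot_adj// ST. Qed.

Definition dcomm S T := (forall x, S (T x) = T (S x)) /\
  forall x, adj S (T x) = T (adj S x).

Section Dcomm.
Variables S T : V -> V.
Hypotheses (hS : isom S) (hT : isom T) (ST : dcomm S T).

(** The adjoint of the relation $S^*T=TS^*$ is $T^*S=ST^*$. *)
Lemma dcomm_sym : dcomm T S.
Proof.
split=> x; first by rewrite ST.1.
apply: dot_ext => z; rewrite dot_adj// -(dot_adjr _ _ hS) -(dot_adjr _ _ hS).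
by rewrite dot_adj// ST.2.
Qed.

Lemma adj_pr x : adj S (pr T x) = pr T (adj S x).
Proof. by rewrite /pr ST.2 (adj_comm _ hS hT ST.1). Qed.

End Dcomm.

End Isometry.

(** The coordinates form a matrix with more rows than columns, which is killed by a nonzero row
    vector. *)
Lemma lin_dep (F : fieldType) (V : lmodType F) m (e : 'I_m -> V) (x : 'I_m.+1 -> V) :
  (forall k, exists c : 'I_m -> F, x k = \sum_i c i *: e i) ->
  exists2 a : 'I_m.+1 -> F, (exists k, a k != 0) & \sum_k a k *: x k = 0.
Proof.
move=> hx; have [c hc] := choice hx.
pose A : 'M[F]_(m.+1, m) := \matrix_(k, i) c k i.
have : kermx A != 0.
  by rewrite kermx_eq0 /row_free neq_ltn ltnS rank_leq_col.
case/rowV0Pn => v /sub_kermxP vA /eqP v0.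
exists (fun k => v ord0 k).
  apply/existsP; rewrite -negb_forall; apply/negP => /forallP h; apply: v0.
  by apply/rowP => k; rewrite [RHS]mxE; exact/eqP/h.
transitivity (\sum_k \sum_i (v ord0 k * A k i) *: e i).
  by apply: eq_bigr => k _; rewrite hc scaler_sumr; apply: eq_bigr => i _; rewrite scalerA mxE.
rewrite exchange_big big1// => i _; rewrite -scaler_suml.
have /rowP/(_ i) := vA; rewrite !mxE => ->; exact: scale0r.
Qed.

(** Induction on the number of functionals that separate points: a family for the kernel of the last
    one is completed by one vector of [N] off that kernel, if there is any. *)
Lemma finite_span (F : fieldType) (V : lmodType F) m (L : nat -> V -> F) (N : set V) :
  (forall k c x y, L k (c *: x + y) = c * L k x + L k y) ->
  (forall c x y, N x -> N y -> N (c *: x + y)) ->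
  (forall x, N x -> (forall k, (k < m)%N -> L k x = 0) -> x = 0) ->
  exists e : seq V, forall x, N x -> exists c : nat -> F, x = \sum_(k < size e) c k *: e`_k.
Proof.
move=> hL; elim: m N => [|m IH] N hN inj.
  by exists [::] => x Nx; exists (fun=> 0); rewrite big_ord0; exact: inj.
have [||e he] := IH (N `&` [set x | L m x = 0]).
- move=> c x y [Nx /= Lx] [Ny /= Ly]; split; first exact: hN.
  by rewrite /= hL Lx Ly mulr0 addr0.
- move=> x [Nx /= Lx] h; apply: inj => // k; rewrite ltnS leq_eqVlt => /orP[/eqP ->//|].
  exact: h.
have [[y [Ny Ly]]|ny] := pselect (exists y, N y /\ L m y != 0); last first.
  exists e => x Nx; apply: he; split=> //=; apply/eqP/negPn/negP => Lx.
  by apply: ny; exists x.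
exists (y :: e) => x Nx; pose a := L m x / L m y.
have [|c hc] := he (- a *: y + x).
  by split; [exact: hN|rewrite /= hL mulNr divfK// addNr].
exists (fun k => if k is k'.+1 then c k' else a).
by rewrite big_ord_recl /= -hc scaleNr addNKr.
Qed.

(** * Projections attached to doubly commuting families *)

Section Family.
Context {R : realType} {V : lmodType R[i]}.
Local Notation C := R[i].
Variable dot : V -> V -> C.
Hypothesis H : is_hilbert dot.
Implicit Types (x y z : V) (c : C) (N : set V).
Local Notation csub := (csub dot).
Local Notation oproj := (oproj dot).
Local Notation adj := (adj dot).
Local Notation pr := (pr dot).
Local Notation isom := (isom dot).
Local Notation dcomm := (dcomm dot).

Lemma oproj_lin N : csub N -> islin (oproj N).
Proof.
move=> hN c x y; have [_ Nl _] := hN.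
apply: (proj_uniq H) => //; first by apply: Nl; exact: (proj_in H).
move=> z Nz; rewrite opprD addrACA -scalerBr (dotL H).
by rewrite !(proj_orth H)// mulr0 addr0.
Qed.

Lemma oproj_dot N x y : csub N -> dot (oproj N x) y = dot x (oproj N y).
Proof.
move=> hN; have hx := proj_in H x hN; have hy := proj_in H y hN.
have := proj_orth H x hN hy; rewrite (dotBl H) => /eqP; rewrite subr_eq0 => /eqP ->.
have := proj_orth H y hN hx; rewrite (dotBl H) => /eqP; rewrite subr_eq0.
by move=> /eqP E; rewrite (dotC H y) E -(dotC H).
Qed.

(** As the first projection preserves [N2], the product lands in both subspaces, and the two
    successive residuals are orthogonal to the intersection. *)
Lemma oproj_comp N1 N2 x : csub N1 -> csub N2 ->
  (forall y, N2 y -> N2 (oproj N1 y)) ->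
  oproj N1 (oproj N2 x) = oproj (N1 `&` N2) x.
Proof.
move=> h1 h2 h12; have N2x := proj_in H x h2.
apply/esym/(proj_uniq H); first exact: csubI.
  by split; [exact: (proj_in H)|exact: h12].
move=> z [z1 z2]; set y := oproj N2 x.
have -> : x - oproj N1 y = (x - y) + (y - oproj N1 y) by rewrite addrA subrK.
by rewrite (dotDl H) !(proj_orth H)// addr0.
Qed.

Variables (I : eqType) (T : I -> V -> V).

Definition cap (s : seq I) : set V := [set x | forall i, i \in s -> adj (T i) x = 0].

Definition compr (s : seq I) x := foldr (fun i y => y - pr (T i) y) x s.

Definition dcfam (s : seq I) := (forall i, i \in s -> isom (T i)) /\
  forall i j, i \in s -> j \in s -> i != j -> dcomm (T i) (T j).

Lemma dcfam_sub s s' : {subset s' <= s} -> dcfam s -> dcfam s'.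
Proof. by move=> ss [h1 h2]; split=> [i /ss /h1|i j /ss hi /ss hj]//; exact: h2. Qed.

Lemma csub_cap s : (forall i, i \in s -> isom (T i)) -> csub (cap s).
Proof.
move=> hT; have -> : cap s = \bigcap_(i in [set i | i \in s]) [set x | adj (T i) x = 0] by [].
by apply: csub_bigcap => i /= /hT hi; exact: (csub_adj H).
Qed.

(** Double commutation makes [adj (T j)] commute with [pr (T i)], so subtracting the component in
    the range of [T i] keeps the conditions already achieved for the other indices. *)
Lemma compr_oproj s x : uniq s -> dcfam s -> oproj (cap s) x = compr s x.
Proof.
elim: s => [_ _|i s IH] /=.
  have c0 : csub (cap [::]) by exact: csub_cap.
  exact: (proj_id H).
move=> /andP[si us] hT; have hs : dcfam s by apply: dcfam_sub hT => j; rewrite inE orbC => ->.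
have hi : isom (T i) by apply: hT.1; rewrite mem_head.
rewrite -IH//; set y := oproj (cap s) x.
have cs : csub (cap s) by apply: csub_cap; exact: hs.1.
have ys : cap s y := proj_in H x cs.
apply: (proj_uniq H); first by apply: csub_cap; exact: hT.1.
  move=> j; rewrite inE => /orP[/eqP ->|sj]; first exact: (adj_sub_pr H).
  have hj : isom (T j) := hs.1 j sj.
  have ji : dcomm (T j) (T i).
    by apply: hT.2; rewrite ?mem_head// ?inE ?sj ?orbT//; apply: contraNneq si => <-.
  rewrite (islinB _ _ (adj_lin H hj)) (adj_pr H hj hi ji) ys//.
  by rewrite (islin0 (pr_lin H hi)) subrr.
move=> z hz; rewrite opprB addrCA addrC (dotDl H).
have -> : dot (x - y) z = 0.
  by apply: (proj_orth H) => // j sj; apply: hz; rewrite inE sj orbT.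
rewrite add0r (pr_dot H) // /pr hz ?mem_head// (islin0 hi.1).
exact: (dot0r H).
Qed.

Lemma compr_inv s N x : (forall i y, i \in s -> N y -> N (y - pr (T i) y)) ->
  N x -> N (compr s x).
Proof.
elim: s => //= i s IH hN Nx; apply: (hN) => //; first exact: mem_head.
by apply: IH => // j y js; apply: (hN) => //; rewrite inE js orbT.
Qed.

End Family.

(** * Multiplication by inner functions *)

Section Monomials.
Context {R : realType} {n : nat}.
Local Notation C := R[i].
Local Notation fct := ('rV[C]_n -> C).
Local Notation V := (@Hd R n).
Local Notation dot := (@dotH R n).
Local Notation H := (@Hd_hilbert R n).
Local Notation csub := (@csub R V dot).
Implicit Types (f g : fct) (x y : V) (alpha beta : 'I_n -> nat) (z w : 'rV[C]_n).

Definition delta alpha beta : C := [forall j, alpha j == beta j]%:R.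

Lemma delta_id alpha : delta alpha alpha = 1.
Proof. by rewrite /delta (introT forallP). Qed.

Lemma delta_neq alpha beta : alpha <> beta -> delta alpha beta = 0.
Proof.
by move=> ab; rewrite /delta; case: forallP => // h; case: ab; apply/funext => j; exact/eqP.
Qed.

Lemma box_delta (F : ('I_n -> nat) -> C) alpha N : (deg alpha < N)%N ->
  \sum_(beta : {ffun 'I_n -> 'I_N}) F (expo beta) * delta alpha (expo beta) = F alpha.
Proof.
case: N => // N; rewrite ltnS => aN.
rewrite (bigD1 (toffun N alpha))//= expo_toffun// delta_id mulr1 big1 ?addr0// => beta.
move=> /eqP nb; rewrite delta_neq ?mulr0// => ab; apply: nb; apply/ffunP => j.
by apply: val_inj; rewrite /toffun ffunE ab /= inord_val.
Qed.

Lemma is_coef_monom alpha : is_coef (monom alpha) (delta alpha).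
Proof.
move=> r e r0 r1 e0; exists (deg alpha).+1 => N w aN cw.
rewrite /psum; under eq_bigr do rewrite mulrC.
by rewrite (@box_delta (fun beta => monom beta w))// subrr normc0.
Qed.

Lemma is_coef_extz f a : is_coef f a -> is_coef (extz f) a.
Proof.
move=> h r e r0 r1 e0; have [N0 hN] := h r e r0 r1 e0; exists N0 => N w NN cw.
by rewrite extzE; [exact: hN|exact: cpoly_polydisc r1 cw].
Qed.

Lemma analytic_monom alpha : analytic_on_polydisc (monom alpha : fct).
Proof.
move=> z _; rewrite /monom.
elim: (index_enum _) => [|j s IH].
  rewrite (_ : (fun _ => _) = cst 1); first exact: differentiable_cst.
  by apply/funext => w; rewrite big_nil.
rewrite (_ : (fun _ => _) = (fun w : 'rV[C]_n => w ord0 j ^+ alpha j) *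
  (fun w : 'rV[C]_n => \prod_(k <- s) w ord0 k ^+ alpha k)); last first.
  by apply/funext => w; rewrite big_cons.
apply: differentiableM => //; elim: (alpha j) => [|k IHk].
  rewrite (_ : (fun _ => _) = cst 1); first exact: differentiable_cst.
  by apply/funext => w; rewrite expr0.
rewrite (_ : (fun _ => _) = (fun w : 'rV[C]_n => w ord0 j) *
  (fun w : 'rV[C]_n => w ord0 j ^+ k)); last by apply/funext => w; rewrite exprS.
by apply: differentiableM => //; exact: differentiable_coord.
Qed.

Lemma normc_monom alpha z : polydisc z -> normc (monom alpha z) <= 1.
Proof.
move=> zp; rewrite normc_prod prodr_ile1// => j _.
rewrite normcX exprn_ge0 ?normc_ge0//= exprn_ile1 ?normc_ge0//.
by have := zp j; rewrite normr_lt1 => /ltW.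
Qed.

Lemma bounded_hardy g (B : R) : analytic_on_polydisc g ->
  (forall z, polydisc z -> normc (g z) <= B) ->
  hardy (extz g) /\ sqnorm (extz g) <= B ^+ 2.
Proof.
move=> ag gB; have ae := analytic_extz ag; apply: (coefsq_bound (coefP ae)) => //.
  move=> N; apply: coefsq_le => r r0 r1; apply: (boxsq_le_sup N (coefP ae) r0 r1) => w cw.
  by have wp := cpoly_polydisc r1 cw; rewrite extzE// gB.
by move=> z zp; rewrite extz0.
Qed.

Definition chi alpha : V := toHd (extz (monom alpha)).

Lemma hardy_monom alpha : hardy (extz (monom alpha) : fct).
Proof.
by have [] := @bounded_hardy (monom alpha) 1 (@analytic_monom alpha) (@normc_monom alpha).
Qed.

Lemma chiE alpha z : polydisc z -> chi alpha z = monom alpha z.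
Proof. by move=> zp; rewrite /chi toHdE ?extzE//; exact: hardy_monom. Qed.

Lemma coef_chi alpha : coef (chi alpha) = delta alpha.
Proof.
rewrite /chi toHdE; last exact: hardy_monom.
exact/coef_eq/is_coef_extz/is_coef_monom.
Qed.

Lemma dot_chi x alpha : dot x (chi alpha) = coef x alpha.
Proof.
apply: (cvgC_unique (@dotH_cvg _ _ x (chi alpha))).
apply/cvgC_P => e e0; exists (deg alpha).+1 => N aN.
suff -> : coefdot (coef x) (coef (chi alpha)) N = coef x alpha by rewrite subrr normc0.
rewrite coef_chi /coefdot -[RHS](@box_delta (coef x) alpha N)//; apply: eq_bigr => beta _.
by congr (_ * _); rewrite /delta; case: [forall _, _]; [exact: conjc1|exact: conjc0].
Qed.

Lemma coef_eq0 x : (forall alpha, coef x alpha = 0) -> x = 0.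
Proof.
move=> h; apply: coefH_inj; apply/funext => alpha; rewrite h.
by rewrite -(subrr x) coefHB subrr.
Qed.

Definition supp (P : set ('I_n -> nat)) : set V :=
  [set x | forall alpha, ~ P alpha -> coef x alpha = 0].

Lemma csub_supp P : csub (supp P).
Proof.
have -> : supp P = orth dot [set chi alpha | alpha in ~` P].
  apply/seteqP; split=> x hx.
    by move=> _ [alpha Pa <-]; rewrite dot_chi hx.
  by move=> alpha Pa; rewrite -dot_chi; apply: hx; exists alpha.
exact: (csub_orth H).
Qed.

(** The residual of [x] after projection onto the part of [N] supported in [P] is orthogonal to the
    monomials of [P] and has no other coefficients, so it is 0. *)
Lemma csub_dense_supp P (N : set V) : csub N -> (forall alpha, P alpha -> N (chi alpha)) ->
  supp P `<=` N.
Proof.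
move=> hN NP x Px; have hNP := csubI hN (csub_supp P).
have [[Np Pp] hp] := projP H x hNP.
set p := oproj _ _ _ in Np Pp hp.
suff : x - p = 0 by move/eqP; rewrite subr_eq0 => /eqP ->.
apply: coef_eq0 => alpha; have [Pa|Pa] := pselect (P alpha); last first.
  by rewrite coefHB Px// Pp// subrr.
rewrite -dot_chi; apply: hp; split; first exact: NP.
by move=> beta Pb; rewrite coef_chi delta_neq// => ab; apply: Pb; rewrite -ab.
Qed.

Lemma csub_dense (N : set V) : csub N -> (forall alpha, N (chi alpha)) -> forall x, N x.
Proof. by move=> hN h x; apply: (@csub_dense_supp setT) => // alpha; case. Qed.

Lemma sqH x : sq dot x = sqnorm x.
Proof. by rewrite /sq dotH_self. Qed.

End Monomials.

(** * Multiplication by bounded analytic functions *)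

Section Multipliers.
Context {R : realType} {n : nat}.
Local Notation C := R[i].
Local Notation fct := ('rV[C]_n -> C).
Local Notation V := (@Hd R n).
Local Notation dot := (@dotH R n).
Implicit Types (f g : fct) (x y : V) (alpha beta : 'I_n -> nat) (z w : 'rV[C]_n).

Definition multiplier g := analytic_on_polydisc g /\
  exists B, forall z, polydisc z -> normc (g z) <= B.

Definition Mul g x : V := toHd (fun z => g z * x z).

Lemma mean2_le_sqnorm x r : 0 <= r -> r < 1 -> mean2 x r <= sqnorm x.
Proof.
move=> r0 r1; apply: (mean2_le (coefP (@Hd_analytic _ _ x)) r0 r1) => N.
apply: le_trans (coefsq_le_sqnorm x N); apply: boxsq_le_coefsq => //; exact: ltW.
Qed.

Lemma analyticM f g : analytic_on_polydisc f -> analytic_on_polydisc g ->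
  analytic_on_polydisc (fun z => f z * g z).
Proof. by move=> af ag z zp; apply: (differentiableM (af z zp) (ag z zp)). Qed.

Lemma mul_hardy g (B : R) x : analytic_on_polydisc g ->
  (forall z, polydisc z -> normc (g z) <= B) ->
  hardy (fun z => g z * x z) /\ sqnorm (fun z => g z * x z) <= B ^+ 2 * sqnorm x.
Proof.
move=> ag gB; have ax := @Hd_analytic _ _ x; have agx := analyticM ag ax.
have cgx := coefP agx; have cx := coefP ax.
apply: (coefsq_bound cgx) => //; last first.
  by move=> z zp; have [x0 _ _] := Hd_hardy x; rewrite x0// mulr0.
move=> N; apply: coefsq_le => r r0 r1; apply: (le_trans (boxsq_le_mean2 N cgx r0 r1)).
apply: (@le_trans _ _ (B ^+ 2 * mean2 x r)); last first.
  by rewrite ler_wpM2l ?sqr_ge0// mean2_le_sqnorm.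
have isq (f : fct) a : is_coef f a ->
    (torus_measure n).-integrable setT (EFin \o (fun t => normc (f (tpt r t)) ^+ 2)).
  move=> hf; have bg := coef_bmeas hf r0 r1; have [_ _ [L hL]] := bg.
  apply: (@bounded_integrable _ _ _ _ _ (L ^+ 2)); first exact: bmeas_sqnorm.
  move=> t; rewrite ger0_norm ?sqr_ge0// lerXn2r ?nnegrE ?normc_ge0//.
  exact: le_trans (normc_ge0 _) (hL t).
rewrite /mean2 -RintegralZl//; last exact: isq cx.
apply: le_Rintegral => //; first exact: isq cgx.
  exact: (integrableZl measurableT _ (isq _ _ cx)).
move=> t _; have tp := cpoly_polydisc r1 (tpt_cpoly t r0).
rewrite normcM exprMn ler_wpM2r ?sqr_ge0// lerXn2r ?nnegrE ?normc_ge0 ?gB//.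
exact: le_trans (normc_ge0 _) (gB _ tp).
Qed.

Lemma MulE g x z : multiplier g -> Mul g x z = g z * x z.
Proof. by move=> [ag [B gB]]; rewrite /Mul toHdE//; have [] := mul_hardy x ag gB. Qed.

Lemma Mul_lin g : multiplier g -> islin (Mul g).
Proof. by move=> hg c x y; apply: Hd_ext => z _; rewrite HdD HdZ !MulE// HdD HdZ; ring. Qed.

Lemma sq_Mul g : multiplier g -> exists B, forall x, sq dot (Mul g x) <= B * sq dot x.
Proof.
move=> [ag [B gB]]; exists (B ^+ 2) => x; rewrite !sqH.
by have [h1 h2] := mul_hardy x ag gB; rewrite /Mul toHdE.
Qed.

Lemma multiplierM f g : multiplier f -> multiplier g -> multiplier (fun z => f z * g z).
Proof.
move=> [af [B fB]] [ag [B' gB]]; split; first exact: analyticM.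
by exists (B * B') => z zp; rewrite normcM; apply: ler_pM; rewrite ?normc_ge0 ?fB ?gB.
Qed.

Lemma multiplier_lin (c : C) f g : multiplier f -> multiplier g -> multiplier (c \*o f + g).
Proof.
move=> [af [B fB]] [ag [B' gB]]; split; first exact: analytic_lin.
exists (normc c * B + B') => z zp; rewrite (le_trans (le_normcD _ _))//.
by rewrite lerD ?gB// normcM ler_wpM2l ?normc_ge0 ?fB.
Qed.

Lemma multiplier_cst (c : C) : multiplier (fun=> c).
Proof. by split; [move=> z _; exact: differentiable_cst|exists (normc c)]. Qed.

Lemma multiplier_monom alpha : multiplier (monom alpha).
Proof. by split; [exact: analytic_monom|exists 1 => z zp; exact: normc_monom]. Qed.

Lemma multiplier_hardy g : multiplier g -> hardy (extz g).
Proof. by move=> [ag [B gB]]; have [] := bounded_hardy ag gB. Qed.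

Definition HdM g : V := toHd (extz g).

Lemma HdME g z : multiplier g -> polydisc z -> HdM g z = g z.
Proof. by move=> hg zp; rewrite /HdM toHdE ?extzE//; exact: multiplier_hardy. Qed.

Lemma eq_multiplier f g : (forall z, polydisc z -> f z = g z) -> multiplier f -> multiplier g.
Proof.
move=> fg [af [B fB]]; split; first exact: eq_analytic af.
by exists B => z zp; rewrite -fg// fB.
Qed.

Lemma MulC f g x : multiplier f -> multiplier g -> Mul f (Mul g x) = Mul g (Mul f x).
Proof. by move=> hf hg; apply: Hd_ext => z _; rewrite !MulE// mulrCA. Qed.

End Multipliers.

(** * Inner functions as isometries *)

Section Inner.
Context {R : realType} {n : nat}.
Local Notation C := R[i].
Local Notation fct := ('rV[C]_n -> C).
Local Notation V := (@Hd R n).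
Local Notation dot := (@dotH R n).
Local Notation H := (@Hd_hilbert R n).
Local Notation csub := (@csub R V dot).
Local Notation isom := (@isom R V dot).
Local Notation T := (n.-tuple (measurableTypeR R)).
Local Notation P := (@torus_measure R n).
Implicit Types (f g h : fct) (x y : V) (alpha beta : 'I_n -> nat) (z w : 'rV[C]_n) (b : C).

Lemma cvgC_left (f : R -> C) b : f r @[r --> (1 : R)^'-] --> b <->
  forall e, 0 < e -> exists2 d, 0 < d & forall r, 1 - d < r -> r < 1 -> normc (f r - b) < e.
Proof.
split=> h.
  move=> e e0.
  have /h : nbhs b [set y : C | normc (y - b) < e] by apply/nbhs_normcP; exists e.
  move=> /nbhs_ballP[d /= d0 hd]; exists d => // r dr r1; apply: hd => //.
  by rewrite /ball /= ger0_norm; lra.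
move=> A /nbhs_normcP[e e0 hA]; have [d d0 hd] := h e e0.
apply/nbhs_ballP; exists d => //= r /ltr_normlP[_ hr] r1; apply/hA/hd => //.
by move: hr; lra.
Qed.

Lemma inner_multiplier f : inner_function f -> multiplier f.
Proof.
move=> [af [B fB] _]; split=> //; exists B => z zp.
by have := fB z zp; rewrite normr_leC.
Qed.

Lemma mean2_cvg x : mean2 x (1 - k.+1%:R^-1) @[k --> \oo] --> sqnorm x.
Proof.
have cx := coefP (@Hd_analytic _ _ x).
apply/cvgrPdist_lt => e e0; have e2 : 0 < e / 2 by rewrite divr_gt0.
have /cvgrPdist_lt/(_ _ e2)[N _ /(_ N (leqnn N)) /= hN] := sqnorm_cvg (Hd_hardy x).
have /cvgrPdist_lt/(_ _ e2)[K _ hK] := @boxsq_cvg _ _ (coef x) N.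
exists K => // k Kk; have [r0 r1] := harmonic_radius (R := R) k.
have /= := hK k Kk; have := boxsq_le_mean2 N cx r0 r1; have := mean2_le_sqnorm x r0 r1.
move: hN => /ltr_normlP[h1 h2] h3 h4 /ltr_normlP[h5 h6].
rewrite /= ger0_norm ?subr_ge0//; lra.
Qed.

Lemma mean2_integrable f a r : is_coef f a -> 0 <= r -> r < 1 ->
  P.-integrable setT (EFin \o (fun t => normc (f (tpt r t)) ^+ 2)).
Proof.
move=> hf r0 r1; have bg := coef_bmeas hf r0 r1; have [_ _ [L hL]] := bg.
apply: (@bounded_integrable _ _ _ _ _ (L ^+ 2)); first exact: bmeas_sqnorm.
move=> t; rewrite ger0_norm ?sqr_ge0// lerXn2r ?nnegrE ?normc_ge0//.
exact: le_trans (normc_ge0 _) (hL t).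
Qed.

(** Dominated convergence along the radii $1-1/(k+1)$: the difference of the integrands tends to 0
    almost everywhere because $|f|$ tends to 1 radially, and boundedness of [x] supplies the
    dominating constant. *)
Lemma inner_sq_bounded f x : inner_function f ->
  (exists M, forall z, polydisc z -> normc (x z) <= M) -> sqnorm (Mul f x) = sqnorm x.
Proof.
move=> hf [M xM]; have mf := inner_multiplier hf; have [af [B fB]] := mf.
have [_ _ rad] := hf; pose y := Mul f x.
have cx := coefP (@Hd_analytic _ _ x); have cy := coefP (@Hd_analytic _ _ y).
pose rk k : R := 1 - k.+1%:R^-1.
have rk0 k : 0 <= rk k by case: (harmonic_radius (R := R) k).
have rk1 k : rk k < 1 by case: (harmonic_radius (R := R) k).
have tp k (t : T) : polydisc (tpt (rk k) t) by exact: cpoly_polydisc (rk1 k) (tpt_cpoly t (rk0 k)).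
pose h k (t : T) : R := normc (y (tpt (rk k) t)) ^+ 2 - normc (x (tpt (rk k) t)) ^+ 2.
have hE k t : h k t = normc (x (tpt (rk k) t)) ^+ 2 * (normc (f (tpt (rk k) t)) ^+ 2 - 1).
  by rewrite /h MulE// normcM; ring.
pose K := M ^+ 2 * (`|B| + 1); have K0 : 0 <= K by rewrite mulr_ge0 ?sqr_ge0// addr_ge0.
have hle k t : `|h k t| <= K * `|normc (f (tpt (rk k) t)) - 1|.
  rewrite hE normrM ger0_norm ?sqr_ge0// -[X in _ - X](expr1n _ 2) subr_sqr normrM.
  rewrite /K -mulrA; apply: ler_pM; rewrite ?sqr_ge0 ?mulr_ge0//.
    have xt := xM _ (tp k t).
    by rewrite lerXn2r ?nnegrE ?normc_ge0// (le_trans (normc_ge0 _) xt).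
  rewrite mulrC ler_wpM2r// ger0_norm ?addr_ge0 ?normc_ge0// lerD2r.
  exact: le_trans (fB _ (tp k t)) (ler_norm B).
have hb k t : `|h k t| <= K * (`|B| + 1).
  rewrite (le_trans (hle k t))// ler_wpM2l// (le_trans (ler_normB _ _))// normr1 lerD2r.
  by rewrite ger0_norm ?normc_ge0// (le_trans (fB _ (tp k t)))// ler_norm.
have ih k : P.-integrable setT (EFin \o h k).
  have := integrableB measurableT (mean2_integrable cy (rk0 k) (rk1 k)) (mean2_integrable cx (rk0 k) (rk1 k)).
  by [].
have mh k : measurable_fun setT (EFin \o h k) by case/integrableP: (ih k).
have lim0 : {ae P, forall t, setT t -> (fun k => (EFin \o h k) t) @ \oo --> (cst 0%E : T -> \bar R) t}.
  apply: filterS rad => t [b b1 /cvgC_left hcv] _.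
  have nb : normc b = 1 by move: b1; rewrite norm_normc => -[].
  apply: cvg_EFin; first by near=> k.
  apply/cvgrPdist_lt => e e0.
  have K1 : 0 < K + 1 by rewrite ltr_wpDl.
  have [d d0 hd] := hcv _ (divr_gt0 e0 K1).
  have /cvgrPdist_lt/(_ _ d0)[N _ hN] := @cvg_harmonic R.
  exists N => // k Nk /=; rewrite sub0r normrN (le_lt_trans (hle k t))//.
  have kd : 1 - d < rk k.
    have := hN k Nk; rewrite /= sub0r normrN => /(le_lt_trans (ler_norm _)).
    by rewrite /rk; set i := _^-1; lra.
  have := hd _ kd (rk1 k); rewrite -/(tpt (rk k) t) => hd'.
  have : `|normc (f (tpt (rk k) t)) - 1| <= e / (K + 1).
    have h1 := le_normcB (f (tpt (rk k) t)) b; have h2 := le_normcB b (f (tpt (rk k) t)).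
    rewrite normcB in h2; rewrite nb in h1 h2; rewrite ler_norml.
    by apply/andP; split; move: hd'; set q := _ / _; lra.
  move=> h1; apply: (@le_lt_trans _ _ (K * (e / (K + 1)))); first exact: ler_wpM2l.
  by rewrite mulrCA -[ltRHS]mulr1 ltr_pM2l// ltr_pdivrMr// mul1r ltrDl.
have ig : P.-integrable setT (fun=> (K * (`|B| + 1))%:E) by exact: finite_measure_integrable_cst.
have fg : {ae P, forall t k, setT t -> (`|(EFin \o h k) t| <= (K * (`|B| + 1))%:E)%E}.
  by apply: aeW => t k _; rewrite lee_fin.
have [_ _] := dominated_convergence measurableT mh (measurable_cst _) lim0 ig fg.
rewrite integral0 => cv.
have c0 : mean2 y (rk k) - mean2 x (rk k) @[k --> \oo] --> (0 : R).
  have -> : (fun k => mean2 y (rk k) - mean2 x (rk k)) =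
      fine \o (fun k => \int[P]_(t in setT) ((EFin \o h k) t))%E.
    apply/funext => k; rewrite /mean2 -RintegralB//.
      exact: mean2_integrable cy (rk0 k) (rk1 k).
    exact: mean2_integrable cx (rk0 k) (rk1 k).
  exact: fine_cvg cv.
have c1 : mean2 y (rk k) - mean2 x (rk k) @[k --> \oo] --> sqnorm y - sqnorm x.
  by apply: cvgB; exact: mean2_cvg.
apply/eqP; rewrite -subr_eq0; apply/eqP; exact: (cvg_unique (@Rhausdorff R) c1 c0).
Unshelve. all: end_near.
Qed.

(** Combinations of two monomials are bounded, so polarization gives the inner products of the
    images of monomials; density in each argument in turn gives the rest. *)
Lemma isom_chi g : multiplier g ->
  (forall x, (exists M, forall z, polydisc z -> normc (x z) <= M) ->
     sq dot (Mul g x) = sq dot x) -> isom (Mul g).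
Proof.
move=> mg hb; have lg := Mul_lin mg; have [B gB] := sq_Mul mg.
have bchi alpha : exists M, forall z, polydisc z -> normc ((chi alpha : V) z) <= M.
  by exists 1 => z zp; rewrite chiE// normc_monom.
have h0 alpha beta : dot (Mul g (chi alpha)) (Mul g (chi beta)) = dot (chi alpha) (chi beta).
  apply: (polar_eq H lg) => [c|]; apply: hb => //.
  exists (1 + normc c) => z zp; rewrite HdD HdZ (le_trans (le_normcD _ _))//.
  apply: lerD; first by rewrite chiE// normc_monom.
  by rewrite normcM chiE// ler_piMr ?normc_ge0// normc_monom.
have h1 x beta : dot (Mul g x) (Mul g (chi beta)) = dot x (chi beta).
  by apply: (csub_dense (csub_dot H (Mul g (chi beta)) (chi beta) lg gB)) => alpha; exact: h0.
split=> // x; suff : dot (Mul g x) (Mul g x) = dot x x by rewrite /sq => ->.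
apply: (csub_dense (csub_dot H (Mul g x) x lg gB)) => alpha /=.
by rewrite (dotC H) h1 -(dotC H).
Qed.

Lemma inner_isom f : inner_function f -> isom (Mul f).
Proof.
move=> hf; apply: isom_chi; first exact: inner_multiplier.
by move=> x xM; rewrite !sqH; exact: inner_sq_bounded.
Qed.

Lemma bernoulli_ineq (d : R) m : 0 <= d -> 1 + m%:R * d <= (1 + d) ^+ m.
Proof.
move=> d0; elim: m => [|m IH]; first by rewrite mul0r addr0.
rewrite exprS; apply: (@le_trans _ _ ((1 + d) * (1 + m%:R * d))); last first.
  by rewrite ler_wpM2l// addr_ge0.
rewrite -natr1; have : 0 <= m%:R * d * d by rewrite !mulr_ge0.
by nra.
Qed.

Lemma exprn_bounded_le1 (v K : R) : 0 <= v -> (forall m, v ^+ m <= K) -> v <= 1.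
Proof.
move=> v0 hK; rewrite leNgt; apply/negP => v1.
have d0 : 0 < v - 1 by rewrite subr_gt0.
have K0 : 0 <= K / (v - 1).
  by rewrite divr_ge0 ?(ltW d0)// (le_trans _ (hK 0%N)).
have [m] : exists m : nat, K / (v - 1) < m%:R by eexists; exact: archi_boundP K0.
rewrite ltr_pdivrMr// => h; have := hK m; have := bernoulli_ineq m (ltW d0).
have -> : 1 + (v - 1) = v by ring.
by move: h; set q := _%:R => h h1 h2; lra.
Qed.

(** The vectors $S^m1$ have constant norm and take the values $c^m$ at [z]; evaluation at [z] is
    bounded, so the powers of [c] are. This serves as the maximum principle for inner functions. *)
Lemma isom_eigen_le1 (S : V -> V) z (c : C) : polydisc z ->
  (forall x, sq dot (S x) = sq dot x) -> (forall x, S x z = c * x z) -> normc c <= 1.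
Proof.
move=> zp Ssq Sz; have [r [d [r0 r1 d0 hr]]] := polydisc_room zp.
have cz : cpoly r z by move=> j; rewrite (le_trans _ (hr j))// lerDl ltW.
have [K K0 hK] := @eval_bound R n r r0 r1; pose o : V := chi (fun=> 0%N).
have oz : o z = 1 by rewrite chiE// /monom big1.
have hm m : sq dot (iter m S o) = sq dot o by elim: m => //= m IH; rewrite Ssq.
have ev m : iter m S o z = c ^+ m by elim: m => [|m IH]; rewrite ?expr0//= Sz IH exprS.
apply: (@exprn_bounded_le1 _ (K * Num.sqrt (sqnorm o))); first exact: normc_ge0.
by move=> m; rewrite -normcX -ev -sqH -(hm m) sqH hK.
Qed.

Lemma inner_le1 f z : inner_function f -> polydisc z -> normc (f z) <= 1.
Proof.
move=> hf zp; have [_ fsq] := inner_isom hf.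
by apply: (isom_eigen_le1 zp fsq) => x; rewrite MulE//; exact: inner_multiplier.
Qed.

(** Evaluation at [z] is bounded, so the relation is closed in [x]; [inner_quotient] uses this to
    pass from monomials to all vectors. *)
Lemma csub_eval (S : V -> V) (B : R) z (c : C) : polydisc z -> islin S ->
  (forall x, sq dot (S x) <= B * sq dot x) -> csub [set x | S x z = c * x z].
Proof.
move=> zp hS SB; split; first by rewrite /= (islin0 hS) Hd0 mulr0.
  by move=> a x y; rewrite /mkset => hx hy; rewrite hS !HdD !HdZ hx hy; ring.
have [r [d [r0 r1 d0 hr]]] := polydisc_room zp.
have cz : cpoly r z by move=> j; rewrite (le_trans _ (hr j))// lerDl ltW.
have [K K0 hK] := @eval_bound R n r r0 r1.
move=> x hx /=; pose D := K * (1 + normc c).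
have D0 : 0 < D by rewrite mulr_gt0// ltr_pwDl// normc_ge0.
have B0 : 0 < `|B| + 1 by rewrite ltr_wpDl.
apply/eqP; rewrite -subr_eq0 -normc_eq0 eq_le normc_ge0 andbT.
apply/ler_addgt0Pl => e e0; rewrite addr0.
have eD : 0 < e / D := divr_gt0 e0 D0.
have [y /= hy xy] := hx _ (divr_gt0 (exprn_gt0 2 eD) B0).
have {}xy : (`|B| + 1) * sq dot (x - y) <= (e / D) ^+ 2.
  by rewrite mulrC -ler_pdivlMr// ltW.
have n0 (u : V) : sq dot u <= (e / D) ^+ 2 -> normc (u z) <= K * (e / D).
  rewrite sqH => h; apply: (le_trans (hK u z cz)); apply: ler_wpM2l; first exact: ltW.
  by rewrite -(@ler_pXn2r _ 2)// ?nnegrE ?sqrtr_ge0 ?(ltW eD)// sqr_sqrtr ?sqnorm_ge0.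
have n1 : normc ((x - y) z) <= K * (e / D).
  by apply/n0/(le_trans _ xy); rewrite ler_peMl ?(sq_ge0 H)// lerDr.
have n2 : normc (S (x - y) z) <= K * (e / D).
  apply/n0/(le_trans _ xy); rewrite (le_trans (SB _))//.
  by rewrite ler_wpM2r ?(sq_ge0 H)// (le_trans (ler_norm _))// lerDl.
have -> : S x z - c * x z = S (x - y) z - c * (x - y) z.
  by rewrite (islinB _ _ hS) !HdB hy; ring.
rewrite (le_trans (le_normcD _ _))// normcN normcM.
apply: (@le_trans _ _ (K * (e / D) + normc c * (K * (e / D)))).
  by apply: lerD => //; apply: ler_wpM2l; rewrite ?normc_ge0.
set q := e / D; have -> : K * q + normc c * (K * q) = D * q by rewrite /D; ring.
by rewrite /q mulrC divfK// gt_eqF.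
Qed.

End Inner.

(** * Quotients of inner functions, shifts and supports *)

Section Coordinates.
Context {R : realType} {n : nat}.
Local Notation C := R[i].
Local Notation fct := ('rV[C]_n -> C).
Local Notation V := (@Hd R n).
Local Notation dot := (@dotH R n).
Local Notation H := (@Hd_hilbert R n).
Local Notation csub := (@csub R V dot).
Local Notation isom := (@isom R V dot).
Local Notation adj := (@adj R V dot).
Implicit Types (f g h : fct) (x y : V) (alpha beta gamma : 'I_n -> nat) (z w : 'rV[C]_n) (b : C).

Lemma near_left (Q : R -> Prop) (d : R) : 0 < d ->
  (forall r, 1 - d < r -> r < 1 -> Q r) -> \forall r \near (1 : R)^'-, Q r.
Proof.
move=> d0 hQ; apply/nbhs_ballP; exists d => //= r /ltr_normlP[_ hr] r1.
by apply: hQ => //; move: hr; lra.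
Qed.

(** The point is the boundedness of [h]. As the range of $M_f$ lies in that of $M_g$, the operator
    $M_g^*M_f$ is an isometry; it acts as multiplication by [h], and [isom_eigen_le1] gives
    $|h|\le1$. Radial limits are then divided. *)
Lemma inner_quotient f g (h : V) : inner_function g -> inner_function f ->
  (forall z, polydisc z -> f z = g z * h z) -> inner_function h.
Proof.
move=> hg hf fgh; have mg := inner_multiplier hg; have mf := inner_multiplier hf.
have ig := inner_isom hg; have If := inner_isom hf.
pose S x := adj (Mul g) (Mul f x).
have Sg x : Mul g (S x) = Mul f x.
  rewrite /S; suff [y _ <-] : range (Mul g) (Mul f x) by rewrite (adjK H).
  have cs : csub (Mul f @^-1` range (Mul g)).
    apply: (@csub_preimage _ _ _ H _ 1 _ If.1); last exact: (isom_csub H ig).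
    by move=> y; rewrite mul1r If.2.
  apply: (csub_dense cs) => alpha; exists (Mul (monom alpha) h) => //.
  apply: Hd_ext => z zp; rewrite !MulE//; last exact: multiplier_monom.
  by rewrite fgh// chiE// -mulrA [h z * _]mulrC.
have Ssq x : sq dot (S x) = sq dot x by rewrite -(ig.2 (S x)) Sg If.2.
have Sl : islin S by move=> c x y; rewrite /S If.1 (adj_lin H ig).
have Sz z x : polydisc z -> S x z = h z * x z.
  move=> zp; apply: (csub_dense (@csub_eval _ _ S 1 z (h z) zp Sl _)).
    by move=> y; rewrite mul1r Ssq.
  move=> alpha /=.
  have -> : S (chi alpha) = Mul (monom alpha) h.
    apply: (isom_inj H ig); rewrite Sg; apply: Hd_ext => w wp.
    rewrite !MulE//; last exact: multiplier_monom.
    by rewrite fgh// chiE//; ring.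
  by rewrite MulE; [rewrite chiE// mulrC|exact: multiplier_monom].
split; first exact: Hd_analytic.
  exists 1 => z zp; rewrite normr_leC.
  by apply: (isom_eigen_le1 zp Ssq) => x; exact: Sz.
have [_ _ rf] := hf; have [_ _ rg] := hg.
apply: filterS2 rf rg => t [b b1 hb] [b' b1' hb'].
have n1' : normc b' = 1 by move: b1'; rewrite norm_normc => -[].
have b'0 : b' != 0 by rewrite -normc_eq0 n1' oner_eq0.
exists (b / b'); first by rewrite normrM normrV ?unitfE// b1 b1' divr1.
apply: cvg_trans (cvgM hb (cvgV b'0 hb')); apply: near_eq_cvg.
have [d d0 hd] := (cvgC_left _ _).1 hb' 1 ltr01.
apply: (@near_left _ (Num.min d 1)) => [|r]; first by rewrite lt_min d0 ltr01.
rewrite ltrBlDr -ltrBlDl lt_min => /andP[dr r0] r1.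
have r0' : 0 <= r by move: r0; lra.
have tp : polydisc (r%:C *: torus_point t) := cpoly_polydisc r1 (tpt_cpoly t r0').
have g0 : g (r%:C *: torus_point t) != 0.
  apply/eqP => g0; have dr' : 1 - d < r by move: dr; lra.
  have := hd r dr' r1.
  by rewrite g0 sub0r normcN n1' ltxx.
by rewrite /= fgh// mulrAC divff// mul1r.
Qed.

Lemma inner_monom alpha : inner_function (monom alpha : fct).
Proof.
have [am [B hB]] := @multiplier_monom R n alpha; split=> //.
  by exists B => z zp; rewrite normr_leC hB.
apply: aeW => t; have nt : normc (tchar alpha t : C) = 1.
  rewrite /tchar normc_prod big1// => j _.
  by rewrite normcX normc_circ ?ler01// expr1n.
exists (tchar alpha t); first by rewrite norm_normc nt.
apply/cvgC_left => e e0.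
have /cvgrPdist_lt/(_ _ e0)/nbhs_ballP[d /= d0 hd] := @exprn_continuous R (deg alpha) 1.
exists d => // r dr r1; rewrite -/(tpt r t) monom_tpt -[X in _ - X]mul1r -mulrBl normcM nt mulr1.
have -> : (r ^+ deg alpha)%:C - 1 = (r ^+ deg alpha - 1)%:C :> C by rewrite rmorphB.
rewrite normcR distrC -[X in `|X - _|](expr1n _ (deg alpha)); apply: hd.
by rewrite /ball /= ger0_norm; lra.
Qed.

Definition em (j : 'I_n) : 'I_n -> nat := fun k => (k == j)%N.

Definition addm alpha beta : 'I_n -> nat := fun k => (alpha k + beta k)%N.

Lemma monomD alpha beta z : monom (addm alpha beta) z = monom alpha z * monom beta z.
Proof. by rewrite /monom -big_split; apply: eq_bigr => j _; rewrite exprD. Qed.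

Lemma monom_em j z : monom (em j) z = z ord0 j.
Proof.
rewrite /monom (bigD1 j)//= /em eqxx expr1 big1 ?mulr1// => k /negPf ->.
exact: expr0.
Qed.

Lemma isom_monom alpha : isom (Mul (monom alpha)).
Proof. exact/inner_isom/inner_monom. Qed.

Lemma Mul_chi alpha beta : Mul (monom alpha) (chi beta) = chi (addm alpha beta) :> V.
Proof.
apply: Hd_ext => z zp; rewrite MulE; last exact: multiplier_monom.
by rewrite !chiE// monomD.
Qed.

Lemma coef_shift alpha beta x : coef (Mul (monom alpha) x) (addm alpha beta) = coef x beta.
Proof. by rewrite -!dot_chi -Mul_chi (isom_dot H)//; exact: isom_monom. Qed.

Lemma coef_shift0 alpha gamma x : ~ (forall j, (alpha j <= gamma j)%N) ->
  coef (Mul (monom alpha) x) gamma = 0.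
Proof.
move=> ag; rewrite -dot_chi -(dot0r H x).
have [Ml Msq] := isom_monom alpha.
have cs := @csub_dot _ _ _ H (Mul (monom alpha)) 1 (chi gamma) 0 Ml.
apply: (csub_dense (cs _)) => [y|beta /=]; first by rewrite mul1r Msq.
rewrite (dot0r H) Mul_chi dot_chi coef_chi delta_neq// => E; apply: ag => j.
by rewrite -E /addm leq_addr.
Qed.

Definition zshift j := Mul (monom (em j)) : V -> V.

Lemma isom_shift j : isom (zshift j). Proof. exact: isom_monom. Qed.

Lemma shiftE j x z : zshift j x z = z ord0 j * x z.
Proof. by rewrite /zshift MulE ?monom_em//; exact: multiplier_monom. Qed.

Lemma addm_em j gamma : gamma j != 0%N ->
  exists2 beta, gamma = addm (em j) beta & deg gamma = (deg beta).+1.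
Proof.
move=> gj; exists (fun k => (gamma k - (k == j))%N).
  apply/funext => k; rewrite /addm /em; case: eqP => [->|_]; last by rewrite subn0.
  by rewrite subnKC// lt0n.
rewrite /deg (bigD1 j)//= [in RHS](bigD1 j)//= eqxx -addSn subn1 prednK ?lt0n//.
by congr (_ + _)%N; apply: eq_bigr => k /negPf ->; rewrite subn0.
Qed.

(** This turns independence of the variable $z_j$ into an operator equation, which commutation
    relations preserve. *)
Lemma adj_shift_eq0 j x : adj (zshift j) x = 0 <-> supp [set alpha | alpha j = 0%N] x.
Proof.
have ij := isom_shift j; split=> [x0 alpha /= /eqP /addm_em[beta -> _]|hx].
  by rewrite -dot_chi -Mul_chi -(dot_adj H)// x0 (dot0l H).
apply/(adj_eq0P H) => // y; rewrite (dotC H) -[RHS]conjc0 -(dot0r H y); congr conjc.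
have cs := @csub_dot _ _ _ H (zshift j) 1 x 0 ij.1.
apply: (csub_dense (cs _)) => [u|beta /=]; first by rewrite mul1r ij.2.
rewrite (dot0r H) (dotC H) /zshift Mul_chi dot_chi hx ?conjc0//=.
by rewrite /addm /em eqxx.
Qed.

Lemma supp_eval P x z w : supp P x -> polydisc z -> polydisc w ->
  (forall alpha, P alpha -> monom alpha z = monom alpha w) -> x z = x w.
Proof.
move=> Px zp wp zw; apply/eqP; rewrite -subr_eq0 -normc_eq0 eq_le normc_ge0 andbT.
have [r [d [r0 r1 d0 hr]]] := polydisc_room zp.
have [r' [d' [r0' r1' d0' hr']]] := polydisc_room wp.
pose s := Num.max r r'; have s0 : 0 <= s by rewrite le_max r0.
have s1 : s < 1 by rewrite gt_max r1.
have cz : cpoly s z by move=> j; rewrite le_max (le_trans _ (hr j))// lerDl ltW.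
have cw : cpoly s w by move=> j; rewrite le_max (le_trans _ (hr' j)) ?orbT// lerDl ltW.
apply/ler_addgt0Pl => e e0; rewrite addr0; have e2 : 0 < e / 2 by rewrite divr_gt0.
have [N h] := coefP (@Hd_analytic _ _ x) s0 s1 e2.
have hz := h N z (leqnn N) cz; have hw := h N w (leqnn N) cw.
have E : psum (coef x) N z = psum (coef x) N w.
  apply: eq_bigr => alpha _; have [Pa|Pa] := pselect (P (expo alpha)); first by rewrite zw.
  by rewrite Px// !mul0r.
have -> : x z - x w = (x z - psum (coef x) N z) - (x w - psum (coef x) N w).
  by rewrite E; ring.
rewrite (le_trans (le_normcD _ _))// normcN; move: hz hw; set a := normc _; set b := normc _.
lra.
Qed.

(** Composition with [tau] deletes the monomials outside [P] from the expansion; as [x] is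
    unchanged, uniqueness of coefficients shows that theirs were 0. *)
Lemma supp_of_invariant P x (tau : 'rV[C]_n -> 'rV[C]_n) :
  (forall z, polydisc z -> polydisc (tau z) /\ x z = x (tau z)) ->
  (forall r z, 0 <= r -> cpoly r z -> cpoly r (tau z)) ->
  (forall alpha z, P alpha -> monom alpha (tau z) = monom alpha z) ->
  (forall alpha z, ~ P alpha -> monom alpha (tau z) = 0) -> supp P x.
Proof.
move=> xt ct mP mN; have cx := coefP (@Hd_analytic _ _ x).
have cx' : is_coef x (fun alpha => if `[< P alpha >] then coef x alpha else 0).
  move=> r e r0 r1 e0; have [N0 hN] := cx r e r0 r1 e0; exists N0 => N w NN cw.
  have [_ ->] := xt w (cpoly_polydisc r1 cw).
  have -> : psum (fun alpha => if `[< P alpha >] then coef x alpha else 0) N w =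
     psum (coef x) N (tau w); last exact/hN/ct.
  apply: eq_bigr => alpha _; case: asboolP => Pa; first by rewrite mP.
  by rewrite mN// mulr0 mul0r.
by move=> alpha Pa; rewrite (coef_eq cx') asboolF.
Qed.

Lemma monom_upd0 j alpha z : alpha j <> 0%N -> monom alpha (upd z j 0) = 0.
Proof.
by move=> /eqP aj; rewrite /monom (bigD1 j)//= updE eqxx expr0n (negPf aj) mul0r.
Qed.

Lemma monom_eq alpha z w : (forall j, alpha j <> 0%N -> z ord0 j = w ord0 j) ->
  monom alpha z = monom alpha w.
Proof.
move=> zw; apply: eq_bigr => j _; case: (alpha j) (zw j) => [|k] zk; first by rewrite !expr0.
by rewrite zk.
Qed.

Definition only j : set ('I_n -> nat) := [set alpha | forall k, k != j -> alpha k = 0%N].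

Lemma supp_only j x : supp (only j) x <-> depends_only_on j x.
Proof.
split=> [hx z w zp wp zw|hx].
  apply: (supp_eval hx) => // alpha ha; apply: monom_eq => k ak.
  by have [->//|/ha] := eqVneq k j.
pose tau z : 'rV[C]_n := \row_k (if k == j then z ord0 k else 0).
have tE z k : tau z ord0 k = if k == j then z ord0 k else 0 by rewrite mxE.
apply: (@supp_of_invariant _ _ tau).
- move=> z zp; have tp : polydisc (tau z).
    by move=> k; rewrite tE; case: ifP => // _; rewrite normr0.
  by split=> //; apply: hx => //; rewrite tE eqxx.
- by move=> r z r0 cz k; rewrite tE; case: ifP => // _; rewrite normc0.
- by move=> alpha z ha; apply: monom_eq => k ak; rewrite tE; case: eqP => // /eqP /ha.
- move=> alpha z ha; have [k kj ak] : exists2 k, k != j & alpha k != 0%N.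
    apply: contrapT => h; apply: ha => k kj; apply/eqP/negPn/negP => ak.
    by apply: h; exists k.
  by rewrite /monom (bigD1 k)//= tE (negPf kj) expr0n (negPf ak) mul0r.
Qed.

Lemma supp_off j x : (forall z w, polydisc z -> polydisc w ->
    (forall k, k != j -> z ord0 k = w ord0 k) -> x z = x w) ->
  supp [set alpha | alpha j = 0%N] x.
Proof.
move=> hx; have uE z k : upd z j 0 ord0 k = if k == j then 0 else z ord0 k by rewrite updE.
apply: (@supp_of_invariant _ _ (fun z => upd z j 0)).
- move=> z zp; have up : polydisc (upd z j 0).
    by move=> k; rewrite uE; case: ifP => // _; rewrite normr0.
  by split=> //; apply: hx => // k kj; rewrite uE (negPf kj).
- by move=> r z r0 cz k; rewrite uE; case: ifP => // _; rewrite normc0.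
- by move=> alpha z /= aj; apply: monom_eq => k ak; rewrite uE; case: eqP => // kj; rewrite kj in ak.
- by move=> alpha z /= aj; exact: monom_upd0.
Qed.

End Coordinates.

(** * Double commutation of multiplications in different variables *)

Section DoublyCommuting.
Context {R : realType} {n : nat}.
Local Notation C := R[i].
Local Notation fct := ('rV[C]_n -> C).
Local Notation V := (@Hd R n).
Local Notation dot := (@dotH R n).
Local Notation H := (@Hd_hilbert R n).
Local Notation isom := (@isom R V dot).
Local Notation adj := (@adj R V dot).
Local Notation pr := (@pr R V dot).
Local Notation dcomm := (@dcomm R V dot).
Implicit Types (f g h : fct) (x y : V) (alpha beta gamma : 'I_n -> nat) (z w : 'rV[C]_n) (b : C).

(** On the range of [S] the relation $S^*T=TS^*$ follows from $S^*S=1$ and commutation; only the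
    kernel of $S^*$ remains. *)
Lemma dcomm_of_ker (S T : V -> V) : isom S -> isom T -> (forall x, S (T x) = T (S x)) ->
  (forall x, adj S x = 0 -> adj S (T x) = 0) -> dcomm S T.
Proof.
move=> hS hT ST hk; split=> // x.
have {1}-> : x = S (adj S x) + (x - pr S x) by rewrite addrC subrK.
rewrite (islinD _ _ hT.1) -ST (islinD _ _ (adj_lin H hS)) (adjK H)// hk ?addr0//.
exact: (adj_sub_pr H).
Qed.

Lemma dcomm_comp (S T T' : V -> V) : dcomm S T -> dcomm S T' -> dcomm S (T \o T').
Proof. by move=> [h1 h2] [h3 h4]; split=> x /=; rewrite ?h1 ?h3 ?h2 ?h4. Qed.

Lemma supp_HdM j f : multiplier f -> depends_only_on j f -> supp (only j) (HdM f).
Proof.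
by move=> mf fj; apply/supp_only => z w zp wp zw; rewrite !HdME//; exact: fj.
Qed.

(** For $x\perp fH^2$ the vector $z_jx$ is tested against $f\chi_\delta$. When $\delta_j\ne0$ a
    factor $z_j$ is cancelled on both sides; otherwise $f\chi_\delta$ is free of $z_j$, hence
    orthogonal to every multiple of $z_j$. *)
Lemma dcomm_shift f i j : inner_function f -> depends_only_on i f -> i != j ->
  dcomm (Mul f) (zshift j).
Proof.
move=> hf fi ij; have If := inner_isom hf; have Ij := isom_shift (R := R) j.
have mf := inner_multiplier hf.
have comm x : Mul f (zshift j x) = zshift j (Mul f x).
  exact: (MulC x mf (multiplier_monom (em j))).
apply: (dcomm_of_ker If Ij comm) => x /(adj_eq0P H _ If) hx.
apply/(adj_eq0P H _ If) => y.
rewrite (dotC H) -[RHS]conjc0 -(dot0r H y); congr conjc.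
have cs := @csub_dot _ _ _ H (Mul f) 1 (zshift j x) 0 If.1.
apply: (csub_dense (cs _)) => [u|delta /=]; first by rewrite mul1r If.2.
rewrite (dot0r H); have [dj|dj] := eqVneq (delta j) 0%N; last first.
  have [beta -> _] := addm_em dj; rewrite -Mul_chi -/(zshift j) comm (isom_dot H)//.
  by rewrite (dotC H) hx conjc0.
have /(adj_shift_eq0 j) h0 : supp [set alpha | alpha j = 0%N] (Mul f (chi delta)).
  apply: supp_off => z w zp wp zw; rewrite !MulE// !chiE//; congr (_ * _).
    by apply: fi => //; apply: zw.
  by apply: monom_eq => k dk; apply: zw; apply/eqP => kj; rewrite kj dj in dk.
by rewrite (adj_eq0P H _ Ij).1.
Qed.

Lemma Mul1 (x : V) alpha : (forall j, alpha j = 0%N) -> Mul (monom alpha) x = x.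
Proof.
move=> a0; apply: Hd_ext => z zp; rewrite MulE; last exact: multiplier_monom.
by rewrite /monom big1 ?mul1r// => j _; rewrite a0 expr0.
Qed.

Lemma dcomm_monom f i gamma : inner_function f -> depends_only_on i f -> gamma i = 0%N ->
  dcomm (Mul f) (Mul (monom gamma)).
Proof.
move=> hf fi; elim: {gamma}(deg gamma) {-2}gamma (erefl (deg gamma)) => [|d IH] gamma dg gi.
  have g0 j : gamma j = 0%N.
    by apply/eqP; have := leqnn (deg gamma); rewrite {2}dg leqn0 sum_nat_eq0 => /forallP/(_ j).
  by split=> x; rewrite !Mul1.
have [j gj] : exists j, gamma j != 0%N.
  apply/existsP; rewrite -negb_forall; apply/negP => /forallP h.
  by move: dg; rewrite /deg big1// => j _; exact/eqP.
have [beta gE dE] := addm_em gj.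
have ij : i != j by apply: contraNneq gj => <-; rewrite gi.
have -> : Mul (monom gamma) = zshift j \o Mul (monom beta) :> (V -> V).
  apply/funext => x; apply: Hd_ext => z _ /=.
  by rewrite shiftE !MulE ?gE ?monomD ?monom_em ?mulrA//; exact: multiplier_monom.
apply: dcomm_comp; first exact: dcomm_shift fi ij.
apply: IH; first by move: dg; rewrite dE => -[].
by move: gi; rewrite gE /addm => /eqP; rewrite addn_eq0 => /andP[_ /eqP].
Qed.

Lemma delta_sym alpha beta : delta alpha beta = delta beta alpha :> C.
Proof. by rewrite /delta; congr (_%:R); congr nat_of_bool; apply: eq_forallb => j; rewrite eq_sym. Qed.

Lemma supp_box_multiplier beta x : supp [set gamma | forall j, (gamma j <= beta j)%N] x ->
  multiplier x.
Proof.
move=> hx; split; first exact: Hd_analytic.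
pose N := (deg beta).+1; pose c (alpha : {ffun 'I_n -> 'I_N}) := coef x (expo alpha).
have -> : x = \sum_(alpha : {ffun 'I_n -> 'I_N}) c alpha *: chi (expo alpha).
  apply: coefH_inj; apply/funext => gamma.
  rewrite -[RHS]dot_chi (dot_suml H).
  under eq_bigr do rewrite (dotZl H) dot_chi coef_chi delta_sym.
  have [gN|gN] := ltnP (deg gamma) N; first by rewrite (@box_delta _ _ (coef x)).
  have x0 : coef x gamma = 0.
    apply: hx => /= gb; move: gN; rewrite /N ltnNge leq_sum//.
  rewrite x0 big1// => alpha _; have [ag|ag] := pselect (gamma = expo alpha).
    by rewrite /c -ag x0 mul0r.
  by rewrite delta_neq// mulr0.
exists (\sum_(alpha : {ffun 'I_n -> 'I_N}) normc (c alpha)) => z zp.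
rewrite Hd_sum (le_trans (normc_sum _ _ _))//; apply: ler_sum => alpha _.
by rewrite HdZ normcM chiE// ler_piMr ?normc_ge0// normc_monom.
Qed.

(** The vector is a polynomial, with exponents bounded by those of [beta]; being bounded, it can act
    as a multiplier in [dcomm_Mul]. *)
Lemma multiplier_adj_chi f beta : inner_function f -> multiplier (adj (Mul f) (chi beta)).
Proof.
move=> hf; have If := inner_isom hf; have mf := inner_multiplier hf.
apply: (@supp_box_multiplier beta) => gamma /= gb.
rewrite -dot_chi (dot_adj H)// (dotC H) dot_chi.
have -> : Mul f (chi gamma) = Mul (monom gamma) (HdM f).
  apply: Hd_ext => z zp; rewrite !MulE//; last exact: multiplier_monom.
  by rewrite HdME// chiE// mulrC.
by rewrite coef_shift0// conjc0.
Qed.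

(** Two density arguments: [x] is reduced to a monomial, after which both sides depend continuously
    on [g] as an element of $H^2$, and [g] is reduced to a power of $z_j$, the case of
    [dcomm_monom]. *)
Lemma dcomm_Mul f g i j : inner_function f -> depends_only_on i f ->
  multiplier g -> depends_only_on j g -> i != j -> dcomm (Mul f) (Mul g).
Proof.
move=> hf fi mg gj ij; have If := inner_isom hf; have mf := inner_multiplier hf.
split=> x; first exact: MulC.
have [B gB] := sq_Mul mg; have gl := Mul_lin mg; have al := adj_lin H If.
pose D y := adj (Mul f) (Mul g y) - Mul g (adj (Mul f) y).
have Dl : islin D.
  by move=> c u v; rewrite /D gl !al gl scalerBr opprD addrACA.
have DB y : sq dot (D y) <= 4 * `|B| * sq dot y.
  have h4 := sq_adj H y If.
  have h9 u : sq dot u <= sq dot y -> B * sq dot u <= `|B| * sq dot y.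
    move=> uy; apply: le_trans (ler_wpM2r (sq_ge0 H u) (ler_norm B)) _.
    exact: ler_wpM2l.
  have k1 := le_trans (sq_adj H (Mul g y) If) (le_trans (gB y) (h9 y (lexx _))).
  have k2 := le_trans (gB (adj (Mul f) y)) (h9 _ h4).
  apply: (le_trans (sqD_le H _ _)); rewrite (sqN H).
  have -> : 4 * `|B| * sq dot y = 2 * (`|B| * sq dot y) + 2 * (`|B| * sq dot y) by ring.
  by apply: lerD; apply: ler_wpM2l.
apply/eqP; rewrite -subr_eq0; apply/eqP.
apply: (csub_dense (csub_ker H Dl DB)) => beta /=; apply/eqP; rewrite subr_eq0; apply/eqP.
set q := adj (Mul f) (chi beta); have mq : multiplier q := multiplier_adj_chi beta hf.
have [Bq qB] := sq_Mul mq.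
apply: coefH_inj; apply/funext => gamma; rewrite -!dot_chi (dot_adj H _ _ If).
have Ib := isom_monom (R := R) beta.
have cs := csub_dot H (chi gamma) (adj (Mul (monom beta)) (Mul f (chi gamma))) (Mul_lin mq) qB.
have E := csub_dense_supp cs _ (supp_HdM mg gj).
have -> : Mul g (chi beta) = Mul (monom beta) (HdM g).
  apply: Hd_ext => z zp; rewrite !MulE//; last exact: multiplier_monom.
  by rewrite HdME// chiE// mulrC.
have -> : Mul g q = Mul q (HdM g).
  by apply: Hd_ext => z zp; rewrite !MulE// HdME// mulrC.
rewrite -(dot_adjr H _ _ Ib); apply/esym/E => alpha aj /=; rewrite (dot_adjr H _ _ Ib).
have -> : Mul q (chi alpha) = Mul (monom alpha) q.
  apply: Hd_ext => z zp; rewrite !MulE//; last exact: multiplier_monom.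
  by rewrite chiE// mulrC.
rewrite -(dcomm_monom hf fi (aj i ij)).2 (dot_adj H _ _ If) !Mul_chi.
by have -> : addm beta alpha = addm alpha beta by apply/funext => k; exact: addnC.
Qed.

End DoublyCommuting.

(** * Finite Blaschke products *)

Section Blaschke.
Context {R : realType} {n : nat}.
Local Notation C := R[i].
Local Notation fct := ('rV[C]_n -> C).
Local Notation V := (@Hd R n).
Local Notation dot := (@dotH R n).
Local Notation H := (@Hd_hilbert R n).
Local Notation adj := (@adj R V dot).
Local Notation pr := (@pr R V dot).
Implicit Types (f g h : fct) (x y : V) (alpha beta gamma : 'I_n -> nat) (z w : 'rV[C]_n) (a b c : C).

Definition blaschke j a : fct := fun z => (z ord0 j - a) / (1 - conjc a * z ord0 j).

Lemma blaschke_den_ge a c : normc a < 1 -> normc c <= 1 ->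
  1 - normc a <= normc (1 - conjc a * c).
Proof.
move=> a1 c1; have := le_normcB 1 (conjc a * c); rewrite normc1 normcM normc_conj.
have : normc a * normc c <= normc a by rewrite ler_piMr ?normc_ge0.
lra.
Qed.

Lemma blaschke_den_neq0 a c : normc a < 1 -> normc c <= 1 -> 1 - conjc a * c != 0.
Proof.
move=> a1 c1; rewrite -normc_eq0 gt_eqF// (lt_le_trans _ (blaschke_den_ge a1 c1))//.
by rewrite subr_gt0.
Qed.

Lemma polydisc_le1 z j : polydisc z -> normc (z ord0 j) <= 1.
Proof. by move=> zp; have := zp j; rewrite normr_lt1 => /ltW. Qed.

Lemma multiplier_affine j (a b : C) : multiplier (fun z => a + b * z ord0 j).
Proof.
apply: (eq_multiplier _ (multiplier_lin b (multiplier_monom (em j)) (multiplier_cst a))).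
by move=> z zp; rewrite fctE /= monom_em addrC.
Qed.

Lemma inner_blaschke j a : normc a < 1 -> inner_function (blaschke j a).
Proof.
move=> a1; split.
- move=> z zp; have [an _] := multiplier_affine j (- a) 1.
  have [ad _] := multiplier_affine j 1 (- conjc a).
  have d0 : 1 + - conjc a * z ord0 j != 0.
    by rewrite mulNr blaschke_den_neq0// polydisc_le1.
  have := differentiableM (an z zp) (differentiableV (ad z zp) d0).
  congr (differentiable _ z); apply/funext => w.
  transitivity ((- a + 1 * w ord0 j) * (1 + - conjc a * w ord0 j)^-1) => //.
  by rewrite /blaschke mulNr mul1r addrC.
- exists (2 / (1 - normc a)) => z zp; rewrite normr_leC normcM normcV.
  have d0 : 0 < 1 - normc a by rewrite subr_gt0.
  have h := blaschke_den_ge a1 (polydisc_le1 j zp).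
  apply: ler_pM; rewrite ?normc_ge0 ?invr_ge0 ?normc_ge0//.
    rewrite (le_trans (le_normcD _ _))// normcN; have := polydisc_le1 j zp; move: a1; lra.
  by rewrite lef_pV2 ?posrE// (lt_le_trans d0).
apply: aeW => t; pose w : C := circ 1 (tnth t j).
have w1 : normc w = 1 by rewrite /w normc_circ// ler01.
have d0 : 1 - conjc a * w != 0 by rewrite blaschke_den_neq0// w1.
exists ((w - a) / (1 - conjc a * w)).
  rewrite norm_normc normcM normcV.
  have -> : w - a = w * conjc (1 - conjc a * w).
    rewrite conjcB conjc1 conjcM conjcK mulrBr mulr1 mulrCA mulcJ w1 expr1n.
    by rewrite mulr1.
  by rewrite normcM w1 mul1r normc_conj divff// normc_eq0.
have cw : r%:C * w @[r --> (1 : R)^'-] --> w.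
  apply/cvgC_left => e e0; exists e => // r r1 r2.
  have -> : r%:C * w - w = (r - 1)%:C * w by rewrite rmorphB mulrBl mul1r.
  by rewrite normcM w1 mulr1 normcR ltr0_norm; lra.
have hc := cvgM (cvgB cw (cvg_cst a))
  (cvgV d0 (cvgB (cvg_cst (1 : C)) (cvgM (cvg_cst (conjc a)) cw))).
suff -> : (fun r : R => blaschke j a (r%:C *: torus_point t)) =
    (fun r => (r%:C * w - a) * (1 - conjc a * (r%:C * w))^-1) by exact: hc.
by apply/funext => r; rewrite /blaschke -/(tpt r t) tptE.
Qed.

Lemma upd_polydisc z j c : polydisc z -> normc c < 1 -> polydisc (upd z j c).
Proof. by move=> zp c1 k; rewrite updE; case: ifP => // _; rewrite normr_lt1. Qed.

(** Let [e] be the component of [x] orthogonal to the range. Then $(1-\bar az_j)e$ is orthogonal to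
    all multiples of $z_j$, so it is free of $z_j$; it vanishes where $z_j=a$, because [x] and the
    Blaschke factor do, hence everywhere. *)
Lemma blaschke_divides j a x : normc a < 1 ->
  (forall z, polydisc z -> z ord0 j = a -> x z = 0) -> range (Mul (blaschke j a)) x.
Proof.
move=> a1 xa; have ib := inner_blaschke j a1; have Ib := inner_isom ib.
have mb := inner_multiplier ib; have Ij := isom_shift (R := R) j.
pose e := x - pr (Mul (blaschke j a)) x.
have e0 : adj (Mul (blaschke j a)) e = 0 by exact: (adj_sub_pr H).
pose e' := e - conjc a *: zshift j e.
have e'0 : adj (zshift j) e' = 0.
  apply/(adj_eq0P H _ Ij) => y.
  rewrite (dotBl H) (dotZl H) (isom_dot H _ _ Ij) -(dotZr H) -(dotBr H).
  have -> : zshift j y - a *: y = Mul (blaschke j a) (y - conjc a *: zshift j y).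
    apply: Hd_ext => z zp; rewrite MulE// !HdB !HdZ !shiftE /blaschke.
    have := blaschke_den_neq0 a1 (polydisc_le1 j zp).
    by move=> d0; field.
  by rewrite (adj_eq0P H _ Ib).1.
have e00 : e = 0.
  apply: Hd_ext => z zp; rewrite Hd0.
  have up := upd_polydisc j zp a1.
  have : e' z = e' (upd z j a).
    apply: (supp_eval ((adj_shift_eq0 j e').1 e'0)) => // alpha /= aj.
    by apply: monom_eq => k ak; rewrite updE; case: eqP => // kj; rewrite kj in ak.
  rewrite {2}/e' HdB HdZ shiftE.
  have -> : e (upd z j a) = 0.
    rewrite /e HdB /pr MulE// xa//; last by rewrite updE eqxx.
    by rewrite /blaschke updE eqxx subrr !mul0r subrr.
  rewrite !mulr0 subrr /e' HdB HdZ shiftE mulrA -{1}[e z]mul1r -mulrBl => /eqP.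
  by rewrite mulf_eq0 (negPf (blaschke_den_neq0 a1 (polydisc_le1 j zp))) => /eqP.
exists (adj (Mul (blaschke j a)) x) => //.
by move/eqP: e00; rewrite /e subr_eq0 => /eqP/esym.
Qed.

Lemma only_adj j x : supp (only j) x <-> forall i, i != j -> adj (zshift i) x = 0.
Proof.
split=> [hx i ij|hx alpha ha].
  by apply/adj_shift_eq0 => alpha /= ai; apply: hx => h; apply: ai; exact: h.
have [k kj ak] : exists2 k, k != j & alpha k != 0%N.
  apply: contrapT => h; apply: ha => k kj; apply/eqP/negPn/negP => ak.
  by apply: h; exists k.
by apply: ((adj_shift_eq0 k x).1 (hx k kj)) => /= /eqP; exact/negP.
Qed.

(** $x=M_g^*(gx)$, and $M_g^*$ commutes with all backward shifts. *)
Lemma only_quotient j g x : inner_function g ->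
  supp (only j) (Mul g x) -> supp (only j) x.
Proof.
move=> hg /only_adj hx; apply/only_adj => i ij; have Ig := inner_isom hg.
have mg := inner_multiplier hg.
rewrite -(adjK H x Ig) (adj_comm H _ (isom_shift i) Ig); last first.
  by move=> y; exact: MulC (multiplier_monom (em i)) mg.
by rewrite hx// (islin0 (adj_lin H Ig)).
Qed.

Definition hpoly j (p : {poly C}) : fct := fun z => p.[z ord0 j].

Lemma multiplier_poly j p : multiplier (hpoly j p).
Proof.
elim/poly_ind: p => [|p c IH].
  by apply: (eq_multiplier _ (multiplier_cst 0)) => z _; rewrite /hpoly horner0.
apply: (eq_multiplier _ (multiplier_lin 1 (multiplierM IH (multiplier_monom (em j))) (multiplier_cst c))).
by move=> z _; rewrite fctE /= mul1r monom_em /hpoly hornerMXaddC.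
Qed.

(** Here $x/c=M_g^*1$. The adjoint of a multiplication does not raise exponents, so this is a
    constant; [g] is its inverse, of modulus 1 by the isometry property, and the Blaschke product is
    empty. *)
Lemma inner_unit_const j g x c : inner_function g -> c != 0 ->
  (forall z, polydisc z -> c = g z * x z) -> finite_Blaschke_product j g.
Proof.
move=> hg c0 gx; have Ig := inner_isom hg; have mg := inner_multiplier hg.
pose o : V := chi (fun=> 0%N); pose k := c^-1 *: x.
have o1 z : polydisc z -> o z = 1 by move=> zp; rewrite chiE// /monom big1.
have gk : Mul g k = o.
  by apply: Hd_ext => z zp; rewrite MulE// HdZ o1// mulrCA -gx// mulVf.
have kc : supp [set alpha | forall j, alpha j = 0%N] k.
  move=> gamma g0; rewrite -(adjK H k Ig) gk -dot_chi (dot_adj H _ _ Ig) (dotC H) dot_chi.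
  have -> : Mul g (chi gamma) = Mul (monom gamma) (HdM g).
    apply: Hd_ext => z zp; rewrite !MulE//; last exact: multiplier_monom.
    by rewrite HdME// chiE// mulrC.
  rewrite coef_shift0 ?conjc0// => h; apply: g0 => i.
  by apply/eqP; rewrite -leqn0.
have z0p : polydisc (0 : 'rV[C]_n) by move=> i; rewrite mxE normr0.
have kE z : polydisc z -> g z = (k 0)^-1.
  move=> zp; have := o1 z zp; rewrite -gk MulE// (supp_eval kc zp z0p).
    by move=> E; have k0 : k 0 != 0 by [apply: contra_eq_neq E => ->; rewrite mulr0 eq_sym oner_eq0];
      apply: (mulIf k0); rewrite E mulVf.
  by move=> alpha a0; apply: monom_eq => i; rewrite a0.
exists (k 0)^-1, [::]; split=> //; last by move=> z zp; rewrite big_nil mulr1 kE.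
have : sq dot (Mul g o) = sq dot o by rewrite Ig.2.
have -> : Mul g o = (k 0)^-1 *: o by apply: Hd_ext => z zp; rewrite MulE// HdZ kE.
have so : sq dot o != 0.
  apply/eqP => /(sq_eq0 H) o0; have := o1 0 z0p; rewrite o0 Hd0 => /eqP.
  by rewrite eq_sym oner_eq0.
rewrite (sqZ H) => /eqP; rewrite -subr_eq0 -{2}[sq dot o]mul1r -mulrBl mulf_eq0 (negPf so) orbF.
rewrite subr_eq0 sqrp_eq1 ?normc_ge0// => /eqP h.
by rewrite norm_normc h.
Qed.

End Blaschke.

(** * Inner functions whose range contains a polynomial *)

Section PolyRange.
Context {R : realType} {n : nat}.
Local Notation C := R[i].
Local Notation fct := ('rV[C]_n -> C).
Local Notation V := (@Hd R n).
Local Notation dot := (@dotH R n).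
Local Notation H := (@Hd_hilbert R n).
Local Notation adj := (@adj R V dot).
Local Notation pr := (@pr R V dot).
Implicit Types (f g : fct) (x y : V) (z w : 'rV[C]_n) (a c : C) (p q : {poly C}).

(* With [p = q * ('X - a)] and [b] the Blaschke factor at [a], dividing
   [p = b g k] by [b] gives [(1 - conj a z) q = g k], and multiplication by
   [1 - conj a z] is invertible modulo the range of [g]. *)
Lemma poly_range_factor j a q g x : normc a < 1 -> inner_function g ->
  (forall z, polydisc z -> (q * ('X - a%:P)).[z ord0 j] = blaschke j a z * (g z * x z)) ->
  range (Mul g) (HdM (hpoly j q)).
Proof.
move=> a1 hg hq; have Ig := inner_isom hg; have mg := inner_multiplier hg.
have ib := inner_blaschke j a1; have mb := inner_multiplier ib.
have mq := multiplier_poly j q; set u := HdM _; have Ij := isom_shift (R := R) j.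
have E : 1 *: u - conjc a *: zshift j u = Mul g x.
  apply: (isom_inj H (inner_isom ib)); apply: Hd_ext => z zp.
  rewrite !MulE// -hq// !HdB !HdZ shiftE HdME// hornerM hornerXsubC /hpoly /blaschke.
  have := blaschke_den_neq0 a1 (polydisc_le1 j zp).
  by move=> d0; field.
apply: (@csub_resolvent _ _ _ H (range (Mul g)) (zshift j) 1 (conjc a)).
- exact: (isom_csub H Ig).
- exact: Ij.1.
- by move=> y; rewrite Ij.2.
- move=> _ [y _ <-]; exists (zshift j y); first exact: I.
  exact: (MulC y mg (multiplier_monom (em j))).
- by rewrite normc_conj normc1.
- by rewrite E; exists x.
Qed.

(** Let [e] be the component of [q] orthogonal to $gH^2$. Then $d=(z_j-a)e$ lies in $gH^2$, so
    $d\perp e$ and $\|d\|^2=(1-|a|^2)\|e\|^2\le0$. *)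
Lemma poly_range_outside j a q g x : 1 <= normc a -> inner_function g ->
  (forall z, polydisc z -> (q * ('X - a%:P)).[z ord0 j] = g z * x z) ->
  range (Mul g) (HdM (hpoly j q)).
Proof.
move=> a1 hg hq; have Ig := inner_isom hg; have mg := inner_multiplier hg.
have mq := multiplier_poly j q; set u := HdM _; have Ij := isom_shift (R := R) j.
pose e := u - pr (Mul g) u.
have e0 : adj (Mul g) e = 0 by exact: (adj_sub_pr H).
pose d := zshift j e - a *: e.
have de : dot d e = 0.
  have -> : d = Mul g (x - zshift j (adj (Mul g) u) + a *: adj (Mul g) u).
    apply: Hd_ext => z zp; rewrite MulE// HdD !HdB !HdZ !shiftE /e !HdB /pr MulE// HdME//.
    have := hq z zp; rewrite hornerM hornerXsubC -/(hpoly j q z) !mulrDr => <-.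
    by ring.
  by rewrite (dotC H) (adj_eq0P H _ Ig).1// conjc0.
have dE : dot (zshift j e) e = a * (sq dot e)%:C.
  by move/eqP: de; rewrite (dotBl H) (dotZl H) subr_eq0 (dotxx H) => /eqP.
have d0 : d = 0.
  apply/(sq_eq0 H)/eqP; rewrite eq_le (sq_ge0 H) andbT.
  suff -> : sq dot d = (1 - normc a ^+ 2) * sq dot e.
    by rewrite mulr_le0_ge0 ?(sq_ge0 H)// subr_le0 exprn_ege1.
  rewrite (sqB H) (sqZ H) Ij.2 (dotZr H) dE mulrA [conjc a * a]mulrC mulcJ.
  by rewrite -rmorphM /=; ring.
have e00 : e = 0.
  apply: Hd_ext => z zp; rewrite Hd0; have : d z = 0 by rewrite d0 Hd0.
  rewrite /d HdB HdZ shiftE -mulrBl => /eqP; rewrite mulf_eq0 subr_eq0 => /orP[|/eqP//].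
  move=> /eqP za; have := zp j; rewrite normr_lt1 za => /(le_lt_trans a1).
  by rewrite ltxx.
by exists (adj (Mul g) u) => //; move/eqP: e00; rewrite /e subr_eq0 => /eqP/esym.
Qed.

(** Induction on the size of [p], removing a root [a]. A root outside the open disc is cancelled.
    For a root inside, either [g] vanishes where $z_j=a$ and gives up a Blaschke factor, or [x]
    does: one nonzero value of [g] there suffices, as [g] depends on $z_j$ only. *)
Lemma poly_range_Blaschke j p g x : p != 0 -> inner_function g -> depends_only_on j g ->
  (forall z, polydisc z -> p.[z ord0 j] = g z * x z) -> finite_Blaschke_product j g.
Proof.
move: {2}(size p) (erefl (size p)) => d; elim: d p g x => [|d IH] p g x sp p0 hg gj hp.
  by move: p0; rewrite -size_poly_eq0 sp.
have [/eqP p1|p1] := boolP (size p == 1%N).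
  have [c c0 pc] := size_poly1P _ (introT eqP p1).
  by apply: (@inner_unit_const _ _ j g x c) => // z zp; rewrite -hp// pc hornerC.
have [a /factor_theorem[q pq]] := closed_rootP _ p1.
have q0 : q != 0 by apply: contraNneq p0 => q0; rewrite pq q0 mul0r.
have sq : size q = d.
  by move: sp; rewrite pq size_Mmonic ?monicXsubC// size_XsubC addn2 /= => -[].
have mg := inner_multiplier hg.
have finish g' : inner_function g' -> depends_only_on j g' ->
    range (Mul g') (HdM (hpoly j q)) -> finite_Blaschke_product j g'.
  move=> hg' gj' [y _ qy]; apply: (IH q g' y) => // z zp.
  by rewrite -(MulE _ _ (inner_multiplier hg')) qy (HdME (multiplier_poly j q) zp).
have [a1|a1] := leP 1 (normc a).
  by apply: finish => //; apply: (@poly_range_outside j a q g x a1 hg) => z zp; rewrite -pq hp.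
have ib := inner_blaschke j a1; have mb := inner_multiplier ib.
have [ga|] := pselect (forall z, polydisc z -> z ord0 j = a -> g z = 0).
  have [|g' _ gE] := @blaschke_divides _ _ j a (HdM g) a1.
    by move=> z zp za; rewrite HdME// ga.
  have g'E z : polydisc z -> g z = blaschke j a z * g' z.
    by move=> zp; rewrite -(MulE _ _ mb) gE HdME.
  have hg' : inner_function g' by exact: inner_quotient ib hg g'E.
  have gj' : depends_only_on j g'.
    apply/supp_only/(only_quotient ib).
    by rewrite gE; exact: supp_HdM.
  have [] := finish g' hg' gj'.
    by apply: (poly_range_factor (x := x) a1 hg') => z zp; rewrite -pq hp// g'E// mulrA.
  move=> c [s [c1 hs sE]]; exists c, (a :: s); split=> //.
    move=> b; rewrite inE => /orP[/eqP ->|]; last exact: hs.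
    by rewrite normr_lt1.
  by move=> z zp; rewrite g'E// sE// big_cons mulrCA.
move=> /existsNP[z0 /not_implyP[z0p /not_implyP[z0a /eqP gz0]]].
have xa z : polydisc z -> z ord0 j = a -> x z = 0.
  move=> zp za; have := hp z zp; rewrite pq hornerM hornerXsubC za subrr mulr0.
  rewrite (gj z z0 zp z0p); last by rewrite za z0a.
  by move/esym/eqP; rewrite mulf_eq0 (negPf gz0) => /eqP.
have [x' _ xE] := blaschke_divides a1 xa.
apply: finish => //; apply: (poly_range_factor (x := x') a1 hg) => z zp.
by rewrite -pq hp// -xE MulE// mulrCA.
Qed.

End PolyRange.

(** * Quotient modules *)

Section Link.
Context {R : realType} {n : nat}.
Local Notation C := R[i].
Local Notation fct := ('rV[C]_n -> C).
Local Notation V := (@Hd R n).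
Local Notation dot := (@dotH R n).
Local Notation H := (@Hd_hilbert R n).
Local Notation csub := (@csub R V dot).
Local Notation oproj := (@oproj R V dot).
Local Notation isom := (@isom R V dot).
Implicit Types (f g : fct) (x y : V) (N : set V) (M : set fct) (z : 'rV[C]_n).

(** Transports subspaces of the bundled [Hd] to sets of plain functions, the language of the
    theorem. *)
Definition hset N : set fct := [set f | hardy f /\ N (toHd f)].

Lemma hset_Hd N x : hset N x <-> N x.
Proof.
rewrite /hset /mkset toHdK; split=> [[]//|Nx]; split=> //.
exact: Hd_hardy.
Qed.

Lemma Hd_of_hardy f : hardy f -> exists x : V, f = x.
Proof. by move=> hf; exists (toHd f); rewrite toHdE. Qed.

Lemma hset_restrict M : M `<=` hardy -> M = hset [set x : V | M x].
Proof.
move=> Mh; apply/seteqP; split=> f.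
  by move=> Mf; split; [exact: Mh|rewrite /= toHdE//; exact: Mh].
by move=> [hf /=]; rewrite toHdE.
Qed.

Lemma hardy_norm_lt x (e : R) : 0 < e -> (hardy_norm x < e%:E)%E <-> sq dot x < e ^+ 2.
Proof.
move=> e0; have hx := Hd_hardy x; have h0 := @hardy_norm_ge0 R n x.
have hoo : (hardy_norm x < +oo)%E by case: hx.
have hE : hardy_norm x = (fine (hardy_norm x))%:E by rewrite fineK// ge0_fin_numE.
rewrite sqH /sqnorm {1}hE lte_fin ltr_pXn2r ?nnegrE ?(ltW e0)//.
exact: fine_ge0.
Qed.

Lemma closed_subspaceP N : closed_subspace (hset N) <-> csub N.
Proof.
split=> [[Mh M0 Ml Mc]|[N0 Nl Nc]].
  split.
  - by move: M0 => [_]; rewrite -[0 : fct]/((0 : V) : fct) toHdK.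
  - by move=> c x y /hset_Hd Nx /hset_Hd Ny; apply/hset_Hd; exact: Ml.
  - move=> x hx; apply/hset_Hd/Mc; first exact: Hd_hardy.
    move=> e e0; have [y Ny xy] := hx _ (exprn_gt0 2 e0).
    exists y; first exact/hset_Hd.
    exact/(@hardy_norm_lt (x - y) e e0).
split.
- by move=> f [].
- by apply/(hset_Hd N 0).
- move=> c f g [hf Nf] [hg Ng].
  have -> : c \*o f + g = ((c *: toHd f + toHd g : V) : fct).
    by rewrite Hd_lin !toHdE.
  by apply/hset_Hd/Nl.
- move=> _ /Hd_of_hardy[x ->] hx; apply/hset_Hd/Nc => e e0.
  have s0 : 0 < Num.sqrt e by rewrite sqrtr_gt0.
  have [g [hg Ng] xg] := hx _ s0; have [y yE] := Hd_of_hardy hg.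
  rewrite yE toHdK in Ng xg; exists y => //.
  by have := (@hardy_norm_lt (x - y) _ s0).1 xg; rewrite sqr_sqrtr// ltW.
Qed.

Lemma hardy_projE N x : csub N -> hardy_proj (hset N) x = oproj N x.
Proof.
move=> hN; have [Np hp] := projP H x hN; rewrite /hardy_proj.
case: xgetP => [g _ [[hg Ng] hh]|/(_ (oproj N x : fct)) nh].
  have [y yE] := Hd_of_hardy hg; rewrite yE toHdK in Ng hh *.
  apply/esym; congr hfun; apply: (proj_uniq H) => // z Nz.
  by apply: hh; exact/hset_Hd.
exfalso; apply: nh; split; first exact/hset_Hd.
by move=> h [/Hd_of_hardy[y ->]]; rewrite toHdK => Ny; exact: hp.
Qed.

(** Orthogonality to the algebraic sum is orthogonality to each summand, and that is an equation for
    the adjoint by [adj_eq0P]. *)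
Lemma quotient_moduleE (L : {set 'I_n}) (phi : 'I_n -> fct) :
  (forall l, l \in L -> inner_function (phi l)) ->
  quotient_module L phi = hset (cap dot (fun l => Mul (phi l)) (enum L)).
Proof.
move=> hphi; have mphi l : l \in L -> multiplier (phi l).
  by move=> /hphi; exact: inner_multiplier.
have iphi l : l \in L -> isom (Mul (phi l)) by move=> /hphi; exact: inner_isom.
apply/seteqP; split=> f [/Hd_of_hardy[x ->] hx].
  apply/hset_Hd => l; rewrite mem_enum => lL; apply/(adj_eq0P H _ (iphi l lL)) => y.
  apply: hx; exists (fun k => if k == l then (y : fct) else 0).
    by move=> k; case: ifP => _; [exact: Hd_hardy|exact: hardy0].
  apply/funext => z; rewrite MulE; last exact: mphi.
  rewrite (bigD1 l)//= eqxx big1 ?addr0// => k /andP[_ /negPf ->].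
  by rewrite mulr0.
rewrite toHdK in hx; split; first exact: Hd_hardy.
move=> _ [h hh <-].
have -> : (fun z => \sum_(l in L) phi l z * h l z) =
    ((\sum_(l <- enum L) Mul (phi l) (toHd (h l)) : V) : fct).
  apply/funext => z; rewrite Hd_sum -big_enum; apply: eq_big_seq => l /=.
  by rewrite mem_enum => lL; rewrite MulE ?toHdE//; exact: mphi.
rewrite -/(dotH x _) (dot_sumr H) big_seq big1// => l lL.
by apply: (adj_eq0P H _ (iphi l _)).1; [rewrite -mem_enum|exact: hx].
Qed.

Lemma finite_rank_projectionP N1 N2 : csub N1 -> csub N2 ->
  finite_rank_projection (fun f => hardy_proj (hset N1) (hardy_proj (hset N2) f)) <->
  (exists2 N, csub N & forall x, oproj N1 (oproj N2 x) = oproj N x) /\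
  exists m (e : 'I_m -> fct), forall x, exists c : 'I_m -> C,
    (oproj N1 (oproj N2 x) : fct) = \sum_(k < m) c k \*o e k.
Proof.
move=> h1 h2.
have PE x : hardy_proj (hset N1) (hardy_proj (hset N2) x) = oproj N1 (oproj N2 x) :> fct.
  by rewrite !hardy_projE.
split=> [[[M cM hM] [m [e he]]]|[[N hN NE] [m [e he]]]]; split.
- have [Mh _ _ _] := cM; have E := hset_restrict Mh.
  move: cM hM; rewrite E => /closed_subspaceP cN hM; eexists; first exact: cN.
  move=> x; apply: val_inj => /=.
  by rewrite -PE hM ?hardy_projE//; exact: Hd_hardy.
- exists m, e => x; have [c hc] := he x (Hd_hardy x); exists c.
  by rewrite -PE.
- exists (hset N); first exact/closed_subspaceP.
  by move=> _ /Hd_of_hardy[x ->]; rewrite PE NE hardy_projE.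
- exists m, e => _ /Hd_of_hardy[x ->]; have [c hc] := he x; exists c.
  by rewrite PE.
Qed.

End Link.

(** * Finite dimension from finite Blaschke products *)

Section FiniteCodimension.
Context {R : realType} {n : nat}.
Local Notation C := R[i].
Local Notation fct := ('rV[C]_n -> C).
Local Notation V := (@Hd R n).
Local Notation dot := (@dotH R n).
Local Notation H := (@Hd_hilbert R n).
Local Notation adj := (@adj R V dot).
Implicit Types (f g : fct) (x y : V) (N : set V) (z : 'rV[C]_n) (alpha beta : 'I_n -> nat).

(** Clearing denominators, $\prod_a(z_j-a)=f\cdot c^{-1}\prod_a(1-\bar az_j)$, so the multiples of
    this polynomial lie in the range of [Mul f]. *)
Lemma Blaschke_poly j f : inner_function f -> finite_Blaschke_product j f ->
  exists2 p : {poly C}, p \is monic &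
    forall x, adj (Mul f) x = 0 -> forall y, dot x (Mul (hpoly j p) y) = 0.
Proof.
move=> hf [c [s [c1 hs fE]]]; have mf := inner_multiplier hf.
have c0 : c != 0 by rewrite -normr_eq0 c1 oner_eq0.
exists (\prod_(a <- s) ('X - a%:P)); first exact: monic_prod_XsubC.
move=> x /(adj_eq0P H _ (inner_isom hf)) hx y.
pose q := \prod_(a <- s) (1 - (conjc a)%:P * 'X).
have mp := multiplier_poly j (\prod_(a <- s) ('X - a%:P)); have mq := multiplier_poly j q.
have -> : Mul (hpoly j (\prod_(a <- s) ('X - a%:P))) y = Mul f (c^-1 *: Mul (hpoly j q) y).
  apply: Hd_ext => z zp; rewrite !MulE// HdZ MulE//.
  pose w := z ord0 j; pose B := \prod_(a <- s) ((w - a) / (1 - conjc a * w)).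
  have -> : f z = c * B by exact: fE.
  have -> : hpoly j (\prod_(a <- s) ('X - a%:P)) z = B * hpoly j q z.
    rewrite /hpoly /q !horner_prod /B -big_split; apply: eq_big_seq => a /hs /= a1.
    rewrite hornerXsubC hornerD hornerN hornerM !hornerC hornerX -/w divfK//.
    by apply: blaschke_den_neq0 (polydisc_le1 j zp); rewrite -normr_lt1.
  by rewrite -[RHS]mulrA [B * (c^-1 * _)]mulrCA mulVKf// mulrA.
exact: hx.
Qed.

Definition kem k (j : 'I_n) : 'I_n -> nat := fun i => (k * em j i)%N.

Lemma monom_kem k j z : monom (kem k j) z = z ord0 j ^+ k.
Proof.
rewrite /monom (bigD1 j)//= /kem /em eqxx muln1 big1 ?mulr1// => i /negPf ->.
by rewrite muln0 expr0.
Qed.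

Lemma deg_kem k j beta : deg (addm (kem k j) beta) = (k + deg beta)%N.
Proof.
rewrite /deg /addm big_split/=; congr (_ + _)%N.
rewrite (bigD1 j)//= /kem /em eqxx muln1 big1 ?addn0// => i /negPf ->.
by rewrite muln0.
Qed.

Lemma Mul_poly_chi j (p : {poly C}) beta :
  Mul (hpoly j p) (chi beta) = \sum_(k < size p) p`_k *: chi (addm (kem k j) beta).
Proof.
apply: Hd_ext => z zp; rewrite MulE; last exact: multiplier_poly.
rewrite Hd_sum /hpoly horner_coef mulr_suml; apply: eq_bigr => k _.
by rewrite HdZ !chiE// monomD monom_kem mulrA.
Qed.

(** Orthogonality to $p_j\chi_\beta$ expresses the coefficient at $\beta+me_j$, with $m=\deg p_j$,
    through coefficients of lower degree. By induction on the degree the coefficients in one cube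
    determine [x], and [finite_span] applies to them. *)
Lemma finite_dim_of_poly N (p : 'I_n -> {poly C}) :
  (forall c x y, N x -> N y -> N (c *: x + y)) -> (forall j, p j \is monic) ->
  (forall j x y, N x -> dot x (Mul (hpoly j (p j)) y) = 0) ->
  exists e : seq V, forall x, N x -> exists c : nat -> C, x = \sum_(k < size e) c k *: e`_k.
Proof.
(* An exponent above [D] in $z_j$ leaves room for the full degree of [p j]. *)
move=> Nl pm pN; pose D := (\max_j size (p j))%N.
pose a0 : {ffun 'I_n -> 'I_D.+1} := [ffun=> ord0].
pose L k x := coef x (expo (nth a0 (enum {ffun 'I_n -> 'I_D.+1}) k)).
apply: (@finite_span _ _ #|{ffun 'I_n -> 'I_D.+1}| L) => //.
  by move=> k c x y; exact: coefH_lin.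
move=> x Nx Lx.
have box (a : {ffun 'I_n -> 'I_D.+1}) : coef x (expo a) = 0.
  have := Lx (enum_rank a) (ltn_ord _); by rewrite /L nth_enum_rank.
apply: coef_eq0 => alpha; have [d] := ubnP (deg alpha).
elim: d alpha => // d IH alpha ad.
have [/forallP h|] := boolP [forall j, (alpha j < D.+1)%N].
  have <- : expo [ffun j => Ordinal (h j)] = alpha by apply/funext => j; rewrite /expo ffunE.
  exact: box.
rewrite negb_forall => /existsP[j]; rewrite -leqNgt => Dj.
pose m := (size (p j)).-1; have sp : size (p j) = m.+1.
  by rewrite /m prednK// size_poly_gt0 monic_neq0.
have mD : (m <= alpha j)%N.
  apply: (leq_trans _ (ltnW Dj)); apply: (@leq_trans (size (p j))); first by rewrite sp.
  exact: (leq_bigmax (F := fun j => size (p j))).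
pose beta i := (alpha i - kem m j i)%N.
have aE : alpha = addm (kem m j) beta.
  apply/funext => i; rewrite /addm /beta subnKC// /kem /em; case: eqP => [->|_].
    by rewrite muln1.
  by rewrite muln0.
have := pN j x (chi beta) Nx; rewrite Mul_poly_chi sp big_ord_recr /=.
rewrite (dotDr H) (dot_sumr H) big1 => [|k _]; last first.
  rewrite (dotZr H) dot_chi IH ?mulr0//.
  move: ad; rewrite {1}aE !deg_kem; have := ltn_ord k.
  by move=> km; rewrite ltnS; apply: leq_trans; rewrite ltn_add2r.
have -> : (p j)`_m = 1 by have /monicP := pm j; rewrite /lead_coef /m.
by rewrite add0r scale1r dot_chi -aE.
Qed.

End FiniteCodimension.

(** * The conditions give a finite rank projection *)

Section Families.
Context {R : realType} {n : nat}.
Local Notation C := R[i].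
Local Notation fct := ('rV[C]_n -> C).
Local Notation V := (@Hd R n).
Local Notation dot := (@dotH R n).
Local Notation H := (@Hd_hilbert R n).
Local Notation csub := (@csub R V dot).
Local Notation oproj := (@oproj R V dot).
Local Notation isom := (@isom R V dot).
Local Notation adj := (@adj R V dot).
Local Notation pr := (@pr R V dot).
Local Notation dcomm := (@dcomm R V dot).
Implicit Types (f g : fct) (x y : V) (N : set V) (z : 'rV[C]_n) (L : {set 'I_n})
  (phi psi : 'I_n -> fct).

Definition coord_inner L phi := forall l, l \in L ->
  inner_function (phi l) /\ depends_only_on l (phi l).

Definition quot L phi : set V := cap dot (fun l => Mul (phi l)) (enum L).

Lemma quot_adjP L phi x : quot L phi x <-> forall l, l \in L -> adj (Mul (phi l)) x = 0.
Proof. by split=> h l; have := h l; rewrite mem_enum. Qed.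

Lemma coord_isom L phi l : coord_inner L phi -> l \in L -> isom (Mul (phi l)).
Proof. by move=> h /h[/inner_isom]. Qed.

Lemma coord_mult L phi l : coord_inner L phi -> l \in L -> multiplier (phi l).
Proof. by move=> h /h[/inner_multiplier]. Qed.

Lemma coord_dcomm L L' phi psi i j : coord_inner L phi -> coord_inner L' psi ->
  i \in L -> j \in L' -> i != j -> dcomm (Mul (phi i)) (Mul (psi j)).
Proof.
move=> h h' /h[hi di] /h'[hj dj] ij.
exact: (dcomm_Mul hi di (inner_multiplier hj) dj ij).
Qed.

Lemma coord_dcfam L phi : coord_inner L phi -> dcfam dot (fun l => Mul (phi l)) (enum L).
Proof.
move=> h; split=> [i|i j]; rewrite !mem_enum; first exact: coord_isom.
exact: coord_dcomm.
Qed.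

Lemma csub_quot L phi : coord_inner L phi -> csub (quot L phi).
Proof. by move=> h; apply: (csub_cap H) => i; rewrite mem_enum; exact: coord_isom. Qed.

Lemma inner_divides_range f g x : inner_function f -> inner_function g -> inner_divides f g ->
  exists y, Mul g x = Mul f y.
Proof.
move=> hf hg [h hh gE]; exists (Mul h x); apply: Hd_ext => z zp.
by rewrite !MulE ?gE ?mulrA//; exact: inner_multiplier.
Qed.

(** For $t\ne l$ this is double commutation. For $t=l$: if $\varphi_l$ divides $\psi_l$, the vectors
    $\psi_lu$ lie in the range of $M_{\varphi_l}$, so projecting [y] there keeps its inner products
    with them; if $\psi_l$ divides $\varphi_l$, then [y] is already orthogonal to $\varphi_lH^2$ and
    nothing is subtracted. *)
Lemma quot_stable (Lambda Gamma : {set 'I_n}) phi psi :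
  coord_inner Lambda phi -> coord_inner Gamma psi ->
  (forall j, j \in Lambda :&: Gamma ->
    inner_divides (phi j) (psi j) \/ inner_divides (psi j) (phi j)) ->
  forall y, quot Gamma psi y -> quot Gamma psi (oproj (quot Lambda phi) y).
Proof.
move=> hL hG hd y hy.
rewrite [oproj _ _](compr_oproj H y (enum_uniq _) (coord_dcfam hL)).
apply: (compr_inv _ hy) => l {hy}y lL hy.
rewrite mem_enum in lL; move/quot_adjP in hy; apply/quot_adjP => t tG.
have It := coord_isom hG tG; have Il := coord_isom hL lL.
rewrite (islinB _ _ (adj_lin H It)) hy// sub0r.
suff -> : adj (Mul (psi t)) (pr (Mul (phi l)) y) = 0 by rewrite oppr0.
have [tl|tl] := eqVneq t l; last first.
  rewrite (adj_pr H It Il (coord_dcomm hG hL tG lL tl)) hy//.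
  exact: (islin0 (pr_lin H Il)).
subst t; have [hpsi _] := hG l tG; have [hphi _] := hL l lL.
have [|dv|dv] := hd l; first by rewrite inE lL.
  apply/(adj_eq0P H _ It) => u; rewrite (pr_dot H _ _ Il).
  have [v E] := inner_divides_range u hphi hpsi dv.
  by rewrite E (pr_id H _ Il) -E; apply: (adj_eq0P H _ It).1; exact: hy.
rewrite /pr; suff -> : adj (Mul (phi l)) y = 0 by rewrite (islin0 Il.1) (islin0 (adj_lin H It)).
apply/(adj_eq0P H _ Il) => u; have [v ->] := inner_divides_range u hpsi hphi dv.
by apply: (adj_eq0P H _ It).1; exact: hy.
Qed.

Lemma coord_poly (L : {set 'I_n}) phi j : coord_inner L phi -> j \in L ->
  finite_Blaschke_product j (phi j) -> exists2 p : {poly C}, p \is monic &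
    forall x, quot L phi x -> forall y, dot x (Mul (hpoly j p) y) = 0.
Proof.
move=> hL jL hB; have [p pm hp] := Blaschke_poly (hL j jL).1 hB.
by exists p => // x /quot_adjP hx; apply: hp; exact: hx.
Qed.

Lemma finite_rank_if (Lambda Gamma : {set 'I_n}) phi psi :
  coord_inner Lambda phi -> coord_inner Gamma psi -> Lambda :|: Gamma = [set: 'I_n]%SET ->
  (forall i, i \in Lambda :\: (Lambda :&: Gamma) -> finite_Blaschke_product i (phi i)) ->
  (forall j, j \in Gamma :\: (Lambda :&: Gamma) -> finite_Blaschke_product j (psi j)) ->
  (forall j, j \in Lambda :&: Gamma ->
      (inner_divides (phi j) (psi j) /\ finite_Blaschke_product j (phi j))
   \/ (inner_divides (psi j) (phi j) /\ finite_Blaschke_product j (psi j))) ->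
  (exists2 N, csub N & forall x, oproj (quot Lambda phi) (oproj (quot Gamma psi) x) = oproj N x) /\
  exists m (e : 'I_m -> fct), forall x, exists c : 'I_m -> C,
    (oproj (quot Lambda phi) (oproj (quot Gamma psi) x) : fct) = \sum_(k < m) c k \*o e k.
Proof.
move=> hL hG LG h1 h2 h3; have cL := csub_quot hL; have cG := csub_quot hG.
have st : forall y, quot Gamma psi y -> quot Gamma psi (oproj (quot Lambda phi) y).
  by apply: quot_stable => // j /h3[[]|[]]; [left|right].
pose N := quot Lambda phi `&` quot Gamma psi; have cN : csub N by exact: (csubI cL cG).
have PE x : oproj (quot Lambda phi) (oproj (quot Gamma psi) x) = oproj N x.
  exact: (oproj_comp H x cL cG st).
split; first by exists N.
have hp j : exists p : {poly C}, p \is monic /\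
    forall x y, N x -> dot x (Mul (hpoly j p) y) = 0.
  have [jL|jL] := boolP (j \in Lambda); have [jG|jG] := boolP (j \in Gamma).
  - have [|[_ hB]|[_ hB]] := h3 j; first by rewrite inE jL.
      by have [p pm hp] := coord_poly hL jL hB; exists p; split=> // x y [/hp].
    by have [p pm hp] := coord_poly hG jG hB; exists p; split=> // x y [_ /hp].
  - have hB : finite_Blaschke_product j (phi j) by apply: h1; rewrite !inE jL (negPf jG).
    by have [p pm hp] := coord_poly hL jL hB; exists p; split=> // x y [/hp].
  - have hB : finite_Blaschke_product j (psi j) by apply: h2; rewrite !inE jG (negPf jL).
    by have [p pm hp] := coord_poly hG jG hB; exists p; split=> // x y [_ /hp].
  - by have := finset.in_setT j; rewrite -LG inE (negPf jL) (negPf jG).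
have [p hpp] := choice hp.
have [_ Nl _] := cN.
have [e he] := finite_dim_of_poly (N := N) Nl (fun j => (hpp j).1) (fun j => (hpp j).2).
exists (size e), (fun k => (e`_k : fct)) => x.
have [c hc] := he (oproj N x) (proj_in H x cN); exists (fun k => c k).
rewrite PE hc; apply/funext => z; rewrite Hd_sum fct_sumE.
by apply: eq_bigr => k _; rewrite HdZ.
Qed.

End Families.

(** * Products of projections *)

Section CommonVector.
Context {R : realType} {n : nat}.
Local Notation C := R[i].
Local Notation fct := ('rV[C]_n -> C).
Local Notation V := (@Hd R n).
Local Notation dot := (@dotH R n).
Local Notation H := (@Hd_hilbert R n).
Local Notation csub := (@csub R V dot).
Local Notation oproj := (@oproj R V dot).
Local Notation orth := (@orth R V dot).
Local Notation isom := (@isom R V dot).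
Local Notation adj := (@adj R V dot).
Local Notation dcomm := (@dcomm R V dot).
Implicit Types (f g : fct) (x y k : V) (N : set V) (z : 'rV[C]_n) (L : {set 'I_n})
  (phi psi : 'I_n -> fct).

Definition hone : V := chi (fun=> 0%N).

Lemma honeE z : polydisc z -> hone z = 1.
Proof. by move=> zp; rewrite chiE// /monom big1. Qed.

Lemma polydisc0 : polydisc (0 : 'rV[C]_n).
Proof. by move=> j; rewrite mxE normr0. Qed.

Lemma Mul_hone g : multiplier g -> Mul g hone = HdM g.
Proof. by move=> mg; apply: Hd_ext => z zp; rewrite MulE// honeE// HdME// mulr1. Qed.

Lemma dot_hone x : dot x hone = x 0.
Proof.
rewrite dot_chi; apply/eqP; rewrite eq_sym -subr_eq0 -normc_eq0 eq_le normc_ge0 andbT.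
apply/ler_addgt0Pl => e e0; rewrite addr0.
have h0 : (0 : R) < 2^-1 by rewrite invr_gt0.
have h1 : (2^-1 : R) < 1 by rewrite invf_lt1// ltr1n.
have [N hN] := coefP (@Hd_analytic _ _ x) (ltW h0) h1 e0.
have c0 : cpoly (2^-1) (0 : 'rV[C]_n) by move=> j; rewrite mxE normc0 ltW.
have := hN N.+1 0 (leqnSn N) c0.
have -> : psum (coef x) N.+1 0 = coef x (fun=> 0%N); last exact: ltW.
rewrite -(@box_delta R n (coef x) (fun=> 0%N) N.+1); last by rewrite /deg big1.
apply: eq_bigr => alpha _; congr (_ * _).
have [a0|a0] := pselect (expo alpha = fun=> 0%N).
  by rewrite a0 delta_id /monom big1// => j _; rewrite expr0.
rewrite delta_neq; last by move=> h; apply: a0.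
have [j aj] : exists j, expo alpha j <> 0%N.
  by apply/existsNP => h; apply: a0; apply/funext.
by rewrite /monom (bigD1 j)//= mxE expr0n; move/eqP/negPf: aj => ->; rewrite mul0r.
Qed.

Lemma sq_hone : sq dot hone = 1.
Proof.
have : (sq dot hone)%:C = 1 :> C by rewrite -(dotxx H) dot_hone honeE//; exact: polydisc0.
by move=> [].
Qed.

(** $\|f-f(0)\|^2=1-|f(0)|^2$, so modulus 1 at the origin would make [f] constant. *)
Lemma inner_lt1_at0 f : inner_function f -> nonconstant f -> normc (f 0) < 1.
Proof.
move=> hf nf; have mf := inner_multiplier hf; have If := inner_isom hf.
rewrite lt_neqAle (inner_le1 hf polydisc0) andbT; apply/eqP => f1; apply: nf.
exists (f 0) => z zp; have : HdM f - f 0 *: hone = 0.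
  apply: (sq_eq0 H); rewrite (sqB H) (sqZ H) sq_hone f1 -(Mul_hone mf) If.2 sq_hone.
  rewrite (dotZr H) dot_hone Mul_hone// HdME//; last exact: polydisc0.
  by rewrite [conjc _ * _]mulrC mulcJ f1 /=; ring.
move/(congr1 (fun x : V => x z)); rewrite HdB HdZ Hd0 HdME// honeE// mulr1 => /eqP.
by rewrite subr_eq0 => /eqP.
Qed.

(** Tested against $\chi_\gamma$, every power of $z_t$ in the expansion of [f] except the constant
    term pairs to 0 with a vector free of $z_t$. *)
Lemma adj_free t f k : inner_function f -> depends_only_on t f ->
  adj (zshift t) k = 0 -> adj (Mul f) k = conjc (f 0) *: k.
Proof.
move=> hf ft /adj_shift_eq0 kt; have mf := inner_multiplier hf; have If := inner_isom hf.
apply: coefH_inj; apply/funext => gamma; rewrite -!dot_chi (dot_adj H _ _ If) (dotZl H).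
have -> : Mul f (chi gamma) = Mul (monom gamma) (HdM f).
  apply: Hd_ext => z zp; rewrite !MulE//; last exact: multiplier_monom.
  by rewrite HdME// chiE// mulrC.
pose a := dot k (chi gamma).
have [Ml Msq] := isom_monom (R := R) gamma.
have cs := @csub_dot _ _ _ H (Mul (monom gamma)) 1 k (a *: hone) Ml.
have : dot (Mul (monom gamma) (HdM f)) k = dot (HdM f) (a *: hone).
  apply: (csub_dense_supp (cs _) _ (supp_HdM mf ft)) => [x|alpha aj /=].
    by rewrite mul1r Msq.
  rewrite Mul_chi (dotZr H) dot_hone (dotC H) dot_chi.
  have [a0|/eqP at0] := eqVneq (alpha t) 0%N; last first.
    rewrite kt ?conjc0 /=; last by move=> /eqP; rewrite /addm addn_eq0 => /andP[_ /eqP].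
    rewrite -dot_hone dot_chi coef_chi delta_neq ?mulr0// => E.
    by apply: at0; rewrite E.
  have -> : alpha = fun=> 0%N.
    by apply/funext => i; have [->//|it] := eqVneq i t; exact: aj.
  rewrite chiE; last exact: polydisc0.
  rewrite /monom [\prod_(j < n) _]big1// mulr1 /a dot_chi; congr (conjc (coef k _)).
  by apply/funext => i; rewrite /addm addn0.
rewrite (dotZr H) dot_hone HdME//; last exact: polydisc0.
by move=> E; rewrite (dotC H) E conjcM conjcK mulrC.
Qed.

(* Each factor [1 - conj (phi_l 0) phi_l] is the compression of [1] to the
   orthogonal complement of [phi_l H]. *)
Definition kernel_vector phi (s : seq 'I_n) : V :=
  foldr (fun l k => k - conjc (phi l 0) *: Mul (phi l) k) hone s.

Lemma kernel_vector_free L phi s i : coord_inner L phi -> {subset s <= L} -> i \notin s ->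
  adj (zshift i) (kernel_vector phi s) = 0.
Proof.
move=> hL; elim: s => [_ _|l s IH sL /=].
  by apply/adj_shift_eq0 => alpha /= a0; rewrite coef_chi delta_neq// => E; rewrite -E in a0.
rewrite inE negb_or => /andP[il si]; have Ii := isom_shift (R := R) i.
have lL : l \in L by apply: sL; exact: mem_head.
have {IH}h : adj (zshift i) (kernel_vector phi s) = 0.
  by apply: IH => // k ks; apply: sL; rewrite inE ks orbT.
have Il := coord_isom hL lL; have [hi hd] := hL l lL.
have dc : dcomm (zshift i) (Mul (phi l)).
  by apply: (dcomm_sym H Il Ii); apply: (dcomm_shift hi hd); rewrite eq_sym.
rewrite (islinB _ _ (adj_lin H Ii)) (islinZ _ _ (adj_lin H Ii)) dc.2 h.
by rewrite (islin0 Il.1) scaler0 subrr.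
Qed.

(** A new factor is killed by its own adjoint: $M^*(k-\overline{\varphi(0)}\varphi
    k)=\overline{\varphi(0)}k-\overline{\varphi(0)}k$ by [adj_free]. For the other indices double
    commutation moves the adjoint past it. *)
Lemma kernel_vector_quot L phi s : coord_inner L phi -> {subset s <= L} -> uniq s ->
  forall l, l \in s -> adj (Mul (phi l)) (kernel_vector phi s) = 0.
Proof.
move=> hL; elim: s => // l s IH sL /= /andP[ls us] t.
have lL : l \in L by apply: sL; exact: mem_head.
have sL' : {subset s <= L} by move=> k ks; apply: sL; rewrite inE ks orbT.
have Il := coord_isom hL lL; have [hi hd] := hL l lL.
rewrite inE => /orP[/eqP ->|ts].
  rewrite (islinB _ _ (adj_lin H Il)) (islinZ _ _ (adj_lin H Il)) (adjK H _ Il).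
  rewrite (adj_free hi hd) ?subrr//; exact: (kernel_vector_free hL sL' ls).
have tL := sL' t ts; have It := coord_isom hL tL.
have tl : t != l by apply: contraNneq ls => <-.
rewrite (islinB _ _ (adj_lin H It)) (islinZ _ _ (adj_lin H It)).
rewrite (coord_dcomm hL hL tL lL tl).2 (IH sL' us t ts) (islin0 Il.1).
by rewrite scaler0 subrr.
Qed.

Lemma kernel_vector_at0 phi s : (forall l, l \in s -> multiplier (phi l)) ->
  (forall l, l \in s -> normc (phi l 0) < 1) -> kernel_vector phi s 0 != 0.
Proof.
elim: s => [_ _|l s IH h1 h2]; first by rewrite honeE ?oner_eq0//; exact: polydisc0.
rewrite (_ : kernel_vector phi (l :: s) =
  kernel_vector phi s - conjc (phi l 0) *: Mul (phi l) (kernel_vector phi s))//.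
rewrite HdB HdZ MulE; last exact/h1/mem_head.
rewrite mulrA -{1}[kernel_vector phi s 0]mul1r -mulrBl mulf_neq0//; last first.
  by apply: IH => k ks; [apply: h1|apply: h2]; rewrite inE ks orbT.
have v1 := h2 l (mem_head _ _); rewrite [conjc _ * _]mulrC mulcJ subr_eq0.
apply/eqP => -[E]; have : normc (phi l 0) ^+ 2 < 1 by rewrite expr_lt1 ?normc_ge0.
by rewrite -E ltxx.
Qed.

Lemma exists_common_vector (Lambda Gamma : {set 'I_n}) phi psi :
  coord_inner Lambda phi -> coord_inner Gamma psi ->
  (forall l, l \in Lambda -> nonconstant (phi l)) ->
  (forall l, l \in Gamma -> nonconstant (psi l)) ->
  exists x, oproj (quot Lambda phi) (oproj (quot Gamma psi) x) != 0.
Proof.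
move=> hL hG nL nG; have cL := csub_quot hL; have cG := csub_quot hG.
apply: contrapT => h; have P0 x : oproj (quot Lambda phi) (oproj (quot Gamma psi) x) = 0.
  by apply/eqP/negPn/negP => hx; apply: h; exists x.
pose W := orth (quot Lambda phi); have cW : csub W := csub_orth H _.
have kW : W (kernel_vector psi (enum Gamma)).
  have kG : quot Gamma psi (kernel_vector psi (enum Gamma)).
    move=> l; apply: (kernel_vector_quot hG) (enum_uniq _) l => t.
    by rewrite mem_enum.
  have := P0 (kernel_vector psi (enum Gamma)); rewrite (proj_id H cG kG) => p0 z Qz.
  by have := proj_orth H (kernel_vector psi (enum Gamma)) cL Qz; rewrite p0 subr0.
have WM g x : multiplier g -> isom (Mul g) -> W x -> W (Mul g x).
  move=> mg Ig Wx z /quot_adjP Qz; rewrite -(dot_adjr H _ _ Ig); apply: Wx.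
  apply/quot_adjP => l lL; have Il := coord_isom hL lL.
  rewrite (adj_comm H _ Il Ig) ?Qz ?(islin0 (adj_lin H Ig))// => y.
  exact: MulC (coord_mult hL lL) mg.
(* The factors $1-\overline{\psi_l(0)}\psi_l$ are removed one at a time by [csub_resolvent], as
   $|\psi_l(0)|<1$ and [W] is invariant under multiplications. *)
have W1 : W hone.
  move: kW; have : {subset enum Gamma <= Gamma} by move=> l; rewrite mem_enum.
  elim: (enum Gamma) => [//|l s IH sG /= Ws]; apply: IH.
    by move=> t ts; apply: sG; rewrite inE ts orbT.
  have lG : l \in Gamma by apply: sG; exact: mem_head.
  have Il := coord_isom hG lG.
  apply: (csub_resolvent H cW Il.1 (c1 := 1) (c2 := conjc (psi l 0))).
  - by move=> u; rewrite Il.2.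
  - by move=> u; apply: WM => //; exact: coord_mult hG lG.
  - by rewrite normc_conj normc1; apply: inner_lt1_at0 (nG l lG); case: (hG l lG).
  - by rewrite scale1r.
have kL : quot Lambda phi (kernel_vector phi (enum Lambda)).
  move=> l; apply: (kernel_vector_quot hL) (enum_uniq _) l => t.
  by rewrite mem_enum.
(* The kernel vector of the first family pairs with 1 to the conjugate of its value at 0, which is
   nonzero. *)
have := W1 _ kL; rewrite (dotC H) dot_hone => /eqP; rewrite -normc_eq0 normc_conj normc_eq0.
apply/negP/kernel_vector_at0 => l; rewrite mem_enum => lL; first exact: coord_mult hL lL.
by apply: inner_lt1_at0 (nL l lL); case: (hL l lL).
Qed.

End CommonVector.

(** * Commuting projections in one variable force divisibility *)

Section RankTwo.
Context {R : realType} {n : nat}.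
Local Notation C := R[i].
Local Notation fct := ('rV[C]_n -> C).
Local Notation V := (@Hd R n).
Local Notation dot := (@dotH R n).
Local Notation H := (@Hd_hilbert R n).
Local Notation adj := (@adj R V dot).
Local Notation pr := (@pr R V dot).
Local Notation hone := (@hone R n).
Implicit Types (f g : fct) (x y : V) (z w : 'rV[C]_n).

Lemma only_shift j x : supp (only j) x -> supp (only j) (adj (zshift j) x).
Proof.
move=> /only_adj hx; apply/only_adj => i ij.
rewrite (adj_comm H _ (isom_shift i) (isom_shift j)).
  by rewrite hx// (islin0 (adj_lin H (isom_shift j))).
by move=> y; apply: MulC; exact: multiplier_monom.
Qed.

Lemma only_coord_adj j f x : inner_function f ->
  supp (only j) x -> supp (only j) (adj (Mul f) x).
Proof.
move=> hf /only_adj hx; apply/only_adj => i ij; have If := inner_isom hf.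
rewrite (adj_comm H _ (isom_shift i) If).
  by rewrite hx// (islin0 (adj_lin H If)).
by move=> y; exact: MulC (multiplier_monom _) (inner_multiplier hf).
Qed.

Lemma only_Mul j f x : multiplier f -> depends_only_on j f ->
  supp (only j) x -> supp (only j) (Mul f x).
Proof.
move=> mf fj /supp_only hx; apply/supp_only => z w zp wp zw.
by rewrite !MulE// (fj z w zp wp zw) (hx z w zp wp zw).
Qed.

Lemma only_pr j f x : inner_function f -> depends_only_on j f ->
  supp (only j) x -> supp (only j) (pr (Mul f) x).
Proof.
move=> hf fj hx; apply: only_Mul => //; first exact: inner_multiplier.
exact: only_coord_adj.
Qed.

(* The shift commutes with multiplication by [f] and its adjoint, and [1 - S S^*]
   projects one-variable functions onto the constants. *)
Lemma pr_shift j f x : inner_function f -> depends_only_on j f -> supp (only j) x ->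
  pr (Mul f) x = zshift j (pr (Mul f) (adj (zshift j) x)) + dot x (HdM f) *: HdM f.
Proof.
move=> hf fj hx; have mf := inner_multiplier hf; have If := inner_isom hf.
have Ij := isom_shift (R := R) j.
have comm y : Mul f (zshift j y) = zshift j (Mul f y).
  exact: MulC mf (multiplier_monom _).
pose a := adj (Mul f) x; have ha : supp (only j) a by exact: only_coord_adj.
have S1 : adj (zshift j) hone = 0.
  by apply/adj_shift_eq0 => alpha /= a0; rewrite coef_chi delta_neq// => E; rewrite -E in a0.
have E : a - pr (zshift j) a = dot x (HdM f) *: hone.
  set w := a - _; have wj : adj (zshift j) w = 0 by exact: (adj_sub_pr H).
  have wo : supp (only j) w.
    rewrite /w; refine (csubB (csub_supp (only j)) ha _); rewrite /pr /zshift.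
    apply: only_Mul; [exact: multiplier_monom| |exact: only_shift].
    by move=> z z' _ _ zz'; rewrite !monom_em.
  apply: coefH_inj; apply/funext => alpha; rewrite -!dot_chi (dotZl H) [dot hone _]dot_chi coef_chi.
  have [a0|a0] := pselect (alpha = fun=> 0%N).
    rewrite a0 delta_id mulr1 -/hone /w (dotBl H) /pr -(dot_adjr H _ _ Ij) S1 (dot0r H) subr0.
    by rewrite /a (dot_adj H _ _ If) Mul_hone.
  rewrite delta_neq ?mulr0; last by move=> h; apply: a0.
  rewrite dot_chi; have [aj|aj] := eqVneq (alpha j) 0%N.
    by apply: wo => h; apply: a0; apply/funext => i; have [->//|/h] := eqVneq i j.
  by apply: ((adj_shift_eq0 j w).1 wj) => /= /eqP; exact/negP.
have -> : zshift j (pr (Mul f) (adj (zshift j) x)) = Mul f (pr (zshift j) a).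
  rewrite /pr /a -comm; congr (Mul f (zshift j _)).
  exact: (adj_comm H x If Ij comm).
rewrite -(Mul_hone mf) -(islinZ _ _ If.1) -(islinD _ _ If.1) (Mul_hone mf) -E.
by rewrite addrC subrK.
Qed.

Lemma range_of_scale g x y (c : C) : inner_function g -> c != 0 ->
  range (Mul g) y -> c *: x = y -> range (Mul g) x.
Proof.
move=> hg c0 [u _ <-] E; exists (c^-1 *: u) => //.
by rewrite (islinZ _ _ (inner_isom hg).1) -E scalerA mulVf// scale1r.
Qed.

Lemma scale_regroup (x y : V) (a d q : C) :
  a *: x + (d - q * a) *: y = a *: (x - q *: y) + d *: y.
Proof.
rewrite scalerBl scalerBr -addrA scalerA [q * a]mulrC.
by congr (_ + _); rewrite addrC.
Qed.

(** Pure algebra on abstract maps: [A] and [B] each equal their conjugate by the shift plus a rank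
    one term, and substituting the expansion of [B] into that of [A] gives a rank two correction for
    the product. *)
Lemma shift_expand (A B S S' : V -> V) (x y z : V) (c d q : C) :
  islin A -> islin S -> islin S' -> (forall u, S' (S u) = u) ->
  A (B x) = S (A (S' (B x))) + d *: y -> B x = S (B (S' x)) + c *: z ->
  A z = S (A (S' z)) + q *: y ->
  A (B x) = S (A (B (S' x))) + (c *: (A z - q *: y) + d *: y).
Proof.
move=> Al Sl S'l SS e1 e2 e3; have e4 : A z - q *: y = S (A (S' z)) by rewrite {1}e3 addrK.
rewrite e4 {1}e1 {1}e2 (islinD _ _ S'l) SS (islinZ _ _ S'l) (islinD _ _ Al) (islinZ _ _ Al).
by rewrite (islinD _ _ Sl) (islinZ _ _ Sl) addrA.
Qed.

Lemma pr_pr_shift j f g x : inner_function f -> depends_only_on j f ->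
    inner_function g -> depends_only_on j g -> supp (only j) x ->
  pr (Mul f) (pr (Mul g) x) =
    zshift j (pr (Mul f) (pr (Mul g) (adj (zshift j) x))) +
    (dot x (HdM g) *: (pr (Mul f) (HdM g) - dot (HdM g) (HdM f) *: HdM f) +
     dot x (pr (Mul g) (HdM f)) *: HdM f).
Proof.
move=> hf fj hg gj ox; have If := inner_isom hf; have Ig := inner_isom hg.
have Is := isom_shift (R := R) j.
rewrite -(pr_dot H _ _ Ig).
exact: (shift_expand (pr_lin H If) Is.1 (adj_lin H Is) (fun y => adjK H y Is)
  (pr_shift hf fj (only_pr hg gj ox)) (pr_shift hg gj ox)
  (pr_shift hf fj (supp_HdM (inner_multiplier hg) gj))).
Qed.

(** Subtracting the expansions of $AB$ and $BA$ leaves the identity [E]. At $x=b$, which is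
    orthogonal to [G], it solves for [F] in the range of $M_g$; if $b=0$, then at $x=v$ it solves
    for [G] in the range of $M_f$. *)
Lemma rank_two j f g : inner_function f -> depends_only_on j f ->
  inner_function g -> depends_only_on j g ->
  (forall x, supp (only j) x -> pr (Mul f) (pr (Mul g) x) = pr (Mul g) (pr (Mul f) x)) ->
  range (Mul g) (HdM f) \/ range (Mul f) (HdM g).
Proof.
move=> hf fj hg gj comm; have mf := inner_multiplier hf; have mg := inner_multiplier hg.
have If := inner_isom hf; have Ig := inner_isom hg.
set F := HdM f; set G := HdM g; have oF : supp (only j) F by exact: supp_HdM.
have oG : supp (only j) G by exact: supp_HdM.
pose A := pr (Mul f); pose B := pr (Mul g).
have GG : dot G G = 1 by rewrite /G -(Mul_hone mg) (isom_dot H _ _ Ig) (dotxx H) sq_hone.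
have BG : B G = G by rewrite /G -(Mul_hone mg); exact: (pr_id H).
pose v := A G; pose b := B F - dot F G *: G.
have E x : supp (only j) x ->
    dot x G *: v + dot x b *: F = dot x F *: b + dot x v *: G.
  move=> ox; have e1 := pr_pr_shift hf fj hg gj ox; have e2 := pr_pr_shift hg gj hf fj ox.
  have := comm x ox; rewrite e1 e2 (comm _ (only_shift ox)) => /addrI.
  rewrite -/F -/G => h.
  have hb : dot x b = dot x (B F) - dot G F * dot x G.
    by rewrite /b (dotBr H) (dotZr H) -(dotC H).
  transitivity (dot x G *: (v - dot G F *: F) + dot x (B F) *: F); last exact: h.
  by rewrite hb scale_regroup.
have [b0|b0] := eqVneq b 0; last first.
  left; have bb : dot b b != 0 by apply: contra b0 => /eqP/(dot_eq0 H) ->.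
  have ob : supp (only j) b.
    refine (csubB (csub_supp (only j)) (only_pr hg gj oF) _).
    exact (csubZ _ (csub_supp (only j)) oG).
  have cg := isom_csub H Ig.
  have rG : range (Mul g) G by exists hone => //; exact: Mul_hone.
  have rb : range (Mul g) b.
    have rB : range (Mul g) (B F) by exists (adj (Mul g) F).
    exact (csubB cg rB (csubZ (dot F G) cg rG)).
  have bG : dot b G = 0.
    by rewrite /b (dotBl H) (dotZl H) GG mulr1 (pr_dot H _ _ Ig) -/B BG subrr.
  have ry := csubD cg (csubZ (dot b F) cg rb) (csubZ (dot b v) cg rG).
  apply: (range_of_scale hg bb ry).
  by have := E b ob; rewrite bG scale0r add0r.
right; have [v0|v0] := eqVneq v 0; last first.
  have vv : dot v v != 0 by apply: contra v0 => /eqP/(dot_eq0 H) ->.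
  have ov : supp (only j) v by exact: only_pr.
  have rv : range (Mul f) v by exists (adj (Mul f) G).
  apply: (range_of_scale hf vv (csubZ (dot v G) (isom_csub H If) rv)).
  by have := E v ov; rewrite b0 (dot0r H) scale0r addr0 scaler0 add0r.
(* If $b=v=0$, the images under $M_f$ and $M_g$ of the functions of $z_j$ are orthogonal to each
   other. This is impossible, since the nonzero function $fg$ is in both. *)
exfalso.
have aG : adj (Mul f) G = 0 by apply: (isom_inj H If); rewrite (islin0 If.1).
have FG : dot F G = 0.
  by rewrite /F -(Mul_hone mf) (dotC H) -(dot_adj H _ _ If) aG (dot0l H) conjc0.
have aF : adj (Mul g) F = 0.
  apply: (isom_inj H Ig); rewrite (islin0 Ig.1) -/(pr _ _) -/B.
  by move: b0; rewrite /b FG scale0r subr0.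
(* The smaller power of $z_j$ is cancelled on both sides as an isometry, after which [aF] or [aG]
   applies. *)
have mono k l : dot (Mul f (chi (kem k j))) (Mul g (chi (kem l j))) = 0.
  have E1 (h : fct) i : multiplier h -> Mul h (chi (kem i j)) = Mul (monom (kem i j)) (HdM h).
    move=> mh; apply: Hd_ext => z zp; rewrite !MulE//; last exact: multiplier_monom.
    by rewrite HdME// chiE// mulrC.
  have E2 (h : fct) i i' : multiplier h ->
      Mul h (chi (kem (i + i') j)) = Mul (monom (kem i j)) (Mul h (chi (kem i' j))).
    move=> mh; apply: Hd_ext => z zp; rewrite !MulE//; try exact: multiplier_monom.
    by rewrite !chiE// !monom_kem exprD; ring.
  have [kl|/ltnW lk] := leqP k l.
    rewrite -(subnKC kl) (E2 g)// (E1 f)// (isom_dot H _ _ (isom_monom _)).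
    by rewrite -(dot_adj H _ _ Ig) aF (dot0l H).
  rewrite -(subnKC lk) (E2 f)// (E1 g)// (isom_dot H _ _ (isom_monom _)).
  by rewrite (dotC H) -(dot_adj H _ _ If) aG (dot0l H) conjc0.
have kemE alpha : only j alpha -> alpha = kem (alpha j) j.
  move=> ha; apply/funext => i; rewrite /kem /em; case: eqP => [->|/eqP/ha ->].
    by rewrite muln1.
  by rewrite muln0.
have h1 x l : supp (only j) x -> dot (Mul f x) (Mul g (chi (kem l j))) = 0.
  move=> ox; rewrite -(dot0r H x).
  have cs := @csub_dot _ _ _ H (Mul f) 1 (Mul g (chi (kem l j))) 0 If.1.
  apply: (csub_dense_supp (cs _) _ ox) => [y|alpha ha /=]; first by rewrite mul1r If.2.
  by rewrite (dot0r H) (kemE alpha ha) mono.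
have h2 y : supp (only j) y -> dot (Mul g y) (Mul f G) = 0.
  move=> oy; rewrite -(dot0r H y).
  have cs := @csub_dot _ _ _ H (Mul g) 1 (Mul f G) 0 Ig.1.
  apply: (csub_dense_supp (cs _) _ oy) => [u|alpha ha /=]; first by rewrite mul1r Ig.2.
  by rewrite (dot0r H) (kemE alpha ha) (dotC H) h1// conjc0.
have := h2 F oF; have -> : Mul g F = Mul f G.
  by apply: Hd_ext => z zp; rewrite !MulE// !HdME// mulrC.
by rewrite (isom_dot H _ _ If) GG => /eqP; rewrite oner_eq0.
Qed.

End RankTwo.

(** * Reduction to functions of one variable *)

Section Transfer.
Context {R : realType} {n : nat}.
Local Notation C := R[i].
Local Notation fct := ('rV[C]_n -> C).
Local Notation V := (@Hd R n).
Local Notation dot := (@dotH R n).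
Local Notation H := (@Hd_hilbert R n).
Local Notation oproj := (@oproj R V dot).
Local Notation adj := (@adj R V dot).
Local Notation pr := (@pr R V dot).
Implicit Types (f g theta : fct) (x y u : V) (N : set V) (z w : 'rV[C]_n)
  (alpha beta : 'I_n -> nat) (phi psi : 'I_n -> fct) (L : {set 'I_n}).

Lemma monom_kem_only k j : depends_only_on j (monom (kem k j) : fct).
Proof. by move=> z w _ _ zw; rewrite !monom_kem zw. Qed.

(* The one-variable function of [z_j] formed by the coefficients of [x] at the
   multi-indices [beta + k e_j]. *)
Definition slice j beta x : V := oproj (supp (only j)) (adj (Mul (monom beta)) x).

Lemma slice_lin j beta : islin (slice j beta).
Proof.
move=> c x y; rewrite /slice (adj_lin H (isom_monom beta)).
exact: (oproj_lin H (csub_supp (only j))).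
Qed.

(** With $\beta_j=0$, multiplication by $\chi_\beta$ doubly commutes with $M_f$. Moreover
    [pr (Mul f)] is self-adjoint and preserves the functions of $z_j$, so it commutes with the
    projection onto them. *)
Lemma slice_pr j beta f x : inner_function f -> depends_only_on j f -> beta j = 0%N ->
  slice j beta (pr (Mul f) x) = pr (Mul f) (slice j beta x).
Proof.
move=> hf fj bj; have If := inner_isom hf; have Ib := isom_monom (R := R) beta.
have dc := dcomm_sym H If Ib (dcomm_monom hf fj bj).
rewrite /slice (adj_pr H Ib If dc); set y := adj (Mul (monom beta)) x.
have co := csub_supp (R := R) (only j); have oy := proj_in H y co.
apply: (proj_uniq H co); first exact: only_pr hf fj oy.
move=> z oz; rewrite -(islinB _ _ (pr_lin H If)) (pr_dot H _ _ If).
exact: (proj_orth H y co (only_pr hf fj oz)).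
Qed.

Lemma slice_monom j beta u k : adj (zshift j) u = 0 -> beta j = 0%N ->
  slice j beta (Mul (monom (kem k j)) u) = coef u beta *: chi (kem k j).
Proof.
move=> /adj_shift_eq0 uj bj; have Ib := isom_monom (R := R) beta.
have co := csub_supp (R := R) (only j).
have kemE alpha : only j alpha -> alpha = kem (alpha j) j.
  move=> ha; apply/funext => i; rewrite /kem /em; case: eqP => [->|/eqP/ha ->].
    by rewrite muln1.
  by rewrite muln0.
have kemo l : only j (kem l j) by move=> i ij; rewrite /kem /em (negPf ij) muln0.
have kemj l : kem l j j = l by rewrite /kem /em eqxx muln1.
apply: (proj_uniq H co).
  apply: (csubZ _ co) => alpha ha; rewrite coef_chi delta_neq// => E.
  by apply: ha; rewrite -E; exact: kemo.
set v := _ - _ => z oz.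
suff : orth dot [set v] z by move=> /(_ v erefl) h; rewrite (dotC H) h conjc0.
apply: (csub_dense_supp (csub_orth H [set v])) oz => alpha ha _ ->.
rewrite (dotC H) -[RHS]conjc0; congr conjc; rewrite /v (dotBl H) (dotZl H) !dot_chi coef_chi.
rewrite -dot_chi (dot_adj H _ _ Ib) Mul_chi dot_chi; move: (alpha j) (kemE _ ha) => l ->.
have [kl|kl] := ltnP l k.
  rewrite coef_shift0 ?delta_neq ?mulr0 ?subrr//.
    by move=> /(congr1 (fun a => a j)); rewrite !kemj => E; rewrite E ltnn in kl.
  by move=> /(_ j); rewrite /addm bj add0n !kemj leqNgt kl.
have -> : addm beta (kem l j) = addm (kem k j) (addm beta (kem (l - k) j)).
  apply/funext => i; rewrite /addm addnCA /kem -mulnDl subnKC//.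
rewrite coef_shift; have [lk|lk] := eqVneq k l.
  rewrite -lk subnn delta_id mulr1; apply/eqP; rewrite subr_eq0; apply/eqP; congr (coef u _).
  by apply/funext => i; rewrite /addm /kem mul0n addn0.
rewrite delta_neq ?mulr0 ?subr0; last first.
  by move=> /(congr1 (fun a => a j)); rewrite !kemj => E; rewrite E eqxx in lk.
apply: uj => /=; rewrite /addm bj add0n kemj => /eqP; rewrite subn_eq0 => lk'.
by move/negP: lk; apply; rewrite eqn_leq kl.
Qed.

Section Wandering.
Variables (j : 'I_n) (N : set V).
Hypotheses (Nlin : forall c x y, N x -> N y -> N (c *: x + y))
  (NM : forall f x, inner_function f -> depends_only_on j f -> N x ->
    N (Mul f x) /\ N (adj (Mul f) x)).

(** A nonzero coefficient of [x] at $\alpha$ is brought to exponent 0 in $z_j$ by $\alpha_j$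
    backward shifts, and it survives in the part free of $z_j$. That part stays in [N], which is
    invariant under powers of $z_j$ and their adjoints. *)
Lemma wandering_vector x : N x -> x != 0 -> exists u beta,
  [/\ beta j = 0%N, forall k, N (Mul (monom (kem k j)) u), adj (zshift j) u = 0 & coef u beta != 0].
Proof.
move=> Nx x0; have [alpha xa] : exists alpha, coef x alpha != 0.
  apply: contrapT => h; move/eqP: x0; apply; apply: coef_eq0 => alpha.
  by apply/eqP/negPn/negP => xa; apply: h; exists alpha.
have Nmon k y : N y -> N (Mul (monom (kem k j)) y) /\ N (adj (Mul (monom (kem k j))) y).
  by apply: NM; [exact: inner_monom|exact: monom_kem_only].
have emj : em j = kem 1 j by apply/funext => i; rewrite /kem mul1n.
pose m := alpha j; pose e := adj (Mul (monom (kem m j))) x.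
have Ne : N e by case: (Nmon m x Nx).
have Ij := isom_shift (R := R) j.
pose u := e - pr (zshift j) e.
have Nu : N u.
  rewrite /u addrC -scaleN1r; apply: Nlin => //; rewrite /pr /zshift emj.
  by apply: (Nmon 1%N _ _).1; exact: (Nmon 1%N _ Ne).2.
pose beta i := if i == j then 0%N else alpha i.
exists u, beta; split.
- by rewrite /beta eqxx.
- by move=> k; case: (Nmon k u Nu).
- exact: (adj_sub_pr H).
have S1 : adj (zshift j) (chi beta) = 0.
  apply/adj_shift_eq0 => gamma /= g0; rewrite coef_chi delta_neq// => E; apply: g0.
  by rewrite -E /beta eqxx.
rewrite -dot_chi /u (dotBl H) /pr -(dot_adjr H _ _ Ij) S1 (dot0r H) subr0.
rewrite (dot_adj H _ _ (isom_monom _)) Mul_chi dot_chi.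
have -> // : addm (kem m j) beta = alpha.
apply/funext => i; rewrite /addm /beta /kem /em /m; case: eqP => [->|_].
  by rewrite muln1 addn0.
by rewrite muln0 add0n.
Qed.

(** The projections commute on $z_j^ku$, which lies in [N]; slices turn this into commutation on
    $z_j^k$, multiplied by the nonzero number [coef u beta]. *)
Lemma pr_comm_only f g x0 : inner_function f -> depends_only_on j f ->
  inner_function g -> depends_only_on j g -> N x0 -> x0 != 0 ->
  (forall x, N x -> pr (Mul f) (pr (Mul g) x) = pr (Mul g) (pr (Mul f) x)) ->
  forall x, supp (only j) x -> pr (Mul f) (pr (Mul g) x) = pr (Mul g) (pr (Mul f) x).
Proof.
move=> hf fj hg gj Nx0 x00 comm x ox; have If := inner_isom hf; have Ig := inner_isom hg.
have [u [beta [bj Nu uj ub]]] := wandering_vector Nx0 x00.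
have Al := pr_lin H If; have Bl := pr_lin H Ig.
pose D y := pr (Mul f) (pr (Mul g) y) - pr (Mul g) (pr (Mul f) y).
have Dl : islin D.
  by move=> c y z; rewrite /D Bl !Al Bl scalerBr opprD addrACA.
have DB y : sq dot (D y) <= 4 * sq dot y.
  apply: (le_trans (sqD_le H _ _)); rewrite (sqN H).
  have -> : 4 * sq dot y = 2 * sq dot y + 2 * sq dot y by ring.
  by apply: lerD; apply: ler_wpM2l => //; apply: (le_trans (sq_pr H _ _)) => //;
    exact: (sq_pr H).
apply/eqP; rewrite -subr_eq0; apply/eqP.
apply: (csub_dense_supp (csub_ker H Dl DB)) ox => alpha ha /=.
have -> : alpha = kem (alpha j) j.
  apply/funext => i; rewrite /kem /em; case: eqP => [->|/eqP/ha ->].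
    by rewrite muln1.
  by rewrite muln0.
move: (alpha j) => k.
have e f' g' : inner_function f' -> depends_only_on j f' ->
    inner_function g' -> depends_only_on j g' ->
    slice j beta (pr (Mul f') (pr (Mul g') (Mul (monom (kem k j)) u))) =
    coef u beta *: pr (Mul f') (pr (Mul g') (chi (kem k j))).
  move=> hf' fj' hg' gj'; set w := Mul (monom _) u.
  rewrite (slice_pr (pr (Mul g') w) hf' fj' bj) (slice_pr w hg' gj' bj).
  rewrite (slice_monom k uj bj) (islinZ _ _ (pr_lin H (inner_isom hg'))).
  by rewrite (islinZ _ _ (pr_lin H (inner_isom hf'))).
have E := etrans (esym (e f g hf fj hg gj))
  (etrans (congr1 (slice j beta) (comm _ (Nu k))) (e g f hg gj hf fj)).
have E' := scalerI ub E.
by apply/eqP; rewrite subr_eq0; apply/eqP.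
Qed.

(** The residuals of the $m+1$ vectors $z_j^ku$ lie in the span of [m] functions, so some nontrivial
    combination is fixed by [pr (Mul theta)]. Its slice is a nonzero polynomial in the range of
    $M_\theta$. *)
Lemma finite_rank_Blaschke theta x0 m (e : 'I_m -> fct) : inner_function theta ->
  depends_only_on j theta -> N x0 -> x0 != 0 ->
  (forall x, N x -> exists c : 'I_m -> C,
     ((x - pr (Mul theta) x : V) : fct) = \sum_(k < m) c k \*o e k) ->
  finite_Blaschke_product j theta.
Proof.
move=> ht tj Nx0 x00 he; have It := inner_isom ht; have mt := inner_multiplier ht.
have [u [beta [bj Nu uj ub]]] := wandering_vector Nx0 x00.
pose w k := Mul (monom (kem k j)) u.
have [|a [k0 ak0] asum] := @lin_dep _ fct m e (fun k : 'I_m.+1 => (w k - pr (Mul theta) (w k) : V) : fct).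
  by move=> k; have [c hc] := he (w k) (Nu k); exists c.
pose y : V := \sum_(k < m.+1) a k *: w k.
have yE : pr (Mul theta) y = y.
  apply/esym/eqP; rewrite -subr_eq0; apply/eqP.
  rewrite /y (islin_sum _ _ (pr_lin H It)) -sumrB; apply: Hd_ext => z _.
  rewrite Hd_sum Hd0 -[RHS](congr1 (fun f : fct => f z) asum) fct_sumE.
  by apply: eq_bigr => k _; rewrite (islinZ _ _ (pr_lin H It)) -scalerBr HdZ.
pose p : {poly C} := \poly_(k < m.+1) (if insub k is Some i then a i else 0).
have pk (k : 'I_m.+1) : p`_k = a k.
  by rewrite coef_poly ltn_ord insubT//= => h; congr a; exact: val_inj.
have p0 : p != 0 by apply: contraNneq ak0 => p0; rewrite -pk p0 coef0.
have sy : slice j beta y = coef u beta *: HdM (hpoly j p).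
  rewrite /y (islin_sum _ _ (@slice_lin j beta)); apply: Hd_ext => z zp.
  rewrite HdZ (HdME (multiplier_poly j p) zp) Hd_sum /hpoly horner_poly mulr_sumr.
  apply: eq_bigr => k _; rewrite (islinZ _ _ (@slice_lin j beta)) (slice_monom k uj bj) !HdZ.
  rewrite chiE// monom_kem; have := pk k; rewrite coef_poly ltn_ord => ->.
  by ring.
have /(congr1 (slice j beta)) := yE; rewrite slice_pr// sy (islinZ _ _ (pr_lin H It)).
move=> /(scalerI ub) => hp.
apply: (@poly_range_Blaschke _ _ j p theta (adj (Mul theta) (HdM (hpoly j p)))) => //.
move=> z zp; have := congr1 (fun x : V => x z) hp.
by rewrite /pr MulE// (HdME (multiplier_poly j p) zp).
Qed.

End Wandering.

End Transfer.

Section SelfAdjoint.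
Context {R : realType} {V : lmodType R[i]}.
Variable dot : V -> V -> R[i].
Hypothesis H : is_hilbert dot.

(** Expanding $\langle Px,y\rangle=\langle x,Py\rangle$ for $P=(1-A)(1-B)$ leaves $\langle
    ABx,y\rangle=\langle BAx,y\rangle$ for [y] in [N]; the difference of the two vectors is itself
    in [N] and can be taken as [y]. *)
Lemma selfadjoint_comm (A B P : V -> V) (N : set V) : islin A ->
  (forall x y, dot (A x) y = dot x (A y)) -> (forall x y, dot (B x) y = dot x (B y)) ->
  (forall x y, dot (P x) y = dot x (P y)) ->
  (forall c x y, N x -> N y -> N (c *: x + y)) ->
  (forall x, N x -> N (A x)) -> (forall x, N x -> N (B x)) ->
  (forall x, N x -> P x = (x - B x) - A (x - B x)) ->
  forall x, N x -> A (B x) = B (A x).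
Proof.
move=> Al As Bs Ps Nl NA NB PE x Nx.
have key y : N y -> dot (A (B x)) y = dot (B (A x)) y.
  move=> Ny; have := Ps x y; rewrite !PE// !(islinB _ _ Al) !(dotBl H) !(dotBr H).
  have -> : dot x (A (B y)) = dot (B (A x)) y by rewrite -As -Bs.
  by rewrite (Bs x y) (As x y) => /addrI/oppr_inj/addrI/oppr_inj.
apply/eqP; rewrite -subr_eq0; apply/eqP/(dot_eq0 H).
set d := A (B x) - B (A x).
have Nd : N d.
  by rewrite /d addrC -scaleN1r; apply: Nl; [exact/NB/NA|exact/NA/NB].
by rewrite {1}/d (dotBl H) key// subrr.
Qed.

End SelfAdjoint.

(** * A finite rank projection forces the conditions *)

Section OnlyIf.
Context {R : realType} {n : nat}.
Local Notation C := R[i].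
Local Notation fct := ('rV[C]_n -> C).
Local Notation V := (@Hd R n).
Local Notation dot := (@dotH R n).
Local Notation H := (@Hd_hilbert R n).
Local Notation csub := (@csub R V dot).
Local Notation oproj := (@oproj R V dot).
Local Notation adj := (@adj R V dot).
Local Notation pr := (@pr R V dot).
Implicit Types (f g theta : fct) (x y : V) (N : set V) (phi psi : 'I_n -> fct)
  (L : {set 'I_n}) (j : 'I_n).

(** Unlike [quot], this space is invariant under multiplication by inner functions of $z_j$, and the
    projection onto [quot] acts on it in the variable $z_j$ only. *)
Definition off_quot L phi j : set V :=
  [set x | forall l, l \in L -> l != j -> adj (Mul (phi l)) x = 0].

Lemma off_quot_lin L phi j c x y : coord_inner L phi ->
  off_quot L phi j x -> off_quot L phi j y -> off_quot L phi j (c *: x + y).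
Proof.
move=> hL hx hy l lL lj; rewrite (adj_lin H (coord_isom hL lL)) (hx l lL lj) (hy l lL lj).
by rewrite scaler0 addr0.
Qed.

Lemma off_quot_Mul L phi j theta x : coord_inner L phi ->
  inner_function theta -> depends_only_on j theta -> off_quot L phi j x ->
  off_quot L phi j (Mul theta x) /\ off_quot L phi j (adj (Mul theta) x).
Proof.
move=> hL ht tj hx; have It := inner_isom ht; have mt := inner_multiplier ht.
split=> l lL lj; have Il := coord_isom hL lL; have [hi hd] := hL l lL.
  by rewrite (dcomm_Mul hi hd mt tj lj).2 (hx l lL lj) (islin0 It.1).
rewrite (adj_comm H x Il It (dcomm_Mul hi hd mt tj lj).1) (hx l lL lj).
exact: (islin0 (adj_lin H It)).
Qed.

Lemma oproj_quot_in L phi j x : coord_inner L phi -> j \in L -> off_quot L phi j x ->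
  oproj (quot L phi) x = x - pr (Mul (phi j)) x.
Proof.
move=> hL jL hx; have cL := csub_quot hL; have Ij := coord_isom hL jL.
have [hj dj] := hL j jL.
apply: (proj_uniq H cL).
  apply/quot_adjP => l lL; have [->|lj] := eqVneq l j; first exact: (adj_sub_pr H).
  have Il := coord_isom hL lL.
  rewrite (islinB _ _ (adj_lin H Il)) (hx l lL lj) sub0r.
  rewrite (adj_pr H Il Ij (coord_dcomm hL hL lL jL lj)) (hx l lL lj).
  by rewrite (islin0 (pr_lin H Ij)) oppr0.
move=> z /quot_adjP hz; rewrite opprB addrC subrK (pr_dot H _ _ Ij) /pr hz//.
by rewrite (islin0 Ij.1) (dot0r H).
Qed.

Lemma oproj_quot_out L phi j x : coord_inner L phi -> j \notin L -> off_quot L phi j x ->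
  oproj (quot L phi) x = x.
Proof.
move=> hL jL hx; apply: (proj_id H (csub_quot hL)); apply/quot_adjP => l lL.
by apply: hx => //; apply: contraNneq jL => <-.
Qed.

Lemma range_inner_divides f g : inner_function f -> inner_function g ->
  range (Mul f) (HdM g) -> inner_divides f g.
Proof.
move=> hf hg [h _ hE]; have mf := inner_multiplier hf; have mg := inner_multiplier hg.
have E z : polydisc z -> g z = f z * h z by move=> zp; rewrite -(MulE _ _ mf) hE HdME.
by exists (h : fct) => //; exact: inner_quotient hf hg E.
Qed.

Lemma finite_rank_only_if (Lambda Gamma : {set 'I_n}) phi psi N m (e : 'I_m -> fct) :
  coord_inner Lambda phi -> coord_inner Gamma psi ->
  (forall l, l \in Lambda -> nonconstant (phi l)) ->
  (forall l, l \in Gamma -> nonconstant (psi l)) ->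
  csub N -> (forall x, oproj (quot Lambda phi) (oproj (quot Gamma psi) x) = oproj N x) ->
  (forall x, exists c : 'I_m -> C, (oproj N x : fct) = \sum_(k < m) c k \*o e k) ->
  [/\ forall i, i \in Lambda :\: (Lambda :&: Gamma) -> finite_Blaschke_product i (phi i),
      forall j, j \in Gamma :\: (Lambda :&: Gamma) -> finite_Blaschke_product j (psi j)
    & forall j, j \in Lambda :&: Gamma ->
         (inner_divides (phi j) (psi j) /\ finite_Blaschke_product j (phi j))
      \/ (inner_divides (psi j) (phi j) /\ finite_Blaschke_product j (psi j))].
Proof.
move=> hL hG nL nG cN PE he; have cL := csub_quot hL; have cG := csub_quot hG.
have [x0] := exists_common_vector hL hG nL nG; rewrite PE; set f := oproj N x0 => f0.
have Nf : N f := proj_in H x0 cN.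
have Pf : oproj (quot Lambda phi) (oproj (quot Gamma psi) f) = f.
  by rewrite PE (proj_id H cN Nf).
(* The two projections in succession fix [f], so the first one applied cannot shorten it; hence [f]
   belongs to both quotient modules. *)
have Gf : oproj (quot Gamma psi) f = f.
  have := sq_proj H f cG; have := sq_proj H (oproj (quot Gamma psi) f) cL; rewrite Pf.
  set y := oproj _ f => h1 h2; have h3 := sq_ge0 H (y - f); have h4 := sq_ge0 H (f - y).
  have : sq dot (f - y) = 0 by apply/eqP; rewrite eq_le h4 andbT; move: h1 h2 h3; lra.
  by move/(sq_eq0 H)/eqP; rewrite subr_eq0 => /eqP.
have fG : quot Gamma psi f by rewrite -Gf; exact: (proj_in H).
have fL : quot Lambda phi f by rewrite -Pf; exact: (proj_in H).
pose W j := off_quot Lambda phi j `&` off_quot Gamma psi j.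
have Wf j : W j f.
  by split=> l lL _; [exact: ((quot_adjP Lambda phi f).1 fL)|exact: ((quot_adjP Gamma psi f).1 fG)].
have Wl j c x y : W j x -> W j y -> W j (c *: x + y).
  by move=> [x1 x2] [y1 y2]; split; exact: off_quot_lin.
have WM j theta x : inner_function theta -> depends_only_on j theta -> W j x ->
    W j (Mul theta x) /\ W j (adj (Mul theta) x).
  move=> ht tj [x1 x2]; have [a1 a2] := off_quot_Mul hL ht tj x1.
  by have [b1 b2] := off_quot_Mul hG ht tj x2; split.
have Wpr j theta x : inner_function theta -> depends_only_on j theta -> W j x ->
    W j (pr (Mul theta) x).
  by move=> ht tj Wx; apply: (WM j theta _ ht tj _).1; exact: (WM j theta x ht tj Wx).2.
have WB j theta x : inner_function theta -> depends_only_on j theta -> W j x ->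
    W j (x - pr (Mul theta) x).
  move=> ht tj Wx; have -> : x - pr (Mul theta) x = (-1) *: pr (Mul theta) x + x.
    by rewrite scaleN1r addrC.
  exact (Wl j _ _ _ (Wpr j theta x ht tj Wx) Wx).
(* Every claim about Blaschke products is reduced to this: on [W j] the finite rank operator is
   $1-M_\theta M_\theta^*$. *)
have blaschke_of j theta : inner_function theta -> depends_only_on j theta ->
    (forall x, W j x -> oproj N x = x - pr (Mul theta) x) -> finite_Blaschke_product j theta.
  move=> ht tj hP; apply: (@finite_rank_Blaschke _ _ j (W j) (Wl j) (WM j) theta f m e ht tj (Wf j) f0).
  by move=> x Wx; rewrite -hP.
split.
- move=> j; rewrite !inE => /andP[]; rewrite negb_and => jN jL.
  have jG : j \notin Gamma by move: jN; rewrite jL.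
  have [hj dj] := hL j jL; apply: (blaschke_of j _ hj dj) => x [x1 x2].
  apply: etrans (esym (PE x)) _.
  exact: etrans (congr1 _ (oproj_quot_out hG jG x2)) (oproj_quot_in hL jL x1).
- move=> j; rewrite !inE => /andP[]; rewrite negb_and => jN jG.
  have jL : j \notin Lambda by move: jN; rewrite jG orbF.
  have [hj dj] := hG j jG; apply: (blaschke_of j _ hj dj) => x Wx.
  apply: etrans (esym (PE x)) _; have [Wx' _] := WB j (psi j) x hj dj Wx.
  exact: etrans (congr1 _ (oproj_quot_in hG jG Wx.2)) (oproj_quot_out hL jL Wx').
move=> j; rewrite inE => /andP[jL jG].
have [hj dj] := hL j jL; have [hj' dj'] := hG j jG.
have Ij := inner_isom hj; have Ij' := inner_isom hj'.
have PW x : W j x -> oproj N x =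
    (x - pr (Mul (psi j)) x) - pr (Mul (phi j)) (x - pr (Mul (psi j)) x).
  move=> Wx; apply: etrans (esym (PE x)) _; have [Wx' _] := WB j (psi j) x hj' dj' Wx.
  exact: etrans (congr1 _ (oproj_quot_in hG jG Wx.2)) (oproj_quot_in hL jL Wx').
have comm := selfadjoint_comm H (pr_lin H Ij) (fun x y => pr_dot H x y Ij)
  (fun x y => pr_dot H x y Ij') (fun x y => oproj_dot H x y cN) (Wl j)
  (fun x => Wpr j _ x hj dj) (fun x => Wpr j _ x hj' dj') PW.
have := rank_two hj dj hj' dj' (pr_comm_only (Wl j) (WM j) hj dj hj' dj' (Wf j) f0 comm).
case=> [/(range_inner_divides hj' hj) dv|/(range_inner_divides hj hj') dv]; [right|left].
  (* When $\psi_j$ divides $\varphi_j$, the range of $M_{\varphi_j}$ lies in that of $M_{\psi_j}$,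
     so the second subtraction in [PW] is 0. *)
  split; first exact: dv.
  apply: (blaschke_of j _ hj' dj') => x Wx; apply: etrans (PW x Wx) _; set y := x - _.
  suff a0 : adj (Mul (phi j)) y = 0 by rewrite /pr a0 (islin0 Ij.1) subr0.
  apply/(adj_eq0P H _ Ij) => w; have [v ->] := inner_divides_range w hj' hj dv.
  apply: (adj_eq0P H _ Ij').1; exact: (adj_sub_pr H).
(* When $\varphi_j$ divides $\psi_j$, the larger projection [pr (Mul (phi j))] absorbs
   [pr (Mul (psi j))], and [PW] reduces to [x - pr (Mul (phi j)) x]. *)
split; first exact: dv.
apply: (blaschke_of j _ hj dj) => x Wx; apply: etrans (PW x Wx) _.
rewrite (islinB _ _ (pr_lin H Ij)).
have [v vE] := inner_divides_range (adj (Mul (psi j)) x) hj hj' dv.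
have E : pr (Mul (psi j)) x = Mul (phi j) v := vE.
have -> : pr (Mul (phi j)) (pr (Mul (psi j)) x) = pr (Mul (psi j)) x.
  by rewrite E; exact: (pr_id H).
by rewrite opprB addrA subrK.
Qed.

End OnlyIf.

Theorem theorem1p7 (R : realType) (n : nat) (hn : (1 < n)%N)
    (Lambda Gamma : {set 'I_n})
    (hLG : Lambda :|: Gamma = [set: 'I_n]%SET)
    (phi psi : 'I_n -> 'rV[R[i]]_n -> R[i])
    (hphi : forall l, l \in Lambda ->
       [/\ inner_function (phi l), nonconstant (phi l)
          & depends_only_on l (phi l)])
    (hpsi : forall t, t \in Gamma ->
       [/\ inner_function (psi t), nonconstant (psi t)
          & depends_only_on t (psi t)]) :
  finite_rank_projection
    (fun f => hardy_proj (quotient_module Lambda phi)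
                (hardy_proj (quotient_module Gamma psi) f))
  <->
  [/\ forall i, i \in Lambda :\: (Lambda :&: Gamma) ->
         finite_Blaschke_product i (phi i),
      forall j, j \in Gamma :\: (Lambda :&: Gamma) ->
         finite_Blaschke_product j (psi j)
    & forall j, j \in Lambda :&: Gamma ->
         (inner_divides (phi j) (psi j) /\ finite_Blaschke_product j (phi j))
      \/ (inner_divides (psi j) (phi j) /\ finite_Blaschke_product j (psi j))].
Proof.
have hL : coord_inner Lambda phi by move=> l /hphi[].
have hG : coord_inner Gamma psi by move=> l /hpsi[].
rewrite (quotient_moduleE (fun l lL => (hL l lL).1)) (quotient_moduleE (fun l lL => (hG l lL).1)).
rewrite (finite_rank_projectionP (csub_quot hL) (csub_quot hG)).
split=> [[[N cN PE] [m [e he]]]|[h1 h2 h3]]; last exact: finite_rank_if.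
apply: (@finite_rank_only_if _ _ _ _ _ _ N m e) => //.
- by move=> l /hphi[].
- by move=> l /hpsi[].
- by move=> x; rewrite -PE.
Qed.
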